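(* Let $C_0(X)=A\subseteq B$ be a regular commutative $C^*$-subalgebra with a faithful conditional expectation $E\colon B\to A$. The following are equivalent: (1) $A$ is a $C^*$-diagonal in $B$, that is, normalisers $b\in B$ of $A$ with $b^2=0$ are linearly dense in $\ker E$; (2) $A\subseteq B$ has the extension property; (3) there is a twist $\Sigma$ of a principal, Hausdorff, étale groupoid $H$ with unit space $X$ and an isomorphism $B\cong C^*_{\mathrm r}(H,\Sigma)$ which is the identity on $A=C_0(X)$. The twisted groupoid $(H,\Sigma)$ in (3) is unique up to isomorphism.
   Context: $X$ is a locally compact Hausdorff space. An element $b\in B$ is a normaliser of $A$ if $bAb^*\subseteq A$ and $b^*Ab\subseteq A$. The inclusion $A\subseteq B$ is regular if it is non-degenerate ($\overline{AB}=B$) and the normalisers of $A$ generate $B$ as a $C^*$-algebra (equivalently, are linearly dense in $B$). $A\subseteq B$ has the extension property if every pure state of $A$ extends uniquely to a state on $B$. A topological groupoid is étale if its range and source maps are local homeomorphisms, and principal if every unit has trivial isotropy group. A twist $\Sigma$ of a Hausdorff étale groupoid $H$ with unit space $X$ is a locally compact Hausdorff topological groupoid in a central extension $X\times\mathbb T\to\Sigma\to H$ that is a locally trivial principal $\mathbb T$-bundle over $H$. The reduced $C^*$-algebra $C^*_{\mathrm r}(H,\Sigma)$ is the completion of the $*$-algebra of continuous functions $f\colon\Sigma\to\mathbb C$ with $f(z\sigma)=zf(\sigma)$ for $z\in\mathbb T$ and with support compact modulo $\mathbb T$, with convolution $(f*g)(\sigma)=\sum_{\dot\tau\in H,\ r(\dot\tau)=r(\sigma)}f(\tau)g(\tau^{-1}\sigma)$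 (where $\tau\in\Sigma$ is any lift of $\dot\tau$) and involution $f^*(\sigma)=\overline{f(\sigma^{-1})}$, in the norm given by the regular representations on the square-summable $\mathbb T$-equivariant functions on $\Sigma_x=s^{-1}(x)$ for $x\in X$. It contains $C_0(X)$ as the closure of the functions supported over $X\subseteq H$. *)

(* Defs.v *)
From HB Require Import structures.
From mathcomp Require Import all_boot all_order all_algebra complex.
From mathcomp Require Import all_classical all_reals all_analysis.

Set Implicit Arguments.
Unset Strict Implicit.
Unset Printing Implicit Defensive.

Import Order.TTheory GRing.Theory Num.Theory.
Import numFieldNormedType.Exports.

Local Open Scope classical_set_scope.
Local Open Scope ring_scope.

(* R[i] packaged as a numClosedFieldType, so that it is found both as a field
   and as a normed module over itself. The order on it is the partial one:
   0 <= z means that z is real and nonnegative. *)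
Definition Cplx (R : realType) : numClosedFieldType := R[i]%C.

Definition circle (R : realType) : set (Cplx R) := [set z | `|z| = 1].

(* Norms over Cplx R take values in Cplx R; this is the same norm in R. *)
Definition rnorm (R : realType) (V : normedModType (Cplx R)) (v : V) : R :=
  complex.Re `|v|.

(** * C*-algebras, not necessarily unital *)

HB.mixin Record CompleteNormedModule_isCStarAlgebra (R : realType) B
    of CompleteNormedModule (Cplx R) B := {
  cmul : B -> B -> B;
  cadj : B -> B;
  cmulA : forall a b c, cmul a (cmul b c) = cmul (cmul a b) c;
  cmulDl : forall a b c, cmul (a + b) c = cmul a c + cmul b c;
  cmulDr : forall a b c, cmul a (b + c) = cmul a b + cmul a c;
  cmulZl : forall (z : Cplx R) a b, cmul (z *: a) b = z *: cmul a b;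
  cmulZr : forall (z : Cplx R) a b, cmul a (z *: b) = z *: cmul a b;
  cadjK : forall a, cadj (cadj a) = a;
  cadjD : forall a b, cadj (a + b) = cadj a + cadj b;
  cadjZ : forall (z : Cplx R) a, cadj (z *: a) = z^* *: cadj a;
  cadjM : forall a b, cadj (cmul a b) = cmul (cadj b) (cadj a);
  cnormM : forall a b : B, `|cmul a b| <= `|a| * `|b|;
  cnorm_adjM : forall a : B, `|cmul (cadj a) a| = `|a| ^+ 2
}.

#[short(type="cstarAlgType")]
HB.structure Definition CStarAlgebra (R : realType) :=
  {B of CompleteNormedModule (Cplx R) B
      & CompleteNormedModule_isCStarAlgebra R B}.

(* j restricts to a *-homomorphism on the *-algebra S, whose product and
   involution are mul and adj; the values of j outside S are irrelevant. *)
Definition star_hom_on (R : realType) (V : lmodType (Cplx R))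
    (mul : V -> V -> V) (adj : V -> V) (S : set V)
    (B : cstarAlgType R) (j : V -> B) : Prop :=
  [/\ forall (z : Cplx R) f g, S f -> S g -> j (z *: f + g) = z *: j f + j g,
      forall f g, S f -> S g -> j (mul f g) = cmul (j f) (j g)
    & forall f, S f -> j (adj f) = cadj (j f)].

Definition star_iso (R : realType) (B D : cstarAlgType R) (Phi : B -> D) :=
  star_hom_on cmul cadj setT Phi /\ bijective Phi.

Section Subalgebras.
Context (R : realType) (B : cstarAlgType R).
Implicit Types (A S N : set B) (E : B -> B) (phi psi : B -> Cplx R).

Definition lspan S : set B :=
  [set b | exists n (c : 'I_n -> Cplx R) (v : 'I_n -> B),
     (forall i, S (v i)) /\ b = \sum_(i < n) c i *: v i].

Definition closed_star_subalgebra S : Prop :=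
  [/\ closed S, S 0,
      forall (z : Cplx R) a b, S a -> S b -> S (z *: a + b),
      forall a b, S a -> S b -> S (cmul a b)
    & forall a, S a -> S (cadj a)].

Definition generates_cstar N : Prop :=
  forall S, closed_star_subalgebra S -> N `<=` S -> S = setT.

Definition normaliser A : set B :=
  [set b | forall a, A a ->
     A (cmul (cmul b a) (cadj b)) /\ A (cmul (cmul (cadj b) a) b)].

Definition nondegenerate A : Prop :=
  closure (lspan [set c | exists a b, A a /\ c = cmul a b]) = setT.

Definition regular_inclusion A : Prop :=
  nondegenerate A /\ generates_cstar (normaliser A).

Definition conditional_expectation A E : Prop :=
  [/\ forall (z : Cplx R) a b, E (z *: a + b) = z *: E a + E b,
      (forall b, A (E b)) /\ (forall a, A a -> E a = a),
      forall b, exists c, E (cmul (cadj b) b) = cmul (cadj c) c,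
      forall b, `|E b| <= `|b|
    & forall a b, A a ->
        E (cmul a b) = cmul a (E b) /\ E (cmul b a) = cmul (E b) a].

Definition faithful_expectation E : Prop :=
  forall b, E (cmul (cadj b) b) = 0 -> b = 0.

Definition cstar_diagonal A E : Prop :=
  closure (lspan [set b | normaliser A b /\ cmul b b = 0]) =
  [set b | E b = 0].

(* A functional on a subalgebra S is a function on B of which only the
   restriction to S matters. *)
Definition state_on S phi : Prop :=
  [/\ forall (z : Cplx R) a b, S a -> S b ->
        phi (z *: a + b) = z * phi a + phi b,
      forall a, S a -> 0 <= phi (cmul (cadj a) a)
    & ereal_sup [set (rnorm (phi a))%:E | a in S `&` [set a | `|a| <= 1]]
      = 1%E].

(* Extreme points of the set of states on S. *)
Definition pure_state_on S phi : Prop :=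
  state_on S phi /\
  forall psi1 psi2 (t : Cplx R), state_on S psi1 -> state_on S psi2 ->
    0 < t -> t < 1 ->
    (forall a, S a -> phi a = t * psi1 a + (1 - t) * psi2 a) ->
    forall a, S a -> psi1 a = phi a /\ psi2 a = phi a.

Definition extension_property A : Prop :=
  forall phi, pure_state_on A phi ->
    exists! psi, state_on setT psi /\ (forall a, A a -> psi a = phi a).

End Subalgebras.

(** * The algebra of continuous functions vanishing at infinity *)

Definition C0 (R : realType) (X : topologicalType) : set (X -> Cplx R) :=
  [set f | continuous f /\
     forall e : Cplx R, 0 < e ->
       exists2 K : set X, compact K & forall x, ~ K x -> `|f x| < e].

Definition C0_star_hom (R : realType) (X : topologicalType)
    (B : cstarAlgType R) (iota : (X -> Cplx R) -> B) : Prop :=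
  star_hom_on (fun f g x => f x * g x) (fun f x => (f x)^*) (@C0 R X) iota.

Definition C0_embedding (R : realType) (X : topologicalType)
    (B : cstarAlgType R) (iota : (X -> Cplx R) -> B) : Prop :=
  C0_star_hom iota /\
  forall f g, C0 f -> C0 g -> iota f = iota g -> f = g.

Definition C0_image (R : realType) (X : topologicalType)
    (B : cstarAlgType R) (iota : (X -> Cplx R) -> B) : set B :=
  iota @` @C0 R X.

(** * Topological groupoids with unit space X *)

(* gmul is a total function, only meaningful on composable pairs, that is,
   pairs (a, b) with gsrc a = grng b. *)
Record topGroupoid (X : topologicalType) := TopGroupoid {
  arrow :> topologicalType;
  gsrc : arrow -> X;
  grng : arrow -> X;
  gunit : X -> arrow;
  gmul : arrow -> arrow -> arrow;
  ginv : arrow -> arrow;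
  gsrc1 : forall x, gsrc (gunit x) = x;
  grng1 : forall x, grng (gunit x) = x;
  gsrcM : forall a b, gsrc a = grng b -> gsrc (gmul a b) = gsrc b;
  grngM : forall a b, gsrc a = grng b -> grng (gmul a b) = grng a;
  gmulA : forall a b c, gsrc a = grng b -> gsrc b = grng c ->
    gmul a (gmul b c) = gmul (gmul a b) c;
  gmul1 : forall a, gmul a (gunit (gsrc a)) = a;
  g1mul : forall a, gmul (gunit (grng a)) a = a;
  gsrcV : forall a, gsrc (ginv a) = grng a;
  grngV : forall a, grng (ginv a) = gsrc a;
  gmulV : forall a, gmul a (ginv a) = gunit (grng a);
  gVmul : forall a, gmul (ginv a) a = gunit (gsrc a);
  gsrc_continuous : continuous gsrc;
  grng_continuous : continuous grng;
  gunit_continuous : continuous gunit;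
  gmul_continuous : {within [set p | gsrc p.1 = grng p.2],
    continuous (fun p : arrow * arrow => gmul p.1 p.2)};
  ginv_continuous : continuous ginv
}.

Definition local_homeomorphism (T U : topologicalType) (f : T -> U) : Prop :=
  forall x, exists V : set T, [/\ open V, V x, open (f @` V),
    {within V, continuous f}
  & exists g : U -> T, {within f @` V, continuous g} /\
      forall y, V y -> g (f y) = y].

Definition etale (X : topologicalType) (H : topGroupoid X) : Prop :=
  local_homeomorphism (@grng X H) /\ local_homeomorphism (@gsrc X H).

Definition principal (X : topologicalType) (H : topGroupoid X) : Prop :=
  forall h : H, gsrc h = grng h -> h = gunit H (gsrc h).

Definition groupoid_iso (X : topologicalType) (G G' : topGroupoid X)
    (F : G -> G') : Prop :=
  [/\ continuous F,
      exists F' : G' -> G, [/\ continuous F', cancel F F' & cancel F' F],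
      forall a, gsrc (F a) = gsrc a,
      forall a, grng (F a) = grng a
    & forall a b, gsrc a = grng b -> F (gmul a b) = gmul (F a) (F b)].

(** * Twists *)

(* The central extension X * T -> tgpd -> H; tincl x z only matters for z on
   the circle, and X * T has the product topology. *)
Record twist (R : realType) (X : topologicalType) (H : topGroupoid X) :=
  Twist {
  tgpd :> topGroupoid X;
  tincl : X -> Cplx R -> tgpd;
  tproj : tgpd -> H;
  tgpd_hausdorff : hausdorff_space tgpd;
  tgpd_locally_compact : locally_compact [set: tgpd];
  tincl_src : forall x z, circle z -> gsrc (tincl x z) = x;
  tincl_rng : forall x z, circle z -> grng (tincl x z) = x;
  tinclM : forall x z w, circle z -> circle w ->
    tincl x (z * w) = gmul (tincl x z) (tincl x w);
  tincl_continuous : {within [set: X] `*` @circle R,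
    continuous (fun p : X * Cplx R => tincl p.1 p.2)};
  tincl_inj : forall x z w, circle z -> circle w ->
    tincl x z = tincl x w -> z = w;
  tproj_src : forall s, gsrc (tproj s) = gsrc s;
  tproj_rng : forall s, grng (tproj s) = grng s;
  tprojM : forall s t, gsrc s = grng t ->
    tproj (gmul s t) = gmul (tproj s) (tproj t);
  tproj_continuous : continuous tproj;
  tproj_surj : forall h, exists s, tproj s = h;
  twist_exact : forall s x,
    tproj s = gunit H x <-> exists2 z, circle z & s = tincl x z;
  twist_central : forall s z, circle z ->
    gmul (tincl (grng s) z) s = gmul s (tincl (gsrc s) z);
  (* phi and psi are the fibre coordinate and the inverse of an equivariant
     homeomorphism from the preimage of U onto U * T *)
  twist_locally_trivial : forall h, exists (U : set H)
      (phi : tgpd -> Cplx R) (psi : H -> Cplx R -> tgpd),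
    [/\ open U /\ U h,
        {within tproj @^-1` U, continuous phi},
        {within U `*` @circle R,
          continuous (fun p : H * Cplx R => psi p.1 p.2)},
        forall s, U (tproj s) ->
          [/\ circle (phi s), psi (tproj s) (phi s) = s
            & forall z, circle z ->
                phi (gmul (tincl (grng s) z) s) = z * phi s]
      & forall k z, U k -> circle z ->
          tproj (psi k z) = k /\ phi (psi k z) = z]
}.

Definition twist_isomorphic (R : realType) (X : topologicalType)
    (H H' : topGroupoid X) (S : twist R H) (S' : twist R H') : Prop :=
  exists (F : H -> H') (Ft : S -> S'),
    [/\ groupoid_iso F, groupoid_iso Ft,
        forall s, tproj (Ft s) = F (tproj s)
      & forall x z, circle z -> Ft (tincl S x z) = tincl S' x z].

(** * The reduced C*-algebra of a twisted groupoid *)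

Section Reduced.
Context (R : realType) (X : topologicalType) (H : topGroupoid X).
Context (S : twist R H).
Implicit Types (f g xi : S -> Cplx R) (s : S) (x : X).

Definition equivariant f : Prop :=
  forall z s, circle z -> f (gmul (tincl S (grng s) z) s) = z * f s.

Definition Cc_twist : set (S -> Cplx R) :=
  [set f | [/\ continuous f, equivariant f
    & compact ((@tproj _ _ _ S) @` closure [set s | f s != 0])]].

Definition tlift (h : H) : S := projT1 (cid (tproj_surj S h)).

(* \sum_(h \in A) F h is 0 by convention when F has infinite support on A. Here
   the support is finite when f is in Cc_twist and H is Hausdorff and etale. *)
Definition tconv f g : S -> Cplx R := fun s =>
  \sum_(h \in [set h : H | grng h = grng s])
    f (tlift h) * g (gmul (ginv (tlift h)) s).

Definition tstar f : S -> Cplx R := fun s => (f (ginv s))^*.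

(* The square-summable equivariant functions on gsrc @^-1` [set x], extended
   by 0; the regular representation at x sends f to the operator tconv f. *)
Definition l2norm x xi : \bar R :=
  ((\esum_(h in [set h : H | gsrc h = x]) ((rnorm (xi (tlift h))) ^+ 2)%:E)
     `^ 2^-1)%E.

Definition l2_twist x : set (S -> Cplx R) :=
  [set xi | [/\ equivariant xi, forall s, gsrc s <> x -> xi s = 0
    & (l2norm x xi < +oo)%E]].

(* The maximum with 0 only matters when X is empty. *)
Definition reduced_norm f : \bar R :=
  maxe 0%E (ereal_sup [set y | exists x xi,
    [/\ l2_twist x xi, (l2norm x xi <= 1)%E & y = l2norm x (tconv f xi)]]).

(* The completion of Cc_twist, given by its defining property. *)
Record reduced_cstar := ReducedCstar {
  rcstar :> cstarAlgType R;
  rmap : (S -> Cplx R) -> rcstar;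
  rmap_star_hom : star_hom_on tconv tstar Cc_twist rmap;
  rmap_isometric : forall f, Cc_twist f -> (rnorm (rmap f))%:E = reduced_norm f;
  rmap_dense : closure (rmap @` Cc_twist) = setT
}.

(* k is the canonical inclusion of C0 X: a function supported over the units
   of H is identified with its restriction to the units of S. *)
Definition C0_inclusion (D : reduced_cstar) (k : (X -> Cplx R) -> D) : Prop :=
  C0_star_hom k /\
  forall f, Cc_twist f ->
    (forall s, (forall x, tproj s <> gunit H x) -> f s = 0) ->
    k (fun x => f (gunit S x)) = rmap D f.

(* B is isomorphic to the reduced C*-algebra, by an isomorphism that is the
   identity on C0 X. *)
Definition reduced_model (B : cstarAlgType R) (iota : (X -> Cplx R) -> B) :=
  exists (D : reduced_cstar) (k : (X -> Cplx R) -> D) (Phi : B -> D),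
    [/\ C0_inclusion k, star_iso Phi
      & forall a, C0 a -> Phi (iota a) = k a].

End Reduced.

Definition twist_model (R : realType) (X : topologicalType)
    (B : cstarAlgType R) (iota : (X -> Cplx R) -> B)
    (H : topGroupoid X) (S : twist R H) : Prop :=
  [/\ hausdorff_space H, etale H, principal H & reduced_model S iota].

(* Main.v *)
Require Import Defs.
From HB Require Import structures.
From mathcomp Require Import all_boot all_order all_algebra complex.
From mathcomp Require Import all_classical all_reals all_analysis.
From mathcomp Require Import ring lra.

(** By the extension property, each normaliser n induces a partial map x |-> y of X with
    E(n* b n)(x) = E(b)(y) E(n* n)(x).  The functionals b |-> E(n* b)(x) with E(n* n)(x) = 1
    are the elements of the canonical twist, with the topology of pointwise convergence;
    its quotient by T is an equivalence relation on X, and evaluation turns elements of B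
    into functions on it.  Bessel's inequality, Parseval's identity and the faithfulness of E
    show that this is the reduced representation.  Conversely, in a model (H, Sigma) functions
    supported in a compact subset of a bisection are normalisers; on bisections without units
    that have disjoint source and range they square to zero, and a partition of unity on H
    gives (1).  Uniqueness holds since sigma in Sigma acts on compactly supported functions
    by evaluation, which identifies Sigma with the canonical twist.  (1) implies (2) since
    n^2 = 0 makes the elements n* n and n n* of A orthogonal, so that a state extending a
    pure state of A kills n. *)

Set Implicit Arguments.
Unset Strict Implicit.
Unset Printing Implicit Defensive.

Import Order.TTheory GRing.Theory Num.Theory.
Import numFieldNormedType.Exports.

Local Open Scope classical_set_scope.
Local Open Scope ring_scope.

(** [B] has no unit, and the proof uses no spectral theory. The substitute is [sqrt_exists], which
    solves 2w - w^2 = y inside [B], so that w plays the role of 1 - sqrt(1 - y). A pair (h, w) with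
    h^2 = 2w - w^2 behaves like the sine and one minus the cosine of an angle. Contractivity of
    homomorphisms, the positivity of functions of the form c^# c and the norm of [B] are extracted
    from such pairs. Hilbert spaces are avoided as well: the regular representation at x is the GNS
    representation of b |-> E(b)(x), with inner product E(c^# b)(x), and on finitely many
    coordinates a square-summable vector agrees with an element of [B]. Hence [B] itself, with the
    inverse of evaluation, serves as the completion of the compactly supported functions. The
    extension property enters at one point only: a contractive positive functional that restricts on
    A to evaluation at x must be b |-> E(b)(x). Partitions of unity take the form of the induction
    principle [Cc_ind], which reduces additive claims to functions supported in small open sets. *)

Local Notation toC r := (r%:C%C : Cplx _).
Local Notation "a ** b" := (cmul a b) (at level 40, left associativity).
Local Notation "a ^#" := (cadj a) (at level 1, format "a ^#").

(* The square-zero extension K + V of K by a K-module V is a commutative ring, in which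
   linear identities of V become ring identities. *)
Section SquareZero.
Context (K : fieldType) (V : lmodType K).

Definition sqzero : Type := (K * V)%type.
HB.instance Definition _ := GRing.Zmodule.on sqzero.

Definition sqzero_mul (p q : sqzero) : sqzero := (p.1 * q.1, p.1 *: q.2 + q.1 *: p.2).

Fact sqzero_mulA : associative sqzero_mul.
Proof.
move=> p q r; congr (_, _); first exact: mulrA.
by rewrite /= !scalerDr !scalerA addrA [r.1 * _]mulrC [r.1 * _]mulrC.
Qed.

Fact sqzero_mulC : commutative sqzero_mul.
Proof. by move=> p q; rewrite /sqzero_mul mulrC addrC. Qed.

Fact sqzero_mul1 : left_id (1, 0) sqzero_mul.
Proof. by move=> [a v]; rewrite /sqzero_mul /= mul1r scale1r scaler0 addr0. Qed.

Fact sqzero_mulDl : left_distributive sqzero_mul +%R.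
Proof.
move=> p q r; congr (_, _); first exact: mulrDl.
by rewrite /= scalerDl scalerDr addrACA.
Qed.

Fact sqzero_1_neq0 : (1, 0) != 0 :> sqzero.
Proof. by apply/eqP => -[/eqP]; rewrite oner_eq0. Qed.

HB.instance Definition _ := GRing.Zmodule_isComNzRing.Build sqzero
  sqzero_mulA sqzero_mulC sqzero_mul1 sqzero_mulDl sqzero_1_neq0.

Definition sqvec (v : V) : sqzero := (0, v).
Definition sqscal (a : K) : sqzero := (a, 0).

Fact sqscal_is_additive : additive sqscal.
Proof. by move=> a b; congr (_, _); rewrite /= subr0. Qed.

Fact sqscal_is_multiplicative : multiplicative sqscal.
Proof. by split=> // a b; congr (_, _); rewrite /= !scaler0 addr0. Qed.

HB.instance Definition _ := GRing.isAdditive.Build K sqzero sqscal sqscal_is_additive.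
HB.instance Definition _ := GRing.isMultiplicative.Build K sqzero sqscal sqscal_is_multiplicative.

Lemma sqvecD u v : sqvec (u + v) = sqvec u + sqvec v.
Proof. by congr (_, _); rewrite /= addr0. Qed.

Lemma sqvecN v : sqvec (- v) = - sqvec v.
Proof. by congr (_, _); rewrite /= oppr0. Qed.

Lemma sqvec0 : sqvec 0 = 0. Proof. by []. Qed.

Lemma sqvecZ a v : sqvec (a *: v) = sqscal a * sqvec v.
Proof. by congr (_, _); rewrite /= ?mulr0 // scaler0 addr0. Qed.

Lemma sqvecMn v n : sqvec (v *+ n) = sqvec v *+ n.
Proof. by elim: n => // n IH; rewrite !mulrSr sqvecD IH. Qed.

Lemma sqscalV n : n.+1%:R != 0 :> K -> sqscal (n.+1%:R^-1) * n.+1%:R = 1.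
Proof. by move=> n0; rewrite -(rmorph_nat sqscal) -rmorphM mulVf // rmorph1. Qed.

Lemma sqvec_inj u v : sqvec u = sqvec v -> u = v.
Proof. by case. Qed.

End SquareZero.

Ltac module := apply: sqvec_inj; rewrite !(sqvecD, sqvecN, sqvecZ, sqvecMn, sqvec0); ring.

(** * Real and complex scalars *)

Section ComplexNumbers.
Context (R : realType).
Implicit Types (r s : R) (z w : Cplx R).

Lemma toC_Re z : z \is Num.real -> toC (complex.Re z) = z.
Proof. exact: RRe_real. Qed.

Lemma toC_Re_ge0 z : 0 <= z -> toC (complex.Re z) = z.
Proof. by move=> z0; rewrite toC_Re ?ger0_real. Qed.

Lemma toC_le r s : (toC r <= toC s) = (r <= s).
Proof. exact: lecR. Qed.

Lemma toC_lt r s : (toC r < toC s) = (r < s).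
Proof. exact: ltcR. Qed.

Lemma toC_norm r : `|toC r| = toC `|r|.
Proof. by rewrite normc_def /= expr0n addr0 sqrtr_sqr. Qed.

Lemma toCD r s : toC (r + s) = toC r + toC s. Proof. exact: rmorphD. Qed.
Lemma toCB r s : toC (r - s) = toC r - toC s. Proof. exact: rmorphB. Qed.
Lemma toCM r s : toC (r * s) = toC r * toC s. Proof. exact: rmorphM. Qed.
Lemma toCX r n : toC (r ^+ n) = toC r ^+ n. Proof. exact: rmorphXn. Qed.
Lemma toCV r : toC r^-1 = (toC r)^-1. Proof. exact: fmorphV. Qed.
Lemma toC_nat n : toC (n%:R : R) = n%:R. Proof. exact: rmorph_nat. Qed.

Lemma toC_conj r : (toC r)^* = toC r.
Proof. by apply/CrealP; rewrite complex_real. Qed.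

Lemma conj_half : (2^-1 : Cplx R)^* = 2^-1.
Proof. by rewrite -[2]toC_nat -toCV toC_conj. Qed.

Lemma rnormE (V : normedModType (Cplx R)) (v : V) : toC (rnorm v) = `|v|.
Proof. by rewrite /rnorm toC_Re_ge0. Qed.

Lemma toC_continuous : continuous (fun r : R => toC r).
Proof.
move=> r; apply/cvgrPdist_lt => e e0.
have re0 : 0 < complex.Re e by rewrite -toC_lt toC_Re_ge0 // ltW.
near=> s; rewrite -raddfB toC_norm -(toC_Re_ge0 (ltW e0)) toC_lt.
near: s.
have /cvgrPdist_lt : w @[w --> r] --> (r : R) by exact: cvg_id.
by apply.
Unshelve. all: by end_near. Qed.

Lemma Re_continuous : continuous (fun z : Cplx R => complex.Re z).
Proof.
move=> z; apply/(cvgrPdist_lt (F := nbhs (z : Cplx R))) => e e0; near=> w.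
rewrite -toC_lt -raddfB; apply: le_lt_trans (normc_ge_Re _) _.
near: w.
have /cvgrPdist_lt : w @[w --> z] --> (z : Cplx R) by exact: cvg_id.
by apply; rewrite toC_lt.
Unshelve. all: by end_near. Qed.

Lemma conj_continuous : continuous (fun z : Cplx R => z^*).
Proof.
move=> z; apply/(cvgrPdist_lt (F := nbhs (z : Cplx R))) => e e0; near=> w.
rewrite -rmorphB norm_conjC; near: w.
have /cvgrPdist_lt : w @[w --> z] --> (z : Cplx R) by exact: cvg_id.
by apply.
Unshelve. all: by end_near. Qed.

End ComplexNumbers.
(** * C*-algebras without unit *)

Section CStarBasics.
Context (R : realType) (B : cstarAlgType R).
Implicit Types (a b c x y w h : B) (z : Cplx R).

Lemma cmul0l a : 0 ** a = 0.
Proof. by have := cmulZl 0 0 a; rewrite !scale0r. Qed.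

Lemma cmul0r a : a ** 0 = 0.
Proof. by have := cmulZr 0 a 0; rewrite !scale0r. Qed.

Lemma cmulNl a b : (- a) ** b = - (a ** b).
Proof. by rewrite -scaleN1r cmulZl scaleN1r. Qed.

Lemma cmulNr a b : a ** (- b) = - (a ** b).
Proof. by rewrite -scaleN1r cmulZr scaleN1r. Qed.

Lemma cmulBl a b c : (a - b) ** c = a ** c - b ** c.
Proof. by rewrite cmulDl cmulNl. Qed.

Lemma cmulBr a b c : a ** (b - c) = a ** b - a ** c.
Proof. by rewrite cmulDr cmulNr. Qed.

Lemma cadj0 : (0 : B)^# = 0.
Proof. by have := cadjZ 0 (0 : B); rewrite scale0r conjC0 scale0r. Qed.

Lemma cadjN a : (- a)^# = - a^#.
Proof. by rewrite -scaleN1r cadjZ rmorphN rmorph1 scaleN1r. Qed.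

Lemma cadjB a b : (a - b)^# = a^# - b^#.
Proof. by rewrite cadjD cadjN. Qed.

Lemma norm_cadj a : `|a^#| = `|a|.
Proof.
suff le b : `|b| <= `|b^#| by apply/le_anti; rewrite -{2}(cadjK a) !le.
have [->|b0] := eqVneq b 0; first by rewrite normr0.
have := cnormM b^# b; rewrite cnorm_adjM expr2 ler_pM2r //.
by rewrite normr_gt0.
Qed.

Lemma norm_cmul_adj a : `|a ** a^#| = `|a| ^+ 2.
Proof. by rewrite -{1}(cadjK a) cnorm_adjM norm_cadj. Qed.

Lemma cvg_cmul (T : Type) (F : set_system T) {FF : Filter F} (f g : T -> B) a b :
  f @ F --> a -> g @ F --> b -> (fun t => f t ** g t) @ F --> a ** b.
Proof.
move=> fa gb; apply/cvgrPdist_lt => e e0.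
have a1 : 0 < `|a| + 1 by rewrite ltr_wpDl.
have b1 : 0 < `|b| + 1 by rewrite ltr_wpDl.
near=> t.
have -> : a ** b - f t ** g t = (a - f t) ** b + f t ** (b - g t).
  by rewrite cmulBl cmulBr addrA subrK.
rewrite [ltRHS]splitr; apply: le_lt_trans (ler_normD _ _) _; apply: ltrD.
- apply: le_lt_trans (cnormM _ _) _.
  apply: (@le_lt_trans _ _ (`|a - f t| * (`|b| + 1))); first by rewrite ler_wpM2l ?lerDl.
  rewrite -ltr_pdivlMr //; near: t; apply: (cvgrPdist_lt _ _).1 => //.
  by rewrite divr_gt0 // divr_gt0.
- apply: le_lt_trans (cnormM _ _) _.
  apply: (@le_lt_trans _ _ ((`|a| + 1) * `|b - g t|)).
    rewrite ler_wpM2r //; have -> : f t = a - (a - f t) by rewrite opprB addrC subrK.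
    apply: le_trans (ler_normB _ _) _; rewrite lerD2l; apply: ltW.
    by near: t; apply: (cvgrPdist_lt _ _).1.
  rewrite mulrC -ltr_pdivlMr //; near: t; apply: (cvgrPdist_lt _ _).1 => //.
  by rewrite divr_gt0 // divr_gt0.
Unshelve. all: by end_near. Qed.

Lemma cvg_cadj (T : Type) (F : set_system T) {FF : Filter F} (f : T -> B) a :
  f @ F --> a -> (fun t => (f t)^#) @ F --> a^#.
Proof.
move=> fa; apply/cvgrPdist_lt => e e0; near=> t.
by rewrite -cadjB norm_cadj; near: t; apply: (cvgrPdist_lt _ _).1.
Unshelve. all: by end_near. Qed.

(** Majorant method: the increments of [w] are bounded by those of a monotone bounded real sequence,
    so their norms telescope. *)
Lemma cauchy_dominated (w : nat -> B) (o : nat -> R) (M : R) :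
  (forall n, `|w n.+1 - w n| <= toC (o n.+1 - o n)) -> (forall n, o n <= M) ->
  cvg (w @ \oo).
Proof.
move=> wo oM.
have oS n : o n <= o n.+1.
  by rewrite -subr_ge0 -toC_le; apply: le_trans (wo n).
have wd n m : (n <= m)%N -> `|w m - w n| <= toC (o m - o n).
  elim: m => [|m IH]; first by rewrite leqn0 => /eqP ->; rewrite !subrr normr0.
  rewrite leq_eqVlt => /predU1P[->|]; first by rewrite !subrr normr0.
  rewrite ltnS => nm.
  have -> : w m.+1 - w n = (w m.+1 - w m) + (w m - w n) by rewrite addrA subrK.
  have -> : o m.+1 - o n = (o m.+1 - o m) + (o m - o n) by rewrite addrA subrK.
  by apply: le_trans (ler_normD _ _) _; rewrite raddfD lerD ?IH.
have oc : cvgn o.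
  apply: nondecreasing_is_cvgn; first exact/nondecreasing_seqP.
  by exists M => _ [n _ <-].
apply/cauchy_cvgP/cauchy_exP => e e0.
have e20 : 0 < complex.Re e / 2.
  by rewrite divr_gt0 // -toC_lt toC_Re_ge0 // ltW.
have [N _ HN] := (cvgrPdist_lt o _).1 oc _ e20.
exists (w N), N => // n /= Nn; rewrite -ball_normE /= distrC.
apply: le_lt_trans (wd _ _ Nn) _; rewrite -(toC_Re_ge0 (ltW e0)) toC_lt.
have /= := HN _ Nn; have /= := HN _ (leqnn N).
rewrite !ltr_norml => /andP[? ?] /andP[? ?]; lra.
Qed.

Lemma cvg_norm_le (T : Type) (F : set_system T) {FF : ProperFilter F}
    (f : T -> B) l (M : Cplx R) :
  f @ F --> l -> (\forall t \near F, `|f t| <= M) -> `|l| <= M.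
Proof.
move=> fl fM; have [t0 /= ft0] := filter_ex fM.
have Mr : M \is Num.real by apply: ger0_real; apply: le_trans ft0.
have [//|Ml] := real_leP (normr_real l) Mr.
have e0 : 0 < `|l| - M by rewrite subr_gt0.
have [t [/= ft lt]] := filter_ex (filterI fM ((cvgrPdist_lt _ _).1 fl _ e0)).
have : `|l| < `|l|; last by rewrite ltxx.
rewrite -{1}(subrK (f t) l); apply: le_lt_trans (ler_normD _ _) _.
by rewrite -(subrK M `|l|); apply: ltr_leD.
Qed.

Lemma cvgn_unique (f g : nat -> B) a b :
  f @ \oo --> a -> g @ \oo --> b -> f =1 g -> a = b.
Proof.
move=> fa gb /funext fg; rewrite fg in fa.
exact: (cvg_unique (@norm_hausdorff _ B) fa gb).
Qed.

(** The limit solves 2w - w^2 = y. It is 1 - sqrt(1 - y) in the unitization, but lies in [B]. *)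
Fixpoint sqrt_seq y n :=
  if n is n'.+1 then 2^-1 *: (y + sqrt_seq y n' ** sqrt_seq y n') else 0.

Fixpoint sqrt_bound n : R := if n is n'.+1 then 2^-1 * (1 + sqrt_bound n' ^+ 2) else 0.

Lemma sqrt_bound01 n : 0 <= sqrt_bound n <= 1.
Proof. by elim: n => [|n /andP[? ?]] /=; nra. Qed.

(* The Picard iteration w |-> (y + w^2)/2 is dominated by the scalar one at y = 1. *)
Lemma sqrt_exists y : y^# = y -> `|y| <= 1 ->
  exists w, [/\ w^# = w, `|w| <= 1, w + w - w ** w = y
    & forall c, c ** y = y ** c -> c ** w = w ** c].
Proof.
move=> ys y1; pose w := sqrt_seq y; pose o := sqrt_bound.
have wo n : `|w n| <= toC (o n).
  elim: n => [|n IH] /=; first by rewrite normr0.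
  rewrite normrZ ger0_norm ?invr_ge0 ?ler0n // /o /= rmorphM rmorphD rmorphXn /=.
  rewrite fmorphV rmorph_nat rmorph1 ler_wpM2l ?invr_ge0 ?ler0n //.
  apply: le_trans (ler_normD _ _) _; rewrite lerD //.
  by apply: le_trans (cnormM _ _) _; rewrite expr2 ler_pM.
have dwo n : `|w n.+1 - w n| <= toC (o n.+1 - o n).
  elim: n => [|n IH].
    rewrite /w /o /= !subr0 cmul0l addr0 expr0n /= addr0 mulr1.
    by rewrite normrZ ger0_norm ?invr_ge0 ?ler0n // fmorphV rmorph_nat ler_piMr // invr_ge0 ler0n.
  have -> : w n.+2 - w n.+1 =
    2^-1 *: ((w n.+1 - w n) ** w n.+1 + w n ** (w n.+1 - w n)).
    have -> : w n.+2 - w n.+1 = 2^-1 *: (y + w n.+1 ** w n.+1) - 2^-1 *: (y + w n ** w n) by [].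
    by rewrite -scalerBr opprD addrACA subrr add0r cmulBl cmulBr addrA subrK.
  have -> : o n.+2 - o n.+1 = 2^-1 * ((o n.+1 - o n) * o n.+1 + o n * (o n.+1 - o n)).
    have -> : o n.+2 - o n.+1 = 2^-1 * (1 + o n.+1 ^+ 2) - 2^-1 * (1 + o n ^+ 2) by [].
    by ring.
  rewrite normrZ ger0_norm ?invr_ge0 ?ler0n // toCM toCV toC_nat.
  rewrite toCD (toCM _ (o n.+1)) (toCM (o n)) ler_wpM2l ?invr_ge0 ?ler0n //.
  by apply: le_trans (ler_normD _ _) _; rewrite lerD //;
    apply: le_trans (cnormM _ _) _; rewrite ler_pM.
have wc : cvg (w @ \oo).
  by apply: (cauchy_dominated dwo (M := 1)) => n; case/andP: (sqrt_bound01 n).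
set l := lim (w @ \oo) in wc *.
have wS : w n.+1 @[n --> \oo] --> l by have := wc; rewrite -(cvg_shiftS w).
exists l; split.
- apply: (cvgn_unique (cvg_cadj wc) wc); elim => [|n IH] /=; first by rewrite cadj0.
  by rewrite cadjZ cadjD cadjM ys [_^#]IH conj_half.
- apply: (cvg_norm_le wc); near=> n; apply: le_trans (wo n) _.
  by rewrite (_ : 1 = toC 1) // toC_le; case/andP: (sqrt_bound01 n).
- apply: (cvgn_unique (cvgB (cvgD wS wS) (cvg_cmul wc wc)) (cvg_cst y)) => n.
  change (w n.+1 + w n.+1 - w n ** w n = y).
  have -> : w n.+1 = 2^-1 *: (y + w n ** w n) by [].
  by rewrite -scalerDl -{1 2}(div1r 2) -splitr scale1r addrK.
- move=> c cy.
  apply: (cvgn_unique (cvg_cmul (cvg_cst c) wc) (cvg_cmul wc (cvg_cst c))).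
  elim => [|n IH] /=; first by rewrite cmul0l cmul0r.
  by rewrite cmulZr cmulZl cmulDr cmulDl cy cmulA IH -!cmulA IH.
Unshelve. all: by end_near. Qed.

(* p + iq and p - iq have the same modulus as x. *)
Lemma norm_le_pair x p q : p^# ** p + q^# ** q = x^# ** x ->
  p^# ** q = q^# ** p -> `|p| <= `|x| /\ `|q| <= `|x|.
Proof.
move=> pq com.
have nu (t : Cplx R) : t = 'i \/ t = - 'i -> `|p + t *: q| = `|x|.
  move=> tE; apply/eqP; rewrite -(@eqrXn2 _ 2) // -!cnorm_adjM; apply/eqP; congr `|_|.
  rewrite cadjD cadjZ cmulDl !cmulDr !cmulZl !cmulZr com scalerA.
  have [-> ->] : t^* = - t /\ - t * t = 1.
    case: tE => ->; rewrite ?rmorphN /= ?conjCi ?opprK; split=> //.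
      by rewrite mulNr -expr2 sqrCi opprK.
    by rewrite mulrN -expr2 sqrCi opprK.
  by rewrite scale1r scaleNr addrA -[_ + _ - _]addrA subrr addr0.
have np := nu 'i (or_introl erefl); have nm := nu (- 'i) (or_intror erefl).
have half (u v : B) : `|u| = `|x| -> `|v| = `|x| -> `|2^-1 *: (u + v)| <= `|x|.
  move=> nu1 nv1; rewrite normrZ ger0_norm ?invr_ge0 ?ler0n //.
  rewrite ler_pdivrMl ?ltr0n // mulr_natl mulr2n -{1}nu1 -nv1; exact: ler_normD.
split.
- have <- : 2^-1 *: ((p + 'i *: q) + (p + (- 'i) *: q)) = p; last exact: half.
  rewrite addrACA scaleNr subrr addr0 scalerDr -scalerDl.
  by rewrite -{1 2}(div1r 2) -splitr scale1r.
- have <- : 2^-1 *: ((- 'i) *: (p + 'i *: q) + 'i *: (p + (- 'i) *: q)) = q; last first.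
    by apply: half; rewrite normrZ ?normrN normCi mul1r.
  have -> : - 'i *: (p + 'i *: q) + 'i *: (p + (- 'i) *: q) = q + q.
    rewrite [- 'i *: _]scalerDr ['i *: (_ + _)]scalerDr !scalerA addrACA -scalerDl.
    by rewrite addNr scale0r add0r mulNr mulrN -expr2 sqrCi opprK scale1r.
  by rewrite scalerDr -scalerDl -{1 2}(div1r 2) -splitr scale1r.
Qed.

(** In the unitization [h] and 1 - w are commuting self-adjoint elements whose squares add up to 1,
    so [h x] and [x - w x] satisfy the hypotheses of [norm_le_pair]. *)
Lemma isom_pair h w x : h^# = h -> w^# = w -> h ** w = w ** h ->
  h ** h = w + w - w ** w -> `|h ** x| <= `|x| /\ `|x - w ** x| <= `|x|.
Proof.
move=> hs ws hw hh; apply: norm_le_pair.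
- rewrite cadjM hs cmulA -(cmulA _ h h) hh cadjB cadjM ws.
  have -> : (x^# - x^# ** w) ** (x - w ** x) =
      x^# ** x - x^# ** (w + w - w ** w) ** x; last by rewrite addrC subrK.
  rewrite cmulBl !cmulBr cmulDr cmulBl cmulDl !cmulA -addrA; congr (_ + _).
  by rewrite -opprD addrA.
- by rewrite cadjB !cadjM hs ws cmulBr cmulBl -!cmulA (cmulA h) hw -!cmulA.
Qed.

(** With 2w - w^2 = h^2 one has 1 - h^2 = (1 - w)^2, and 1 - w acts as a contraction by
    [isom_pair]. *)
Lemma norm_sub_sqr h x : h^# = h -> `|h| <= 1 -> `|x - h ** h ** x| <= `|x|.
Proof.
move=> hs h1; have hhs : (h ** h)^# = h ** h by rewrite cadjM hs.
have hh1 : `|h ** h| <= 1 by rewrite -{1}hs cnorm_adjM expr_le1.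
have [w [ws _ wE wC]] := sqrt_exists hhs hh1.
have hw : h ** w = w ** h by apply: wC; rewrite cmulA.
have K u := (isom_pair u hs ws hw (esym wE)).2.
apply: le_trans (K x); apply: le_trans (K _); rewrite le_eqVlt; apply/orP; left.
apply/eqP; congr `|_|; rewrite cmulBr -wE cmulBl cmulDl cmulA.
by rewrite !opprD !opprK !addrA addrAC.
Qed.

(** Tested on [h^#], since [h h^#] has norm |h|^2. *)
Lemma norm_le1 h : (forall x, `|h ** x| <= `|x|) -> `|h| <= 1.
Proof.
move=> /(_ h^#); rewrite norm_cmul_adj norm_cadj => hh.
have [->|h0] := eqVneq h 0; first by rewrite normr0.
by rewrite -(@ler_pM2r _ `|h|) ?normr_gt0 // mul1r -expr2.
Qed.

End CStarBasics.

(** Continuity is automatic: for |c| = 1 the element c^# c belongs to a pair as in [isom_pair],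
    whose algebraic identities survive under [phi]. So multiplication by [phi (c^# c)] is a
    contraction, and [norm_le1] applies. *)
Lemma star_hom_contractive (R : realType) (B D : cstarAlgType R) (phi : B -> D) :
  star_hom_on cmul cadj setT phi -> forall b, `|phi b| <= `|b|.
Proof.
move=> [lin mul adj] b.
have phiD (u v : B) : phi (u + v) = phi u + phi v.
  by have := lin 1 u v I I; rewrite !scale1r.
have phi0 : phi 0 = 0 by apply: (addrI (phi 0)); rewrite -phiD !addr0.
have phiZ z (u : B) : phi (z *: u) = z *: phi u.
  by have := lin z u 0 I I; rewrite phi0 !addr0.
have phiB (u v : B) : phi (u - v) = phi u - phi v.
  by rewrite phiD -scaleN1r phiZ scaleN1r.
have [->|b0] := eqVneq b 0; first by rewrite phi0 !normr0.
have nb : 0 < `|b| by rewrite normr_gt0.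
pose c := `|b|^-1 *: b.
have nc : `|c| = 1 by rewrite normrZ normfV normr_id mulVf // gt_eqF.
suff cle : `|phi c| <= 1.
  have -> : b = `|b| *: c by rewrite scalerA divff ?scale1r // gt_eqF.
  by rewrite phiZ (normrZ `|b| (phi c)) (normrZ `|b| c) nc ler_wpM2l.
pose h := c^# ** c; have hs : h^# = h by rewrite cadjM cadjK.
have h1 : `|h| = 1 by rewrite cnorm_adjM nc expr1n.
have hhs : (h ** h)^# = h ** h by rewrite cadjM hs.
have hh1 : `|h ** h| <= 1 by rewrite -{1}hs cnorm_adjM h1 expr1n.
have [w [ws _ wE wC]] := sqrt_exists hhs hh1.
have hw : h ** w = w ** h by apply: wC; rewrite cmulA.
have ph : `|phi h| <= 1.
  apply: norm_le1 => x.
  have [] // := @isom_pair _ _ (phi h) (phi w) x.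
  - by rewrite -adj // hs.
  - by rewrite -adj // ws.
  - by rewrite -!mul // hw.
  - by rewrite -!mul // -wE phiB phiD.
by rewrite -(@expr_le1 _ 2) // -cnorm_adjM -adj // -mul.
Qed.

(** * Positive functionals and the Cauchy-Schwarz inequality *)

Section PositiveFunctionals.
Context (R : realType) (B : cstarAlgType R).
Implicit Types (a b c v : B) (psi : B -> Cplx R).

Definition positive_functional psi : Prop :=
  (forall (z : Cplx R) a b, psi (z *: a + b) = z * psi a + psi b) /\
  (forall b, 0 <= psi (b^# ** b)).

Context (psi : B -> Cplx R) (hpsi : positive_functional psi).

Lemma pfD a b : psi (a + b) = psi a + psi b.
Proof. by have := hpsi.1 1 a b; rewrite scale1r mul1r. Qed.

Lemma pf0 : psi 0 = 0.
Proof. by apply: (addrI (psi 0)); rewrite -pfD !addr0. Qed.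

Lemma pfZ z a : psi (z *: a) = z * psi a.
Proof. by have := hpsi.1 z a 0; rewrite pf0 !addr0. Qed.

Lemma pfN a : psi (- a) = - psi a.
Proof. by rewrite -scaleN1r pfZ mulN1r. Qed.

Lemma pfB a b : psi (a - b) = psi a - psi b.
Proof. by rewrite pfD pfN. Qed.

(** Without a unit, symmetry is stated for products [a^# b]. Positivity at [a + b] and at [a + 'i b]
    makes P + Q and 'i (P - Q) real, which determines the conjugate of Q. *)
Lemma pf_herm a b : psi (a^# ** b) = (psi (b^# ** a))^*.
Proof.
have real c : psi (c^# ** c) \is Num.real by rewrite ger0_real // hpsi.2.
have conjr (z : Cplx R) : z \is Num.real -> z^* = z by move/CrealP.
set P := psi (a^# ** b); set Q := psi (b^# ** a).
have h1 : (P + Q)^* = P + Q.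
  apply: conjr; have -> : P + Q = psi ((a + b)^# ** (a + b)) - psi (a^# ** a) - psi (b^# ** b).
    by rewrite cadjD !cmulDl !cmulDr !pfD -/P -/Q; ring.
  by rewrite !rpredB.
have h2 : ('i * (P - Q))^* = 'i * (P - Q).
  apply: conjr; have -> : 'i * (P - Q) = psi ((a + 'i *: b)^# ** (a + 'i *: b)) - psi (a^# ** a) - psi (b^# ** b).
    rewrite cadjD cadjZ !cmulDl !cmulDr !cmulZl !cmulZr scalerA !pfD !pfZ -/P -/Q.
    rewrite conjCi (_ : - 'i * 'i = 1); last by rewrite mulNr -expr2 sqrCi opprK.
    ring.
  by rewrite !rpredB.
move: h1 h2; rewrite rmorphM /= conjCi rmorphB rmorphD /= => h1 h2.
have {}h2 : P^* - Q^* = - (P - Q).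
  by apply: (mulfI (@neq0Ci (Cplx R))); rewrite mulrN -h2 mulNr opprK.
have : 2 * Q^* = 2 * P.
  have -> : 2 * Q^* = (P^* + Q^*) - (P^* - Q^*) by ring.
  by rewrite h1 h2; ring.
by move/mulfI; rewrite pnatr_eq0 => /(_ isT).
Qed.

Lemma cauchy_schwarz a b :
  `|psi (a^# ** b)| ^+ 2 <= psi (a^# ** a) * psi (b^# ** b).
Proof.
set P := psi (a^# ** b); set A := psi (a^# ** a); set C := psi (b^# ** b).
have A0 : 0 <= A := hpsi.2 a; have C0 : 0 <= C := hpsi.2 b.
(* Positivity at [b - s P a] for real [s]; this quadratic polynomial in [s] carries the whole
   inequality. *)
have key (s : Cplx R) : s^* = s -> 0 <= s ^+ 2 * `|P| ^+ 2 * A - 2 * s * `|P| ^+ 2 + C.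
  move=> sr; have := hpsi.2 ((- (s * P)) *: a + b).
  rewrite cadjD cadjZ !cmulDl !cmulDr !cmulZl !cmulZr scalerA !pfD !pfZ.
  rewrite -/A -/C -/P [psi (b^# ** a)]pf_herm -/P rmorphN rmorphM /= sr normCK.
  by congr (0 <= _); ring.
have [N0|N0] := eqVneq (`|P| ^+ 2) 0; first by rewrite N0 mulr_ge0.
have Ngt : 0 < `|P| ^+ 2 by rewrite lt_neqAle eq_sym N0 exprn_ge0.
have creal (s : Cplx R) : 0 <= s -> s^* = s by move=> /ger0_real/CrealP.
have [Az|An] := eqVneq A 0.
  (* For A = 0 the polynomial is affine and takes the value -1 at this [s]. For A > 0 its minimum is
     attained at the inverse of A. *)
  have s0 : 0 <= (C + 1) / (2 * `|P| ^+ 2).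
    by rewrite divr_ge0 ?addr_ge0 ?mulr_ge0 ?ler0n ?exprn_ge0.
  have := key _ (creal _ s0); rewrite Az mulr0 add0r.
  have -> : - (2 * ((C + 1) / (2 * `|P| ^+ 2)) * `|P| ^+ 2) + C = - 1.
    by move: N0; rewrite expf_eq0 /= => N0; field.
  by rewrite oppr_ge0 ler10.
have Agt : 0 < A by rewrite lt_neqAle eq_sym An.
have := key A^-1 (creal _ _); rewrite invr_ge0 => /(_ A0).
have -> : A^-1 ^+ 2 * `|P| ^+ 2 * A - 2 * A^-1 * `|P| ^+ 2 + C = C - A^-1 * `|P| ^+ 2.
  by field.
by rewrite subr_ge0 ler_pdivrMl.
Qed.

Lemma pf_null a b : psi (b^# ** b) = 0 -> psi (a ** b) = 0.
Proof.
move=> b0; apply/eqP; rewrite -normr_eq0 -sqrf_eq0.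
by rewrite -(cadjK a) eq_le exprn_ge0 // andbT -[leRHS](mulr0 (psi (a^#^# ** a^#))) -b0 cauchy_schwarz.
Qed.

Lemma pf_null_l a b : psi (b ** b^#) = 0 -> psi (b ** a) = 0.
Proof.
move=> b0; apply/eqP; rewrite -normr_eq0 -sqrf_eq0.
by rewrite -{1}(cadjK b) eq_le exprn_ge0 // andbT -[leRHS](mul0r (psi (a^# ** a))) -b0 -{2}(cadjK b) cauchy_schwarz.
Qed.

(** For a contraction [d] and 2w - w^2 = d^# d, the difference of the two sides is the value of
    [psi] at the square of [c - w c]. Scaling gives the general case. *)
Lemma pf_mul_le b c : psi ((b ** c)^# ** (b ** c)) <= `|b| ^+ 2 * psi (c^# ** c).
Proof.
have unit_case d : `|d| <= 1 -> psi ((d ** c)^# ** (d ** c)) <= psi (c^# ** c).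
  move=> d1; have ys : (d^# ** d)^# = d^# ** d by rewrite cadjM cadjK.
  have y1 : `|d^# ** d| <= 1 by rewrite cnorm_adjM expr_le1.
  have [w [ws _ wE _]] := sqrt_exists ys y1.
  rewrite -subr_ge0; have := hpsi.2 (c - w ** c); congr (0 <= _).
  have -> : (d ** c)^# ** (d ** c) = c^# ** (w + w - w ** w) ** c.
    by rewrite wE cadjM !cmulA.
  rewrite cadjB cadjM ws !(cmulBl, cmulBr, cmulDl, cmulDr, cmulA) !(pfB, pfD).
  ring.
have [->|b0] := eqVneq b 0; first by rewrite cmul0l cmul0r pf0 normr0 expr0n mul0r.
have nb : 0 < `|b| by rewrite normr_gt0.
have -> : b = `|b| *: (`|b|^-1 *: b) by rewrite scalerA divff ?scale1r // gt_eqF.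
set d := _ *: b; have d1 : `|d| = 1 by rewrite normrZ normfV normr_id mulVf // gt_eqF.
rewrite cmulZl cadjZ cmulZl cmulZr !pfZ (normrZ `|b| d) d1 mulr1 normr_id mulrA.
have -> : `|b|^* = `|b| by apply/CrealP/ger0_real.
by rewrite -expr2 ler_wpM2l ?exprn_ge0 // unit_case ?d1.
Qed.

(** Cauchy-Schwarz for [v] and [b v], followed by [pf_mul_le]. This makes vector functionals
    continuous with an explicit bound. *)
Lemma pf_conj_le v b : `|psi (v^# ** b ** v)| <= `|b| * psi (v^# ** v).
Proof.
rewrite -(@ler_pXn2r _ 2) ?nnegrE ?mulr_ge0 ?hpsi.2 // -cmulA.
apply: le_trans (cauchy_schwarz _ _) _; rewrite exprMn mulrC expr2 mulrA.
by rewrite ler_wpM2r ?hpsi.2 // pf_mul_le.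
Qed.

End PositiveFunctionals.

(** * Finite subcovers *)

Section Topology.
Context (T : topologicalType).

Lemma compact_cover_seq (K : set T) (V : T -> set T) : compact K ->
  (forall x, K x -> nbhs x (V x)) ->
  exists2 l : seq T, (forall i, i \in l -> K i) &
    forall x, K x -> exists2 i, i \in l & V i x.
Proof.
move=> /compact_near_coveringP cK Vn.
pose inK (l : seq T) := forall i, i \in l -> K i.
(* The filter of properties shared by all sufficiently large finite lists in [K]; near-covering
   compactness for it yields a single list that serves every point of [K]. *)
pose F (S : set (seq T)) := exists2 l0, inK l0 &
  forall l, inK l -> {subset l0 <= l} -> S l.
have FF : Filter F.
  split; first by exists [::].
  - move=> S1 S2 [l1 K1 H1] [l2 K2 H2]; exists (l1 ++ l2).
      by move=> i; rewrite mem_cat => /orP[/K1|/K2].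
    move=> l Kl sl; split; [apply: H1 => //|apply: H2 => //] => i il;
      by apply: sl; rewrite mem_cat il ?orbT.
  - by move=> S1 S2 S12 [l1 K1 H1]; exists l1 => // l Kl sl; apply/S12/H1.
have [] := cK _ F (fun l x => exists2 i, i \in l & V i x) FF.
  move=> x Kx; exists (V x, [set l : seq T | x \in l]).
    split => /=; first exact: Vn.
    exists [:: x]; first by move=> i; rewrite inE => /eqP ->.
    by move=> l _; apply; rewrite inE.
  by move=> [y l] /= [Vy xl]; exists x.
by move=> l0 K0 /(_ l0 K0 (fun _ => id)) H; exists l0.
Qed.

End Topology.

(** * Functions vanishing at infinity *)

Section C0Functions.
Context (R : realType) (X : topologicalType).
Implicit Types (f g : X -> Cplx R).

Lemma C0_lin (z : Cplx R) f g : C0 f -> C0 g -> C0 (fun x => z * f x + g x).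
Proof.
move=> [fc f0] [gc g0]; split.
  by move=> x; apply: cvgD; [apply: cvgM; [exact: cvg_cst|exact: fc]|exact: gc].
move=> e e0; have z1 : 0 < `|z| + 1 by rewrite ltr_wpDl.
have e1 : 0 < e / 2 / (`|z| + 1) by rewrite !divr_gt0.
have e2 : 0 < e / 2 by rewrite divr_gt0.
have [K Kc Kf] := f0 _ e1; have [L Lc Lg] := g0 _ e2.
exists (K `|` L); first exact: compactU.
move=> x /not_orP[/Kf fx /Lg gx]; rewrite [ltRHS]splitr.
apply: le_lt_trans (ler_normD _ _) _; apply: ltrD => //.
rewrite normrM; move: fx; rewrite ltr_pdivlMr // mulrC; apply: le_lt_trans.
by rewrite ler_wpM2r // lerDl.
Qed.

Lemma C0_0 : C0 (fun _ : X => 0 : Cplx R).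
Proof.
split; first by move=> x; exact: cvg_cst.
by move=> e e0; exists set0; [exact: compact0|rewrite normr0].
Qed.

Lemma C0Z (z : Cplx R) f : C0 f -> C0 (fun x => z * f x).
Proof.
move=> f0; have := C0_lin z f0 C0_0; congr C0.
by apply/funext => x; rewrite addr0.
Qed.

Lemma C0D f g : C0 f -> C0 g -> C0 (fun x => f x + g x).
Proof.
move=> f0 g0; have := C0_lin 1 f0 g0; congr C0.
by apply/funext => x; rewrite mul1r.
Qed.

Lemma C0B f g : C0 f -> C0 g -> C0 (fun x => f x - g x).
Proof.
move=> f0 g0; have := C0D f0 (C0Z (- 1) g0); congr C0.
by apply/funext => x; rewrite mulN1r.
Qed.

Lemma C0M f g : C0 f -> C0 g -> C0 (fun x => f x * g x).
Proof.
move=> [fc f0] [gc g0]; split.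
  by move=> x; apply: cvgM; [exact: fc|exact: gc].
move=> e e0; have [K Kc Kf] := f0 _ e0; have [L Lc Lg] := g0 _ ltr01.
exists (K `|` L); first exact: compactU.
move=> x /not_orP[/Kf fx /Lg gx]; rewrite normrM -(mulr1 e).
by rewrite ltr_pM.
Qed.

Lemma C0_comp f (phi : Cplx R -> Cplx R) : C0 f -> continuous phi -> phi 0 = 0 ->
  C0 (fun x => phi (f x)).
Proof.
move=> [fc f0] pc p0; split.
  by move=> x; apply: (@continuous_comp _ _ _ f phi); [exact: fc|exact: pc].
move=> e e0.
have [d /= d0 dH] := cvgr_dist_lt _ _ (pc 0) _ e0.
have [K Kc Kf] := f0 _ d0; exists K => // x /Kf fx.
by have := dH (f x); rewrite /= p0 !sub0r !normrN; apply.
Qed.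

Lemma C0_conj f : C0 f -> C0 (fun x => (f x)^*).
Proof. by move=> f0; apply: (C0_comp f0); [exact: conj_continuous|rewrite conjC0]. Qed.

Lemma C0_compact f (K : set X) : continuous f -> compact K ->
  (forall x, ~ K x -> f x = 0) -> C0 f.
Proof.
by move=> fc Kc Kf; split => // e e0; exists K => // x /Kf ->; rewrite normr0.
Qed.

End C0Functions.

(** * Bump functions *)

Section Clamp.
Context (R : realType).

(** This is min(max(r, 0), 1), written with absolute values so that continuity is immediate. *)
Definition clamp (r : R) : R := 2^-1 * (`|r| - `|r - 1| + 1).

Lemma clampP r : [/\ 0 <= clamp r <= 1, r <= 0 -> clamp r = 0 & 1 <= r -> clamp r = 1].
Proof.
rewrite /clamp; have [r0|r0] := leP 0 r; have [r1|r1] := leP 1 r.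
- by rewrite !ger0_norm ?subr_ge0 //; split=> [|?|?]; [apply/andP; split|..]; lra.
- rewrite ger0_norm // ltr0_norm ?subr_lt0 //.
  by split=> [|?|?]; [apply/andP; split|..]; lra.
- by lra.
- rewrite !ltr0_norm ?subr_lt0 //.
  by split=> [|?|?]; [apply/andP; split|..]; lra.
Qed.

Lemma clamp_continuous : continuous clamp.
Proof.
move=> r; apply: cvgM; first exact: cvg_cst.
apply: cvgD; last exact: cvg_cst.
apply: cvgB; first by apply: cvg_norm; exact: cvg_id.
by apply: cvg_norm; apply: cvgB; [exact: cvg_id|exact: cvg_cst].
Qed.

End Clamp.

Section Bump.
Context (R : realType) (X : topologicalType).
Context (hXc : locally_compact [set: X]) (hX : hausdorff_space X).

Lemma bump_exists (x : X) (U : set X) : open U -> U x ->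
  exists u : X -> R, exists K : set X,
    [/\ continuous u, compact K, K `<=` U, forall y, ~ K y -> u y = 0
      & (forall y, 0 <= u y <= 1) /\ \forall y \near x, u y = 1].
Proof.
move=> oU Ux; have [N Nx [Nc Ncl]] := hXc I (x := x).
pose O := U `&` interior N.
have oO : open O by apply: openI => //; exact: open_interior.
have Nx' : nbhs x N by move: Nx; rewrite /within /=; apply: filterS => y; apply.
have Ox : O x by split.
have [] := (@uniform_separatorP _ R [set x] (~` O)).1.
  have := @locally_compact_completely_regular X R hXc hX x (~` O).
  by apply; [exact: open_closedC|move=> /(_ Ox)].
move=> f [fc f01 fx fO].
have fx0 : f x = 0 by apply: fx; exists x.
have fO1 y : ~ O y -> f y = 1 by move=> nOy; apply: fO; exists y.
(* The Urysohn function [f] is 0 at [x] and 1 off [O]. Thus [clamp g] is 1 where f <= 1/3 and 0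
   where f >= 2/3, and the set f <= 2/3 is a closed part of the compact set [N] inside [U]. *)
pose g y : R := 2 - 3 * f y.
have gc : continuous g.
  by move=> y; apply: cvgB; [exact: cvg_cst|apply: cvgM; [exact: cvg_cst|exact: fc]].
exists (fun y => clamp (g y)), [set y | 0 <= g y]; split.
- by move=> y; apply: (@continuous_comp _ _ _ g (@clamp R)); [exact: gc|exact: clamp_continuous].
- apply: (subclosed_compact _ Nc).
  + by apply: (@preimage_closed _ _ g [set r | 0 <= r]); [move=> y _; exact: gc|exact: closed_ge].
  + move=> y /= gy; apply: contrapT => nNy; move: gy; rewrite /g fO1 ?mulr1; last first.
      by move=> [_ /interior_subset].
    lra.
- move=> y /= gy; apply: contrapT => nUy; move: gy; rewrite /g fO1 ?mulr1; last by move=> [].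
  lra.
- by move=> y /= /negP; rewrite -ltNge => /ltW; have [_ + _] := clampP (g y); apply.
- split; first by move=> y; have [] := clampP (g y).
  have : \forall y \near x, `|g x - g y| < 1.
    by apply: cvgr_dist_lt; [exact: gc|exact: ltr01].
  apply: filterS => y /=; rewrite {1}/g fx0 mulr0 subr0 ltr_norml => /andP[_ gy].
  by have [_ _] := clampP (g y); apply; lra.
Qed.

Lemma C0_bump (x : X) (U : set X) : open U -> U x ->
  exists u : X -> Cplx R, exists K : set X,
    [/\ C0 u, compact K, K `<=` U, forall y, ~ K y -> u y = 0
      & (forall y, 0 <= u y <= 1) /\ \forall y \near x, u y = 1].
Proof.
move=> oU Ux; have [u [K [uc Kc KU uK [u01 u1]]]] := bump_exists oU Ux.
have uc' : continuous (fun y => toC (u y) : Cplx R).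
  by move=> y; apply: (@continuous_comp _ _ _ u (fun r => toC r)); [exact: uc|exact: toC_continuous].
exists (fun y => toC (u y)), K; split => //.
- by apply: (C0_compact uc' Kc) => y /uK ->.
- by move=> y /uK ->.
- split => [y|]; last by apply: filterS u1 => y ->.
  by rewrite (_ : 0 = toC 0) // (_ : 1 = toC 1) // !toC_le.
Qed.

End Bump.

Lemma toC_Re_comp_continuous (R : realType) (p : R -> R) : continuous p ->
  continuous (fun z : Cplx R => toC (p (complex.Re z)) : Cplx R).
Proof.
move=> pc z; apply: (@continuous_comp _ _ _ (fun z : Cplx R => p (complex.Re z)) (fun r : R => toC r)); last exact: toC_continuous.
by apply: (@continuous_comp _ _ _ (fun z : Cplx R => complex.Re z) p); [exact: Re_continuous|exact: pc].
Qed.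

(** * Homomorphisms from C0(X) *)

Section C0Homomorphism.
Context (R : realType) (X : topologicalType) (B : cstarAlgType R).
Context (iota : (X -> Cplx R) -> B) (hiota : C0_star_hom iota).
Implicit Types (f g : X -> Cplx R) (b : B).

Lemma iota_0 : iota (fun=> 0) = 0.
Proof.
have [lin _ _] := hiota; have := lin 1 (fun=> 0) (fun=> 0) (@C0_0 R X) (@C0_0 R X).
rewrite !scale1r addr0 => h; apply: (addrI (iota (fun=> 0))).
by rewrite addr0 -h.
Qed.

Lemma iota_Z z f : C0 f -> iota (fun x => z * f x) = z *: iota f.
Proof.
move=> f0; have [lin _ _] := hiota; have := lin z f (fun=> 0) f0 (@C0_0 R X).
by rewrite iota_0 !addr0.
Qed.

Lemma iota_D f g : C0 f -> C0 g -> iota (fun x => f x + g x) = iota f + iota g.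
Proof.
move=> f0 g0; have [lin _ _] := hiota; have := lin 1 f g f0 g0.
by rewrite !scale1r.
Qed.

Lemma iota_B f g : C0 f -> C0 g -> iota (fun x => f x - g x) = iota f - iota g.
Proof.
move=> f0 g0; have := iota_D f0 (C0Z (- 1) g0); rewrite iota_Z // scaleN1r => <-.
by congr iota; apply/funext => x; rewrite mulN1r.
Qed.

Lemma iota_M f g : C0 f -> C0 g -> iota (fun x => f x * g x) = iota f ** iota g.
Proof. by have [_ mul _] := hiota; exact: mul. Qed.

Lemma iota_conj f : C0 f -> iota (fun x => (f x)^*) = (iota f)^#.
Proof. by have [_ _ adj] := hiota; exact: adj. Qed.

Lemma iota_comm f g : C0 f -> C0 g -> iota f ** iota g = iota g ** iota f.
Proof.
by move=> f0 g0; rewrite -!iota_M //; congr iota; apply/funext => x; rewrite mulrC.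
Qed.

Lemma iota_real f : C0 f -> (forall x, f x \is Num.real) -> (iota f)^# = iota f.
Proof.
move=> f0 fr; rewrite -iota_conj //; congr iota; apply/funext => x.
by apply/CrealP; exact: fr.
Qed.

(** The scalar solution of 2w - w^2 = r^2. It vanishes at 0, so composing with it preserves
    C0(X). *)
Let compl_sqrt (r : R) : R := 1 - Num.sqrt (1 - r ^+ 2).

Let compl_sqrt_continuous : continuous compl_sqrt.
Proof.
move=> r; apply: cvgB; first exact: cvg_cst.
apply: (@continuous_comp _ _ _ (fun r : R => 1 - r ^+ 2) Num.sqrt); last exact: sqrt_continuous.
by apply: cvgB; [exact: cvg_cst|apply: cvgM; exact: cvg_id].
Qed.

Lemma iota_contraction_pair f b : C0 f -> (forall x, exists2 r : R, f x = toC r & `|r| <= 1) ->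
  exists w : X -> Cplx R, [/\ C0 w, forall x, w x = toC (compl_sqrt (complex.Re (f x))),
    `|iota f ** b| <= `|b| & `|b - iota w ** b| <= `|b|].
Proof.
move=> f0 fr; pose w x : Cplx R := toC (compl_sqrt (complex.Re (f x))).
have w0 : C0 w.
  apply: (@C0_comp _ _ _ (fun z => toC (compl_sqrt (complex.Re z)))) => //.
    exact: toC_Re_comp_continuous.
  by rewrite /compl_sqrt expr0n subr0 sqrtr1 subrr.
exists w; have [] // := @isom_pair _ _ (iota f) (iota w) b.
- by apply: iota_real => // x; have [r -> _] := fr x; apply/complex_realP; exists r.
- by apply: iota_real => // x; apply/complex_realP; eexists.
- exact: iota_comm.
- rewrite -!iota_M // -iota_D // -iota_B //; last exact: C0M; last exact: C0D.
  congr iota; apply/funext => x; rewrite /w; have [r -> r1] := fr x.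
  rewrite -!toCM -toCD -toCB; congr (_%:C%C); rewrite /compl_sqrt /=.
  set s := Num.sqrt _; have ss : s ^+ 2 = 1 - r ^+ 2.
    by rewrite sqr_sqrtr // subr_ge0 -real_normK ?num_real // expr_le1.
  have -> : 1 - s + (1 - s) - (1 - s) * (1 - s) = 1 - s ^+ 2 by ring.
  by rewrite ss; ring.
Qed.

(** [C0_star_hom] is purely algebraic, so the bound has to be derived: after scaling, |f|^2 takes
    values in [0, 1], its partner in [isom_pair] is again a function, and [norm_le1] bounds its
    image. *)
Lemma iota_norm_le f (M : Cplx R) : C0 f -> 0 <= M -> (forall x, `|f x| <= M) ->
  `|iota f| <= M.
Proof.
move=> f0 M0 fM; have [Mz|Mn] := eqVneq M 0.
  suff -> : f = fun=> 0 by rewrite iota_0 normr0.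
  by apply/funext => x; apply/eqP; rewrite -normr_le0 -Mz.
have Mgt : 0 < M by rewrite lt_neqAle eq_sym Mn.
pose g x := M^-1 * f x; have g0 : C0 g by exact: C0Z.
have -> : f = fun x => M * g x by apply/funext => x; rewrite mulrA divff // mul1r.
rewrite iota_Z // normrZ ger0_norm // ler_piMr //.
have g1 x : `|g x| <= 1 by rewrite normrM normfV (ger0_norm M0) ler_pdivrMl // mulr1.
rewrite -(@expr_le1 _ 2) // -cnorm_adjM -iota_conj // -iota_M //; last exact: C0_conj.
have gg0 : C0 (fun x => (g x)^* * g x) by apply: C0M => //; exact: C0_conj.
apply: norm_le1 => b; have [] // := @iota_contraction_pair _ b gg0.
  move=> x; exists (complex.Re (`|g x| ^+ 2)).
    by rewrite toC_Re_ge0 ?exprn_ge0 // normCK mulrC.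
  rewrite -toC_le -toC_norm toC_Re_ge0 ?exprn_ge0 //.
  by rewrite ger0_norm ?exprn_ge0 // expr_le1.
by move=> w [].
Qed.

End C0Homomorphism.

(** * Conditional expectations *)

Section Expectation.
Context (R : realType) (X : topologicalType).
Context (B : cstarAlgType R) (iota : (X -> Cplx R) -> B).
Context (hiota : C0_embedding iota).
Context (E : B -> B) (hE : conditional_expectation (C0_image iota) E).
Implicit Types (f g : X -> Cplx R) (a b c : B) (x y : X).

Let iota_hom : C0_star_hom iota := hiota.1.

Lemma E_lin z a b : E (z *: a + b) = z *: E a + E b.
Proof. by have [lin _ _ _ _] := hE; exact: lin. Qed.

Lemma ED a b : E (a + b) = E a + E b.
Proof. by have := E_lin 1 a b; rewrite !scale1r. Qed.

Lemma E0 : E 0 = 0.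
Proof. by apply: (addrI (E 0)); rewrite -ED !addr0. Qed.

Lemma EZ z a : E (z *: a) = z *: E a.
Proof. by have := E_lin z a 0; rewrite E0 !addr0. Qed.

Lemma EB a b : E (a - b) = E a - E b.
Proof. by rewrite ED -scaleN1r EZ scaleN1r. Qed.

Lemma E_le b : `|E b| <= `|b|.
Proof. by have [_ _ _ le _] := hE; exact: le. Qed.

Lemma E_in b : C0_image iota (E b).
Proof. by have [_ [h _] _ _ _] := hE; exact: h. Qed.

Lemma E_iota f : C0 f -> E (iota f) = iota f.
Proof. by move=> f0; have [_ [_ h] _ _ _] := hE; apply: h; exists f. Qed.

Lemma cvg_E (b_ : nat -> B) b : b_ @ \oo --> b -> (fun n => E (b_ n)) @ \oo --> E b.
Proof.
move=> bb; apply/cvgrPdist_lt => e e0; near=> n.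
rewrite -EB; apply: le_lt_trans (E_le _) _.
by near: n; apply: (cvgrPdist_lt _ _).1.
Unshelve. all: by end_near. Qed.

(** The range of the continuous projection [E] is closed. This is available before [iota] is known
    to be isometric, and it is what lets the Neumann series below converge inside A. *)
Lemma C0_image_seq_closed (a_ : nat -> B) a : (forall n, C0_image iota (a_ n)) ->
  a_ @ \oo --> a -> C0_image iota a.
Proof.
move=> aA al; have -> : a = E a; last exact: E_in.
by apply: (cvgn_unique al (cvg_E al)) => n; have [f f0 <-] := aA n; rewrite E_iota.
Qed.

(* Otherwise 1 - f/f(x) would be inverted in A by a Neumann series, while it vanishes at x. *)
Lemma iota_norm_ge f x : C0 f -> `|f x| <= `|iota f|.
Proof.
move=> f0; have [//|lt] := real_leP (normr_real (f x)) (normr_real (iota f)).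
have fx0 : f x != 0 by rewrite -normr_gt0; apply: le_lt_trans lt.
pose g y := (f x)^-1 * f y; have g0 : C0 g by exact: C0Z.
have gx : g x = 1 by rewrite /g mulVf.
have q1 : `|iota g| < 1.
  by rewrite /g iota_Z // normrZ normfV ltr_pdivrMl ?normr_gt0 // mulr1.
pose q := rnorm (iota g); have qE : toC q = `|iota g| by exact: rnormE.
have q0 : 0 <= q by rewrite -toC_le qE; exact: normr_ge0.
have {}q1 : q < 1 by rewrite -toC_lt qE; exact: q1.
pose s := fix s n := if n is n'.+1 then iota g + iota g ** s n' else 0 : B.
have sd n : `|s n.+1 - s n| <= toC q ^+ n.+1.
  elim: n => [|n IH]; first by rewrite /= subr0 cmul0r addr0 expr1 qE.
  have -> : s n.+2 - s n.+1 = iota g ** (s n.+1 - s n).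
    by rewrite cmulBr /= opprD addrACA subrr add0r.
  by apply: le_trans (cnormM _ _) _; rewrite exprS qE ler_wpM2l // -qE.
have : cvg (s @ \oo).
  apply: (@cauchy_dominated _ _ s (fun n => (1 - q ^+ n.+1) / (1 - q)) (1 - q)^-1) => n.
    apply: le_trans (sd n) _; rewrite -toCX toC_le le_eqVlt; apply/orP; left.
    apply/eqP; rewrite -mulrBl opprB addrC addrA subrK (exprS _ n.+1).
    by field; rewrite subr_eq0 gt_eqF.
  by rewrite ler_piMl ?invr_ge0 ?subr_ge0 ?(ltW q1) // gerBl exprn_ge0.
set l := lim _ => sl.
have sA n : C0_image iota (s n).
  elim: n => [|n [h h0 hn]]; first by exists (fun=> 0); [exact: C0_0|exact: iota_0].
  exists (fun y => g y + g y * h y); first by apply: C0D => //; exact: C0M.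
  by rewrite /= (iota_D iota_hom g0 (C0M g0 h0)) (iota_M iota_hom g0 h0) hn.
have [h h0 hl] := C0_image_seq_closed sA sl.
have lE : l = iota g + iota g ** l.
  have sl' : s n.+1 @[n --> \oo] --> l by have := sl; rewrite -(cvg_shiftS s).
  exact: (cvgn_unique sl' (cvgD (cvg_cst (iota g)) (cvg_cmul (cvg_cst (iota g)) sl))).
have gh : C0 (fun y => g y + g y * h y) by apply: C0D => //; exact: C0M.
have : h = fun y => g y + g y * h y.
  by apply: hiota.2 => //; rewrite (iota_D iota_hom g0 (C0M g0 h0)) (iota_M iota_hom g0 h0) hl.
move/(congr1 (fun k : X -> Cplx R => k x)); rewrite gx mul1r => /eqP.
by rewrite -{1}(add0r (h x)) (inj_eq (addIr _)) eq_sym oner_eq0.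
Qed.

(** The operator 1 - (2u^2 + 2v^2 + w^2)/5 is the average of five contractions: 1 - u^2 twice, 1 -
    v^2 twice and 1 - w^2 once. *)
Lemma norm_sub_scaled_sqrs (u v w y : B) : u^# = u -> v^# = v -> w^# = w ->
  `|u| <= 1 -> `|v| <= 1 -> `|w| <= 1 ->
  `|y - 5^-1 *: ((u ** u *+ 2 + v ** v *+ 2 + w ** w) ** y)| <= `|y|.
Proof.
move=> us vs ws u1 v1 w1.
have -> : y - 5^-1 *: ((u ** u *+ 2 + v ** v *+ 2 + w ** w) ** y) =
  5^-1 *: ((y - u ** u ** y) + (y - u ** u ** y) + ((y - v ** v ** y) + (y - v ** v ** y))
           + (y - w ** w ** y)).
  rewrite !mulr2n !cmulDl.
  have h5 : sqscal B (5 : Cplx R)^-1 * 5 = 1 by apply: sqscalV; rewrite pnatr_eq0.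
  by apply: sqvec_inj; rewrite !(sqvecD, sqvecN, sqvecZ); ring: h5.
rewrite normrZ ger0_norm ?invr_ge0 ?ler0n // ler_pdivrMl ?ltr0n //.
have -> : 5 * `|y| = `|y| + `|y| + (`|y| + `|y|) + `|y| by ring.
apply: le_trans (ler_normD _ _) _; rewrite lerD ?norm_sub_sqr //.
apply: le_trans (ler_normD _ _) _; rewrite lerD //;
  by apply: le_trans (ler_normD _ _) _; rewrite lerD ?norm_sub_sqr.
Qed.

(** For d = h - 'i k with [h] and [k] self-adjoint, d d^# + d^# d = 2h^2 + 2k^2; and here - d^# d =
    e^2. *)
Lemma mul_adj_sqrs (d e : B) : d^# ** d = - (e ** e) ->
  let h := 2^-1 *: (d + d^#) in let k := (2^-1 * 'i) *: (d - d^#) in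
  d ** d^# = h ** h *+ 2 + k ** k *+ 2 + e ** e.
Proof.
move=> de h k.
have i2 : 2^-1 * 'i * (2^-1 * 'i) = - (2^-1 * 2^-1) :> Cplx R.
  by rewrite mulrACA -['i * 'i]expr2 sqrCi mulrN1.
have -> : e ** e = - (d^# ** d) by rewrite de opprK.
rewrite /h /k !cmulZl !cmulZr !scalerA i2 !cmulBl !cmulBr !cmulDl !cmulDr.
have h2 : sqscal B (2 : Cplx R)^-1 * 2 = 1 by apply: sqscalV; rewrite pnatr_eq0.
have h4 : sqscal B (2 : Cplx R)^-1 * sqscal B 2^-1 * 4 = 1.
  have -> : 4 = 2 * 2 :> sqzero B by ring.
  by rewrite mulrACA h2 mulr1.
move: (2^-1 : Cplx R) h4 => t h4.
by apply: sqvec_inj; rewrite !(sqvecD, sqvecN, sqvecZ, sqvecMn); ring: h4.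
Qed.

(* If f(x) < 0 then d = c sqrt(f_-) satisfies d* d = - e^2 with e = f_-, so P = d d* is a sum
   of squares of self-adjoint elements and 1 - P/5 is a contraction (after scaling). But it
   multiplies d by 1 + e^2/5. *)
Lemma iota_sqr_ge0 f c x : C0 f -> iota f = c^# ** c -> 0 <= f x.
Proof.
move=> f0 fc.
have fr y : f y = toC (complex.Re (f y)).
  rewrite toC_Re //; apply/CrealP.
  have : (fun y => (f y)^*) = f.
    apply: hiota.2 => //; first exact: C0_conj.
    by rewrite iota_conj // fc cadjM cadjK.
  by move/(congr1 (fun k : X -> Cplx R => k y)).
rewrite fr (_ : 0 = toC 0) // toC_le leNgt; apply/negP => neg.
pose np (r : R) := 2^-1 * (`|r| - r).
have np0 : np 0 = 0 by rewrite /np normr0 subrr mulr0.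
have npc : continuous np.
  move=> r; apply: cvgM; first exact: cvg_cst.
  by apply: cvgB; [apply: cvg_norm; exact: cvg_id|exact: cvg_id].
have npE r : 0 <= np r /\ r * np r = - np r ^+ 2.
  rewrite /np; have [r0|r0] := leP 0 r; first by rewrite ger0_norm // subrr mulr0 mulr0 expr0n oppr0.
  by rewrite ltr0_norm //; split; [lra|field].
pose n y : Cplx R := toC (np (complex.Re (f y))).
pose s y : Cplx R := toC (Num.sqrt (np (complex.Re (f y)))).
have n0 : C0 n.
  apply: (@C0_comp _ _ _ (fun z => toC (np (complex.Re z)))) => //; last by rewrite np0.
  exact: toC_Re_comp_continuous.
have s0 : C0 s.
  apply: (@C0_comp _ _ _ (fun z => toC (Num.sqrt (np (complex.Re z))))) => //; last by rewrite np0 sqrtr0.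
  apply: (@toC_Re_comp_continuous _ (fun r => Num.sqrt (np r))) => r.
  by apply: (@continuous_comp _ _ _ np Num.sqrt); [exact: npc|exact: sqrt_continuous].
have toCr r : toC r \is Num.real by apply/complex_realP; exists r.
have ns : (iota n)^# = iota n by apply: iota_real => // y; exact: toCr.
have ss : (iota s)^# = iota s by apply: iota_real => // y; exact: toCr.
(* This scale brings [e], hence [d] by d^# d = - e^2, into the unit ball, as [norm_sub_scaled_sqrs]
   requires. *)
pose l : R := (1 + rnorm (iota n))^-1.
have rn0 (b : B) : 0 <= rnorm b by rewrite -toC_le rnormE; exact: normr_ge0.
have l0 : 0 < l by rewrite invr_gt0 ltr_wpDr.
pose e := toC l *: iota n; pose d := toC l *: (c ** iota s).
have es : e^# = e by rewrite cadjZ toC_conj ns.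
have de : d^# ** d = - (e ** e).
  have sfs : iota s ** (iota f ** iota s) = - (iota n ** iota n).
    rewrite -!iota_M //; last exact: C0M.
    rewrite -scaleN1r -iota_Z //; last exact: C0M.
    congr iota; apply/funext => y; rewrite fr /s /n.
    have [p0 pE] := npE (complex.Re (f y)).
    rewrite -!toCM mulN1r -raddfN /=; congr (_%:C%C).
    by rewrite mulrCA -expr2 sqr_sqrtr // pE expr2.
  rewrite /d /e cadjZ cadjM ss toC_conj !cmulZl !cmulZr !scalerA -scalerN; congr (_ *: _).
  by rewrite cmulA -(cmulA (iota s)) -fc -cmulA sfs.
have e1 : `|e| <= 1.
  rewrite normrZ toC_norm gtr0_norm // -rnormE -toCM (_ : 1 = toC 1) // toC_le.
  by rewrite mulrC ler_pdivrMr ?mul1r ?lerDr ?ltr_wpDr.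
have d1 : `|d| <= 1.
  rewrite -(@expr_le1 _ 2) // -cnorm_adjM de normrN.
  by apply: le_trans (cnormM _ _) _; rewrite mulr_ile1.
pose u : R := (l * np (complex.Re (f x))) ^+ 2; pose t : R := u / 5.
pose m y : Cplx R := (toC l * n y) ^+ 2.
have m0 : C0 m.
  by have := C0M (C0Z (toC l) n0) (C0Z (toC l) n0); congr C0; apply/funext => y; rewrite /m expr2.
have mE : e ** e = iota m.
  rewrite /e -iota_Z // -iota_M; [|exact: iota_hom|exact: C0Z|exact: C0Z].
  by congr iota; apply/funext => y; rewrite /m expr2.
have mx : m x = toC u by rewrite /m /n /u toCX toCM.
have ms : (e ** e)^# = e ** e by rewrite cadjM es.
clearbody d e m.
(* The iterates d (1 + e^2/5)^k. By [PD], passing from one to the next is also multiplication on the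
   left by the contraction 1 - d d^#/5. *)
pose D := fix D k := if k is k'.+1 then D k' + 5^-1 *: (D k' ** (e ** e)) else d.
have DE k : D k.+1 = D k + 5^-1 *: (D k ** (e ** e)) by [].
have PD k : d ** d^# ** D k = - (D k ** (e ** e)).
  elim: k => [|k IH]; first by rewrite /= -cmulA de cmulNr.
  by rewrite DE cmulDr cmulZr !cmulA IH !cmulNl !cmulDl !cmulZl !cmulA scalerN opprD.
have DS k : `|D k| <= 1.
  elim: k => [//|k IH]; apply: le_trans IH.
  have -> : D k.+1 = D k - 5^-1 *: (d ** d^# ** D k) by rewrite PD scalerN opprK.
  have half (v : B) : `|v| <= 2 -> `|2^-1 *: v| <= 1.
    by rewrite normrZ ger0_norm ?invr_ge0 ?ler0n // ler_pdivrMl ?ltr0n // mulr1.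
  rewrite (mul_adj_sqrs de); apply: norm_sub_scaled_sqrs => //.
  - by rewrite cadjZ cadjD cadjK conj_half addrC.
  - rewrite cadjZ cadjB cadjK rmorphM /= conj_half conjCi mulrN scaleNr -scalerN.
    by rewrite opprB.
  - apply: half; apply: le_trans (ler_normD _ _) _; rewrite norm_cadj;
    by rewrite (_ : 2 = 1 + 1) ?lerD.
  - rewrite -scalerA half // normrZ normCi mul1r; apply: le_trans (ler_normB _ _) _.
    by rewrite norm_cadj (_ : 2 = 1 + 1) ?lerD.
have DD k : exists g, [/\ C0 g, iota g = (D k)^# ** D k
    & g x = toC (- (u * ((1 + t) ^+ 2) ^+ k))].
  elim: k => [|k [g [g0 gE gx]]].
    exists (fun y => -1 * m y); split; first exact: C0Z.
      by rewrite iota_Z // -mE scaleN1r /= de.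
    by rewrite mx mulN1r expr0 mulr1 raddfN.
  have h1 : C0 (fun y => (2 / 5) * (g y * m y)) by apply: C0Z; exact: C0M.
  have h2 : C0 (fun y => (5^-1 * 5^-1) * (m y * g y * m y)).
    by apply: C0Z; apply: C0M => //; exact: C0M.
  exists (fun y => g y + (2 / 5 * (g y * m y) + 5^-1 * 5^-1 * (m y * g y * m y))); split.
  - by apply: C0D => //; exact: C0D.
  - rewrite !iota_D //; last exact: C0D.
    rewrite !iota_Z ?iota_M //; try exact: C0M; try by apply: C0M => //; exact: C0M.
    rewrite -mE gE DE cadjD cadjZ (_ : (5^-1)^* = 5^-1 :> Cplx R); last first.
      by rewrite -[5]toC_nat -toCV toC_conj.
    have gm : e ** e ** ((D k)^# ** D k) = (D k)^# ** D k ** (e ** e).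
      by rewrite -gE mE iota_comm.
    rewrite cadjM ms !cmulDl !cmulDr !cmulZl !cmulZr gm.
    rewrite -(cmulA (e ** e)) gm -(cmulA (e ** e)) (cmulA (D k)^#) (cmulA (e ** e)) gm.
    by module.
  - rewrite gx mx [_ ^+ k.+1]exprS -[2]toC_nat -[5]toC_nat -!toCV -!toCM -!toCD; congr (_%:C%C).
    by rewrite /t; field.
have u0 : 0 < u.
  rewrite exprn_gt0 // mulr_gt0 // /np ltr0_norm //.
  by move: neg => /=; lra.
have t0 : 0 < t by rewrite divr_gt0.
(* As [D k] stays in the unit ball, u (1 + t)^(2k) stays at most 1, while this inequality makes it
   grow at least linearly in [k]. *)
have bernoulli k : 1 + k%:R * t <= ((1 + t) ^+ 2) ^+ k.
  elim: k => [|k IH]; first by rewrite mul0r addr0 expr0.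
  have k0 : 0 <= k%:R * t by rewrite mulr_ge0 ?ler0n // ltW.
  rewrite exprS -natr1; apply: (@le_trans _ _ ((1 + t) ^+ 2 * (1 + k%:R * t))).
    by nra.
  by rewrite ler_wpM2l // exprn_ge0 // addr_ge0 // ltW.
have bound k : u * (1 + k%:R * t) <= 1.
  have [g [g0 gE gx]] := DD k.
  have := iota_norm_ge x g0; rewrite gE cnorm_adjM gx toC_norm normrN.
  have p0 : 0 <= u * ((1 + t) ^+ 2) ^+ k.
    by rewrite mulr_ge0 ?(ltW u0) // exprn_ge0 // exprn_ge0 // addr_ge0 // ltW.
  rewrite ger0_norm // => /le_trans /(_ (_ : `|D k| ^+ 2 <= toC 1)); rewrite toC_le => le1.
  apply: le_trans (le1 _); last by rewrite expr_le1.
  by rewrite ler_pM2l.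
have := archi_boundP (_ : 0 <= (u * t)^-1); set N := Num.bound _.
rewrite invr_ge0 mulr_ge0 ?(ltW u0) ?(ltW t0) // => /(_ isT).
have ut : 0 < u * t by exact: mulr_gt0.
rewrite -[_^-1]mul1r ltr_pdivrMr // => lt1.
by have := bound N; nra.
Qed.

End Expectation.

(** * Cut-offs and quotients with compact support *)

Section CompactlySupported.
Context (R : realType) (X : topologicalType).
Implicit Types (f g s : X -> Cplx R) (x y : X).

Lemma closed_norm_ge f (e : R) : continuous f -> closed [set x | toC e <= `|f x|].
Proof.
move=> fc; have -> : [set x | toC e <= `|f x|] = (fun x => rnorm (f x)) @^-1` [set r | e <= r].
  by apply/seteqP; split => x /=; rewrite -toC_le rnormE.
apply: preimage_closed; last exact: closed_ge.
move=> x _; apply: (@continuous_comp _ _ _ (fun x => `|f x|) (fun z : Cplx R => complex.Re z)).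
  by apply: cvg_norm; exact: fc.
exact: Re_continuous.
Qed.

Lemma C0_compact_ge f (e : R) : C0 f -> 0 < e -> compact [set x | toC e <= `|f x|].
Proof.
move=> [fc f0] e0; have [|K Kc Kf] := f0 (toC e); first by rewrite (_ : 0 = toC 0) // toC_lt.
apply: (subclosed_compact _ Kc); first exact: closed_norm_ge.
move=> x /= ex; apply: contrapT => /Kf /(le_lt_trans ex).
by rewrite ltxx.
Qed.

Lemma open_neq0 f : continuous f -> open [set x | f x != 0].
Proof. by move=> fc; rewrite openE => x /= fx; apply: (cvgr_neq0 (f x)) => //; exact: fc. Qed.

(** The function clamp(|f|/e - 1): it can only be nonzero on the compact set where |f| >= e, and it
    has reached 1 once |f| >= 2e. *)
Lemma C0_cutoff f (e : R) : C0 f -> 0 < e ->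
  exists k : X -> Cplx R, [/\ C0 k, forall x, 0 <= k x <= 1,
    forall x, k x != 0 -> toC e <= `|f x|
    & forall x, toC (2 * e) <= `|f x| -> k x = 1].
Proof.
move=> f0 e0; pose phi (z : Cplx R) : Cplx R := toC (clamp (rnorm z / e - 1)).
have pc : continuous phi.
  have rc (T : topologicalType) (g : T -> R) : continuous g -> continuous (fun t => clamp (g t / e - 1)).
    move=> gc t; apply: (@continuous_comp _ _ _ (fun t => g t / e - 1) (@clamp R)); last exact: clamp_continuous.
    apply: cvgB; last exact: cvg_cst.
    by apply: cvgM; [exact: gc|exact: cvg_cst].
  move=> z; apply: (@continuous_comp _ _ _ (fun z : Cplx R => clamp (rnorm z / e - 1)) (fun r => toC r)); last exact: toC_continuous.
  apply: rc => {}z.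
  apply: (@continuous_comp _ _ _ (fun z : Cplx R => `|z|) (fun z : Cplx R => complex.Re z)).
    exact: norm_continuous.
  exact: Re_continuous.
have c0 r : r <= e -> clamp (r / e - 1) = 0.
  by move=> re; have [_ + _] := clampP (r / e - 1); apply; rewrite subr_le0 ler_pdivrMr // mul1r.
exists (fun x => phi (f x)); split.
- apply: C0_comp => //; rewrite /phi c0 // -toC_le rnormE normr0; apply/ltW.
  by rewrite (_ : 0 = toC 0) // toC_lt.
- move=> x; rewrite (_ : 0 = toC 0) // (_ : 1 = toC 1) // !toC_le.
  by have [] := clampP (rnorm (f x) / e - 1).
- move=> x; apply: contraR => fe; rewrite /phi c0 //.
  by move: fe; rewrite -rnormE toC_le -ltNge => /ltW.
- move=> x fe; rewrite /phi; have [_ _ ->] // := clampP (rnorm (f x) / e - 1).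
  rewrite lerBrDl ler_pdivlMr //; move: fe; rewrite -rnormE toC_le.
  by have -> : 1 + 1 = 2 :> R by [].
Qed.

(** Off the closed set [K] the numerator vanishes identically, so the quotient is locally 0 there,
    whatever [s] does. *)
Lemma C0_div f s (K : set X) : closed K -> compact K -> continuous f -> continuous s ->
  (forall x, f x != 0 -> K x) -> (forall x, K x -> s x != 0) ->
  C0 (fun x => f x / s x).
Proof.
move=> cK Kc fc sc fK Ks.
have nK x : ~ K x -> f x / s x = 0.
  move=> nKx; have [->|/fK//] := eqVneq (f x) 0.
  by rewrite mul0r.
suff fsc : continuous (fun x => f x / s x) by exact: (C0_compact fsc Kc nK).
move=> x; have [Kx|nKx] := pselect (K x).
  apply: cvgM; first exact: fc.
  by apply: cvgV; [exact: Ks|exact: sc].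
apply: cvg_near_cst; rewrite (nK _ nKx).
have : nbhs x (~` K) by apply: open_nbhs_nbhs; split => //; exact: closed_openC.
by apply: filterS => y /nK.
Qed.

End CompactlySupported.

(** * Characters of C0(X) *)

Section Characters.
Context (R : realType) (X : topologicalType).
Context (hXc : locally_compact [set: X]) (hX : hausdorff_space X).
Implicit Types (f g : X -> Cplx R) (x y : X).

(** If no point represents [chi], every [y] has a nonnegative function in the kernel that is nonzero
    at [y]. Finitely many of them add up to some [s] without zeros on the compact set |e| >= 1/4.
    Then [e k] is [s] times a function in C0(X), so it lies in the kernel, against chi(e k) != 0. *)
Lemma C0_character (chi : (X -> Cplx R) -> Cplx R) :
  (forall z f g, C0 f -> C0 g -> chi (fun x => z * f x + g x) = z * chi f + chi g) ->
  (forall f g, C0 f -> C0 g -> chi (fun x => f x * g x) = chi f * chi g) ->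
  (forall f (M : Cplx R), C0 f -> 0 <= M -> (forall x, `|f x| <= M) -> `|chi f| <= M) ->
  (exists2 e, C0 e & chi e != 0) ->
  exists y, forall f, C0 f -> chi f = f y.
Proof.
move=> lin mul bd [e' e'0 ce'].
have chi0 : chi (fun=> 0) = 0.
  apply/eqP; rewrite -normr_le0; apply: bd => // [|x]; last by rewrite normr0.
  exact: C0_0.
have chiZ z f : C0 f -> chi (fun x => z * f x) = z * chi f.
  move=> f0; have := lin z f (fun=> 0) f0 (@C0_0 R X); rewrite chi0 addr0 => <-.
  by congr chi; apply/funext => x; rewrite addr0.
have chiD f g : C0 f -> C0 g -> chi (fun x => f x + g x) = chi f + chi g.
  move=> f0 g0; have := lin 1 f g f0 g0; rewrite mul1r => <-.
  by congr chi; apply/funext => x; rewrite mul1r.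
have chiB f g : C0 f -> C0 g -> chi (fun x => f x - g x) = chi f - chi g.
  move=> f0 g0; have := chiD _ _ f0 (C0Z (-1) g0); rewrite chiZ // mulN1r => <-.
  by congr chi; apply/funext => x; rewrite mulN1r.
pose e x := (chi e')^-1 * e' x.
have e0 : C0 e by exact: C0Z.
have ce : chi e = 1 by rewrite chiZ // mulVf.
have chiK f : C0 f -> chi (fun x => f x - chi f * e x) = 0.
  by move=> f0; rewrite (chiB _ _ f0 (C0Z _ e0)) chiZ // ce mulr1 subrr.
apply: contrapT => /forallNP no.
(* Kernel elements that do not vanish at [y]: h - chi(h) e if e(y) = 0; f - chi(f) e with chi(f) !=
   f(y) if e(y) = 1; and e^2 - e otherwise. The square of the modulus makes them nonnegative. *)
have ker y : exists g, [/\ C0 g, chi g = 0, forall x, 0 <= g x & g y != 0].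
  suff [g [g0 cg gy]] : exists g, [/\ C0 g, chi g = 0 & g y != 0].
    exists (fun x => (g x)^* * g x); split.
    - by apply: C0M => //; exact: C0_conj.
    - by rewrite mul ?cg ?mulr0 //; exact: C0_conj.
    - by move=> x; rewrite mulrC -normCK exprn_ge0.
    - by rewrite mulf_neq0 // conjC_eq0.
  have /existsNP[f /not_implyP[f0 cf]] := no y.
  have [ey0|eyn0] := eqVneq (e y) 0.
    have [h [K [h0 _ _ _ [_ /nbhs_singleton hy]]]] := C0_bump R hXc hX openT (I : [set: X] y).
    exists (fun x => h x - chi h * e x); split.
    - by apply: C0B => //; exact: C0Z.
    - exact: chiK.
    - by rewrite hy ey0 mulr0 subr0 oner_eq0.
  have [ey1|eyn1] := eqVneq (e y) 1.
    exists (fun x => f x - chi f * e x); split.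
    - by apply: C0B => //; exact: C0Z.
    - exact: chiK.
    - by rewrite ey1 mulr1 subr_eq0 eq_sym; apply/eqP.
  exists (fun x => e x * e x - e x); split.
  - by apply: C0B => //; exact: C0M.
  - by rewrite (chiB _ _ (C0M e0 e0) e0) mul // ce mulr1 subrr.
  - by rewrite -{3}(mulr1 (e y)) -mulrBr mulf_neq0 // subr_eq0.
(* Cutting off at 1/4 changes [e] by at most 1/2 uniformly; since chi(e) = 1, the value chi(e k)
   cannot vanish. *)
have q0 : 0 < 4^-1 :> R by rewrite invr_gt0.
have [k [k0 k01 ke k1]] := C0_cutoff e0 q0.
have {k1}ck : chi (fun x => e x * k x) != 0.
  apply/negP => /eqP ck; have : `|chi (fun x => e x - e x * k x)| <= toC (2 * 4^-1).
    apply: bd; first by apply: C0B => //; exact: C0M.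
      by rewrite (_ : 0 = toC 0) // toC_le; lra.
    move=> x; have [/k1 ->|] := boolP (toC (2 * 4^-1) <= `|e x|).
      by rewrite mulr1 subrr normr0 (_ : 0 = toC 0) // toC_le; lra.
    rewrite -rnormE toC_le -ltNge -toC_lt rnormE => /ltW; apply: le_trans.
    rewrite -{1}(mulr1 (e x)) -mulrBr normrM ler_piMr //.
    by have /andP[? ?] := k01 x; rewrite ger0_norm ?subr_ge0 // gerBl.
  by rewrite (chiB _ _ e0 (C0M e0 k0)) ce ck subr0 normr1 (_ : 1 = toC 1) // toC_le; lra.
pose K := [set x | toC 4^-1 <= `|e x|].
have cK : closed K by apply: closed_norm_ge; case: e0.
have Kc : compact K by apply: C0_compact_ge => //.
pose G y := projT1 (cid (ker y)).
have GP y : [/\ C0 (G y), chi (G y) = 0, forall x, 0 <= G y x & G y y != 0] := projT2 (cid (ker y)).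
have [y Ky|l _ lK] := @compact_cover_seq _ K (fun y => [set x | G y x != 0]) Kc.
  by have [[Gc _] _ _ Gy] := GP y; apply: open_nbhs_nbhs; split => //; exact: open_neq0.
have [s [s0 cs sge sl]] : exists s, [/\ C0 s, chi s = 0, forall x, 0 <= s x
    & forall x y, y \in l -> G y x != 0 -> s x != 0].
  elim: l {lK} => [|y l [s [s0 cs sge sl]]]; first by exists (fun=> 0); split => //; exact: C0_0.
  have [G0 cG Gge _] := GP y; exists (fun x => G y x + s x); split.
  - exact: C0D.
  - by rewrite chiD // cG cs addr0.
  - by move=> x; rewrite addr_ge0.
  - move=> x y'; rewrite inE paddr_eq0 // => /predU1P[->|yl] Gx; first by rewrite negb_and Gx.
    by rewrite negb_and (sl _ _ yl Gx) orbT.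
have Ks x : K x -> s x != 0 by move=> /lK[y yl Gy]; apply: (sl x y).
have ek0 : C0 (fun x => e x * k x) by exact: C0M.
have h0 : C0 (fun x => e x * k x / s x).
  apply: (@C0_div _ _ (fun x => e x * k x) s K) => //; [by case: ek0|by case: s0|].
  by move=> x; rewrite mulf_eq0 negb_or => /andP[_ /ke].
case/negP: ck; rewrite -(_ : (fun x => s x * (e x * k x / s x)) = fun x => e x * k x).
  by rewrite mul // cs mul0r.
apply/funext => x; have [sx|sx] := eqVneq (s x) 0; last by rewrite mulrC divfK.
rewrite sx mul0r; have [->|kx] := eqVneq (k x) 0; first by rewrite mulr0.
by have := Ks _ (ke _ kx); rewrite sx eqxx.
Qed.

End Characters.

(** * Closures and linear spans *)

Section Closures.
Context (R : realType) (B : cstarAlgType R).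
Implicit Types (S : set B) (P : B -> Prop).

Lemma closure_normP S b : closure S b <->
  forall e : Cplx R, 0 < e -> exists2 c, S c & `|b - c| < e.
Proof.
split=> [cl e e0|cl V /nbhs_ballP[e /= e0 eV]].
  have [c [Sc]] := cl _ (nbhsx_ballx b _ e0).
  by rewrite -ball_normE /=; exists c.
have [c Sc bc] := cl e e0; exists c; split => //; apply: eV.
by rewrite -ball_normE.
Qed.

Lemma lspan_ind S P : P 0 -> (forall z a b, S a -> P b -> P (z *: a + b)) ->
  forall b, lspan S b -> P b.
Proof.
move=> P0 PS b [n]; elim: n b => [|n IH] b [c [v [Sv ->]]]; first by rewrite big_ord0.
rewrite big_ord_recl; apply: PS => //; apply: IH.
by exists (fun i => c (lift ord0 i)), (fun i => v (lift ord0 i)).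
Qed.

Lemma lspan0 S : lspan S 0.
Proof.
exists 0%N, (fun=> 0), (fun=> 0); split; first by case.
by rewrite big_ord0.
Qed.

Lemma lspan_cons S z a b : S a -> lspan S b -> lspan S (z *: a + b).
Proof.
move=> Sa [n [c [v [Sv ->]]]].
exists n.+1, (fun i => oapp c z (unlift ord0 i)), (fun i => oapp v a (unlift ord0 i)).
split; first by move=> i; case: (unlift ord0 i).
rewrite big_ord_recl unlift_none; congr (_ + _); apply: eq_bigr => i _.
by rewrite liftK.
Qed.

Lemma lspan_lin S z a b : lspan S a -> lspan S b -> lspan S (z *: a + b).
Proof.
move=> Sa Sb; elim/lspan_ind: Sa => [|w c d Sc IH]; first by rewrite scaler0 add0r.
by rewrite scalerDr scalerA -addrA; apply: lspan_cons.
Qed.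

Lemma lspan_sub S a : S a -> lspan S a.
Proof. by move=> Sa; rewrite -(addr0 a) -(scale1r a); apply: lspan_cons => //; exact: lspan0. Qed.

End Closures.

(** * The states b |-> E(b)(x) and approximate units *)

Section PointEvaluations.
Context (R : realType) (X : topologicalType) (B : cstarAlgType R).

Record faithful_inclusion (iota : (X -> Cplx R) -> B) (E : B -> B) : Prop := {
  fi_locally_compact : locally_compact [set: X];
  fi_hausdorff : hausdorff_space X;
  fi_embedding : C0_embedding iota;
  fi_regular : regular_inclusion (C0_image iota);
  fi_expectation : conditional_expectation (C0_image iota) E;
  fi_faithful : faithful_expectation E
}.

(** [iota] is not given with an inverse, so the preimage of [E b] is chosen by [xget]. Injectivity
    on C0(X) makes the choice unique. *)
Definition expect_fun (iota : (X -> Cplx R) -> B) (E : B -> B) (b : B) : X -> Cplx R :=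
  xget (fun=> 0) [set f | C0 f /\ iota f = E b].

Definition expect (iota : (X -> Cplx R) -> B) (E : B -> B) (x : X) (b : B) : Cplx R :=
  expect_fun iota E b x.

Context (iota : (X -> Cplx R) -> B) (E : B -> B) (hs : faithful_inclusion iota E).
Implicit Types (f g u : X -> Cplx R) (a b c v n m : B) (x y : X).

Local Notation ev := (expect iota E).
Local Notation A := (C0_image iota).
Let hio : C0_star_hom iota := (fi_embedding hs).1.
Let hinj := (fi_embedding hs).2.
Let hE := fi_expectation hs.

Lemma expect_funP b : C0 (expect_fun iota E b) /\ iota (expect_fun iota E b) = E b.
Proof.
have [f f0 fb] := E_in hE b.
exact: (@xgetPex _ (fun=> 0) [set f | C0 f /\ iota f = E b] (ex_intro _ f (conj f0 fb))).
Qed.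

Lemma expect_C0 b : C0 (fun x => ev x b). Proof. exact: (expect_funP b).1. Qed.

Lemma iota_expect b : iota (fun x => ev x b) = E b. Proof. exact: (expect_funP b).2. Qed.

Lemma expect_eq f b : C0 f -> iota f = E b -> forall x, ev x b = f x.
Proof.
move=> f0 fb x; have := hinj f0 (expect_C0 b); rewrite iota_expect => /(_ fb).
by move/(congr1 (fun k : X -> Cplx R => k x)).
Qed.

Lemma expect_iota f x : C0 f -> ev x (iota f) = f x.
Proof. by move=> f0; apply: expect_eq => //; rewrite (E_iota hE). Qed.

Lemma expect_lin x z a b : ev x (z *: a + b) = z * ev x a + ev x b.
Proof.
apply: (expect_eq (C0_lin z (expect_C0 a) (expect_C0 b))).
rewrite iota_D //; [|by apply: C0Z; exact: expect_C0|exact: expect_C0].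
rewrite iota_Z //; last exact: expect_C0.
by rewrite !iota_expect (E_lin hE).
Qed.

Lemma expect_iota_l f b x : C0 f -> ev x (iota f ** b) = f x * ev x b.
Proof.
move=> f0; apply: (expect_eq (C0M f0 (expect_C0 b))).
rewrite iota_M //; last exact: expect_C0.
have [_ _ _ _ bim] := hE; have [|-> _] := bim (iota f) b; first by exists f.
by rewrite iota_expect.
Qed.

Lemma expect_iota_r f b x : C0 f -> ev x (b ** iota f) = ev x b * f x.
Proof.
move=> f0; apply: (expect_eq (C0M (expect_C0 b) f0)).
rewrite iota_M //; last exact: expect_C0.
have [_ _ _ _ bim] := hE; have [|_ ->] := bim (iota f) b; first by exists f.
by rewrite iota_expect.
Qed.

Lemma expect_le x b : `|ev x b| <= `|b|.
Proof.
apply: le_trans (E_le hE b); rewrite -iota_expect.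
exact: (iota_norm_ge (fi_embedding hs) hE x (expect_C0 b)).
Qed.

Lemma expect_pos x : positive_functional (ev x).
Proof.
split=> [z a b|b]; first exact: expect_lin.
have [_ _ pos _ _] := hE; have [c cE] := pos b.
apply: (iota_sqr_ge0 (fi_embedding hs) hE x (expect_C0 _)).
by rewrite iota_expect; exact: cE.
Qed.

Lemma expect_faithful b : (forall x, ev x (b^# ** b) = 0) -> b = 0.
Proof.
move=> b0; apply: (fi_faithful hs); rewrite -iota_expect -[RHS](iota_0 hio).
by congr iota; apply/funext => x; exact: b0.
Qed.

Lemma bump_at x (U : set X) : open U -> U x ->
  exists u : X -> Cplx R, exists K : set X,
    [/\ C0 u, compact K, K `<=` U, forall y, ~ K y -> u y = 0
      & (forall y, 0 <= u y <= 1) /\ \forall y \near x, u y = 1].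
Proof. exact: (C0_bump R (fi_locally_compact hs) (fi_hausdorff hs)). Qed.

Lemma unit_bump x : exists u : X -> Cplx R, [/\ C0 u, forall y, 0 <= u y <= 1 & u x = 1].
Proof.
have [u [K [u0 _ _ _ [u01 /nbhs_singleton u1]]]] := bump_at openT (I : [set: X] x).
by exists u.
Qed.

Lemma C0_separates x y : (forall f : X -> Cplx R, C0 f -> f x = f y) -> x = y.
Proof.
move=> fxy; apply: contrapT => xy.
have oU : open (~` [set y]).
  by apply: closed_openC; apply: accessible_closed_set1; apply: hausdorff_accessible; exact: fi_hausdorff hs.
have [u [K [u0 _ KU uK [_ /nbhs_singleton u1]]]] := bump_at oU (xy : (~` [set y]) x).
have uy : u y = 0 by apply: uK => /KU; apply.
by have := fxy _ u0; rewrite u1 uy => /eqP; rewrite oner_eq0.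
Qed.

Lemma expect_adj x b : ev x b^# = (ev x b)^*.
Proof.
have [u [u0 u01 u1]] := unit_bump x.
have us : (iota u)^# = iota u by apply: iota_real => // y; apply: ger0_real; case/andP: (u01 y).
have := pf_herm (expect_pos x) (iota u) b^#.
by rewrite us cadjK expect_iota_l // expect_iota_r // u1 mul1r mulr1.
Qed.

Lemma expect_continuous b : continuous (fun x => ev x b).
Proof. by have [] := expect_C0 b. Qed.

(** [E] is a contraction that fixes A, so the distance from [b] to [E b] is at most twice the
    distance from [b] to any element of A. *)
Lemma C0_image_closed b :
  (forall e : Cplx R, 0 < e -> exists2 a, A a & `|b - a| <= e) -> A b.
Proof.
move=> ba; have <- : E b = b; last exact: (E_in hE b).
apply/eqP; rewrite -subr_eq0 -normr_le0; apply/ler_addgt0Pl => e e0; rewrite addr0.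
have [|_ [f f0 <-] le] := ba (e / 2); first by rewrite divr_gt0.
have -> : E b - b = E (b - iota f) - (b - iota f).
  by rewrite (EB hE) (E_iota hE) // opprB addrA subrK.
apply: le_trans (ler_normB _ _) _; rewrite [leRHS]splitr lerD //.
exact: le_trans (E_le hE _) _.
Qed.

(** The partner of [u] in [isom_pair] is sqrt(u (2 - u)), so 1 - u acts on [B] as a contraction. *)
Lemma sub_bump_le u b : C0 u -> (forall y, 0 <= u y <= 1) -> `|b - iota u ** b| <= `|b|.
Proof.
move=> u0 u01; pose q (r : R) := Num.sqrt (`|r * (2 - r)|).
have qc : continuous q.
  move=> r; apply: (@continuous_comp _ _ _ (fun r : R => `|r * (2 - r)|) Num.sqrt); last exact: sqrt_continuous.
  apply: cvg_norm; apply: cvgM; first exact: cvg_id.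
  by apply: cvgB; [exact: cvg_cst|exact: cvg_id].
pose f y : Cplx R := toC (q (complex.Re (u y))).
have f0 : C0 f.
  apply: (@C0_comp _ _ _ (fun z => toC (q (complex.Re z)))) => //.
    exact: toC_Re_comp_continuous.
  by rewrite /q mul0r normr0 sqrtr0.
have [] // := @isom_pair _ _ (iota f) (iota u) b.
- by apply: iota_real => // y; apply/complex_realP; eexists.
- by apply: iota_real => // y; apply: ger0_real; case/andP: (u01 y).
- exact: iota_comm.
- rewrite -!iota_M // -iota_D // -iota_B //; last exact: C0M; last exact: C0D.
  congr iota; apply/funext => y; have /andP[uy0 uy1] := u01 y; rewrite /f.
  have uE := toC_Re_ge0 uy0; set r := complex.Re (u y) in uE *.
  have r0 : 0 <= r by rewrite -toC_le uE.
  have r1 : r <= 1 by rewrite -toC_le uE.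
  rewrite -uE -!toCM -toCD -toCB; congr (_%:C%C).
  by rewrite -expr2 sqr_sqrtr // ger0_norm; [ring|rewrite mulr_ge0 //; lra].
Qed.

(** Nondegeneracy provides sums of products [f a]. A cut-off of [f] handles one product, and 1 - u =
    (1 - k)(1 - v) merges two such functions within 0 <= u <= 1. *)
Lemma approx_unit b (e : Cplx R) : 0 < e ->
  exists u, [/\ C0 u, forall y, 0 <= u y <= 1 & `|b - iota u ** b| <= e].
Proof.
move: e; have : closure (lspan [set c | exists a b, A a /\ c = a ** b]) b.
  by have [-> _] := fi_regular hs.
move=> /closure_normP cl e e0.
have e30 : 0 < e / 2 by rewrite divr_gt0.
have [c Sc bc] := cl _ e30.
suff [u [u0 u01 uc]] : exists u, [/\ C0 u, forall y, 0 <= u y <= 1 & `|c - iota u ** c| <= e / 2].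
  exists u; split => //; have -> : b - iota u ** b = (b - c) - iota u ** (b - c) + (c - iota u ** c).
    by rewrite cmulBr; module.
  apply: le_trans (ler_normD _ _) _; rewrite [leRHS]splitr lerD //.
  by apply: le_trans (sub_bump_le _ u0 u01) _; apply: ltW.
move: (e / 2) e30 => {e e0 bc}e e0; move: e e0.
elim/lspan_ind: Sc => [|z _ d [_ [a [[f f0 <-] ->]]] IH] e e0.
  exists (fun=> 0); split; [exact: C0_0|by move=> y; rewrite lexx ler01|].
  by rewrite cmul0r subr0 normr0 ltW.
have e20 : 0 < e / 2 by rewrite divr_gt0.
have [v [v0 v01 dv]] := IH _ e20.
pose M := 1 + `|z *: a|; have M0 : 0 < M by rewrite ltr_wpDr.
(* The value is e/(4M): where |f| < 2t, the function f - k f is at most e/(2M), and |z a| <= M. *)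
pose t := complex.Re (e / 2 / M / 2).
have tE : toC t = e / 2 / M / 2 by rewrite toC_Re_ge0 // ltW // !divr_gt0.
have t0 : 0 < t by rewrite -toC_lt tE !divr_gt0.
have [k [k0 k01 _ k1]] := C0_cutoff f0 t0.
pose u y := k y + v y - v y * k y.
have kv0 : C0 (fun y => v y * k y) by exact: C0M.
exists u; split.
- by apply: C0B => //; exact: C0D.
- move=> y; have /andP[? ?] := k01 y; have /andP[? ?] := v01 y.
  have -> : u y = 1 - (1 - k y) * (1 - v y) by rewrite /u; ring.
  by rewrite subr_ge0 gerBl mulr_ge0 ?subr_ge0 // mulr_ile1 ?subr_ge0 // gerBl.
rewrite /u iota_B // ?iota_D // ?iota_M //; last exact: C0D.
have -> (s : B) : s - (iota k + iota v - iota v ** iota k) ** s =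
    (s - iota k ** s) - iota v ** (s - iota k ** s).
  by rewrite cmulBl cmulDl cmulBr cmulA; module.
rewrite (_ : _ - iota v ** _ = ((z *: (iota f ** a) - iota k ** (z *: (iota f ** a))) - iota v ** (z *: (iota f ** a) - iota k ** (z *: (iota f ** a)))) + ((d - iota v ** d) - iota k ** (d - iota v ** d))); last first.
  by rewrite !(cmulBr, cmulDr) !cmulA (iota_comm hio v0 k0); module.
apply: le_trans (ler_normD _ _) _; rewrite [leRHS]splitr lerD //; last first.
  exact: le_trans (sub_bump_le _ k0 k01) _.
apply: le_trans (sub_bump_le _ v0 v01) _.
have -> : z *: (iota f ** a) - iota k ** (z *: (iota f ** a)) = iota (fun y => f y - k y * f y) ** (z *: a).
  rewrite iota_B // ?iota_M //; last exact: C0M.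
  by rewrite cmulBl !cmulZr cmulA.
apply: le_trans (cnormM _ _) _.
have le1 : `|iota (fun y => f y - k y * f y)| <= e / 2 / M.
  apply: iota_norm_le => //; first by apply: C0B => //; exact: C0M.
    by rewrite ltW // !divr_gt0.
  move=> y; have /andP[? ?] := k01 y.
  have [/k1 ->|] := boolP (toC (2 * t) <= `|f y|).
    by rewrite mul1r subrr normr0 ltW // !divr_gt0.
  rewrite -rnormE toC_le -ltNge -toC_lt rnormE toCM tE toC_nat => /ltW.
  rewrite mulrC divfK ?pnatr_eq0 //; apply: le_trans.
  by rewrite -{1}(mul1r (f y)) -mulrBl normrM ler_piMl // ger0_norm ?subr_ge0 // gerBl.
apply: (@le_trans _ _ (e / 2 / M * M)); last by rewrite divfK // gt_eqF.
by rewrite ler_pM // lerDr.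
Qed.

Lemma approx_unit_r b (e : Cplx R) : 0 < e ->
  exists u, [/\ C0 u, forall y, 0 <= u y <= 1 & `|b - b ** iota u| <= e].
Proof.
move=> e0; have [u [u0 u01 ub]] := approx_unit b^# e0; exists u; split => //.
rewrite -norm_cadj cadjB cadjM (iota_real hio) // => y.
by apply: ger0_real; case/andP: (u01 y).
Qed.

End PointEvaluations.

(** * States *)

Section States.
Context (R : realType) (X : topologicalType) (B : cstarAlgType R).
Context (iota : (X -> Cplx R) -> B) (E : B -> B) (hs : faithful_inclusion iota E).
Implicit Types (f g u : X -> Cplx R) (a b c v n m : B) (x y : X).

Local Notation ev := (expect iota E).
Local Notation A := (C0_image iota).
Let hio : C0_star_hom iota := (fi_embedding hs).1.
Let hE := fi_expectation hs.

Lemma iota_A f : C0 f -> A (iota f). Proof. by exists f. Qed.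

Lemma expect_A a : A a -> iota (fun x => ev x a) = a.
Proof. by move=> [f f0 <-]; rewrite (iota_expect hs) (E_iota hE). Qed.

Lemma expect_mul_l x a b : A a -> ev x (a ** b) = ev x a * ev x b.
Proof. by move=> [f f0 <-]; rewrite (expect_iota_l hs) // (expect_iota hs). Qed.

Lemma expect_mul_r x a b : A b -> ev x (a ** b) = ev x a * ev x b.
Proof. by move=> [f f0 <-]; rewrite (expect_iota_r hs) // (expect_iota hs). Qed.

Lemma normaliser_adj n : normaliser A n -> normaliser A n^#.
Proof. by move=> nn a Aa; rewrite cadjK; have [? ?] := nn a Aa. Qed.

Lemma normaliser_mul n m : normaliser A n -> normaliser A m -> normaliser A (n ** m).
Proof.
move=> nn nm a Aa; rewrite cadjM; split.
  by have := (nn _ (nm a Aa).1).1; rewrite !cmulA.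
by have := (nm _ (nn a Aa).2).2; rewrite !cmulA.
Qed.

Lemma A_scale z a : A a -> A (z *: a).
Proof. by move=> [f f0 <-]; exists (fun x => z * f x); [exact: C0Z|rewrite iota_Z]. Qed.

Lemma A_mul a b : A a -> A b -> A (a ** b).
Proof. by move=> [f f0 <-] [g g0 <-]; exists (fun x => f x * g x); [exact: C0M|rewrite iota_M]. Qed.

Lemma A_adj a : A a -> A a^#.
Proof. by move=> [f f0 <-]; exists (fun x => (f x)^*); [exact: C0_conj|rewrite iota_conj]. Qed.

Lemma A_comm a b : A a -> A b -> a ** b = b ** a.
Proof. by move=> [f f0 <-] [g g0 <-]; rewrite iota_comm. Qed.

Lemma normaliser_scale z n : normaliser A n -> normaliser A (z *: n).
Proof.
move=> nn a Aa; have [h1 h2] := nn a Aa.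
by rewrite !(cadjZ, cmulZl, cmulZr); split; do 2!apply: A_scale.
Qed.

Lemma normaliser_A a : A a -> normaliser A a.
Proof. by move=> Aa b Ab; split; do !apply: A_mul => //; apply: A_adj. Qed.

(** The definition of a normaliser only puts n^# a n in A; [n^# n] is the limit of n^# u n along
    approximate units. *)
Lemma normaliser_sqr n : normaliser A n -> A (n^# ** n).
Proof.
move=> nn; apply: (C0_image_closed hs) => e e0.
have n1 : 0 < 1 + `|n| by rewrite ltr_wpDr.
have [u [u0 _ un]] := approx_unit hs n (divr_gt0 e0 n1).
exists (n^# ** iota u ** n); first exact: (nn _ (iota_A u0)).2.
rewrite -cmulA -cmulBr; apply: le_trans (cnormM _ _) _; rewrite norm_cadj.
apply: (@le_trans _ _ ((1 + `|n|) * (e / (1 + `|n|)))); last by rewrite mulrC divfK // gt_eqF.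
by rewrite ler_pM // lerDr.
Qed.

Lemma normaliser_sqr_adj n : normaliser A n -> A (n ** n^#).
Proof. by move/normaliser_adj/normaliser_sqr; rewrite cadjK. Qed.

Lemma toC0 : toC 0 = 0 :> Cplx R. Proof. by []. Qed.
Lemma toC1 : toC 1 = 1 :> Cplx R. Proof. by []. Qed.

Lemma state_on_le (S : set B) (phi : B -> Cplx R) a :
  (forall (z : Cplx R) b, S b -> S (z *: b)) -> S 0 ->
  state_on S phi -> S a -> `|phi a| <= `|a|.
Proof.
move=> SZ S0 [lin pos sup1] Sa.
have phi0 : phi 0 = 0.
  have := lin 1 0 0 S0 S0; rewrite scale1r addr0 mul1r => /eqP.
  by rewrite -[X in X == _]addr0 (inj_eq (addrI _)) eq_sym => /eqP.
have phiZ z b : S b -> phi (z *: b) = z * phi b.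
  by move=> Sb; have := lin z b 0 Sb S0; rewrite phi0 !addr0.
have [->|a0] := eqVneq a 0; first by rewrite phi0 !normr0.
have na : 0 < `|a| by rewrite normr_gt0.
have le1 b : S b -> `|b| <= 1 -> `|phi b| <= 1.
  move=> Sb b1; rewrite -rnormE -toC1 toC_le -lee_fin -sup1.
  by apply: ereal_sup_ubound; exists b.
have := le1 (`|a|^-1 *: a) (SZ _ _ Sa).
rewrite normrZ normfV normr_id mulVf ?gt_eqF // phiZ // normrM normfV normr_id.
by rewrite ler_pdivrMl // mulr1; apply.
Qed.

Lemma state_on_intro (S : set B) (phi : B -> Cplx R) :
  (forall (z : Cplx R) a b, S a -> S b -> phi (z *: a + b) = z * phi a + phi b) ->
  (forall a, S a -> 0 <= phi (a^# ** a)) ->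
  (forall a, S a -> `|a| <= 1 -> `|phi a| <= 1) ->
  (forall e : R, 0 < e -> exists a, [/\ S a, `|a| <= 1 & toC (1 - e) <= `|phi a|]) ->
  state_on S phi.
Proof.
move=> lin pos le1 app; split => //; apply/eqP; rewrite eq_le; apply/andP; split.
  apply: ub_ereal_sup => _ [a [Sa a1] <-]; rewrite lee_fin -toC_le rnormE toC1.
  exact: le1.
apply/lee_addgt0Pr => e e0; have [a [Sa a1 ea]] := app e e0.
rewrite -leeBlDr // -EFinB; apply: (@le_trans _ _ (rnorm (phi a))%:E).
  by rewrite lee_fin -toC_le rnormE.
by apply: ereal_sup_ubound; exists a.
Qed.

Lemma state_on_approx (S : set B) (phi : B -> Cplx R) (e : R) :
  state_on S phi -> 0 < e -> exists a, [/\ S a, `|a| <= 1 & toC (1 - e) <= `|phi a|].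
Proof.
move=> [_ _ sup1] e0.
have /ereal_sup_gtP[_ [a [Sa a1] <-]] : ((1 - e)%:E < ereal_sup
    [set (rnorm (phi a))%:E | a in S `&` [set a | (`|a| <= 1)%R]])%E.
  by rewrite sup1 lte_fin gtrBl.
by rewrite lte_fin => /ltW ea; exists a; split => //; rewrite -rnormE toC_le.
Qed.

Lemma C0_sqrt f : C0 f -> (forall x, 0 <= f x) ->
  exists g : X -> Cplx R, [/\ C0 g, forall x, 0 <= g x & forall x, g x * g x = f x].
Proof.
move=> f0 fge; pose q (r : R) := Num.sqrt r.
exists (fun x => toC (q (complex.Re (f x)))); split.
- apply: (@C0_comp _ _ f (fun z => toC (q (complex.Re z)))) => //; last by rewrite /q sqrtr0.
  exact/toC_Re_comp_continuous/sqrt_continuous.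
- by move=> x; rewrite -toC0 toC_le sqrtr_ge0.
- move=> x; rewrite -toCM -expr2 sqr_sqrtr ?toC_Re_ge0 //.
  by rewrite -toC_le toC_Re_ge0.
Qed.

Definition A_positive (phi : B -> Cplx R) : Prop :=
  (forall (z : Cplx R) a b, A a -> A b -> phi (z *: a + b) = z * phi a + phi b) /\
  (forall f, C0 f -> (forall x, 0 <= f x) -> 0 <= phi (iota f)).

(** Composition with [E] turns functionals on A into functionals on [B], so that the Cauchy-Schwarz
    inequality above applies to them. *)
Lemma A_positive_functional phi : A_positive phi -> positive_functional (phi \o E).
Proof.
move=> [lin pos]; split=> [z a b|b] /=.
  by rewrite (E_lin hE) lin //; exact: (E_in hE).
rewrite -(iota_expect hs); apply: pos; first exact: expect_C0.
by move=> x; have [_] := expect_pos hs x; apply.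
Qed.

Lemma state_A_positive phi : state_on A phi -> A_positive phi.
Proof.
move=> [lin pos _]; split => // f f0 fge; have [g [g0 gge gg]] := C0_sqrt f0 fge.
have := pos _ (iota_A g0); rewrite -iota_conj // -iota_M //; last exact: C0_conj.
congr (0 <= phi (iota _)); apply/funext => x.
by rewrite -gg; congr (_ * _); apply/CrealP/ger0_real.
Qed.

Lemma A_state_le phi a : state_on A phi -> A a -> `|phi a| <= `|a|.
Proof.
apply: state_on_le; first by move=> z b; apply: A_scale.
by exists (fun=> 0); [exact: C0_0|exact: iota_0].
Qed.

(** Take [f] in the unit ball where [phi] nearly attains its norm and an approximate unit [u]. By
    Cauchy-Schwarz |phi(u f)|^2 is at most phi(u^2) phi(|f|^2), so |f|^2 serves as the bump. *)
Lemma A_state_bump phi (e : R) : state_on A phi -> 0 < e ->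
  exists g, [/\ C0 g, forall x, 0 <= g x <= 1 & toC (1 - e) <= phi (iota g)].
Proof.
move=> st e0; have pos := state_A_positive st.
have pf := A_positive_functional pos.
have e40 : 0 < e / 4 by rewrite divr_gt0.
have [_ [[f f0 <-] f1 ef]] := state_on_approx st e40.
exists (fun x => (f x)^* * f x).
have ff0 : C0 (fun x => (f x)^* * f x) by apply: C0M => //; exact: C0_conj.
split => //.
  move=> x; rewrite mulrC -normCK exprn_ge0 //= expr_le1 //.
  by apply: le_trans f1; exact: (iota_norm_ge (fi_embedding hs) hE x f0).
have te40 : 0 < toC (e / 4) :> Cplx R by rewrite -toC0 toC_lt.
have [u [u0 u01 uf]] := approx_unit hs (iota f) te40.
have us : (iota u)^# = iota u by apply: iota_real => // y; apply: ger0_real; case/andP: (u01 y).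
have := cauchy_schwarz pf (iota u) (iota f).
rewrite /= us -iota_conj // -!iota_M //; last exact: C0_conj.
have uf0 := C0M u0 f0; have uu0 := C0M u0 u0.
rewrite !(E_iota hE) // => cs.
set P := phi (iota _); have P0 : 0 <= P.
  by apply: pos.2 => // x; rewrite mulrC -normCK exprn_ge0.
have uu1 : phi (iota (fun x => u x * u x)) <= 1.
  apply: le_trans (real_ler_norm _) _; first by apply: ger0_real; apply: pos.2 => // x; case/andP: (u01 x) => *; rewrite mulr_ge0.
  apply: le_trans (A_state_le st (iota_A uu0)) _; apply: iota_norm_le => // x.
  by case/andP: (u01 x) => *; rewrite normrM mulr_ile1 // ger0_norm.
have le1 : `|phi (iota (fun x => u x * f x))| ^+ 2 <= P.
  by apply: le_trans cs _; rewrite ler_piMl.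
apply: le_trans le1.
have le2 : toC (1 - e / 2) <= `|phi (iota (fun x => u x * f x))|.
  have -> : toC (1 - e / 2) = toC (1 - e / 4) - toC (e / 4) :> Cplx R.
    by rewrite -toCB; congr (_%:C%C); field.
  rewrite lerBlDr; apply: le_trans ef _.
  have -> : iota f = (iota f - iota u ** iota f) + iota (fun x => u x * f x).
    by rewrite iota_M // subrK.
  have Ad : A (iota f - iota u ** iota f).
    by rewrite -iota_M // -iota_B //; apply: iota_A; apply: C0B.
  have := pos.1 1 _ _ Ad (iota_A uf0); rewrite scale1r mul1r => ->.
  rewrite addrC; apply: le_trans (ler_normD _ _) _; rewrite lerD2l.
  exact: le_trans (A_state_le st Ad) uf.
have [e2|e2] := leP e 2.
  apply: (@le_trans _ _ (toC (1 - e / 2) ^+ 2)).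
    by rewrite -toCX toC_le; nra.
  by rewrite ler_pXn2r // nnegrE // -toC0 toC_le; lra.
by apply: (@le_trans _ _ 0); rewrite ?exprn_ge0 // -toC0 toC_le; lra.
Qed.

(** The constant [M] supplies continuity only. Cauchy-Schwarz against an approximate unit upgrades
    the bound on functions with values in [0, 1] to norm at most 1. *)
Lemma A_state_intro phi (M : Cplx R) : A_positive phi -> 0 <= M ->
  (forall a, A a -> `|phi a| <= M * `|a|) ->
  (forall g, C0 g -> (forall x, 0 <= g x <= 1) -> phi (iota g) <= 1) ->
  (forall e : R, 0 < e -> exists g, [/\ C0 g, forall x, 0 <= g x <= 1
     & toC (1 - e) <= phi (iota g)]) ->
  state_on A phi.
Proof.
move=> pos M0 bd le1 app; have pf := A_positive_functional pos.
apply: state_on_intro => //; first exact: pos.1.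
- move=> _ [f f0 <-]; rewrite -iota_conj // -iota_M //; last exact: C0_conj.
  apply: pos.2; first by apply: C0M => //; exact: C0_conj.
  by move=> x; rewrite mulrC -normCK exprn_ge0.
- move=> _ [f f0 <-] f1; apply/ler_addgt0Pr => e e0.
  have M1 : 0 < M + 1 by rewrite ltr_wpDl.
  have [u [u0 u01 uf]] := approx_unit hs (iota f) (divr_gt0 e0 M1).
  have us : (iota u)^# = iota u by apply: iota_real => // y; apply: ger0_real; case/andP: (u01 y).
  have uf0 := C0M u0 f0; have uu0 := C0M u0 u0.
  have ff0 : C0 (fun x => (f x)^* * f x) by apply: C0M => //; exact: C0_conj.
  have -> : iota f = (iota f - iota u ** iota f) + iota (fun x => u x * f x).
    by rewrite iota_M // subrK.
  have Ad : A (iota f - iota u ** iota f).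
    by rewrite -iota_M // -iota_B //; apply: iota_A; apply: C0B.
  have := pos.1 1 _ _ Ad (iota_A uf0); rewrite scale1r mul1r => ->.
  rewrite addrC; apply: le_trans (ler_normD _ _) _; rewrite lerD //.
    rewrite -(@expr_le1 _ 2) //; have := cauchy_schwarz pf (iota u) (iota f).
    rewrite /= us -iota_conj // -!iota_M //; last exact: C0_conj.
    rewrite !(E_iota hE) // => cs; apply: le_trans cs _; rewrite mulr_ile1 //.
    + by apply: pos.2 => // x; case/andP: (u01 x) => *; rewrite mulr_ge0.
    + by apply: pos.2 => // x; rewrite mulrC -normCK exprn_ge0.
    + by apply: le1 => // x; case/andP: (u01 x) => *; rewrite mulr_ge0 // mulr_ile1.
    + apply: le1 => // x; rewrite mulrC -normCK exprn_ge0 //= expr_le1 //.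
      by apply: le_trans f1; exact: (iota_norm_ge (fi_embedding hs) hE x f0).
  apply: le_trans (bd _ Ad) _; apply: (@le_trans _ _ (M * (e / (M + 1)))).
    by rewrite ler_wpM2l.
  by rewrite mulrCA ger_pMr // ler_pdivrMr // mul1r lerDl.
- move=> e e0; have [g [g0 g01 ge]] := app e e0; exists (iota g); split.
  + exact: iota_A.
  + by apply: iota_norm_le => // x; case/andP: (g01 x) => *; rewrite ger0_norm.
  + apply: le_trans ge _; apply: real_ler_norm; apply: ger0_real; apply: pos.2 => // x.
    by case/andP: (g01 x).
Qed.

End States.

(** * Pure states of A and the implication from (1) to (2) *)

Section PureStates.
Context (R : realType) (X : topologicalType) (B : cstarAlgType R).
Context (iota : (X -> Cplx R) -> B) (E : B -> B) (hs : faithful_inclusion iota E).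
Implicit Types (f g u : X -> Cplx R) (a b c v n m : B) (x y : X) (phi psi : B -> Cplx R).

Local Notation A := (C0_image iota).
Let hio : C0_star_hom iota := (fi_embedding hs).1.
Let hE := fi_expectation hs.

Lemma A_positive_le phi f g : A_positive iota phi -> C0 f -> C0 g ->
  (forall x, f x <= g x) -> phi (iota f) <= phi (iota g).
Proof.
move=> pos f0 g0 fg; have := pos.2 _ (C0B g0 f0); rewrite iota_B //.
have -> : iota g - iota f = (-1) *: iota f + iota g by rewrite scaleN1r addrC.
rewrite pos.1; [|exact: iota_A|exact: iota_A].
by rewrite mulN1r addrC subr_ge0; apply=> x; rewrite subr_ge0.
Qed.

(* For 0 <= p <= 1/2, a pure state phi is a convex combination of the normalisations of
   phi(p . ) and phi((1 - p) . ), hence multiplicative. *)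
Lemma pure_state_mul phi p a : pure_state_on A phi -> C0 p ->
  (forall x, 0 <= p x <= 2^-1) -> A a -> phi (iota p ** a) = phi (iota p) * phi a.
Proof.
move=> [st pure] p0 p01 Aa.
have pos := state_A_positive hs st; have [lin ge0] := pos.
pose s := phi (iota p).
have p1 x : 0 <= p x /\ p x <= 1.
  case/andP: (p01 x) => ? px; split=> //; apply: le_trans px _.
  by rewrite invf_le1 ?ler1n ?ltr0n.
have s0 : 0 <= s by apply: ge0 => // x; case: (p1 x).
have shalf : s <= 2^-1.
  apply: le_trans (real_ler_norm (ger0_real s0)) _; apply: le_trans (A_state_le hs st (iota_A _ p0)) _.
  apply: (iota_norm_le hio p0); first by rewrite invr_ge0 ler0n.
  by move=> x; case/andP: (p01 x) => *; rewrite ger0_norm.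
have s1 : s < 1 by apply: le_lt_trans shalf _; rewrite invf_lt1 ?ltr1n ?ltr0n.
have Ap : A (iota p) := iota_A _ p0.
have Apm b : A b -> A (iota p ** b) by move=> Ab; apply: (A_mul hs).
have phiD b c : A b -> A c -> phi (b + c) = phi b + phi c.
  by move=> Ab Ac; have := lin 1 b c Ab Ac; rewrite scale1r mul1r.
have phiN b : A b -> phi (- b) = - phi b.
  move=> Ab; have := lin (-1) b (0 *: b) Ab (A_scale hs _ Ab).
  rewrite scale0r addr0 scaleN1r mulN1r => ->.
  have := lin 1 (0 *: b) (0 *: b) (A_scale hs _ Ab) (A_scale hs _ Ab).
  rewrite scale0r scale1r addr0 mul1r => /eqP; rewrite -[X in X == _]addr0.
  by rewrite (inj_eq (addrI _)) => /eqP <-; rewrite addr0.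
have phiB b c : A b -> A c -> phi (b - c) = phi b - phi c.
  move=> Ab Ac; rewrite phiD ?phiN // -scaleN1r; exact: (A_scale hs).
have lin1 (z : Cplx R) b c : A b -> A c ->
    phi (iota p ** (z *: b + c)) = z * phi (iota p ** b) + phi (iota p ** c).
  by move=> Ab Ac; rewrite cmulDr cmulZr lin //; exact: Apm.
have pf_ge f : C0 f -> (forall x, 0 <= f x) -> 0 <= phi (iota p ** iota f).
  move=> f0 fge; rewrite -iota_M //; apply: ge0; first exact: C0M.
  by move=> x; rewrite mulr_ge0 //; case: (p1 x).
have pf_le f : C0 f -> (forall x, 0 <= f x) -> phi (iota p ** iota f) <= phi (iota f).
  move=> f0 fge; rewrite -iota_M //; apply: (A_positive_le pos) => //; first exact: C0M.
  by move=> x; rewrite ler_piMl //; case: (p1 x).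
have pb b : A b -> `|phi (iota p ** b)| <= `|b|.
  move=> Ab; apply: le_trans (A_state_le hs st (Apm _ Ab)) _; apply: le_trans (cnormM _ _) _.
  rewrite ler_piMl //; apply: iota_norm_le => // x.
  by case: (p1 x) => *; rewrite ger0_norm.
(* If phi(p) = 0 there is nothing to normalise, but then the square root of [p] is null and
   Cauchy-Schwarz gives phi(p a) = 0. *)
have [sz|sn] := eqVneq s 0.
  have pf := A_positive_functional hs pos.
  have [r [r0 rge rr]] := C0_sqrt p0 (fun x => (p1 x).1).
  have rs : (iota r)^# = iota r by apply: iota_real => // x; apply: ger0_real.
  have rrE : iota r ** iota r = iota p.
    by rewrite -iota_M //; congr iota; apply/funext.
  have /(_ (iota r ** a)) := pf_null_l pf _ (b := iota r).
  rewrite /= rs rrE (E_iota hE) // => /(_ sz).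
  have [f f0 <-] := Aa; rewrite cmulA rrE -iota_M // (E_iota hE); last exact: C0M.
  by rewrite iota_M // => ->; rewrite -/s sz mul0r.
have sgt : 0 < s by rewrite lt_neqAle eq_sym sn.
have s1' : 0 < 1 - s by rewrite subr_gt0.
have ABm b c : A b -> A c -> A (b - c).
  move=> [f f0 <-] [g g0 <-]; exists (fun x => f x - g x); first exact: C0B.
  by rewrite iota_B.
(* An approximate unit for [p]; on it the normalised functional [psi1] is almost 1. *)
have near1 (e : R) : 0 < e -> exists g, [/\ C0 g, forall x, 0 <= g x <= 1 & s - toC e <= phi (iota p ** iota g)].
  move=> e0; have te0 : 0 < toC e :> Cplx R by rewrite -toC0 toC_lt.
  have [u [u0 u01 up]] := approx_unit_r hs (iota p) te0.
  exists u; split => //; rewrite lerBlDr -lerBlDl.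
  have Au : A (iota p ** iota u) by apply: Apm; exact: iota_A.
  rewrite -/s -phiB //; apply: le_trans up.
  apply: le_trans (A_state_le hs st (ABm _ _ Ap Au)).
  apply: real_ler_norm; apply: ger0_real; rewrite phiB // subr_ge0.
  rewrite -iota_M //; apply: (A_positive_le pos) => //; first exact: C0M.
  by move=> x; have [? ?] := p1 x; case/andP: (u01 x) => *; rewrite ler_piMr.
pose psi1 b := s^-1 * phi (iota p ** b).
pose psi2 b := (1 - s)^-1 * (phi b - phi (iota p ** b)).
have st1 : state_on A psi1.
  apply: (@A_state_intro _ _ _ _ _ hs _ s^-1).
  - split=> [z b c Ab Ac|f f0 fge]; first by rewrite /psi1 lin1 //; ring.
    by rewrite mulr_ge0 ?invr_ge0 // pf_ge.
  - by rewrite invr_ge0.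
  - by move=> b Ab; rewrite normrM ger0_norm ?invr_ge0 // ler_wpM2l ?invr_ge0 ?pb.
  - move=> g g0 g01; rewrite /psi1 ler_pdivrMl // mulr1 -iota_M //.
    apply: (A_positive_le pos) => //; first exact: C0M.
    by move=> x; have [? ?] := p1 x; case/andP: (g01 x) => *; rewrite ler_piMr.
  - move=> e e0; have ts : 0 < complex.Re s by rewrite -toC_lt toC_Re_ge0.
    have [g [g0 g01 ge]] := near1 _ (mulr_gt0 ts e0); exists g; split => //.
    rewrite /psi1 ler_pdivlMl //; apply: le_trans ge.
    by rewrite toCM toCB toC1 toC_Re_ge0 // mulrBr mulr1.
(* To bound [psi2 g], the function [g] is enlarged to w = 1 - (1 - g)(1 - u), which also dominates
   the approximate unit [u]. Then phi(p w) is almost [s], so phi(w) - phi(p w) is at most about 1 -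
   s. *)
have bound2 g (e : R) : C0 g -> (forall x, 0 <= g x <= 1) -> 0 < e ->
    exists w, [/\ C0 w, forall x, 0 <= w x <= 1, forall x, g x <= w x
      & s - toC e <= phi (iota p ** iota w)].
  move=> g0 g01 e0; have [u [u0 u01 ue]] := near1 e e0.
  pose w x := g x + u x - g x * u x.
  have w0 : C0 w by apply: C0B; [exact: C0D|exact: C0M].
  have wE x : w x = 1 - (1 - g x) * (1 - u x) by rewrite /w; ring.
  have gw x : g x <= w x /\ u x <= w x.
    case/andP: (u01 x) => ? ?; case/andP: (g01 x) => ? ?; rewrite /w; split.
      by rewrite -addrA lerDl -{1}(mul1r (u x)) -mulrBl mulr_ge0 // subr_ge0.
    by rewrite addrAC lerDr -{1}(mulr1 (g x)) -mulrBr mulr_ge0 // subr_ge0.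
  exists w; split => //.
  - move=> x; case/andP: (u01 x) => u_0 u_1; case/andP: (g01 x) => g_0 g_1.
    have [gle _] := gw x; rewrite (le_trans g_0 gle) /= wE gerBl.
    by rewrite mulr_ge0 // subr_ge0.
  - by move=> x; case: (gw x).
  - apply: le_trans ue _; rewrite -!iota_M //; apply: (A_positive_le pos); [exact: C0M|exact: C0M|].
    by move=> x; have [? ?] := p1 x; have [_ ?] := gw x; rewrite ler_wpM2l.
have phi_le1 g : C0 g -> (forall x, 0 <= g x <= 1) -> phi (iota g) <= 1.
  move=> g0 g01; apply: le_trans (real_ler_norm (ger0_real (ge0 _ g0 _))) _.
    by move=> x; case/andP: (g01 x).
  apply: le_trans (A_state_le hs st (iota_A _ g0)) _.
  by apply: (iota_norm_le hio g0) => // x; case/andP: (g01 x) => *; rewrite ger0_norm.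
have i1 : 0 <= (1 - s)^-1 by rewrite invr_ge0 ltW.
have st2 : state_on A psi2.
  apply: (@A_state_intro _ _ _ _ _ hs _ ((1 - s)^-1 * 2)).
  - split=> [z b c Ab Ac|f f0 fge]; first by rewrite /psi2 lin1 // lin //; ring.
    by apply: mulr_ge0 => //; rewrite subr_ge0 pf_le.
  - exact: mulr_ge0.
  - move=> b Ab; rewrite normrM ger0_norm // -mulrA.
    rewrite ler_wpM2l //; apply: le_trans (ler_normB _ _) _.
    by rewrite mulr_natl mulr2n lerD ?pb // (A_state_le hs st).
  - move=> g g0 g01; rewrite /psi2 ler_pdivrMl // mulr1.
    apply/ler_addgt0Pr => e e0.
    have re0 : 0 < complex.Re e by rewrite -toC_lt toC_Re_ge0 // ltW.
    have [w [w0 w01 gw we]] := bound2 g _ g0 g01 re0.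
    rewrite (toC_Re_ge0 (ltW e0)) in we.
    have : phi (iota g) - phi (iota p ** iota g) <= phi (iota w) - phi (iota p ** iota w).
      have wg0 := C0B w0 g0; have Ag := iota_A iota g0; have Aw := iota_A iota w0.
      have := pf_le _ wg0 (fun x => _); rewrite iota_B // cmulBr !phiB //; try exact: Apm.
      move=> H; rewrite lerBlDr addrAC -addrA -lerBlDl -[leRHS]opprB lerNr opprB.
      by apply: H => x; rewrite subr_ge0.
    move/le_trans; apply; rewrite lerBlDr; apply: le_trans (phi_le1 _ w0 w01) _.
    by rewrite [leLHS](_ : 1 = 1 - s + e + (s - e)); [rewrite lerD2l|ring].
  - move=> e e0; have ts : 0 < complex.Re (1 - s) by rewrite -toC_lt toC_Re_ge0 // ltW.
    have [g [g0 g01 ge]] := A_state_bump hs st (mulr_gt0 ts e0); exists g; split => //.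
    rewrite /psi2 ler_pdivlMl // lerBrDr; apply: le_trans ge.
    rewrite [leRHS]toCB toCM (toC_Re_ge0 (ltW s1')) toCB toC1 mulrBr mulr1.
    rewrite [leRHS](_ : _ = 1 - s - (1 - s) * toC e + s); last by move: (toC e) => t; ring.
    rewrite lerD2l -iota_M //; apply: (A_positive_le pos) => //; first exact: C0M.
    by move=> x; have [? ?] := p1 x; case/andP: (g01 x) => *; rewrite ler_piMr.
have [//|psiE _] := pure psi1 psi2 s st1 st2 sgt s1 _ a Aa.
  move=> b Ab; rewrite /psi1 /psi2 !mulrA !divff ?gt_eqF // !mul1r.
  by rewrite addrC subrK.
by rewrite -psiE /psi1 mulrA divff // mul1r.
Qed.

(** Division by M = 2|a|^2 + 1 brings the function [a^# a] below 1/2, the range in which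
    [pure_state_mul] makes [phi] multiplicative. *)
Lemma pure_state_orthogonal phi a b : pure_state_on A phi ->
  A a -> A b -> phi (a^# ** a ** (b^# ** b)) = 0 -> phi (a^# ** a) = 0 \/ phi (b^# ** b) = 0.
Proof.
move=> pu [f f0 <-] Ab ab0; have [lin ge0] := state_A_positive hs pu.1.
pose M := 2 * `|iota f| ^+ 2 + 1.
have M0 : 0 < M by rewrite ltr_wpDl // mulr_ge0 // exprn_ge0.
have ff0 : C0 (fun x => (f x)^* * f x) by apply: C0M => //; exact: C0_conj.
have p0 := C0Z M^-1 ff0.
have := pure_state_mul (a := b^# ** b) pu p0.
have ffE : iota (fun x => (f x)^* * f x) = (iota f)^# ** iota f.
  by rewrite iota_M ?iota_conj //; exact: C0_conj.
have phiZ z c : A c -> phi (z *: c) = z * phi c.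
  move=> Ac; have c0 := A_scale hs 0 Ac; have := lin z c _ Ac c0; rewrite scale0r addr0 => ->.
  have := lin 1 _ _ c0 c0; rewrite scale0r scale1r addr0 mul1r => /eqP.
  by rewrite -[X in X == _]addr0 (inj_eq (addrI _)) => /eqP <-; rewrite addr0.
have Aff : A ((iota f)^# ** iota f) by rewrite -ffE; exact: iota_A.
have Abb : A (b^# ** b) by apply: (A_mul hs) => //; exact: (A_adj hs).
rewrite iota_Z // ffE cmulZl phiZ; last exact: (A_mul hs).
rewrite phiZ // ab0 mulr0 => H; suff /H/(_ Abb)/eqP : forall x, 0 <= M^-1 * ((f x)^* * f x) <= 2^-1.
  rewrite eq_sym !mulf_eq0 invr_eq0 gt_eqF //= => /orP[]/eqP; [by left|by right].
move=> x; rewrite -normCKC mulr_ge0 ?invr_ge0 ?exprn_ge0 ?(ltW M0) //=.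
rewrite ler_pdivrMl // (_ : M * 2^-1 = `|iota f| ^+ 2 + 2^-1); last by rewrite /M; field.
apply: (@le_trans _ _ (`|iota f| ^+ 2)); last by rewrite lerDl invr_ge0 ler0n.
rewrite ler_pXn2r ?nnegrE //.
exact: (iota_norm_ge (fi_embedding hs) hE x f0).
Qed.

Lemma state_positive psi : state_on setT psi -> positive_functional psi.
Proof. by move=> [lin pos _]; split=> *; [apply: lin|apply: pos]. Qed.

Lemma state_le psi b : state_on setT psi -> `|psi b| <= `|b|.
Proof. by move=> st; apply: (state_on_le (S := setT)). Qed.

Lemma state_lift phi : state_on A phi -> state_on setT (phi \o E).
Proof.
move=> st; have pf := A_positive_functional hs (state_A_positive hs st).
apply: state_on_intro; first by move=> *; apply: pf.1.
- by move=> *; apply: pf.2.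
- move=> b _ b1; apply: le_trans (A_state_le hs st (E_in hE b)) _.
  exact: le_trans (E_le hE b) _.
- move=> e e0; have [a [[f f0 <-] a1 ea]] := state_on_approx st e0.
  by exists (iota f); split => //=; rewrite (E_iota hE).
Qed.

(* Both n*n and nn* lie in A and their product vanishes, so the state kills one of them. *)
Lemma state_nilpotent_normaliser phi psi n : pure_state_on A phi -> state_on setT psi ->
  (forall a, A a -> psi a = phi a) -> normaliser A n -> n ** n = 0 -> psi n = 0.
Proof.
move=> pu st psiA nn n2; have pf := state_positive st.
have An1 := normaliser_sqr hs nn; have An2 := normaliser_sqr_adj hs nn.
have [f f0 fE] := An1; have [g g0 gE] := An2.
have fge x : 0 <= f x.
  by apply: (iota_sqr_ge0 (fi_embedding hs) hE x f0 fE).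
have gge x : 0 <= g x.
  by apply: (iota_sqr_ge0 (c := n^#) (fi_embedding hs) hE x g0); rewrite cadjK.
have [r [r0 rge rr]] := C0_sqrt f0 fge; have [t [t0 tge tt]] := C0_sqrt g0 gge.
have rs : (iota r)^# ** iota r = n^# ** n.
  rewrite iota_real // => [|x]; last exact: ger0_real.
  by rewrite -iota_M // -fE; congr iota; apply/funext.
have ts : (iota t)^# ** iota t = n ** n^#.
  rewrite iota_real // => [|x]; last exact: ger0_real.
  by rewrite -iota_M // -gE; congr iota; apply/funext.
have zero : phi ((iota r)^# ** iota r ** ((iota t)^# ** iota t)) = 0.
  rewrite rs ts cmulA -(cmulA n^#) n2 cmul0r cmul0l -psiA; last first.
    by exists (fun=> 0); [exact: C0_0|exact: iota_0].
  exact: (pf0 pf).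
have small (z : Cplx R) : (forall e : Cplx R, 0 < e -> `|z| <= e) -> z = 0.
  move=> H; apply/eqP; rewrite -normr_le0; apply/ler_addgt0Pl => e e0.
  by rewrite addr0 H.
apply: small => e e0.
case: (pure_state_orthogonal pu (iota_A _ r0) (iota_A _ t0) zero).
- rewrite rs -psiA // => p0; have [u [u0 _ un]] := approx_unit hs n e0.
  have un0 := pf_null pf (iota u) p0.
  by rewrite -[psi n]subr0 -un0 -(pfB pf); apply: le_trans (state_le _ st) un.
- rewrite ts -psiA // => p0; have [u [u0 _ un]] := approx_unit_r hs n e0.
  have un0 := pf_null_l pf (iota u) p0.
  by rewrite -[psi n]subr0 -un0 -(pfB pf); apply: le_trans (state_le _ st) un.
Qed.

(** One extension is [phi \o E]. For any other, b - E b lies in the kernel of [E], hence is a limit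
    of combinations of square-zero normalisers, which the extension kills. *)
Lemma diagonal_extension : cstar_diagonal A E -> extension_property A.
Proof.
move=> diag phi pu; have st := pu.1; exists (phi \o E); split.
  by split; [exact: state_lift|move=> _ [f f0 <-] /=; rewrite (E_iota hE)].
move=> psi [stp psiA]; apply/funext => b /=.
have pf := state_positive stp.
rewrite -psiA; last exact: (E_in hE b).
apply/eqP; rewrite eq_sym -subr_eq0 -(pfB pf) -normr_le0; apply/ler_addgt0Pl => e e0.
rewrite addr0.
have : closure (lspan [set b | normaliser A b /\ b ** b = 0]) (b - E b).
  rewrite diag /= (EB hE); have [f f0 <-] := E_in hE b.
  by rewrite (E_iota hE) // subrr.
move=> /closure_normP /(_ _ e0)[c Sc bc].
have pc : psi c = 0.
  elim/lspan_ind: Sc => [|z a d [na a2] IH]; first exact: (pf0 pf).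
  by rewrite pf.1 IH addr0 (state_nilpotent_normaliser pu stp psiA na a2) mulr0.
rewrite -[psi _]subr0 -pc -(pfB pf); apply: le_trans (state_le _ stp) _.
exact: ltW.
Qed.

End PureStates.

(** * The canonical twist *)

Section Eigenfunctionals.
Context (R : realType) (X : topologicalType) (B : cstarAlgType R).
Context (iota : (X -> Cplx R) -> B) (E : B -> B) (hs : faithful_inclusion iota E).
Implicit Types (f g u : X -> Cplx R) (a b c v n m k : B) (x y : X) (phi psi : B -> Cplx R).

Local Notation ev := (expect iota E).
Local Notation A := (C0_image iota).
Let hio : C0_star_hom iota := (fi_embedding hs).1.
Let hE := fi_expectation hs.

Lemma small_eq0 (z : Cplx R) : (forall e : Cplx R, 0 < e -> `|z| <= e) -> z = 0.
Proof.
move=> H; apply/eqP; rewrite -normr_le0; apply/ler_addgt0Pl => e e0.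
by rewrite addr0 H.
Qed.

(** For u(x) = 1 a convex combination of two numbers at most 1 equals 1, so psi1(u) = 1. If g(x) =
    0, both states vanish on |g|^2, hence psi1(g) = 0 by Cauchy-Schwarz. Then [f] is split as f(x) u
    plus a function vanishing at [x]. *)
Lemma point_convex_combination (t : Cplx R) psi1 psi2 x : 0 < t -> t < 1 ->
  state_on A psi1 -> state_on A psi2 ->
  (forall a, A a -> ev x a = t * psi1 a + (1 - t) * psi2 a) ->
  forall f, C0 f -> psi1 (iota f) = f x.
Proof.
move=> t0 t1 st1 st2 comb.
have pos1 := state_A_positive hs st1; have pos2 := state_A_positive hs st2.
have pf := A_positive_functional hs pos1.
have combf f : C0 f -> f x = t * psi1 (iota f) + (1 - t) * psi2 (iota f).
  by move=> f0; rewrite -comb; [rewrite (expect_iota hs)|exact: iota_A].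
have t1' : 0 < 1 - t by rewrite subr_gt0.
have [u [u0 u01 u1]] := unit_bump hs x.
have uge : forall y, 0 <= u y by move=> y; case/andP: (u01 y).
have le1 psi : state_on A psi -> psi (iota u) <= 1.
  move=> st; apply: le_trans (real_ler_norm (ger0_real _)) _.
    by have [_] := state_A_positive hs st; apply.
  apply: le_trans (A_state_le hs st (iota_A _ u0)) _.
  by apply: (iota_norm_le hio u0) => // y; case/andP: (u01 y) => *; rewrite ger0_norm.
have psiu : psi1 (iota u) = 1.
  have := combf _ u0; rewrite u1 => e1.
  have : t * (1 - psi1 (iota u)) + (1 - t) * (1 - psi2 (iota u)) = 0.
    transitivity (1 - (t * psi1 (iota u) + (1 - t) * psi2 (iota u))); first by ring.
    by rewrite -e1 subrr.
  move/eqP; rewrite paddr_eq0; [|by rewrite mulr_ge0 ?(ltW t0) // subr_ge0 le1|by rewrite mulr_ge0 ?(ltW t1') // subr_ge0 le1].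
  by rewrite mulf_eq0 gt_eqF //= subr_eq0 => /andP[/eqP <-].
have vanish g : C0 g -> g x = 0 -> psi1 (iota g) = 0.
  move=> g0 gx; have gg0 : C0 (fun y => (g y)^* * g y) by apply: C0M => //; exact: C0_conj.
  have ggge y : 0 <= (g y)^* * g y by rewrite -normCKC exprn_ge0.
  have := combf _ gg0; rewrite gx mulr0 => /esym/eqP.
  rewrite paddr_eq0; [|by rewrite mulr_ge0 ?(ltW t0) ?pos1.2|by rewrite mulr_ge0 ?(ltW t1') ?pos2.2].
  rewrite mulf_eq0 gt_eqF //= => /andP[/eqP p0 _].
  have pgg : (psi1 \o E) ((iota g)^# ** iota g) = 0.
    by rewrite /= -iota_conj // -iota_M ?(E_iota hE) //; exact: C0_conj.
  apply: small_eq0 => e e0; have [w [w0 _ wg]] := approx_unit hs (iota g) e0.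
  have := pf_null pf (iota w) pgg; rewrite /= -iota_M // (E_iota hE); last exact: C0M.
  move=> pw; have Ad : A (iota g - iota w ** iota g).
    by rewrite -iota_M // -iota_B //; [apply: iota_A; apply: C0B => //|]; exact: C0M.
  have -> : iota g = 1 *: (iota g - iota w ** iota g) + iota (fun y => w y * g y).
    by rewrite scale1r iota_M // subrK.
  rewrite pos1.1 //; last by apply: iota_A; exact: C0M.
  by rewrite mul1r pw addr0; apply: le_trans (A_state_le hs st1 Ad) _.
move=> f f0; have fu0 := C0Z (f x) u0.
have := vanish _ (C0B f0 fu0); rewrite u1 mulr1 subrr => /(_ erefl).
rewrite iota_B // iota_Z // addrC -scaleNr pos1.1; [|exact: iota_A|exact: iota_A].
by rewrite psiu mulr1 addrC => /eqP; rewrite subr_eq0 => /eqP.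
Qed.

Lemma expect_state (S : set B) x : (forall f, C0 f -> S (iota f)) -> state_on S (ev x).
Proof.
move=> SA; apply: state_on_intro => [z a b _ _|a _|a _ a1|e e0].
- exact: (expect_lin hs).
- by have [_] := expect_pos hs x; apply.
- exact: le_trans (expect_le hs x a) _.
- have [u [u0 u01 u1]] := unit_bump hs x; exists (iota u); split; first exact: SA.
    by apply: iota_norm_le => // y; case/andP: (u01 y) => *; rewrite ger0_norm.
  by rewrite (expect_iota hs) // u1 normr1 -toC1 toC_le gerBl ltW.
Qed.

Lemma expect_pure x : pure_state_on A (ev x).
Proof.
split; first by apply: expect_state => f; exact: iota_A.
move=> psi1 psi2 t st1 st2 t0 t1 comb _ [f f0 <-]; rewrite (expect_iota hs) //; split.
  exact: (point_convex_combination t0 t1 st1 st2 comb).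
apply: (@point_convex_combination (1 - t) psi2 psi1) => //; first by rewrite subr_gt0.
  by rewrite gtrBl.
by move=> a Aa; rewrite comb //; ring.
Qed.

Context (hext : extension_property A).

(** The single direct use of the extension property. It is phrased for contractive positive
    functionals, since this is what normalised vector functionals of [B] are known to be. *)
Lemma extension_unique psi x : positive_functional psi -> (forall b, `|psi b| <= `|b|) ->
  (forall f, C0 f -> psi (iota f) = f x) -> psi = ev x.
Proof.
move=> pf bd psiA; have [chi [_ uniq]] := hext (expect_pure x).
rewrite -(uniq (ev x)); last by split => //; exact: expect_state.
apply/esym; apply: uniq; split; last first.
  by move=> _ [f f0 <-]; rewrite psiA // (expect_iota hs).
apply: state_on_intro => [z a b _ _|a _|a _ a1|e e0].
- exact: pf.1.
- exact: pf.2.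
- exact: le_trans (bd a) _.
- have [u [u0 u01 u1]] := unit_bump hs x; exists (iota u); split => //.
    by apply: iota_norm_le => // y; case/andP: (u01 y) => *; rewrite ger0_norm.
  by rewrite psiA // u1 normr1 -toC1 toC_le gerBl ltW.
Qed.

(** Divided by [ev x (v^# v)], the left side is a contractive positive functional that extends
    evaluation at [y], and [extension_unique] identifies it. If the divisor vanishes, so do both
    sides. *)
Lemma expect_conj v x y : (forall f, C0 f -> ev x (v^# ** iota f ** v) = f y * ev x (v^# ** v)) ->
  forall b, ev x (v^# ** b ** v) = ev y b * ev x (v^# ** v).
Proof.
move=> vA b; have pf := expect_pos hs x; set C := ev x (v^# ** v).
have C0 : 0 <= C := pf.2 v.
have [Cz|Cn] := eqVneq C 0; first by rewrite Cz mulr0 (pf_null pf).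
have Cgt : 0 < C by rewrite lt_neqAle eq_sym Cn.
have psiE : (fun b => C^-1 * ev x (v^# ** b ** v)) = ev y.
  apply: extension_unique.
  - split=> [z a c|c].
      by rewrite cmulDr cmulDl cmulZr cmulZl pf.1; ring.
    by rewrite mulr_ge0 ?invr_ge0 // cmulA -cmulA -cadjM; exact: pf.2.
  - move=> c; rewrite normrM normfV (ger0_norm C0) ler_pdivrMl // mulrC.
    exact: (pf_conj_le pf).
  - by move=> f f0; rewrite vA // -/C mulrCA mulVf // mulr1.
by rewrite -psiE mulrAC mulVf // mul1r.
Qed.

(** The element [c] compares the product of [v] with the conjugate of [f] to a scalar multiple of
    [v]. It is null for E(.)(x), so Cauchy-Schwarz removes it. *)
Lemma expect_conj_shift v x y : (forall b, ev x (v^# ** b ** v) = ev y b * ev x (v^# ** v)) ->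
  forall f b, C0 f -> ev x (v^# ** iota f ** b) = f y * ev x (v^# ** b).
Proof.
move=> vb f b f0; have pf := expect_pos hs x.
pose c := iota (fun x => (f x)^*) ** v - (f y)^* *: v.
have cs : c^# = v^# ** iota f - f y *: v^#.
  by rewrite cadjB cadjM cadjZ conjCK iota_conj // cadjK.
have fc0 := C0_conj f0.
have cc : ev x (c^# ** c^#^#) = 0.
  rewrite cadjK cs /c cmulBl !cmulBr !cmulZl !cmulZr !cmulA -(cmulA v^#) -iota_M //.
  rewrite !(pfB pf) !(pfZ pf) !vb !(expect_iota hs) //; last exact: C0M.
  by move: (ev x _) (f y) => C z; ring.
have := pf_null_l pf b cc; rewrite cs cmulBl cmulZl (pfB pf) (pfZ pf) => /eqP.
by rewrite subr_eq0 => /eqP.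
Qed.

(** Since n n^# lies in A and commutes with functions, f |-> E(n^# f n)(x) / E(n^# n)(x) is
    multiplicative; it is nonzero at n n^#. Then [C0_character] provides the point. *)
Lemma normaliser_point n x : normaliser A n -> ev x (n^# ** n) != 0 ->
  exists y, forall b, ev x (n^# ** b ** n) = ev y b * ev x (n^# ** n).
Proof.
move=> nn n0; set C := ev x (n^# ** n); have pf := expect_pos hs x.
have C0 : 0 <= C := pf.2 n.
pose chi f := C^-1 * ev x (n^# ** iota f ** n).
have [||f M f0 M0 fM||y chiE] := @C0_character _ _ (fi_locally_compact hs) (fi_hausdorff hs) chi.
- move=> z f g f0 g0; rewrite /chi iota_D ?iota_Z //; last exact: C0Z.
  by rewrite cmulDr cmulDl cmulZr cmulZl pf.1; ring.
- move=> f g f0 g0; rewrite /chi iota_M //.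
  have Af := (nn _ (iota_A iota f0)).2; have Ag := (nn _ (iota_A iota g0)).2.
  have An := normaliser_sqr hs nn; have An' := normaliser_sqr_adj hs nn.
  have fg : n^# ** iota f ** n ** (n^# ** iota g ** n) = n^# ** (iota f ** iota g) ** n ** (n^# ** n).
    rewrite !cmulA -(cmulA _ n n^#) -(cmulA (n^# ** iota f)) (A_comm hs An') ?cmulA //.
    exact: iota_A.
  have := congr1 (ev x) fg; rewrite (expect_mul_l hs x _ Af) (expect_mul_r hs x _ An) -/C => e.
  by rewrite mulrACA e; field.
- rewrite /chi normrM normfV (ger0_norm C0) ler_pdivrMl; last by rewrite lt_neqAle eq_sym n0.
  rewrite mulrC; apply: le_trans (pf_conj_le pf n (iota f)) _.
  by rewrite ler_wpM2r // (iota_norm_le hio f0).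
- have [f f0 fE] := normaliser_sqr_adj hs nn; exists f => //.
  rewrite /chi mulf_neq0 ?invr_eq0 // fE cmulA -cmulA.
  by rewrite (expect_mul_l hs x _ (normaliser_sqr hs nn)) mulf_neq0.
exists y; apply: expect_conj => f f0; rewrite -chiE // /chi -/C.
by rewrite mulrAC mulVf // mul1r.
Qed.

(* Apply expect_conj to k + z u with u(x) = 1, for z = 0, 1, i, and polarise. *)
Lemma expect_multiplicative k x :
  (forall f, C0 f -> ev x (k^# ** iota f ** k) = f x * ev x (k^# ** k)) ->
  forall b, ev x (k^# ** b) = (ev x k)^* * ev x b.
Proof.
move=> kA b; have pf := expect_pos hs x.
have [u [u0 u01 u1]] := unit_bump hs x.
have us : (iota u)^# = iota u by apply: iota_real => // y; apply: ger0_real; case/andP: (u01 y).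
have expand (z : Cplx R) c : ev x ((k + z *: iota u)^# ** c ** (k + z *: iota u)) =
    ev x (k^# ** c ** k) + z * ev x (k^# ** c) + z^* * ev x (c ** k) + z * z^* * ev x c.
  rewrite cadjD cadjZ us !(cmulDl, cmulDr, cmulZl, cmulZr) !(pfD pf, pfZ pf).
  rewrite -(cmulA (iota u)) !(expect_iota_l hs) // !(expect_iota_r hs) // (expect_iota_l hs) //.
  by rewrite u1; ring.
have expand1 (z : Cplx R) : ev x ((k + z *: iota u)^# ** (k + z *: iota u)) =
    ev x (k^# ** k) + z * (ev x k)^* + z^* * ev x k + z * z^*.
  rewrite cadjD cadjZ us !(cmulDl, cmulDr, cmulZl, cmulZr) !(pfD pf, pfZ pf).
  rewrite !(expect_iota_l hs) // !(expect_iota_r hs) // (expect_iota hs) // (expect_adj hs).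
  by rewrite u1; ring.
have lamb (z : Cplx R) c : ev x ((k + z *: iota u)^# ** c ** (k + z *: iota u)) =
    ev x c * ev x ((k + z *: iota u)^# ** (k + z *: iota u)).
  apply: expect_conj => f f0; rewrite expand expand1 kA //.
  rewrite (expect_iota_l hs) // (expect_iota_r hs) // (expect_iota hs) // (expect_adj hs).
  by ring.
have kk c : ev x (k^# ** c ** k) = ev x c * ev x (k^# ** k) by exact: (expect_conj kA).
have h1 := lamb 1 b; have hi := lamb 'i b.
rewrite !expand !expand1 !kk conjC1 in h1; rewrite !expand !expand1 !kk conjCi in hi.
have s1 : ev x (k^# ** b) + ev x (b ** k) = ((ev x k)^* + ev x k) * ev x b.
  apply: (addrI (ev x b * ev x (k^# ** k) + ev x b)).
  transitivity (ev x b * ev x (k^# ** k) + 1 * ev x (k^# ** b) + 1 * ev x (b ** k) + 1 * 1 * ev x b); first by ring.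
  by rewrite h1; ring.
have s2 : ev x (k^# ** b) - ev x (b ** k) = ((ev x k)^* - ev x k) * ev x b.
  apply: (mulfI (@neq0Ci (Cplx R))); apply: (addrI (ev x b * ev x (k^# ** k) - 'i * 'i * ev x b)).
  transitivity (ev x b * ev x (k^# ** k) + 'i * ev x (k^# ** b) + - 'i * ev x (b ** k) + 'i * - 'i * ev x b); first by ring.
  by rewrite hi; ring.
apply: (@mulfI _ (2 : Cplx R)); first by rewrite pnatr_eq0.
transitivity ((ev x (k^# ** b) + ev x (b ** k)) + (ev x (k^# ** b) - ev x (b ** k))); first by ring.
by rewrite s1 s2; ring.
Qed.

(** In the GNS space of E(.)(x), [phi] is the inner product with the unit vector of [n]; the third
    condition says that this vector induces the state E(.)(y). *)
Definition eigenfunctional phi y x : Prop :=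
  exists n, [/\ normaliser A n, ev x (n^# ** n) = 1,
    forall b, ev x (n^# ** b ** n) = ev y b & forall b, phi b = ev x (n^# ** b)].

Lemma eigen_lin phi y x : eigenfunctional phi y x ->
  forall (z : Cplx R) a b, phi (z *: a + b) = z * phi a + phi b.
Proof.
move=> [n [_ _ _ phiE]] z a b; rewrite !phiE cmulDr cmulZr.
exact: (expect_lin hs).
Qed.

Lemma eigen_le phi y x b : eigenfunctional phi y x -> `|phi b| <= `|b|.
Proof.
move=> [n [_ n1 _ phiE]]; have pf := expect_pos hs x.
rewrite -(@ler_pXn2r _ 2) ?nnegrE // phiE.
apply: le_trans (cauchy_schwarz pf n b) _; rewrite n1 mul1r -cnorm_adjM.
exact: le_trans (real_ler_norm (ger0_real (pf.2 b))) (expect_le hs x _).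
Qed.

Lemma eigen_iota_l phi y x f b : eigenfunctional phi y x -> C0 f ->
  phi (iota f ** b) = f y * phi b.
Proof.
move=> [n [_ n1 nE phiE]] f0; rewrite !phiE cmulA.
by apply: expect_conj_shift => // c; rewrite nE n1 mulr1.
Qed.

Lemma eigen_iota_r phi y x f b : eigenfunctional phi y x -> C0 f ->
  phi (b ** iota f) = phi b * f x.
Proof. by move=> [n [_ _ _ phiE]] f0; rewrite !phiE cmulA (expect_iota_r hs). Qed.

Lemma eigen_neq0 phi y x : eigenfunctional phi y x -> exists2 n, normaliser A n & phi n = 1.
Proof. by move=> [n [nn n1 _ phiE]]; exists n => //; rewrite phiE. Qed.

Lemma eigen_exists n x : normaliser A n -> ev x (n^# ** n) != 0 ->
  exists y, eigenfunctional (fun b => (sqrtC (ev x (n^# ** n)))^-1 * ev x (n^# ** b)) y x.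
Proof.
move=> nn n0; have [y yE] := normaliser_point nn n0; exists y.
have pf := expect_pos hs x; set C := ev x (n^# ** n) in n0 yE *.
have C0 : 0 <= C := pf.2 n.
set s := (sqrtC C)^-1; have s0 : 0 <= s by rewrite invr_ge0 sqrtC_ge0.
have sr : s^* = s by apply/CrealP/ger0_real.
have ss : s * s = C^-1 by rewrite -invfM -expr2 sqrtCK.
exists (s *: n); split; first exact: (normaliser_scale hs).
- by rewrite cadjZ cmulZl cmulZr !(pfZ pf) sr mulrA ss mulVf.
- by move=> b; rewrite cadjZ !(cmulZl, cmulZr) !(pfZ pf) sr mulrA ss yE mulrCA mulVf ?mulr1.
- by move=> b; rewrite cadjZ cmulZl (pfZ pf) sr.
Qed.

Lemma eigen_unit x : eigenfunctional (ev x) x x.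
Proof.
have [u [u0 u01 u1]] := unit_bump hs x.
have us : (iota u)^# = iota u by apply: iota_real => // y; apply: ger0_real; case/andP: (u01 y).
exists (iota u); rewrite us; split.
- by apply: (normaliser_A hs); exact: iota_A.
- by rewrite (expect_iota_l hs) // (expect_iota hs) // u1 mulr1.
- by move=> b; rewrite (expect_iota_r hs) // (expect_iota_l hs) // u1 mul1r mulr1.
- by move=> b; rewrite (expect_iota_l hs) // u1 mul1r.
Qed.

Lemma eigen_scale z phi y x : circle z -> eigenfunctional phi y x ->
  eigenfunctional (fun b => z * phi b) y x.
Proof.
move=> z1 [n [nn n1 nE phiE]]; have pf := expect_pos hs x.
have zz : z * z^* = 1 by rewrite -normCK z1 expr1n.
exists (z^* *: n); rewrite cadjZ conjCK; split.
- exact: (normaliser_scale hs).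
- by rewrite cmulZl cmulZr !(pfZ pf) mulrA zz mul1r.
- by move=> b; rewrite !(cmulZl, cmulZr) !(pfZ pf) mulrA zz mul1r.
- by move=> b; rewrite cmulZl (pfZ pf) phiE.
Qed.

Lemma eigen_mul n phi psi w y x :
  [/\ normaliser A n, ev y (n^# ** n) = 1, forall b, ev y (n^# ** b ** n) = ev w b
    & forall b, phi b = ev y (n^# ** b)] ->
  eigenfunctional psi y x -> eigenfunctional (fun b => psi (n^# ** b)) w x.
Proof.
move=> [nn n1 nE phiE] [m [nm m1 mE psiE]]; exists (n ** m); rewrite cadjM; split.
- exact: (normaliser_mul nn nm).
- by rewrite cmulA -(cmulA m^#) mE n1.
- by move=> b; rewrite cmulA -!(cmulA m^#) !cmulA -(cmulA m^#) -(cmulA m^#) mE nE.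
- by move=> b; rewrite psiE cmulA.
Qed.

(** [n^#] leads back from [y] to [x]: the element n^# n of A takes the value 1 at [x] and so drops
    out of E(.)(x). *)
Lemma eigen_inv phi y x : eigenfunctional phi y x ->
  eigenfunctional (fun b => (phi b^#)^*) x y.
Proof.
move=> [n [nn n1 nE phiE]]; have An := normaliser_sqr hs nn.
exists n^#; rewrite cadjK; split.
- exact: (normaliser_adj nn).
- by rewrite -nE !cmulA -cmulA (expect_mul_l hs x _ An) n1 mulr1.
- move=> b; rewrite -nE !cmulA -cmulA (expect_mul_r hs x _ An).
  by rewrite (expect_mul_l hs x _ An) n1 mulr1 mul1r.
- move=> b; rewrite -nE !cmulA -cmulA (expect_mul_l hs x _ An) n1 mul1r phiE.
  by rewrite -(expect_adj hs) cadjM !cadjK.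
Qed.

(** The element n^# m fixes [x], so [expect_multiplicative] applies to it, and n n^# has value 1 at
    [y]. Only the action of [m] on [x] is assumed; [m] may be any element that carries [x] to
    [y]. *)
Lemma eigen_key phi y x m (c : Cplx R) : eigenfunctional phi y x ->
  (forall b, ev x (m^# ** b ** m) = ev y b * c) ->
  c = ev x (m^# ** m) -> forall b, ev x (m^# ** b) = (phi m)^* * phi b.
Proof.
move=> [n [nn n1 nE phiE]] mE cE b.
have An := normaliser_sqr hs nn; have An' := normaliser_sqr_adj hs nn.
have nn1 : ev y (n ** n^#) = 1.
  by rewrite -nE !cmulA -cmulA (expect_mul_l hs x _ An) n1 mulr1.
have kE d : ev x ((n^# ** m)^# ** d ** (n^# ** m)) = ev y (n ** d ** n^#) * c.
  by rewrite cadjM cadjK -mE !cmulA.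
have kk : ev x ((n^# ** m)^# ** (n^# ** m)) = c.
  by rewrite cadjM cadjK !cmulA -(cmulA m^#) mE nn1 mul1r.
have := @expect_multiplicative (n^# ** m) x _ (n^# ** b).
rewrite -!phiE => <-.
  rewrite cadjM cadjK !cmulA -(cmulA m^# n).
  have [g g0 gE] := An'; rewrite -gE (@expect_conj_shift m x y) // -?cE //.
  by rewrite -(expect_iota hs y g0) gE nn1 mul1r.
move=> f f0; rewrite kE kk; congr (_ * _).
rewrite -nE !cmulA -cmulA (expect_mul_r hs x _ An).
by rewrite (expect_mul_l hs x _ An) n1 mulr1 mul1r (expect_iota hs).
Qed.

(** If [m] carries [x] to y', then E(n^# f m)(x) equals both f(y) phi(m) and f(y') phi(m). Functions
    separate points, so y = y'. *)
Lemma eigen_point phi y x m : eigenfunctional phi y x -> normaliser A m -> phi m != 0 ->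
  forall b, ev x (m^# ** b ** m) = ev y b * ev x (m^# ** m).
Proof.
move=> ep nm m0; have [n [nn n1 nE phiE]] := ep; have pf := expect_pos hs x.
have C0 : ev x (m^# ** m) != 0.
  by apply: contra_neq m0 => mm; rewrite phiE (pf_null pf).
have [y' yE] := normaliser_point nm C0.
suff -> : y = y' by [].
apply: (C0_separates hs) => f f0; apply: (mulIf m0).
rewrite -(eigen_iota_l _ ep f0) phiE cmulA.
have fc0 := C0_conj f0.
have -> : n^# ** iota f ** m = (m^# ** iota (fun x => (f x)^*) ** n)^#.
  by rewrite !cadjM cadjK iota_conj // cadjK cmulA.
rewrite (expect_adj hs) (expect_conj_shift yE) // rmorphM /= conjCK.
by rewrite -(expect_adj hs) cadjM cadjK -phiE.
Qed.

Lemma eigen_formula phi y x m b : eigenfunctional phi y x -> normaliser A m -> phi m != 0 ->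
  ev x (m^# ** b) = (phi m)^* * phi b.
Proof. by move=> ep nm m0; apply: (eigen_key ep (eigen_point ep nm m0)). Qed.

Lemma eigen_sqr phi y x m : eigenfunctional phi y x -> normaliser A m -> phi m != 0 ->
  ev x (m^# ** m) = `|phi m| ^+ 2.
Proof. by move=> ep nm m0; rewrite (eigen_formula _ ep nm m0) normCKC. Qed.

Lemma eigen_rep phi y x m : eigenfunctional phi y x -> normaliser A m -> phi m = 1 ->
  [/\ normaliser A m, ev x (m^# ** m) = 1,
    forall b, ev x (m^# ** b ** m) = ev y b & forall b, phi b = ev x (m^# ** b)].
Proof.
move=> ep nm m1; have m0 : phi m != 0 by rewrite m1 oner_eq0.
have mm : ev x (m^# ** m) = 1 by rewrite (eigen_formula _ ep nm m0) m1 conjC1 mulr1.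
split=> // b; first by rewrite (eigen_point ep nm m0) mm mulr1.
by rewrite (eigen_formula _ ep nm m0) m1 conjC1 mul1r.
Qed.

(** By [eigen_key] the functionals from [x] to [y] form one orbit of the circle. Hence dividing by
    the circle leaves only the pair of endpoints. *)
Lemma eigen_same phi psi y x : eigenfunctional phi y x -> eigenfunctional psi y x ->
  exists2 z, circle z & forall b, psi b = z * phi b.
Proof.
move=> ep [m [nm m1 mE psiE]].
have key := eigen_key ep (c := 1) (m := m) _ (esym m1).
exists (phi m)^*; last by move=> b; rewrite psiE key // => d; rewrite mE mulr1.
rewrite /circle /= norm_conjC; apply/eqP; rewrite -(@pexpr_eq1 _ _ 2) // normCKC -key ?m1 //.
by move=> d; rewrite mE mulr1.
Qed.

End Eigenfunctionals.

(** * Initial topologies and pointwise convergence *)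

Lemma cvg_initial (S : choiceType) (T : topologicalType) (f : S -> T)
    (F : set_system S) (s : S) : Filter F ->
  f @ F --> f s -> F --> (s : initial_topology f).
Proof.
move=> FF cv A /= [_ [[V Vop <-] Vfs sVA]].
have FV : F (f @^-1` V) := cv V (open_nbhs_nbhs (conj Vop Vfs)).
exact: (@filterS _ F _ _ _ sVA FV).
Qed.

Lemma cluster_continuous (S T : topologicalType) (f : S -> T) (s t : S) :
  continuous f -> hausdorff_space T -> cluster (nbhs s) t -> f s = f t.
Proof.
move=> fc hT cl; apply: hT => U V nU nV.
have [r [Ur Vr]] := cl (f @^-1` U) (f @^-1` V) (fc s U nU) (fc t V nV).
by exists (f r).
Qed.

Lemma cvg_surjective_pair (T : Type) (U V : topologicalType) (F : set_system T)
    (h : T -> U * V) (p : U * V) : Filter F ->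
  (fun t => (h t).1) @ F --> p.1 -> (fun t => (h t).2) @ F --> p.2 -> h @ F --> p.
Proof.
move=> FF c1 c2; have -> : h = fun t => ((h t).1, (h t).2).
  by apply/funext => t; rewrite -surjective_pairing.
by case: p c1 c2 => p q /= c1 c2; exact: cvg_pair.
Qed.

Section Coordinates.
Context (R : realType) (I X : topologicalType) (S : choiceType).
Context (co : S -> {ptws I -> Cplx R} * (X * X)).

Lemma coord_cvg (T : Type) (F : set_system T) {FF : Filter F}
    (h : T -> initial_topology co) (s : initial_topology co) :
  (forall b, (fun t => (co (h t)).1 b) @ F --> (co s).1 b) ->
  (fun t => (co (h t)).2.1) @ F --> (co s).2.1 ->
  (fun t => (co (h t)).2.2) @ F --> (co s).2.2 -> h @ F --> s.
Proof.
move=> c1 c2 c3; apply: cvg_initial.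
have c1' : (fun t => (co (h t)).1) @ F --> (co s).1.
  by apply/(@pointwise_cvgP I (Cplx R)) => b; exact: c1.
by apply: cvg_surjective_pair => //; apply: cvg_surjective_pair.
Qed.

Lemma coord_fun_continuous b :
  continuous (fun s : initial_topology co => (co s).1 b : Cplx R).
Proof.
move=> s; apply: (cvg_comp co (fun p => p.1 b) (@initial_continuous _ _ co s)).
apply: (cvg_comp fst (fun h : {ptws I -> Cplx R} => h b) cvg_fst).
exact: (@proj_continuous I (fun=> Cplx R) b).
Qed.

Lemma coord_rng_continuous : continuous (fun s : initial_topology co => (co s).2.1).
Proof.
move=> s; apply: (cvg_comp co (fun p => p.2.1) (@initial_continuous _ _ co s)).
by apply: (cvg_comp snd fst cvg_snd); exact: cvg_fst.
Qed.

Lemma coord_src_continuous : continuous (fun s : initial_topology co => (co s).2.2).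
Proof.
move=> s; apply: (cvg_comp co (fun p => p.2.2) (@initial_continuous _ _ co s)).
by apply: (cvg_comp snd snd cvg_snd); exact: cvg_snd.
Qed.

End Coordinates.

Lemma cvg_near_eq (T : Type) (U : topologicalType) (F : set_system T) (f g : T -> U) (l : U) :
  Filter F -> (\forall t \near F, f t = g t) -> g @ F --> l -> f @ F --> l.
Proof.
move=> FF fg gl; apply: cvg_trans gl; apply: near_eq_cvg.
by apply: filterS fg.
Qed.

(** * The space of eigenfunctionals *)

Section Germs.
Context (R : realType) (X : topologicalType) (B : cstarAlgType R).
Context (iota : (X -> Cplx R) -> B) (E : B -> B) (hs : faithful_inclusion iota E).
Context (hext : extension_property (C0_image iota)).
Implicit Types (f g u : X -> Cplx R) (a b c v n m k : B) (x y : X) (phi psi : B -> Cplx R).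

Local Notation ev := (expect iota E).
Local Notation A := (C0_image iota).
Local Notation eigen := (eigenfunctional iota E).

(** The endpoints are stored beside the functional, so that range and source are coordinates of the
    initial topology and therefore continuous. *)
Definition germ_set : set ((B -> Cplx R) * (X * X)) :=
  [set p | eigen p.1 p.2.1 p.2.2].

Definition germ_coord (s : germ_set) : {ptws B -> Cplx R} * (X * X) := \val s.

Definition germ : topologicalType := initial_topology germ_coord.

Definition germ_fun (s : germ) : B -> Cplx R := (germ_coord s).1.
Definition germ_rng (s : germ) : X := (germ_coord s).2.1.
Definition germ_src (s : germ) : X := (germ_coord s).2.2.

Lemma germP (s : germ) : eigen (germ_fun s) (germ_rng s) (germ_src s).
Proof. exact: (set_valP s). Qed.

Definition mk_germ phi y x (e : eigen phi y x) : germ :=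
  exist (fun p => p \in germ_set) (phi, (y, x)) (mem_set e).

Lemma germ_eq (s t : germ) : (forall b, germ_fun s b = germ_fun t b) ->
  germ_rng s = germ_rng t -> germ_src s = germ_src t -> s = t.
Proof.
move=> /funext e1 e2 e3; apply: val_inj.
move: e1 e2 e3; rewrite /germ_fun /germ_rng /germ_src /germ_coord.
by case: (\val s) => a [b c]; case: (\val t) => a' [b' c'] /= -> -> ->.
Qed.

Lemma germ_cvg (T : Type) (F : set_system T) {FF : Filter F} (h : T -> germ) (s : germ) :
  (forall b, (fun t => germ_fun (h t) b) @ F --> germ_fun s b) ->
  (fun t => germ_rng (h t)) @ F --> germ_rng s ->
  (fun t => germ_src (h t)) @ F --> germ_src s -> h @ F --> s.
Proof. exact: coord_cvg. Qed.

Lemma germ_fun_continuous b : continuous (fun s : germ => germ_fun s b).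
Proof. exact: coord_fun_continuous. Qed.

Lemma germ_rng_continuous : continuous germ_rng.
Proof. exact: coord_rng_continuous. Qed.

Lemma germ_src_continuous : continuous germ_src.
Proof. exact: coord_src_continuous. Qed.

Lemma germ_hausdorff : hausdorff_space germ.
Proof.
move=> s t cl; apply: germ_eq => [b||].
- exact: (cluster_continuous (@germ_fun_continuous b) (@norm_hausdorff _ (Cplx R)) cl).
- exact: (cluster_continuous germ_rng_continuous (fi_hausdorff hs) cl).
- exact: (cluster_continuous germ_src_continuous (fi_hausdorff hs) cl).
Qed.

(** A bump function detects each neighbourhood, so convergence in [X] may be tested on C0(X).
    Formulas give the range of an eigenfunctional only through such tests. *)
Lemma point_cvg (T : Type) (F : set_system T) {FF : Filter F} (h : T -> X) (x : X) :
  (forall f : X -> Cplx R, C0 f -> (fun t => f (h t)) @ F --> f x) -> h @ F --> x.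
Proof.
move=> cv V; rewrite nbhsE => -[U [oU Ux] UV].
have [u [K [u0 _ KU uK [_ /nbhs_singleton u1]]]] := bump_at hs oU Ux.
have ux0 : u x != 0 by rewrite u1 oner_eq0.
have : \forall t \near F, u (h t) != 0 by apply: (cvgr_neq0 (u x)) => //; exact: cv.
apply: filterS => t /= ut; apply: UV; apply: KU; apply: contrapT => /uK/eqP.
by rewrite (negbTE ut).
Qed.

Definition germ_unit x : germ := mk_germ (eigen_unit hs x).

Definition germ_inv (s : germ) : germ := mk_germ (eigen_inv hs (germP s)).

Definition germ_rep (s : germ) : B := projT1 (cid (germP s)).

Lemma germ_repP s : [/\ normaliser A (germ_rep s),
  ev (germ_src s) ((germ_rep s)^# ** germ_rep s) = 1,
  forall b, ev (germ_src s) ((germ_rep s)^# ** b ** germ_rep s) = ev (germ_rng s) b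
  & forall b, germ_fun s b = ev (germ_src s) ((germ_rep s)^# ** b)].
Proof. exact: projT2 (cid (germP s)). Qed.

Lemma germ_mul_eigen s t : germ_src s = germ_rng t ->
  eigen (fun b => germ_fun t ((germ_rep s)^# ** b)) (germ_rng s) (germ_src t).
Proof.
move=> st; have ep := germP t; rewrite -st in ep.
exact: (eigen_mul (germ_repP s) ep).
Qed.

(** The product is read off from a chosen normaliser representing [s]. On pairs that are not
    composable the value [s] is a mere default. *)
Definition germ_mul (s t : germ) : germ :=
  if pselect (germ_src s = germ_rng t) is left e then mk_germ (germ_mul_eigen e) else s.

Lemma germ_mul_src s t : germ_src s = germ_rng t -> germ_src (germ_mul s t) = germ_src t.
Proof. by rewrite /germ_mul; case: pselect. Qed.

Lemma germ_mul_rng s t : germ_src s = germ_rng t -> germ_rng (germ_mul s t) = germ_rng s.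
Proof. by rewrite /germ_mul; case: pselect. Qed.

(** Independence of the representative: two normalisers that represent [s] differ by an element [d]
    with E(d^# d) = 0 at the source of [s], which stays null when multiplied by a representative of
    [t]. *)
Lemma germ_mul_fun s t n b : germ_src s = germ_rng t -> normaliser A n -> germ_fun s n = 1 ->
  germ_fun (germ_mul s t) b = germ_fun t (n^# ** b).
Proof.
move=> st nn n1; rewrite /germ_mul; case: pselect => // e; rewrite /germ_fun /=.
rewrite -/(germ_fun t); set m := germ_rep s.
have [nm m1 mE mfun] := germ_repP s; rewrite -/m in nm m1 mE mfun.
have [_ nn1 nE nfun] := eigen_rep hs hext (germP s) nn n1.
have [k [_ k1 kE kfun]] := germP t.
have pf := expect_pos hs (germ_src t).
have pf' := expect_pos hs (germ_rng t).
pose d := m - n.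
have dd : ev (germ_rng t) (d^# ** d) = 0.
  rewrite -st /d cadjB cmulBl !cmulBr !(pfB (expect_pos hs _)) m1 nn1 -mfun -nfun n1.
  by rewrite mfun m1 !subrr.
have := pf_null_l pf b (b := (d ** k)^#); rewrite cadjK cadjM cmulA -(cmulA k^#) kE dd => /(_ erefl).
rewrite -cmulA -kfun /d cadjB cmulBl => h; apply/eqP; rewrite -subr_eq0.
by rewrite !kfun -(pfB pf) -cmulBr -kfun h.
Qed.

(** A fixed normaliser represents only one multiple of each eigenfunctional, but stays nonzero on a
    neighbourhood. The formula with a denominator therefore holds near [s] and yields continuity of
    the product. *)
Lemma germ_mul_fun_div s t n b : germ_src s = germ_rng t -> normaliser A n -> germ_fun s n != 0 ->
  germ_fun (germ_mul s t) b = germ_fun t (n^# ** b) / (germ_fun s n)^*.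
Proof.
move=> st nn n0; have lin := eigen_lin hs (germP s); have lint := eigen_lin hs (germP t).
have s0 : germ_fun s 0 = 0.
  by apply: (addrI (germ_fun s 0)); have := lin 1 0 0; rewrite scale1r mul1r !addr0 => <-.
have t0 : germ_fun t 0 = 0.
  by apply: (addrI (germ_fun t 0)); have := lint 1 0 0; rewrite scale1r mul1r !addr0 => <-.
have sZ z c : germ_fun s (z *: c) = z * germ_fun s c.
  by have := lin z c 0; rewrite s0 !addr0.
have tZ z c : germ_fun t (z *: c) = z * germ_fun t c.
  by have := lint z c 0; rewrite t0 !addr0.
rewrite (@germ_mul_fun s t ((germ_fun s n)^-1 *: n)) //.
- by rewrite cadjZ cmulZl tZ fmorphV mulrC.
- exact: (normaliser_scale hs).
- by rewrite sZ mulVf.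
Qed.

End Germs.

(** * The groupoid of eigenfunctionals *)

Section CanonicalGroupoids.
Context (R : realType) (X : topologicalType) (B : cstarAlgType R).
Context (iota : (X -> Cplx R) -> B) (E : B -> B) (hs : faithful_inclusion iota E).
Context (hext : extension_property (C0_image iota)).
Implicit Types (f g u : X -> Cplx R) (a b c n m k : B) (x y : X).

Local Notation ev := (expect iota E).
Local Notation A := (C0_image iota).
Local Notation G := (germ iota E).
Implicit Types (s t r : G).
Let hio : C0_star_hom iota := (fi_embedding hs).1.

Lemma germ_lin s z a b : germ_fun s (z *: a + b) = z * germ_fun s a + germ_fun s b.
Proof. exact: (eigen_lin hs (germP s)). Qed.

Lemma germ0 s : germ_fun s 0 = 0.
Proof.
by apply: (addrI (germ_fun s 0)); have := germ_lin s 1 0 0; rewrite scale1r mul1r !addr0 => <-.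
Qed.

Lemma germD s a b : germ_fun s (a + b) = germ_fun s a + germ_fun s b.
Proof. by have := germ_lin s 1 a b; rewrite scale1r mul1r. Qed.

Lemma germZ s z a : germ_fun s (z *: a) = z * germ_fun s a.
Proof. by have := germ_lin s z a 0; rewrite germ0 !addr0. Qed.

Lemma germB s a b : germ_fun s (a - b) = germ_fun s a - germ_fun s b.
Proof. by rewrite germD -scaleN1r germZ mulN1r. Qed.

Lemma germ_le s b : `|germ_fun s b| <= `|b|.
Proof. exact: (eigen_le hs _ (germP s)). Qed.

Lemma germ_iota_l s f b : C0 f -> germ_fun s (iota f ** b) = f (germ_rng s) * germ_fun s b.
Proof. exact: (eigen_iota_l hs _ (germP s)). Qed.

Lemma germ_iota_r s f b : C0 f -> germ_fun s (b ** iota f) = germ_fun s b * f (germ_src s).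
Proof. exact: (eigen_iota_r hs _ (germP s)). Qed.

Lemma germ_A_l s a b : A a -> germ_fun s (a ** b) = ev (germ_rng s) a * germ_fun s b.
Proof. by move=> [f f0 <-]; rewrite germ_iota_l // (expect_iota hs). Qed.

Lemma germ_neq0 s : exists2 n, normaliser A n & germ_fun s n = 1.
Proof. exact: (eigen_neq0 (germP s)). Qed.

Lemma germ_mulA s t r : germ_src s = germ_rng t -> germ_src t = germ_rng r ->
  germ_mul s (germ_mul t r) = germ_mul (germ_mul s t) r.
Proof.
move=> st tr; have [n nn n1] := germ_neq0 s; have [m nm m1] := germ_neq0 t.
have [_ nn1 _ _] := eigen_rep hs hext (germP s) nn n1.
have An := normaliser_sqr hs nn.
have s_tr : germ_src s = germ_rng (germ_mul t r) by rewrite germ_mul_rng.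
have st_r : germ_src (germ_mul s t) = germ_rng r by rewrite germ_mul_src.
apply: germ_eq => [b||].
- rewrite (germ_mul_fun hs hext _ s_tr nn n1) (germ_mul_fun hs hext _ tr nm m1).
  rewrite (@germ_mul_fun _ _ _ _ _ hs hext (germ_mul s t) r (n ** m)) //.
  + by rewrite cadjM cmulA.
  + exact: normaliser_mul.
  + by rewrite (germ_mul_fun hs hext _ st nn n1) cmulA germ_A_l // -st nn1 mul1r.
- by rewrite !germ_mul_rng.
- by rewrite !germ_mul_src.
Qed.

Lemma germ_mul1 s : germ_mul s (germ_unit hs (germ_src s)) = s.
Proof.
have [n nn n1] := germ_neq0 s; have [_ _ _ nE] := eigen_rep hs hext (germP s) nn n1.
apply: germ_eq => [b||]; [|by rewrite germ_mul_rng|by rewrite germ_mul_src].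
by rewrite (germ_mul_fun hs hext _ _ nn n1) // nE.
Qed.

Lemma unit_bump_normaliser x : exists u : X -> Cplx R, [/\ C0 u, u x = 1,
  (iota u)^# = iota u & normaliser A (iota u)].
Proof.
have [u [u0 u01 u1]] := unit_bump hs x; exists u; split => //.
  by apply: iota_real => // y; apply: ger0_real; case/andP: (u01 y).
by apply: (normaliser_A hs); exact: iota_A.
Qed.

Lemma germ_1mul s : germ_mul (germ_unit hs (germ_rng s)) s = s.
Proof.
have [u [u0 u1 us nu]] := unit_bump_normaliser (germ_rng s).
have uv : germ_fun (germ_unit hs (germ_rng s)) (iota u) = 1.
  by rewrite /germ_fun /= (expect_iota hs).
apply: germ_eq => [b||]; [|by rewrite germ_mul_rng|by rewrite germ_mul_src].
by rewrite (germ_mul_fun hs hext _ _ nu uv) // us germ_iota_l // u1 mul1r.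
Qed.

Lemma germ_mulV s : germ_mul s (germ_inv hs s) = germ_unit hs (germ_rng s).
Proof.
have [n nn n1] := germ_neq0 s; have [_ _ nE nF] := eigen_rep hs hext (germP s) nn n1.
apply: germ_eq => [b||]; [|by rewrite germ_mul_rng|by rewrite germ_mul_src].
rewrite (germ_mul_fun hs hext _ _ nn n1) // /germ_fun /= -/(germ_fun s).
by rewrite nF -(expect_adj hs) !cadjM !cadjK nE.
Qed.

Lemma germ_Vmul s : germ_mul (germ_inv hs s) s = germ_unit hs (germ_src s).
Proof.
have [n nn n1] := germ_neq0 s; have [_ nn1 nE nF] := eigen_rep hs hext (germP s) nn n1.
apply: germ_eq => [b||]; [|by rewrite germ_mul_rng|by rewrite germ_mul_src].
rewrite (@germ_mul_fun _ _ _ _ _ hs hext (germ_inv hs s) s n^#) //.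
- rewrite cadjK nF cmulA (expect_mul_l hs) ?nn1 ?mul1r //.
  exact: (normaliser_sqr hs).
- exact: normaliser_adj.
- by rewrite /germ_fun /= -/(germ_fun s) cadjK n1 conjC1.
Qed.

Lemma germ_unit_continuous : continuous (germ_unit hs).
Proof.
move=> x; apply: germ_cvg => [b||]; [exact: (expect_continuous hs)|exact: cvg_id|exact: cvg_id].
Qed.

Lemma germ_inv_continuous : continuous (germ_inv hs).
Proof.
move=> s; apply: (germ_cvg (F := nbhs s)) => [b||]; [|exact: germ_src_continuous|exact: germ_rng_continuous].
apply: (cvg_comp (fun t : G => germ_fun t b^#) (fun z : Cplx R => z^*)).
  exact: germ_fun_continuous.
exact: conj_continuous.
Qed.

Lemma germ_mul_continuous :
  {within [set p : G * G | germ_src p.1 = germ_rng p.2],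
    continuous (fun p : G * G => germ_mul p.1 p.2)}.
Proof.
apply/subspace_continuousP => -[s t] /= st; have [n nn n1] := germ_neq0 s.
set W := within _ _; have FW : Filter W by exact: within_filter.
have c1 : fst @ W --> s.
  by apply: cvg_trans (@cvg_fst _ _ (nbhs s) (nbhs t) _); apply: cvg_app; exact: cvg_within.
have c2 : snd @ W --> t.
  by apply: cvg_trans (@cvg_snd _ _ (nbhs s) (nbhs t) _); apply: cvg_app; exact: cvg_within.
have comp : \forall p \near W, germ_src p.1 = germ_rng p.2 by exact: withinT.
have cf (T : topologicalType) (h : G -> T) (q : G * G -> G) (l : G) :
    continuous h -> q @ W --> l -> (fun p => h (q p)) @ W --> h l.
  by move=> hc ql; apply: (cvg_comp q h ql); exact: hc.
change ((fun p : G * G => germ_mul p.1 p.2) @ W --> germ_mul s t).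
have n00 : germ_fun s n != 0 by rewrite n1 oner_eq0.
apply: germ_cvg => [b||].
- have n0 : \forall p \near W, germ_fun p.1 n != 0.
    apply: (cvgr_neq0 (germ_fun s n)); last by rewrite n1 oner_eq0.
    exact: (cf _ _ fst _ (@germ_fun_continuous _ _ _ _ _ n) c1).
  apply: (@cvg_near_eq _ _ _ _ (fun p : G * G => germ_fun p.2 (n^# ** b) / (germ_fun p.1 n)^*)).
    by apply: filterS2 comp n0 => p pc pn; apply: germ_mul_fun_div.
  rewrite (germ_mul_fun_div hs hext _ st nn n00).
  apply: cvgM; first exact: (cf _ _ snd _ (@germ_fun_continuous _ _ _ _ _ _) c2).
  apply: cvgV; first by rewrite conjC_eq0.
  apply: (cvg_comp (fun p : G * G => germ_fun p.1 n) (fun z : Cplx R => z^*)).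
    exact: (cf _ _ fst _ (@germ_fun_continuous _ _ _ _ _ n) c1).
  exact: conj_continuous.
- apply: (@cvg_near_eq _ _ _ _ (fun p : G * G => germ_rng p.1)).
    by apply: filterS comp => p pc; rewrite germ_mul_rng.
  rewrite germ_mul_rng //.
  exact: (cf _ _ fst _ (@germ_rng_continuous _ _ _ _ _) c1).
- apply: (@cvg_near_eq _ _ _ _ (fun p : G * G => germ_src p.2)).
    by apply: filterS comp => p pc; rewrite germ_mul_src.
  rewrite germ_mul_src //.
  exact: (cf _ _ snd _ (@germ_src_continuous _ _ _ _ _) c2).
Qed.

Definition germ_groupoid : topGroupoid X :=
  @TopGroupoid X G (@germ_src _ _ _ _ _) (@germ_rng _ _ _ _ _) (germ_unit hs)
    (@germ_mul _ _ _ _ _) (germ_inv hs)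
    (fun=> erefl) (fun=> erefl) (fun s t => @germ_mul_src _ _ _ _ _ s t)
    (fun s t => @germ_mul_rng _ _ _ _ _ s t) germ_mulA germ_mul1 germ_1mul
    (fun=> erefl) (fun=> erefl) germ_mulV germ_Vmul
    (@germ_src_continuous _ _ _ _ _) (@germ_rng_continuous _ _ _ _ _)
    germ_unit_continuous germ_mul_continuous germ_inv_continuous.

End CanonicalGroupoids.

Lemma local_homeomorphism_comp (S T U : topologicalType) (i : S -> T) (i' : T -> S) (f : T -> U) :
  continuous i -> continuous i' -> cancel i i' -> cancel i' i ->
  local_homeomorphism f -> local_homeomorphism (f \o i).
Proof.
move=> ic i'c iK i'K lf x; have [V [oV Vx ofV fc [g [gc gK]]]] := lf (i x).
have img : (f \o i) @` (i @^-1` V) = f @` V.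
  apply/seteqP; split=> [_ [y Vy <-]|_ [y Vy <-]]; first by exists (i y).
  by exists (i' y); rewrite /= i'K.
exists (i @^-1` V); split => //.
- by apply: open_comp => // y _; exact: ic.
- by rewrite img.
- apply/subspace_continuousP => y Vy; move/subspace_continuousP: fc => /(_ _ Vy) fc.
  by apply: cvg_comp fc => W Wn; exact: (ic y _ Wn).
- exists (i' \o g); rewrite img; split; last by move=> y Vy; rewrite /= gK.
  apply/subspace_continuousP => y fVy; move/subspace_continuousP: gc => /(_ _ fVy) gc.
  by apply: cvg_comp gc _; exact: i'c.
Qed.

(** * The quotient by the circle *)

Section OrbitGroupoid.
Context (R : realType) (X : topologicalType) (B : cstarAlgType R).
Context (iota : (X -> Cplx R) -> B) (E : B -> B) (hs : faithful_inclusion iota E).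
Context (hext : extension_property (C0_image iota)).
Implicit Types (f g u : X -> Cplx R) (a b c n m : B) (x y : X).

Local Notation eigen := (eigenfunctional iota E).
Local Notation G := (germ_groupoid hs hext).
Implicit Types (s t r : G).

(* Since H is principal it is an equivalence relation on X, and the modulus of an
   eigenfunctional only depends on its source and range. *)
Definition orbit_set : set (X * X) := [set p | exists phi, eigen phi p.1 p.2].

Definition orbit_fun (p : X * X) (b : B) : Cplx R :=
  `|xget (fun=> 0) [set phi | eigen phi p.1 p.2] b|.

Definition orbit_coord (h : orbit_set) : {ptws B -> Cplx R} * (X * X) :=
  (orbit_fun (\val h), \val h).

Definition orbit : topologicalType := initial_topology orbit_coord.

Implicit Types (h k l : orbit).

Definition orbit_rng h : X := (orbit_coord h).2.1.
Definition orbit_src h : X := (orbit_coord h).2.2.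
Definition orbit_mod h : B -> Cplx R := (orbit_coord h).1.

Lemma orbit_eq (h k : orbit) : orbit_rng h = orbit_rng k -> orbit_src h = orbit_src k -> h = k.
Proof.
move=> e1 e2; apply: val_inj; move: e1 e2; rewrite /orbit_rng /orbit_src /=.
by case: (\val h) => p q; case: (\val k) => p' q' /= -> ->.
Qed.

Lemma orbit_cvg (T : Type) (F : set_system T) {FF : Filter F} (h : T -> orbit) (k : orbit) :
  (forall b, (fun i => orbit_mod (h i) b) @ F --> orbit_mod k b) ->
  (fun i => orbit_rng (h i)) @ F --> orbit_rng k ->
  (fun i => orbit_src (h i)) @ F --> orbit_src k -> h @ F --> k.
Proof. exact: coord_cvg. Qed.

Lemma orbit_mod_continuous b : continuous (fun h : orbit => orbit_mod h b).
Proof. exact: coord_fun_continuous. Qed.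

Lemma orbit_rng_continuous : continuous orbit_rng.
Proof. exact: coord_rng_continuous. Qed.

Lemma orbit_src_continuous : continuous orbit_src.
Proof. exact: coord_src_continuous. Qed.

Lemma orbit_hausdorff : hausdorff_space orbit.
Proof.
move=> h k cl; apply: orbit_eq.
- exact: (cluster_continuous orbit_rng_continuous (fi_hausdorff hs) cl).
- exact: (cluster_continuous orbit_src_continuous (fi_hausdorff hs) cl).
Qed.

Definition germ_proj s : orbit :=
  exist (fun p => p \in orbit_set) (grng s, gsrc s)
    (mem_set (ex_intro _ (germ_fun s) (germP s))).

Lemma germ_proj_surj (h : orbit) : exists s, germ_proj s = h.
Proof.
have [phi e] := set_valP h; exists (mk_germ e).
by apply: orbit_eq; rewrite /orbit_rng /orbit_src.
Qed.

Lemma orbit_modE s b : orbit_mod (germ_proj s) b = `|germ_fun s b|.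
Proof.
rewrite /orbit_mod /orbit_coord /orbit_fun /=.
have e := @xgetPex _ (fun=> 0) _ (ex_intro (fun phi => eigen phi (germ_rng s) (germ_src s)) _ (germP s)).
have [z z1 ->] := eigen_same hs hext (germP s) e.
by rewrite normrM z1 mul1r.
Qed.

Definition orbit_lift (h : orbit) : G := projT1 (cid (germ_proj_surj h)).

Lemma orbit_liftK h : germ_proj (orbit_lift h) = h.
Proof. exact: projT2 (cid (germ_proj_surj h)). Qed.

Lemma orbit_lift_src h : gsrc (orbit_lift h) = orbit_src h.
Proof. by rewrite -{2}(orbit_liftK h). Qed.

Lemma orbit_lift_rng h : grng (orbit_lift h) = orbit_rng h.
Proof. by rewrite -{2}(orbit_liftK h). Qed.

(** The operations pass through arbitrary lifts. By [orbit_eq] every groupoid identity becomes a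
    comparison of endpoints, so no coherence of the lifts is involved. *)
Definition orbit_unit x : orbit := germ_proj (gunit G x).
Definition orbit_inv h : orbit := germ_proj (ginv (orbit_lift h)).
Definition orbit_mul h k : orbit := germ_proj (gmul (orbit_lift h) (orbit_lift k)).

Lemma orbit_comp h k : orbit_src h = orbit_rng k ->
  gsrc (orbit_lift h) = grng (orbit_lift k).
Proof. by rewrite orbit_lift_src orbit_lift_rng. Qed.

Lemma orbit_mul_src h k : orbit_src h = orbit_rng k -> orbit_src (orbit_mul h k) = orbit_src k.
Proof. by move=> /orbit_comp hk; exact: etrans (gsrcM hk) (orbit_lift_src k). Qed.

Lemma orbit_mul_rng h k : orbit_src h = orbit_rng k -> orbit_rng (orbit_mul h k) = orbit_rng h.
Proof. by move=> /orbit_comp hk; exact: etrans (grngM hk) (orbit_lift_rng h). Qed.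

Lemma orbit_inv_src h : orbit_src (orbit_inv h) = orbit_rng h.
Proof. exact: etrans (gsrcV (orbit_lift h)) (orbit_lift_rng h). Qed.

Lemma orbit_inv_rng h : orbit_rng (orbit_inv h) = orbit_src h.
Proof. exact: etrans (grngV (orbit_lift h)) (orbit_lift_src h). Qed.

Lemma orbit_mulA h k l : orbit_src h = orbit_rng k -> orbit_src k = orbit_rng l ->
  orbit_mul h (orbit_mul k l) = orbit_mul (orbit_mul h k) l.
Proof.
by move=> hk kl; apply: orbit_eq; rewrite !(orbit_mul_rng, orbit_mul_src) // ?orbit_mul_rng ?orbit_mul_src.
Qed.

Lemma orbit_mul1 h : orbit_mul h (orbit_unit (orbit_src h)) = h.
Proof. by apply: orbit_eq; rewrite !(orbit_mul_rng, orbit_mul_src). Qed.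

Lemma orbit_1mul h : orbit_mul (orbit_unit (orbit_rng h)) h = h.
Proof. by apply: orbit_eq; rewrite !(orbit_mul_rng, orbit_mul_src). Qed.

Lemma orbit_mulV h : orbit_mul h (orbit_inv h) = orbit_unit (orbit_rng h).
Proof.
by apply: orbit_eq; rewrite !(orbit_mul_rng, orbit_mul_src) ?orbit_inv_rng ?orbit_inv_src.
Qed.

Lemma orbit_Vmul h : orbit_mul (orbit_inv h) h = orbit_unit (orbit_src h).
Proof.
by apply: orbit_eq; rewrite !(orbit_mul_rng, orbit_mul_src) ?orbit_inv_rng ?orbit_inv_src.
Qed.

Lemma germ_proj_continuous : continuous germ_proj.
Proof.
move=> s; apply: (orbit_cvg (F := nbhs s)) => [b||].
- rewrite orbit_modE; under eq_fun do rewrite orbit_modE.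
  by apply: cvg_norm; exact: germ_fun_continuous.
- exact: germ_rng_continuous.
- exact: germ_src_continuous.
Qed.

Lemma orbit_modL h b : orbit_mod h b = `|germ_fun (orbit_lift h) b|.
Proof. by rewrite -orbit_modE orbit_liftK. Qed.

Lemma orbit_unit_continuous : continuous orbit_unit.
Proof.
move=> x; apply: (@continuous_comp _ _ _ (gunit G) germ_proj); first exact: gunit_continuous.
exact: germ_proj_continuous.
Qed.

Lemma orbit_inv_continuous : continuous orbit_inv.
Proof.
move=> h; apply: (orbit_cvg (F := nbhs h)) => [b||].
- have modV k : orbit_mod (orbit_inv k) b = orbit_mod k b^#.
    by rewrite orbit_modE orbit_modL /germ_fun /= norm_conjC.
  rewrite modV; under eq_fun do rewrite modV.
  exact: orbit_mod_continuous.
- rewrite orbit_inv_rng; under eq_fun do rewrite orbit_inv_rng.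
  exact: orbit_src_continuous.
- rewrite orbit_inv_src; under eq_fun do rewrite orbit_inv_src.
  exact: orbit_rng_continuous.
Qed.

Lemma orbit_mul_continuous :
  {within [set p : orbit * orbit | orbit_src p.1 = orbit_rng p.2],
    continuous (fun p : orbit * orbit => orbit_mul p.1 p.2)}.
Proof.
apply/subspace_continuousP => -[h k] /= hk; have [n nn n1] := germ_neq0 (orbit_lift h).
set W := within _ _; have FW : Filter W by exact: within_filter.
have c1 : fst @ W --> h.
  by apply: cvg_trans (@cvg_fst _ _ (nbhs h) (nbhs k) _); apply: cvg_app; exact: cvg_within.
have c2 : snd @ W --> k.
  by apply: cvg_trans (@cvg_snd _ _ (nbhs h) (nbhs k) _); apply: cvg_app; exact: cvg_within.
have comp : \forall p \near W, orbit_src p.1 = orbit_rng p.2 by exact: withinT.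
have cf (T : topologicalType) (f : orbit -> T) (q : orbit * orbit -> orbit) (l : orbit) :
    continuous f -> q @ W --> l -> (fun p => f (q p)) @ W --> f l.
  by move=> fc ql; apply: (cvg_comp q f ql); exact: fc.
change ((fun p : orbit * orbit => orbit_mul p.1 p.2) @ W --> orbit_mul h k).
have n00 : orbit_mod h n != 0 by rewrite orbit_modL n1 normr1 oner_eq0.
(* The modulus of the division formula, valid for all arrows near [h] with the same [n]. *)
have mulE (h' k' : orbit) b : orbit_src h' = orbit_rng k' -> orbit_mod h' n != 0 ->
    orbit_mod (orbit_mul h' k') b = orbit_mod k' (n^# ** b) / orbit_mod h' n.
  move=> /orbit_comp hk'; rewrite orbit_modL normr_eq0 => n0.
  rewrite orbit_modE (germ_mul_fun_div hs hext _ hk' nn n0) normrM normfV norm_conjC.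
  by rewrite !orbit_modL.
apply: orbit_cvg => [b||].
- have n0 : \forall p \near W, orbit_mod p.1 n != 0.
    apply: (cvgr_neq0 (orbit_mod h n)) => //.
    exact: (cf _ _ fst _ (@orbit_mod_continuous n) c1).
  apply: (@cvg_near_eq _ _ _ _ (fun p : orbit * orbit => orbit_mod p.2 (n^# ** b) / orbit_mod p.1 n)).
    by apply: filterS2 comp n0 => p pc pn; apply: mulE.
  rewrite mulE //.
  apply: cvgM; first exact: (cf _ _ snd _ (@orbit_mod_continuous _) c2).
  by apply: cvgV => //; exact: (cf _ _ fst _ (@orbit_mod_continuous n) c1).
- apply: (@cvg_near_eq _ _ _ _ (fun p : orbit * orbit => orbit_rng p.1)).
    by apply: filterS comp => p pc; rewrite orbit_mul_rng.
  rewrite orbit_mul_rng //.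
  exact: (cf _ _ fst _ orbit_rng_continuous c1).
- apply: (@cvg_near_eq _ _ _ _ (fun p : orbit * orbit => orbit_src p.2)).
    by apply: filterS comp => p pc; rewrite orbit_mul_src.
  rewrite orbit_mul_src //.
  exact: (cf _ _ snd _ orbit_src_continuous c2).
Qed.

Definition orbit_groupoid : topGroupoid X :=
  @TopGroupoid X orbit orbit_src orbit_rng orbit_unit orbit_mul orbit_inv
    (fun=> erefl) (fun=> erefl) orbit_mul_src orbit_mul_rng orbit_mulA orbit_mul1 orbit_1mul
    orbit_inv_src orbit_inv_rng orbit_mulV orbit_Vmul
    orbit_src_continuous orbit_rng_continuous
    orbit_unit_continuous orbit_mul_continuous orbit_inv_continuous.

Lemma orbit_principal : principal orbit_groupoid.
Proof. by move=> h e; apply: orbit_eq => //; rewrite -[LHS]e. Qed.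

End OrbitGroupoid.

(** * Local sections and the etale topology *)

Section GermSections.
Context (R : realType) (X : topologicalType) (B : cstarAlgType R).
Context (iota : (X -> Cplx R) -> B) (E : B -> B) (hs : faithful_inclusion iota E).
Context (hext : extension_property (C0_image iota)).
Implicit Types (f g u : X -> Cplx R) (a b c n m : B) (x y : X) (z w : Cplx R).

Local Notation ev := (expect iota E).
Local Notation A := (C0_image iota).
Local Notation G := (germ_groupoid hs hext).
Local Notation H := (orbit_groupoid hs hext).
Local Notation proj := (@germ_proj _ _ _ _ _ hs hext).
Implicit Types (s t r : G) (h k : H).

(** The unit at [x] is the default where [n] is no normaliser or E(n^# n)(x) = 0. Elsewhere,
    dividing by the square root normalises the functional and fixes its phase: the value at [n] is
    positive. *)
Lemma germ_section_ex n x : exists s : G, germ_src s = x /\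
  (normaliser A n -> ev x (n^# ** n) != 0 ->
   forall b, germ_fun s b = (sqrtC (ev x (n^# ** n)))^-1 * ev x (n^# ** b)).
Proof.
have [nn|nn] := pselect (normaliser A n); last by exists (germ_unit hs x); split.
have [n0|n0] := eqVneq (ev x (n^# ** n)) 0; first by exists (germ_unit hs x); split.
have [y e] := eigen_exists hs hext nn n0.
by exists (mk_germ e).
Qed.

Definition germ_section n x : G := projT1 (cid (germ_section_ex n x)).

Lemma germ_section_src n x : gsrc (germ_section n x) = x.
Proof. exact: (projT2 (cid (germ_section_ex n x))).1. Qed.

Lemma germ_section_fun n x b : normaliser A n -> ev x (n^# ** n) != 0 ->
  germ_fun (germ_section n x) b = (sqrtC (ev x (n^# ** n)))^-1 * ev x (n^# ** b).
Proof. move=> nn n0; exact: ((projT2 (cid (germ_section_ex n x))).2 nn n0 b). Qed.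

Lemma germ_section_normaliser n x : normaliser A n -> ev x (n^# ** n) != 0 ->
  germ_fun (germ_section n x) n = sqrtC (ev x (n^# ** n)).
Proof.
move=> nn n0; rewrite germ_section_fun //.
have s0 : sqrtC (ev x (n^# ** n)) != 0 by rewrite sqrtC_eq0.
by apply: (mulfI s0); rewrite mulrA divff // mul1r -expr2 sqrtCK.
Qed.

Lemma germ_section_neq0 n x : normaliser A n -> ev x (n^# ** n) != 0 ->
  germ_fun (germ_section n x) n != 0.
Proof. by move=> nn n0; rewrite germ_section_normaliser // sqrtC_eq0. Qed.

Lemma germ_sqr s n : normaliser A n -> germ_fun s n != 0 ->
  ev (gsrc s) (n^# ** n) = `|germ_fun s n| ^+ 2.
Proof. exact: (eigen_sqr hs hext (germP s)). Qed.

Lemma germ_sqr_neq0 s n : normaliser A n -> germ_fun s n != 0 ->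
  ev (gsrc s) (n^# ** n) != 0.
Proof. by move=> nn n0; rewrite germ_sqr // expf_neq0 // normr_eq0. Qed.

Lemma germ_rng_formula s n f : normaliser A n -> germ_fun s n != 0 -> C0 f ->
  f (grng s) = ev (gsrc s) (n^# ** iota f ** n) / ev (gsrc s) (n^# ** n).
Proof.
move=> nn n0 f0; have := eigen_point hs hext (germP s) nn n0 (iota f).
rewrite (expect_iota hs) // => e; rewrite [X in X / _]e mulfK //.
exact: (germ_sqr_neq0 nn n0).
Qed.

Lemma germ_formula s n b : normaliser A n -> germ_fun s n != 0 ->
  germ_fun s b = ev (gsrc s) (n^# ** b) / (germ_fun s n)^*.
Proof.
move=> nn n0; have e := eigen_formula hs hext b (germP s) nn n0.
by rewrite [X in X / _]e mulrAC divff ?mul1r // conjC_eq0.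
Qed.

Lemma germ_rng_unique s t n : normaliser A n -> germ_fun s n != 0 -> germ_fun t n != 0 ->
  gsrc s = gsrc t -> grng s = grng t.
Proof.
move=> nn s0 t0 st; apply: (C0_separates hs) => f f0.
by rewrite (germ_rng_formula nn s0) // (germ_rng_formula nn t0) // st.
Qed.

(** Values are quotients of continuous functions E(.). For the range, [germ_rng_formula] expresses
    f(range) in the same way, and [point_cvg] concludes. *)
Lemma germ_section_continuous n x : normaliser A n -> ev x (n^# ** n) != 0 ->
  germ_section n y @[y --> x] --> germ_section n x.
Proof.
move=> nn n0; have evc b : ev y b @[y --> x] --> ev x b by exact: (expect_continuous hs).
have near0 : \forall y \near x, ev y (n^# ** n) != 0 by apply: (cvgr_neq0 (ev x (n^# ** n))).
have sc (z : Cplx R) : z != 0 -> 0 <= z -> forall (f : X -> Cplx R), (forall y, 0 <= f y) ->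
    f y @[y --> x] --> z -> sqrtC (f y) @[y --> x] --> sqrtC z.
  move=> zn z0 f fge fz.
  have sE (w : Cplx R) : 0 <= w -> sqrtC w = toC (Num.sqrt (complex.Re w)).
    move=> w0; rewrite -{1}(toC_Re_ge0 w0) -{1}(@sqr_sqrtr _ (complex.Re w)); last by rewrite -toC_le toC_Re_ge0.
    by rewrite toCX sqrCK // -toC0 toC_le sqrtr_ge0.
  rewrite (sE z z0); have -> : (fun y => sqrtC (f y)) = fun y => toC (Num.sqrt (complex.Re (f y))).
    by apply/funext => y; exact: sE.
  have h1 : complex.Re (f y) @[y --> x] --> complex.Re z.
    exact: (cvg_comp f (fun z : Cplx R => complex.Re z) fz (@Re_continuous R z)).
  have h2 := cvg_comp _ _ h1 (@sqrt_continuous R (complex.Re z)).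
  exact: (cvg_comp _ _ h2 (@toC_continuous R _)).
apply: (germ_cvg (F := nbhs x)) => [b||].
- apply: (@cvg_near_eq _ _ _ _ (fun y => (sqrtC (ev y (n^# ** n)))^-1 * ev y (n^# ** b))).
    by apply: filterS near0 => y y0; rewrite germ_section_fun.
  rewrite germ_section_fun //; apply: cvgM => //.
  apply: cvgV; first by rewrite sqrtC_eq0.
  have ge y : 0 <= ev y (n^# ** n) by have [_] := expect_pos hs y; apply.
  exact: (sc _ n0 (ge x) (fun y => ev y (n^# ** n)) ge (evc _)).
- apply: (point_cvg hs) => f f0.
  have E1 y : ev y (n^# ** n) != 0 ->
      f (germ_rng (germ_section n y)) = ev y (n^# ** iota f ** n) / ev y (n^# ** n).
    move=> y0; have := germ_rng_formula nn (germ_section_neq0 nn y0) f0.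
    by rewrite germ_section_src.
  apply: (@cvg_near_eq _ _ _ _ (fun y => ev y (n^# ** iota f ** n) / ev y (n^# ** n))).
    by apply: filterS near0 => y y0; rewrite E1.
  by rewrite E1 //; apply: cvgM => //; apply: cvgV.
- have srcE y : germ_src (germ_section n y) = y := germ_section_src n y.
  rewrite srcE; under eq_fun do rewrite srcE; exact: cvg_id.
Qed.

Lemma proj_section h n : normaliser A n -> orbit_mod h n != 0 ->
  proj (germ_section n (gsrc h)) = h.
Proof.
move=> nn h0; set s := orbit_lift hs hext h; have s0 : germ_fun s n != 0.
  by move: h0; rewrite (orbit_modL hs hext) normr_eq0.
have sh : gsrc s = gsrc h := orbit_lift_src hs hext h.
have sqr0 := germ_sqr_neq0 nn s0; rewrite sh in sqr0.
apply: orbit_eq; last exact: germ_section_src.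
have := germ_rng_unique nn (germ_section_neq0 nn sqr0) s0; rewrite germ_section_src sh.
move=> /(_ erefl) e; exact: etrans e (orbit_lift_rng hs hext h).
Qed.

(** On the open set of arrows where [n] does not vanish, an arrow is determined by its source, and
    the section of [n] inverts the source map. *)
Lemma orbit_src_local_homeomorphism : local_homeomorphism (@gsrc X H).
Proof.
move=> h; have [n nn n1] := germ_neq0 (orbit_lift hs hext h).
pose V := [set k : H | orbit_mod k n != 0].
have oV : open V by apply: open_neq0; exact: orbit_mod_continuous.
have img : (@gsrc X H) @` V = [set x | ev x (n^# ** n) != 0].
  apply/seteqP; split=> [_ [k kn <-]|x x0].
    have s0 : germ_fun (orbit_lift hs hext k) n != 0 by move: kn; rewrite /V /= (orbit_modL hs hext) normr_eq0.
    have := germ_sqr_neq0 nn s0.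
    by rewrite (_ : gsrc (orbit_lift hs hext k) = gsrc k) //; exact: orbit_lift_src.
  exists (proj (germ_section n x)); last exact: germ_section_src.
  by rewrite /V /= orbit_modE normr_eq0 germ_section_neq0.
exists V; split => //.
- by rewrite /V /= (orbit_modL hs hext) n1 normr1 oner_eq0.
- by rewrite img; apply: open_neq0; exact: (expect_continuous hs).
- by apply: continuous_subspaceT; exact: gsrc_continuous.
- exists (fun x => proj (germ_section n x)); split; last by move=> k kn; exact: proj_section.
  apply/subspace_continuousP => x; rewrite img => x0; apply: cvg_within_filter.
  apply: (cvg_comp _ proj (germ_section_continuous nn x0)).
  exact: germ_proj_continuous.
Qed.

Lemma orbit_etale : etale H.
Proof.
split; last exact: orbit_src_local_homeomorphism.
have -> : @grng X H = @gsrc X H \o @ginv X H by apply/funext => h; exact: esym (gsrcV h).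
have invK : cancel (@ginv X H) (@ginv X H).
  move=> h; apply: orbit_eq; first exact: etrans (grngV (ginv h)) (gsrcV h).
  exact: etrans (gsrcV (ginv h)) (grngV h).
by apply: (local_homeomorphism_comp (@ginv_continuous X H) (@ginv_continuous X H) invK invK);
  exact: orbit_src_local_homeomorphism.
Qed.

(** Identity off the circle, where the scaled functional would not be normalised. *)
Definition germ_scale z s : G :=
  if pselect (circle z) is left c then mk_germ (eigen_scale hs c (germP s)) else s.

Lemma germ_scale_src z s : gsrc (germ_scale z s) = gsrc s.
Proof. by rewrite /germ_scale; case: pselect. Qed.

Lemma germ_scale_rng z s : grng (germ_scale z s) = grng s.
Proof. by rewrite /germ_scale; case: pselect. Qed.

Lemma germ_scale_fun z s b : circle z -> germ_fun (germ_scale z s) b = z * germ_fun s b.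
Proof. by rewrite /germ_scale; case: pselect. Qed.

Definition germ_incl x z : G := germ_scale z (gunit G x).

Lemma germ_incl_l z s : circle z -> gmul (germ_incl (grng s) z) s = germ_scale z s.
Proof.
move=> z1; have [u [u0 u1 us nu]] := unit_bump_normaliser hs (grng s).
have zz : z * z^* = 1 by rewrite -normCK z1 expr1n.
have comp : gsrc (germ_incl (grng s) z) = grng s by rewrite germ_scale_src gsrc1.
apply: germ_eq => [b||].
- rewrite (@germ_mul_fun _ _ _ _ _ hs hext (germ_incl (grng s) z) s (z^* *: iota u)) //.
  + by rewrite cadjZ conjCK us cmulZl germZ // germ_iota_l // u1 mul1r germ_scale_fun.
  + exact: (normaliser_scale hs).
  + by rewrite germ_scale_fun // germZ // mulrA zz mul1r /germ_fun /= (expect_iota hs).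
- by rewrite [LHS](grngM comp) /germ_incl germ_scale_rng grng1 [RHS]germ_scale_rng.
- by rewrite [LHS](gsrcM comp) [RHS]germ_scale_src.
Qed.

Lemma germ_incl_r z s : circle z -> gmul s (germ_incl (gsrc s) z) = germ_scale z s.
Proof.
move=> z1; have [n nn n1] := germ_neq0 s; have [_ _ _ nE] := eigen_rep hs hext (germP s) nn n1.
have comp : gsrc s = grng (germ_incl (gsrc s) z) by rewrite germ_scale_rng grng1.
apply: germ_eq => [b||].
- rewrite (germ_mul_fun hs hext _ comp nn n1) !germ_scale_fun //.
  by rewrite nE.
- by rewrite [LHS](grngM comp) [RHS]germ_scale_rng.
- by rewrite [LHS](gsrcM comp) /germ_incl germ_scale_src gsrc1 [RHS]germ_scale_src.
Qed.

End GermSections.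

Lemma circle_closed (R : realType) : closed (@circle R).
Proof.
have -> : @circle R = (fun z : Cplx R => `|z|) @^-1` [set 1].
  by apply/seteqP; split=> z.
apply: preimage_closed; first by move=> z _; exact: norm_continuous.
by apply: accessible_closed_set1; apply: hausdorff_accessible; exact: norm_hausdorff.
Qed.

Lemma circle_compact (R : realType) : compact (@circle R).
Proof.
pose c (p : R * R) : Cplx R := toC p.1 + 'i * toC p.2.
have cc : continuous c.
  move=> p; apply: cvgD.
    exact: (cvg_comp fst (fun r => toC r) cvg_fst (@toC_continuous R _)).
  apply: cvgM; first exact: cvg_cst.
  exact: (cvg_comp snd (fun r => toC r) cvg_snd (@toC_continuous R _)).
have Ic := compact_setX (@segment_compact R (-1) 1) (@segment_compact R (-1) 1).
have Q := continuous_compact (continuous_subspaceT cc) Ic.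
apply: (subclosed_compact _ Q); first exact: circle_closed.
move=> z z1; exists (complex.Re z, complex.Im z); last by rewrite /c /= -complexE.
have le1 (r : R) : r ^+ 2 <= 1 -> r \in `[-1, 1].
  by move=> r1; rewrite in_itv /= -ler_norml -(@expr_le1 _ 2) // real_normK ?num_real.
have sq : complex.Re z ^+ 2 + complex.Im z ^+ 2 = 1.
  have := add_Re2_Im2 z; rewrite [`|z|]z1 expr1n => e; apply/eqP.
  by rewrite -(inj_eq (@complexI R)) e.
split => /=; apply: le1; rewrite -sq ?lerDl ?lerDr sqr_ge0 //.
Qed.

(** * The canonical twist *)

Section CanonicalTwist.
Context (R : realType) (X : topologicalType) (B : cstarAlgType R).
Context (iota : (X -> Cplx R) -> B) (E : B -> B) (hs : faithful_inclusion iota E).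
Context (hext : extension_property (C0_image iota)).
Implicit Types (f g u : X -> Cplx R) (a b c n m : B) (x y : X) (z w : Cplx R).

Local Notation ev := (expect iota E).
Local Notation A := (C0_image iota).
Local Notation G := (germ_groupoid hs hext).
Local Notation H := (orbit_groupoid hs hext).
Local Notation proj := (@germ_proj _ _ _ _ _ hs hext : arrow G -> arrow H).
Local Notation incl := (germ_incl hs hext).
Local Notation sec := (germ_section hs hext).
Implicit Types (s t r : G) (h k : H).

Lemma germ_incl_src x z : gsrc (incl x z) = x.
Proof. by rewrite germ_scale_src gsrc1. Qed.

Lemma germ_incl_rng x z : grng (incl x z) = x.
Proof. by rewrite germ_scale_rng grng1. Qed.

Lemma germ_incl_fun x z b : circle z -> germ_fun (incl x z) b = z * ev x b.
Proof. by move=> z1; rewrite germ_scale_fun. Qed.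

Lemma circle_mul z w : circle z -> circle w -> circle (z * w).
Proof. by rewrite /circle /= => z1 w1; rewrite normrM z1 w1 mulr1. Qed.

Lemma germ_inclM x z w : circle z -> circle w -> incl x (z * w) = gmul (incl x z) (incl x w).
Proof.
move=> z1 w1; have := germ_incl_l (incl x w) z1; rewrite germ_incl_rng => ->.
apply: germ_eq => [b||].
- by rewrite !germ_scale_fun ?mulrA //; exact: circle_mul.
- by rewrite [LHS]germ_incl_rng [RHS]germ_scale_rng germ_incl_rng.
- by rewrite [LHS]germ_incl_src [RHS]germ_scale_src germ_incl_src.
Qed.

Lemma germ_incl_continuous : {within [set: X] `*` @circle R,
  continuous (fun p : X * Cplx R => incl p.1 p.2 : G)}.
Proof.
apply/subspace_continuousP => -[x z] [_ /= z1].
set W := within _ _; have FW : Filter W by exact: within_filter.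
have c1 : fst @ W --> x.
  by apply: cvg_trans (@cvg_fst _ _ (nbhs x) (nbhs z) _); apply: cvg_app; exact: cvg_within.
have c2 : snd @ W --> z.
  by apply: cvg_trans (@cvg_snd _ _ (nbhs x) (nbhs z) _); apply: cvg_app; exact: cvg_within.
have comp : \forall p \near W, circle p.2.
  have : \forall p \near W, ([set: X] `*` @circle R) p by exact: withinT.
  by apply: filterS => p [].
change ((fun p : X * Cplx R => incl p.1 p.2 : G) @ W --> (incl x z : G)).
apply: germ_cvg => [b||].
- apply: (@cvg_near_eq _ _ _ _ (fun p : X * Cplx R => p.2 * ev p.1 b)).
    by apply: filterS comp => p p1; rewrite germ_incl_fun.
  rewrite (germ_incl_fun x b z1); apply: cvgM; first exact: c2.
  exact: (cvg_comp fst (fun x => ev x b) c1 (@expect_continuous _ _ _ _ _ hs b x)).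
- have e y w : germ_rng (incl y w) = y := germ_incl_rng y w.
  by rewrite e; under eq_fun do rewrite e.
- have e y w : germ_src (incl y w) = y := germ_incl_src y w.
  by rewrite e; under eq_fun do rewrite e.
Qed.

Lemma germ_incl_inj x z w : circle z -> circle w -> incl x z = incl x w -> z = w.
Proof.
move=> z1 w1 e; have [u [u0 _ u1]] := unit_bump hs x.
have := congr1 (fun s : G => germ_fun s (iota u)) e.
by rewrite !germ_incl_fun // (expect_iota hs) // u1 !mulr1.
Qed.

Lemma germ_projM s t : gsrc s = grng t -> proj (gmul s t) = gmul (proj s) (proj t).
Proof.
move=> st; have pst : gsrc (proj s) = grng (proj t) by exact: st.
apply: orbit_eq.
  exact: etrans (grngM st) (esym (grngM pst)).
exact: etrans (gsrcM st) (esym (gsrcM pst)).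
Qed.

Lemma germ_exact s x : proj s = gunit H x <-> exists2 z, circle z & s = incl x z.
Proof.
split=> [e|[z z1 ->]]; last first.
  by apply: orbit_eq; [exact: germ_incl_rng|exact: germ_incl_src].
have sx : germ_src s = x := congr1 (@gsrc X H) e.
have rx : germ_rng s = x := congr1 (@grng X H) e.
have es := germP s; rewrite sx rx in es.
have [z z1 zE] := eigen_same hs hext (eigen_unit hs x) es.
exists z => //; apply: germ_eq => [b||].
- by rewrite zE germ_incl_fun.
- by rewrite rx; exact: esym (germ_incl_rng x z).
- by rewrite sx; exact: esym (germ_incl_src x z).
Qed.

Lemma germ_central s z : circle z -> gmul (incl (grng s) z) s = gmul s (incl (gsrc s) z).
Proof. by move=> z1; rewrite germ_incl_l // germ_incl_r. Qed.

Definition germ_phase n s : Cplx R := germ_fun s n / `|germ_fun s n|.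

Lemma germ_phase_circle n s : germ_fun s n != 0 -> circle (germ_phase n s).
Proof.
move=> s0; rewrite /circle /= normrM normfV normr_id divff //.
by rewrite normr_eq0.
Qed.

(** [germ_formula] recovers [s] from [n] and the single number s(n); its modulus is the norm of the
    vector of [n], so only its phase is new information. *)
Lemma germ_section_phase n s : normaliser A n -> germ_fun s n != 0 ->
  germ_scale (germ_phase n s) (sec n (gsrc s)) = s.
Proof.
move=> nn s0; have c0 := germ_sqr_neq0 nn s0.
have sq : sqrtC (ev (gsrc s) (n^# ** n)) = `|germ_fun s n|.
  by rewrite (germ_sqr nn s0) sqrCK.
apply: germ_eq => [b||].
- rewrite germ_scale_fun; last exact: germ_phase_circle.
  rewrite germ_section_fun // sq (germ_formula b nn s0) /germ_phase.
  have -> : (germ_fun s n)^*^-1 = germ_fun s n / `|germ_fun s n| ^+ 2.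
    by rewrite normCK invfM mulrA divff // mul1r.
  by rewrite expr2 invfM; move: (_^-1) => w; ring.
- rewrite [LHS]germ_scale_rng; apply: (germ_rng_unique nn _ s0).
    exact: germ_section_neq0.
  exact: germ_section_src.
- by rewrite [LHS]germ_scale_src germ_section_src.
Qed.

Lemma germ_scale_section_continuous n x z : normaliser A n -> ev x (n^# ** n) != 0 -> circle z ->
  germ_scale p.2 (sec n p.1) @[p --> within (setT `*` @circle R) (nbhs (x, z))] -->
  germ_scale z (sec n x).
Proof.
move=> nn n0 z1.
set W := within _ _; have FW : Filter W by exact: within_filter.
have c1 : fst @ W --> x.
  by apply: cvg_trans (@cvg_fst _ _ (nbhs x) (nbhs z) _); apply: cvg_app; exact: cvg_within.
have c2 : snd @ W --> z.
  by apply: cvg_trans (@cvg_snd _ _ (nbhs x) (nbhs z) _); apply: cvg_app; exact: cvg_within.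
have comp : \forall p \near W, circle p.2.
  have : \forall p \near W, ([set: X] `*` @circle R) p by exact: withinT.
  by apply: filterS => p [].
have cs : (fun p : X * Cplx R => sec n p.1) @ W --> sec n x.
  exact: (cvg_comp fst (fun y => sec n y) c1 (@germ_section_continuous _ _ _ _ _ hs hext n x nn n0)).
apply: (germ_cvg (F := W)) => [b||].
- apply: (@cvg_near_eq _ _ _ _ (fun p : X * Cplx R => p.2 * germ_fun (sec n p.1) b)).
    by apply: filterS comp => p p1; rewrite germ_scale_fun.
  rewrite (germ_scale_fun _ b z1); apply: cvgM; first exact: c2.
  exact: (cvg_comp _ _ cs (@germ_fun_continuous _ _ _ _ _ b _)).
- have e w s : germ_rng (germ_scale w s) = germ_rng s := germ_scale_rng w s.
  rewrite e; under eq_fun do rewrite e.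
  exact: (cvg_comp _ _ cs (@germ_rng_continuous _ _ _ _ _ _)).
- have e w s : germ_src (germ_scale w s) = germ_src s := germ_scale_src w s.
  rewrite e; under eq_fun do rewrite e.
  exact: (cvg_comp _ _ cs (@germ_src_continuous _ _ _ _ _ _)).
Qed.

(** Over the arrows where [n] does not vanish, the phase of the value at [n] is a fibre coordinate,
    with the rescaled section of [n] as inverse. *)
Lemma germ_locally_trivial h : exists (U : set H) (phi : G -> Cplx R) (psi : H -> Cplx R -> G),
  [/\ open U /\ U h,
      {within proj @^-1` U, continuous phi},
      {within U `*` @circle R, continuous (fun p : H * Cplx R => psi p.1 p.2)},
      forall s, U (proj s) ->
        [/\ circle (phi s), psi (proj s) (phi s) = s
          & forall z, circle z -> phi (gmul (incl (grng s) z) s) = z * phi s]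
    & forall k z, U k -> circle z -> proj (psi k z) = k /\ phi (psi k z) = z].
Proof.
have [n nn n1] := germ_neq0 (orbit_lift hs hext h).
pose U := [set k : H | orbit_mod k n != 0].
have Us s : U (proj s) -> germ_fun s n != 0 by rewrite /U /= orbit_modE normr_eq0.
have Uk k : U k -> ev (gsrc k) (n^# ** n) != 0.
  move=> kU; have [s sk] := germ_proj_surj hs hext k; rewrite -sk in kU *.
  exact: (germ_sqr_neq0 nn (Us _ kU)).
exists U, (germ_phase n), (fun k z => germ_scale z (sec n (gsrc k))); split.
- split; first by apply: open_neq0; exact: orbit_mod_continuous.
  by rewrite /U /= (orbit_modL hs hext) n1 normr1 oner_eq0.
- apply/subspace_continuousP => s /Us s0; apply: cvg_within_filter.
  apply: cvgM; first exact: germ_fun_continuous.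
  apply: cvgV; first by rewrite normr_eq0.
  by apply: cvg_norm; exact: germ_fun_continuous.
- apply/subspace_continuousP => -[k z] [/= /Uk k0 z1].
  have lim := germ_scale_section_continuous nn k0 z1.
  have g : (fun p : H * Cplx R => (gsrc p.1, p.2)) @ within (U `*` @circle R) (nbhs (k, z)) -->
      within (setT `*` @circle R) (nbhs (gsrc k, z)).
    move=> W [[V1 V2] /= [n1' n2'] VW].
    exists ((@gsrc X H) @^-1` V1, V2) => /=.
      by split => //; exact: (@gsrc_continuous X H k V1 n1').
    by move=> [k' z'] /= [Vk Vz] [_ cz]; apply: (VW (orbit_src k', z')) => //.
  exact: (cvg_comp _ (fun p : X * Cplx R => germ_scale p.2 (sec n p.1)) g lim).
- move=> s /Us s0; split.
  + exact: germ_phase_circle.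
  + exact: germ_section_phase.
  + move=> z z1; rewrite germ_incl_l // /germ_phase germ_scale_fun // normrM z1 mul1r.
    by rewrite mulrA.
- move=> k z kU z1; split.
    apply: etrans (proj_section nn kU).
    by apply: orbit_eq; [exact: germ_scale_rng|exact: germ_scale_src].
  have k0 := Uk _ kU; rewrite /germ_phase germ_scale_fun // normrM z1 mul1r.
  rewrite germ_section_normaliser //; have sq0 : 0 <= sqrtC (ev (gsrc k) (n^# ** n)).
    by rewrite sqrtC_ge0; have [_] := expect_pos hs (gsrc k); apply.
  by rewrite (ger0_norm sq0) mulfK // sqrtC_eq0.
Qed.

(** The rescaled sections of [n] map K x T onto a compact neighbourhood of [s], where [K] is a
    compact neighbourhood of the source on which E(n^# n) does not vanish. *)
Lemma germ_locally_compact : locally_compact [set: G].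
Proof.
move=> s _; have [n nn n1] := germ_neq0 s.
have s0 : germ_fun s n != 0 by rewrite n1 oner_eq0.
pose O := [set x | ev x (n^# ** n) != 0].
have oO : open O by apply: open_neq0; exact: (expect_continuous hs).
have [u [K [_ Kc KO uK [_ u1]]]] := bump_at hs oO (germ_sqr_neq0 nn s0 : O (gsrc s)).
pose Q : set G := (fun p : X * Cplx R => germ_scale p.2 (sec n p.1)) @` (K `*` @circle R).
have Qc : compact Q.
  apply: continuous_compact; last exact: (compact_setX Kc (@circle_compact R)).
  apply/subspace_continuousP => -[x z] [/= /KO x0 z1].
  have g : id @ within (K `*` @circle R) (nbhs (x, z)) -->
      within (setT `*` @circle R) (nbhs (x, z)).
    by move=> W; apply: (@filterS _ (nbhs (x, z))) => p Wp [_ p1]; apply: Wp; split.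
  exact: (cvg_comp _ (fun p : X * Cplx R => germ_scale p.2 (sec n p.1)) g
    (germ_scale_section_continuous nn x0 z1)).
exists Q; last by split => //; exact: compact_closed (germ_hausdorff hs) Qc.
have near : \forall t \near (s : G), germ_fun t n != 0 /\ K (@gsrc X G t).
  apply: filterI.
    exact: (cvgr_neq0 (F := nbhs s) _ (@germ_fun_continuous _ _ _ _ _ n s) s0).
  apply: (@filterS _ (nbhs s)) (@gsrc_continuous X G s _ u1) => t /= ut.
  apply: contrapT => /uK.
  by rewrite ut => /eqP; rewrite oner_eq0.
apply: (@filterS _ (nbhs s)) near => t [t0 Kt] _; exists (gsrc t, germ_phase n t).
  by split => //; exact: germ_phase_circle.
exact: germ_section_phase.
Qed.

Definition germ_twist : twist R H :=
  @Twist R X H G incl proj (germ_hausdorff hs) germ_locally_compact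
    (fun x z _ => germ_incl_src x z) (fun x z _ => germ_incl_rng x z)
    germ_inclM germ_incl_continuous germ_incl_inj (fun=> erefl) (fun=> erefl)
    germ_projM (@germ_proj_continuous _ _ _ _ _ hs hext) (@germ_proj_surj _ _ _ _ _ hs hext)
    germ_exact germ_central germ_locally_trivial.

End CanonicalTwist.

(** * The norm of B *)

Section IsometricCriterion.
Context (R : realType) (X : topologicalType) (B : cstarAlgType R).
Context (iota : (X -> Cplx R) -> B) (E : B -> B) (hs : faithful_inclusion iota E).
Implicit Types (a b c g s v w : B) (x : X).

Local Notation ev := (expect iota E).

(** With [s] as sine and 1 - w as cosine of an angle, 1 - a and [v] are the cosine and sine of twice
    the angle, so (v, a) is again a pair as in [isom_pair]. *)
Lemma double_angle s w : s ** w = w ** s -> w + w - w ** w = s ** s ->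
  let a := s ** s + s ** s in let v := (s - s ** w) + (s - s ** w) in
  v ** v = a + a - a ** a /\ v ** a = a ** v.
Proof.
move=> sw ws a v; have e : (s - s ** w) ** (s - s ** w) = s ** s - s ** s ** (s ** s).
  have -> : s ** s ** (s ** s) = s ** s ** w + s ** s ** w - s ** s ** w ** w.
    by rewrite -{2}ws cmulBr cmulDr !cmulA.
  rewrite cmulBl !cmulBr.
  have -> : s ** w ** s = s ** s ** w by rewrite -cmulA -sw cmulA.
  have -> : s ** w ** (s ** w) = s ** s ** w ** w by rewrite -(cmulA s w) (cmulA w s) -sw !cmulA.
  by rewrite cmulA; module.
split.
  by rewrite /v; move: (s - s ** w) e => t e; rewrite /a !(cmulDl, cmulDr) e; module.
have ss : s ** w ** (s ** s) = s ** s ** (s ** w).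
  by rewrite -!cmulA; congr (_ ** _); rewrite (cmulA w) -sw !cmulA -cmulA -sw cmulA.
have {ss} : (s - s ** w) ** (s ** s) = s ** s ** (s - s ** w).
  by rewrite cmulBl cmulBr ss !cmulA.
by rewrite /v /a; move: (s - s ** w) => t ss; rewrite !(cmulDl, cmulDr) ss.
Qed.

(* With [k := 1 - a] and [|k| := 1 - w] in the unitization, [g = |k| - k], so that
   [|k| g = - k g]; the criterion is violated on [g] if [a] has norm greater than one. *)
Lemma expect_contraction b (m : Cplx R) : `|b| = 1 -> 0 <= m < 1 ->
  ~ forall x c, ev x ((b ** c)^# ** (b ** c)) <= m ^+ 2 * ev x (c^# ** c).
Proof.
move=> b1 /andP[m0 m1] hb.
have m4 : 0 <= m ^+ 4 < 1 by rewrite exprn_ge0 //= exprn_ilt1.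
have /andP[m40 m41] := m4.
have p0 : 0 < 1 + m ^+ 4 by rewrite ltr_wpDr.
(* This scale gives 2 l^2 m^4 < 1 < 2 l^2: the first inequality forces g = 0, and 2 l^2 is the norm
   of [a]. *)
pose l := sqrtC (1 + m ^+ 4)^-1.
have l2 : l ^+ 2 = (1 + m ^+ 4)^-1 by rewrite sqrtCK.
have l0 : 0 <= l by rewrite sqrtC_ge0 invr_ge0 ltW.
pose s := l *: (b^# ** b).
have ss : s^# = s by rewrite /s cadjZ cadjM cadjK geC0_conj.
have sn : `|s| = l by rewrite normrZ cnorm_adjM b1 expr1n mulr1 ger0_norm.
have l21 : l ^+ 2 <= 1 by rewrite l2 invf_le1 // lerDl.
(* Cauchy-Schwarz splits the two factors [b] of one [s], so that the hypothesis is used twice and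
   produces m^4. *)
have sb x c : ev x ((s ** c)^# ** (s ** c)) <= l ^+ 2 * m ^+ 4 * ev x (c^# ** c).
  set P := ev x _; set C := ev x _.
  have pf := expect_pos hs x; have P0 : 0 <= P := pf.2 _; have C0 : 0 <= C := pf.2 _.
  have e : P = l * ev x ((b ** (s ** c))^# ** (b ** c)).
    rewrite -(pfZ pf); congr (ev x _); rewrite (cadjM b) -cmulA (cmulA b^#) -cmulZr.
    by congr (_ ** _); rewrite {1}/s cmulZl.
  have [->|Pn0] := eqVneq P 0; first by rewrite !mulr_ge0 ?exprn_ge0.
  have Pp : 0 < P by rewrite lt_def Pn0.
  rewrite -(ler_pM2r Pp) -expr2 -[P ^+ 2]ger0_norm ?exprn_ge0 // normrX {1}e.
  rewrite normrM exprMn (ger0_norm l0) -[leRHS]mulrA -[leRHS]mulrA.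
  apply: ler_wpM2l; first by rewrite exprn_ge0.
  apply: le_trans (cauchy_schwarz pf _ _) _.
  have -> : m ^+ 4 * (C * P) = (m ^+ 2 * P) * (m ^+ 2 * C) by ring.
  by apply: ler_pM; rewrite ?pf.2 ?hb.
have ssn : `|s ** s| <= 1 by rewrite -{1}ss cnorm_adjM sn.
have [w [ws _ wE wC]] := sqrt_exists (etrans (cadjM s s) (congr2 cmul ss ss)) ssn.
have sw : s ** w = w ** s by apply: wC; rewrite cmulA.
have [vv va] := double_angle sw wE.
set a := s ** s + s ** s in vv va; set v := _ + _ in vv va.
have as' : a^# = a by rewrite cadjD cadjM ss.
have vs : v^# = v by rewrite cadjD cadjB cadjM ss ws -sw.
have v1 : `|v| <= 1.
  by apply: norm_le1 => u; have [] := isom_pair u vs as' va vv.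
have ys : (v ** v)^# = v ** v by rewrite cadjM vs.
have y1 : `|v ** v| <= 1 by rewrite -{1}vs cnorm_adjM expr_le1.
have [w' [ws' w1' wE' wC']] := sqrt_exists ys y1.
have aw : a ** w' = w' ** a by apply: wC'; rewrite cmulA -va -!cmulA va.
pose g := a - w'.
have gs : g^# = g by rewrite cadjB as' ws'.
(* In the unitization this is (k + |k|) g = 0. As w' is a contraction, it leaves E(g^# a g) at least
   E(g^# g), while [sb] makes it smaller unless E(g^# g) = 0. *)
have ag : a ** g + w' ** g = g + g.
  rewrite !cmulBr aw addrA subrK; apply/eqP; rewrite -subr_eq0.
  have := wE'; rewrite vv => /eqP; rewrite -subr_eq0 => /eqP e.
  by apply/eqP; rewrite -{}e /g; module.
have g0 : g = 0.
  apply: (expect_faithful hs) => x; have pf := expect_pos hs x.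
  set G := ev x _; have G0 : 0 <= G := pf.2 _.
  have ea : ev x (g^# ** a ** g) = 2 * ev x ((s ** g)^# ** (s ** g)).
    rewrite mulr2n mulrDl !mul1r -(pfD pf); congr (ev x _).
    by rewrite /a; move: (g) => t; rewrite cadjM ss !cmulDr cmulDl !cmulA.
  have ew : `|ev x (g^# ** w' ** g)| <= G.
    by apply: le_trans (pf_conj_le pf _ _) _; rewrite ler_piMl.
  have eg : ev x (g^# ** a ** g) + ev x (g^# ** w' ** g) = G + G.
    by rewrite -(pfD pf) -!cmulA -cmulDr ag cmulDr (pfD pf).
  have wr : ev x (g^# ** w' ** g) \is Num.real.
    have -> : ev x (g^# ** w' ** g) = G + G - ev x (g^# ** a ** g) by rewrite -eg addrC addKr.
    by rewrite rpredB ?rpredD ?ger0_real // ea mulr_ge0 ?pf.2.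
  have wG := le_trans (real_ler_norm wr) ew.
  have aG : G <= ev x (g^# ** a ** g).
    by rewrite -(lerD2r G) -eg lerD2l.
  have q1 : 2 * (l ^+ 2 * m ^+ 4) < 1.
    by rewrite l2 mulrCA mulrC ltr_pdivrMr // mul1r mulr2n mulrDl mul1r ltrD2r.
  apply/eqP; rewrite eq_le G0 andbT -(pmulr_rle0 _ (_ : 0 < 1 - 2 * (l ^+ 2 * m ^+ 4))) ?subr_gt0 //.
  rewrite mulrBl mul1r subr_le0; apply: le_trans aG _.
  by rewrite ea -mulrA ler_pM2l ?sb // ltr0n.
have := w1'; have -> : w' = a by apply/eqP; rewrite eq_sym -subr_eq0 -/g g0.
have -> : `|a| = 2 * l ^+ 2.
  have -> : a = (2 : Cplx R) *: (s^# ** s) by rewrite ss scaler_nat mulr2n.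
  by rewrite normrZ normr_nat cnorm_adjM sn.
by rewrite l2 ler_pdivrMr // mul1r mulr2n lerD2l => /le_lt_trans/(_ m41); rewrite ltxx.
Qed.

(** In other words, the direct sum of the GNS representations of the states E(.)(x) is isometric.
    This is where faithfulness of [E] enters the norm of [B]. *)
Lemma expect_norm_le b (M : Cplx R) : 0 <= M ->
  (forall x c, ev x ((b ** c)^# ** (b ** c)) <= M ^+ 2 * ev x (c^# ** c)) -> `|b| <= M.
Proof.
move=> M0 hb; rewrite real_leNgt ?ger0_real //; apply/negP => Mb.
have b0 : 0 < `|b| := le_lt_trans M0 Mb.
apply: (@expect_contraction (`|b|^-1 *: b) (M / `|b|)).
- by rewrite normrZ normfV normr_id mulVf ?gt_eqF.
- by rewrite divr_ge0 //= ltr_pdivrMr // mul1r.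
- move=> x c; rewrite cmulZl cadjZ cmulZl cmulZr scalerA.
  have pf := expect_pos hs x; rewrite (pfZ pf) geC0_conj ?invr_ge0 //.
  have -> : (M / `|b|) ^+ 2 * ev x (c^# ** c) = `|b|^-1 * `|b|^-1 * (M ^+ 2 * ev x (c^# ** c)).
    by rewrite expr2 expr2; ring.
  by rewrite ler_pM2l ?mulr_gt0 ?invr_gt0.
Qed.

End IsometricCriterion.

(** * Twists of etale groupoids *)

Section GroupoidAlgebra.
Context (X : topologicalType) (G : topGroupoid X).
Implicit Types (a b c : G) (x : X).

Lemma gmulKl a b : gsrc a = grng b -> gmul (ginv a) (gmul a b) = b.
Proof. by move=> ab; rewrite gmulA ?gsrcV // gVmul ab g1mul. Qed.

Lemma gmulVKl a b : grng a = grng b -> gmul a (gmul (ginv a) b) = b.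
Proof. by move=> ab; rewrite gmulA ?grngV ?gsrcV // gmulV ab g1mul. Qed.

Lemma gmulVKr a b : gsrc a = gsrc b -> gmul (gmul a (ginv b)) b = a.
Proof. by move=> ab; rewrite -gmulA ?grngV ?gsrcV // gVmul -ab gmul1. Qed.

Lemma ginv_unique a b : gsrc a = grng b -> gmul a b = gunit G (grng a) -> b = ginv a.
Proof. by move=> ab e; rewrite -(gmulKl ab) e -{2}(gmul1 (ginv a)) gsrcV. Qed.

Lemma ginvK a : ginv (ginv a) = a.
Proof. by symmetry; apply: ginv_unique; rewrite ?gsrcV // gVmul grngV. Qed.

Lemma ginv1 x : ginv (gunit G x) = gunit G x.
Proof.
symmetry; apply: ginv_unique; rewrite ?gsrc1 ?grng1 //.
by rewrite -{2}(gsrc1 G x) gmul1.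
Qed.

Lemma gidempotent a : gsrc a = grng a -> gmul a a = a -> a = gunit G (gsrc a).
Proof. by move=> e aa; rewrite -(gVmul a) -{3}aa gmulKl. Qed.

End GroupoidAlgebra.

Section CircleFacts.
Context (R : realType).
Implicit Types (z w : Cplx R).

Lemma circle1 : circle (1 : Cplx R).
Proof. by rewrite /circle /= normr1. Qed.

Lemma circle_conj z : circle z -> circle z^*.
Proof. by rewrite /circle /= norm_conjC. Qed.

Lemma circle_conjK z : circle z -> z * z^* = 1.
Proof. by rewrite /circle /= => z1; rewrite -normCK z1 expr1n. Qed.

End CircleFacts.

(** * The circle action and convolution sums *)

Section TwistAlgebra.
Context (R : realType) (X : topologicalType) (H : topGroupoid X) (S : twist R H).
Implicit Types (s t r : S) (h k : H) (x y : X) (z w : Cplx R) (f g : S -> Cplx R).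

Local Notation p := (@tproj R X H S).

Definition tact z s : S := gmul (tincl S (grng s) z) s.

Lemma tact_comp z s : circle z -> gsrc (tincl S (grng s) z) = grng s.
Proof. exact: tincl_src. Qed.

Lemma tact_src z s : circle z -> gsrc (tact z s) = gsrc s.
Proof. by move=> z1; rewrite gsrcM // tact_comp. Qed.

Lemma tact_rng z s : circle z -> grng (tact z s) = grng s.
Proof. by move=> z1; rewrite grngM ?tact_comp // tincl_rng. Qed.

Lemma tincl1 x : tincl S x 1 = gunit S x.
Proof.
have c1 := circle1 R; rewrite -{2}(tincl_src S x c1); apply: gidempotent.
  by rewrite tincl_src // tincl_rng.
by rewrite -tinclM // mulr1.
Qed.

Lemma tact1 s : tact 1 s = s.
Proof. by rewrite /tact tincl1 g1mul. Qed.

Lemma tactM z w s : circle z -> circle w -> tact z (tact w s) = tact (z * w) s.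
Proof.
move=> z1 w1; rewrite {1}/tact tact_rng // /tact tinclM // gmulA //.
  by rewrite tincl_src // tincl_rng.
by rewrite tincl_src.
Qed.

Lemma tincl_act x z : circle z -> tincl S x z = tact z (gunit S x).
Proof. by move=> z1; rewrite /tact grng1 -{3}(tincl_src S x z1) gmul1. Qed.

Lemma tproj_incl x z : circle z -> p (tincl S x z) = gunit H x.
Proof. by move=> z1; apply/twist_exact; exists z. Qed.

Lemma tproj_unit x : p (gunit S x) = gunit H x.
Proof. by rewrite -tincl1; apply: tproj_incl; exact: circle1. Qed.

Lemma tproj_act z s : circle z -> p (tact z s) = p s.
Proof.
by move=> z1; rewrite tprojM ?tact_comp // tproj_incl // -tproj_rng g1mul.
Qed.

Lemma tprojV s : p (ginv s) = ginv (p s).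
Proof.
apply: ginv_unique; first by rewrite tproj_src tproj_rng grngV.
by rewrite -tprojM ?grngV // gmulV tproj_unit tproj_rng.
Qed.

Lemma tproj_eq_src s t : p s = p t -> gsrc s = gsrc t.
Proof. by move=> e; rewrite -tproj_src e tproj_src. Qed.

Lemma tproj_eq_rng s t : p s = p t -> grng s = grng t.
Proof. by move=> e; rewrite -tproj_rng e tproj_rng. Qed.

Lemma tfiber s t : p s = p t -> exists2 z, circle z & s = tact z t.
Proof.
move=> e; have es := tproj_eq_src e; have er := tproj_eq_rng e.
have : p (gmul s (ginv t)) = gunit H (grng t).
  by rewrite tprojM ?grngV // tprojV e gmulV tproj_rng.
move=> /twist_exact[z z1 zE]; exists z => //.
by rewrite /tact -zE gmulVKr.
Qed.

Lemma tlift_proj h : p (tlift S h) = h.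
Proof. exact: projT2 (cid (tproj_surj S h)). Qed.

Lemma tlift_src h : gsrc (tlift S h) = gsrc h.
Proof. by rewrite -{2}(tlift_proj h) tproj_src. Qed.

Lemma tlift_rng h : grng (tlift S h) = grng h.
Proof. by rewrite -{2}(tlift_proj h) tproj_rng. Qed.

Lemma tact_mul_l z s t : circle z -> gsrc s = grng t -> gmul (tact z s) t = tact z (gmul s t).
Proof. by move=> z1 st; rewrite /tact grngM // gmulA // tincl_src. Qed.

Lemma tact_mul_r z s t : circle z -> gsrc s = grng t -> gmul s (tact z t) = tact z (gmul s t).
Proof.
move=> z1 st; rewrite /tact grngM // gmulA ?tincl_rng ?tincl_src // -st -twist_central //.
by rewrite gmulA ?tincl_src.
Qed.

Lemma tact_inv z s : circle z -> ginv (tact z s) = tact z^* (ginv s).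
Proof.
move=> z1; have c1 := circle_conj z1; symmetry; apply: ginv_unique.
  by rewrite tact_src // tact_rng // grngV.
rewrite tact_mul_r ?tact_src ?grngV // tact_mul_l ?grngV // tactM // mulrC circle_conjK //.
by rewrite tact1 gmulV tact_rng.
Qed.

Lemma equivariant_act f z s : equivariant f -> circle z -> f (tact z s) = z * f s.
Proof. by move=> fe z1; exact: fe. Qed.

Lemma equivariant_norm f s t : equivariant f -> p s = p t -> `|f s| = `|f t|.
Proof.
by move=> fe /tfiber[z z1 ->]; rewrite (equivariant_act _ fe z1) normrM z1 mul1r.
Qed.

Lemma equivariant_eq0 f s t : equivariant f -> p s = p t -> f s = 0 -> f t = 0.
Proof.
by move=> fe /(equivariant_norm fe) e s0; apply/eqP; rewrite -normr_eq0 -e s0 normr0.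
Qed.

(** A change of lift multiplies the value of [f] by a phase and that of [g] by its conjugate; so
    [tconv] does not depend on the choice in [tlift]. *)
Lemma tconv_term f g s t r : equivariant f -> equivariant g -> p t = p r -> grng r = grng s ->
  f t * g (gmul (ginv t) s) = f r * g (gmul (ginv r) s).
Proof.
move=> fe ge /tfiber[z z1 ->] rs; have c1 := circle_conj z1.
rewrite tact_inv // tact_mul_l ?gsrcV // !(equivariant_act _ _ z1) // (equivariant_act _ ge c1).
by rewrite mulrACA circle_conjK // mul1r.
Qed.

Lemma tconv_zero f g s :
  (forall t, grng t = grng s -> f t * g (gmul (ginv t) s) = 0) -> tconv f g s = 0.
Proof. by move=> t0; apply: fsbig1 => h /= hs; apply: t0; rewrite tlift_rng. Qed.

Lemma tconv_single f g s r : equivariant f -> equivariant g -> grng r = grng s ->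
  (forall t, grng t = grng s -> f t * g (gmul (ginv t) s) != 0 -> p t = p r) ->
  tconv f g s = f r * g (gmul (ginv r) s).
Proof.
move=> fe ge rs one; rewrite /tconv.
have -> : f r * g (gmul (ginv r) s) =
    f (tlift S (p r)) * g (gmul (ginv (tlift S (p r))) s).
  by symmetry; apply: tconv_term => //; rewrite tlift_proj.
set F := fun h => f (tlift S h) * g (gmul (ginv (tlift S h)) s).
rewrite -[RHS]/(F (p r)) -[RHS](fsbig_set1 +%R (p r) F).
apply/esym/fsbig_widen; first by move=> h ->; rewrite /= tproj_rng.
move=> h [/= hs hr]; apply/eqP; apply: contrapT => /negP n0; apply: hr.
by have := one (tlift S h); rewrite tlift_proj; apply => //; rewrite tlift_rng.
Qed.

End TwistAlgebra.

(** * Open maps and slices *)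

Lemma local_homeomorphism_open (T U : topologicalType) (r : T -> U) :
  local_homeomorphism r -> forall W, open W -> open (r @` W).
Proof.
move=> lr W oW; rewrite openE => _ [h Wh <-].
have [V [oV Vh orV _ [g [gc gK]]]] := lr h.
have g_h : g @ within (r @` V) (nbhs (r h)) --> g (r h).
  by move/subspace_continuousP: gc; apply; exists h.
rewrite gK // in g_h.
have WVh : nbhs h (W `&` V) by apply: open_nbhs_nbhs; split; [exact: openI|].
have rVh : nbhs (r h) (r @` V) by apply: open_nbhs_nbhs; split => //; exists h.
have gW : nbhs (r h) [set y | (r @` V) y -> (W `&` V) (g y)] := g_h _ WVh.
apply: (filterS _ (filterI gW rVh)) => y [gy yV].
have [k Vk ky] := yV; have [Wg Vg] := gy yV.
by exists (g y) => //; rewrite -ky gK.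
Qed.

Section Slices.
Context (T U : topologicalType) (r : T -> U) (V : set T).
Context (rc : continuous r) (ro : forall W, open W -> open (r @` W)) (oV : open V).
Context (rV : forall h k, V h -> V k -> r h = r k -> h = k).
Implicit Types (h k : T) (x y : U).

(** Openness of [r] is continuity of its inverse on the slice [V]. The point [h0] is the default
    value off the image of [V]. *)
Lemma slice_section h0 : exists g : U -> T,
  forall x, (r @` V) x -> [/\ V (g x), r (g x) = x & g @ x --> g x].
Proof.
have ex x : exists h, (r @` V) x -> V h /\ r h = x.
  by have [[h Vh rx]|nV] := pselect ((r @` V) x); [exists h|exists h0].
have [g gP] := choice ex; exists g => x Vx; have [Vg rg] := gP x Vx; split=> // N Ng.
have : nbhs (g x) (N^° `&` V).
  by apply: filterI; [exact: nbhs_interior|exact: open_nbhs_nbhs].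
move=> NV; have oNV : open (N^° `&` V) by apply: openI; [exact: open_interior|].
have : nbhs x (r @` (N^° `&` V)).
  apply: open_nbhs_nbhs; split; first exact: ro.
  by exists (g x) => //; exact: nbhs_singleton NV.
apply: filterS => y [h [Nh Vh] <-] /=.
have [Vgh rgh] := gP (r h) (ex_intro2 _ _ h Vh erefl).
by rewrite (rV Vgh Vh rgh); exact: interior_subset Nh.
Qed.

(** The function is transported to [V] and extended by 0. Off [V] it is continuous because the
    compact set [L] is closed in the Hausdorff space [T]. *)
Lemma slice_fun (R : realType) (u : U -> Cplx R) (K : set U) : hausdorff_space T ->
  continuous u -> compact K -> (forall x, ~ K x -> u x = 0) -> K `<=` r @` V ->
  exists q : T -> Cplx R, exists L : set T,
    [/\ continuous q, compact L, L `<=` V, forall h, ~ L h -> q h = 0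
      & forall h, V h -> q h = u (r h)].
Proof.
move=> hT uc Kc Ku KV.
have [[h0 Vh0]|V0] := pselect (exists h, V h); last first.
  exists (fun=> 0), set0; split => //; first by move=> h; exact: cvg_cst.
    exact: compact0.
  by move=> h Vh; case: V0; exists h.
have [g gP] := slice_section h0.
pose L := g @` K.
have Lc : compact L.
  apply: continuous_compact Kc; apply/subspace_continuousP => x /KV /gP[_ _ gc].
  exact: cvg_within_filter.
have LV : L `<=` V by move=> _ [x /KV /gP[Vg _ _] <-].
have Lout h : ~ L h -> V h -> u (r h) = 0.
  move=> Lh Vh; apply: Ku => Kr; apply: Lh; exists (r h) => //.
  by have [Vg rg _] := gP _ (KV _ Kr); exact: rV.
pose q h := if pselect (V h) then u (r h) else 0.
have qV h : V h -> q h = u (r h) by rewrite /q; case: pselect.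
have qL h : ~ L h -> q h = 0 by rewrite /q; case: pselect => // Vh Lh; exact: Lout.
exists q, L; split => // h; have [Vh|nV] := pselect (V h).
  apply: (@cvg_near_eq _ _ _ _ (u \o r)).
  - by apply: filterS qV _; exact: open_nbhs_nbhs.
  - by rewrite qV //; apply: continuous_comp; [exact: rc|exact: uc].
have Lh : ~ L h by move=> /LV.
apply: (@cvg_near_eq _ _ _ _ (fun=> 0)).
- have : nbhs h (~` L).
    by apply: open_nbhs_nbhs; split => //; apply: closed_openC; exact: compact_closed.
  by apply: filterS => k; exact: qL.
- by rewrite qL //; exact: cvg_cst.
Qed.

End Slices.

Lemma gmul_cvg (X : topologicalType) (G : topGroupoid X) (T : Type) (F : set_system T)
    (FF : Filter F) (u v : T -> G) (a b : G) :
  gsrc a = grng b -> (\forall t \near F, gsrc (u t) = grng (v t)) ->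
  u @ F --> a -> v @ F --> b -> (fun t => gmul (u t) (v t)) @ F --> gmul a b.
Proof.
move=> ab nuv ua vb.
have mc : (fun q : G * G => gmul q.1 q.2) @ within [set q | gsrc q.1 = grng q.2] (nbhs (a, b))
    --> gmul a b.
  by move/subspace_continuousP: (@gmul_continuous X G) => /(_ (a, b)); apply.
have uv : (fun t => (u t, v t)) @ F --> within [set q | gsrc q.1 = grng q.2] (nbhs (a, b)).
  have ruv : (fun t => (u t, v t)) @ F --> (a, b) by exact: cvg_pair.
  move=> W WW; have W' : F [set t | gsrc (u t) = grng (v t) -> W (u t, v t)] := ruv _ WW.
  by apply: (filterS _ (filterI W' nuv)) => t [Wt ct]; exact: Wt.
exact: (cvg_comp _ (fun q : G * G => gmul q.1 q.2) uv mc).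
Qed.

(** * The topology of a twist and compactly supported sections *)

Section TwistTopology.
Context (R : realType) (X : topologicalType) (H : topGroupoid X) (S : twist R H).
Implicit Types (s t r : S) (h k : H) (x y : X) (z w : Cplx R) (f g : S -> Cplx R).

Local Notation p := (@tproj R X H S).

Lemma local_section s0 : exists (U : set H) (sig : H -> S),
  [/\ open U, U (p s0), sig (p s0) = s0 & forall h, U h -> p (sig h) = h /\ sig @ h --> sig h].
Proof.
have [U [phi [psi [[oU Us0] _ psic tr inv]]]] := twist_locally_trivial S (p s0).
have [c0 e0 _] := tr _ Us0.
exists U, (fun h => psi h (phi s0)); split => // h Uh.
split; first by have [] := inv h _ Uh c0.
have pc : (fun q : H * Cplx R => psi q.1 q.2) @ within (U `*` @circle R) (nbhs (h, phi s0)) -->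
    psi h (phi s0).
  by move/subspace_continuousP: psic => /(_ (h, phi s0)); apply.
have hc : (fun k : H => (k, phi s0)) @ h --> within (U `*` @circle R) (nbhs (h, phi s0)).
  have hh : (fun k : H => (k, phi s0)) @ h --> (h, phi s0).
    have c : (fun _ : H => phi s0) @ h --> phi s0 by exact: cvg_cst.
    exact: (cvg_pair (@cvg_id _ (nbhs h)) c).
  move=> W WW.
  have W' : nbhs h [set k | (U `*` @circle R) (k, phi s0) -> W (k, phi s0)] := hh _ WW.
  have nU : nbhs h U by exact: open_nbhs_nbhs.
  by apply: (filterS _ (filterI W' nU)) => k [Wk Uk]; exact: Wk.
exact: (cvg_comp _ (fun q : H * Cplx R => psi q.1 q.2) hc pc).
Qed.

Lemma fibre_coordinate s0 : exists (U : set H) (phi : S -> Cplx R),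
  [/\ open U, U (p s0), phi s0 = 1
    & forall s, U (p s) -> [/\ phi @ s --> phi s, circle (phi s)
        & forall z, circle z -> phi (tact z s) = z * phi s]].
Proof.
have [U [phi [psi [[oU Us0] phic _ tr _]]]] := twist_locally_trivial S (p s0).
have [c0 _ _] := tr _ Us0; have c1 := circle_conj c0.
exists U, (fun s => (phi s0)^* * phi s); split=> //; first by rewrite mulrC circle_conjK.
move=> s Us; have [cs _ es] := tr _ Us; split.
- apply: cvgM; first exact: cvg_cst.
  have phis : phi @ within (p @^-1` U) (nbhs s) --> phi s.
    by move/subspace_continuousP: phic; apply.
  have nU : nbhs s (p @^-1` U).
    by apply: (@tproj_continuous _ _ _ S s); exact: open_nbhs_nbhs.
  move=> W WW; have W' : nbhs s [set t | U (p t) -> W (phi t)] := phis _ WW.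
  by apply: (filterS _ (filterI W' nU)) => t [Wt Ut]; exact: Wt.
- by rewrite /circle /= normrM c1 cs mulr1.
- by move=> z z1; rewrite es // mulrCA.
Qed.

Lemma tproj_open (W : set S) : open W -> open (p @` W).
Proof.
move=> oW; rewrite openE => _ [s Ws <-].
have [U [sig [oU Us sigs sigP]]] := local_section s.
have [_ sc] := sigP _ Us; rewrite sigs in sc.
have nU : nbhs (p s) U by exact: open_nbhs_nbhs.
have nW : nbhs s W by exact: open_nbhs_nbhs.
have W' : nbhs (p s) [set h | W (sig h)] := sc _ nW.
by apply: (filterS _ (filterI W' nU)) => h [Wh /sigP[ph _]]; exists (sig h).
Qed.

Definition supported_in f (K : set H) : Prop := forall s, f s != 0 -> K (p s).

Lemma supported_eq0 f K s : supported_in f K -> ~ K (p s) -> f s = 0.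
Proof. by move=> fK Ks; apply/eqP; apply: contrapT => /negP /fK. Qed.

Lemma Cc_support f : Cc_twist f -> exists2 K, compact K & supported_in f K.
Proof.
move=> [_ _ Kc]; exists (p @` closure [set s | f s != 0]) => // s fs.
by exists s => //; exact: subset_closure.
Qed.

Context (hH : hausdorff_space H).

(** [Cc_twist] involves the image in [H] of a closure taken in the twist. As [tproj] is open and the
    nonvanishing set is invariant under the circle, this image is the closure of the image, a closed
    subset of [K]. *)
Lemma Cc_intro f K : continuous f -> equivariant f -> compact K -> supported_in f K -> Cc_twist f.
Proof.
move=> fc fe Kc fK; split => //.
set D := [set s | f s != 0].
have e : p @` closure D = closure (p @` D).
  apply/seteqP; split=> [_ [s Ds <-] N|h hD].
    move=> /(@tproj_continuous _ _ _ S s) /Ds [t [Dt Nt]].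
    by exists (p t); split => //; exists t.
  have [s sh] := tproj_surj S h; exists s => //.
  rewrite closureE => /= N [cN DN]; apply: contrapT => nN.
  have oN : open (~` N) by exact: closed_openC.
  have : nbhs h (p @` (~` N)).
    by apply: open_nbhs_nbhs; split; [exact: tproj_open|exists s].
  move=> /hD[_ [[t Dt <-] [t' Nt' tt']]]; apply: Nt'; apply: DN.
  by apply/negP => /eqP t0; move/eqP: Dt; apply; exact: equivariant_eq0 t0.
have KD : p @` closure D `<=` K.
  rewrite e closureE => h; apply; split; first exact: compact_closed.
  by move=> _ [s Ds <-]; exact: fK.
by apply: (subclosed_compact _ Kc KD); rewrite e; exact: closed_closure.
Qed.

Lemma Cc_scale (u : H -> Cplx R) f : continuous u -> Cc_twist f -> Cc_twist (fun s => u (p s) * f s).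
Proof.
move=> uc Cf; have [fc fe _] := Cf; have [K Kc fK] := Cc_support Cf.
apply: (@Cc_intro _ K).
- move=> s; apply: cvgM; last exact: fc.
  exact: (@continuous_comp _ _ _ p u s (@tproj_continuous _ _ _ S s) (uc _)).
- by move=> z s z1; rewrite (tproj_act s z1) (equivariant_act _ fe z1) mulrCA.
- exact: Kc.
- by move=> s us; apply: fK; apply: contraNneq us => ->; rewrite mulr0.
Qed.

Lemma Cc_0 : Cc_twist (fun _ : S => 0 : Cplx R).
Proof.
apply: (@Cc_intro _ set0); [by move=> s; exact: cvg_cst|by move=> z s _; rewrite mulr0| |].
  exact: compact0.
by move=> s /eqP.
Qed.

Lemma Cc_lin z f g : Cc_twist f -> Cc_twist g -> Cc_twist (fun s => z * f s + g s).
Proof.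
move=> Cf Cg; have [fc fe _] := Cf; have [gc ge _] := Cg.
have [K Kc fK] := Cc_support Cf; have [L Lc gL] := Cc_support Cg.
apply: (@Cc_intro _ (K `|` L)).
- by move=> s; apply: cvgD; [apply: cvgM; [exact: cvg_cst|exact: fc]|exact: gc].
- move=> w s w1; have := equivariant_act s fe w1; have := equivariant_act s ge w1.
  by rewrite /tact => -> ->; rewrite mulrDr mulrCA.
- exact: compactU.
- move=> s n0; apply: contrapT => /not_orP[Ks Ls]; move/eqP: n0; apply.
  by rewrite (supported_eq0 fK Ks) (supported_eq0 gL Ls) mulr0 addr0.
Qed.

Lemma Cc_conj_star f : Cc_twist f -> Cc_twist (tstar f).
Proof.
move=> Cf; have [fc fe _] := Cf; have [K Kc fK] := Cc_support Cf.
apply: (@Cc_intro _ (@ginv X H @` K)).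
- move=> s; apply: (@continuous_comp _ _ _ (f \o @ginv X S) (fun w : Cplx R => w^*)).
    by apply: continuous_comp; [exact: ginv_continuous|exact: fc].
  exact: conj_continuous.
- move=> z s z1; rewrite /tstar -/(tact z s) tact_inv // (equivariant_act _ fe (circle_conj z1)).
  by rewrite rmorphM /= conjCK.
- apply: continuous_compact Kc; apply: continuous_subspaceT => h.
  exact: ginv_continuous.
- move=> s; rewrite /tstar conjC_eq0 => /fK; rewrite tprojV => Ks.
  by exists (ginv (p s)) => //; rewrite ginvK.
Qed.

End TwistTopology.

Lemma closed_equalizer (T U : topologicalType) (f g : T -> U) : hausdorff_space U ->
  continuous f -> continuous g -> closed [set t | f t = g t].
Proof.
move=> hU fc gc t cl; apply: hU => P Q Pf Qg.
have : nbhs t ((f @^-1` P) `&` (g @^-1` Q)) by apply: filterI; [exact: fc|exact: gc].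
by move=> /cl[u [/= e [Pu Qu]]]; exists (f u); split => //; rewrite e.
Qed.

(** * Bisections and localisation *)

Section Bisections.
Context (R : realType) (X : topologicalType) (H : topGroupoid X) (S : twist R H).
Context (hXc : locally_compact [set: X]) (hX : hausdorff_space X).
Context (hH : hausdorff_space H) (he : etale H).
Implicit Types (s t r : S) (h k : H) (x y : X) (z w : Cplx R) (f g : S -> Cplx R).
Implicit Types (V W : set H).

Local Notation p := (@tproj R X H S).

Definition bisection V : Prop :=
  [/\ open V, forall h k, V h -> V k -> gsrc h = gsrc k -> h = k
    & forall h k, V h -> V k -> grng h = grng k -> h = k].

Lemma bisection_at h W : open W -> W h -> exists V, [/\ bisection V, V h & V `<=` W].
Proof.
move=> oW Wh; have [V [oV Vh _ _ [g [_ gK]]]] := he.1 h.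
have [V' [oV' V'h _ _ [g' [_ g'K]]]] := he.2 h.
exists (W `&` (V `&` V')); split; last by move=> k [].
- split; first by apply: openI => //; exact: openI.
    by move=> k l [_ [_ V'k]] [_ [_ V'l]] e; rewrite -(g'K k) // e g'K.
  by move=> k l [_ [Vk _]] [_ [Vl _]] e; rewrite -(gK k) // e gK.
- by split.
Qed.

(** Bumps on [H] come from [X]: a bump on the source of a bisection is lifted along the inverse of
    the source map. *)
Lemma bump_on h W : open W -> W h -> exists u : H -> Cplx R, exists L V : set H,
  [/\ continuous u, compact L /\ L `<=` V, bisection V /\ V `<=` W,
      forall k, ~ L k -> u k = 0 & \forall k \near h, u k = 1].
Proof.
move=> oW Wh; have [V [bV Vh VW]] := bisection_at oW Wh; have [oV Vs _] := bV.
have so : open (@gsrc X H @` V) by exact: local_homeomorphism_open he.2 _ oV.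
have [v [K [[vc _] Kc KV vK [_ v1]]]] :=
  C0_bump R hXc hX so (ex_intro2 _ _ h Vh erefl : (@gsrc X H @` V) (gsrc h)).
have [u [L [uc Lc LV uL uV]]] := slice_fun (@gsrc_continuous X H)
  (local_homeomorphism_open he.2) oV Vs hH vc Kc vK KV.
exists u, L, V; split => //.
have nV : nbhs h V by exact: open_nbhs_nbhs.
have n1 : nbhs h [set k | v (gsrc k) = 1] := @gsrc_continuous X H h _ v1.
by apply: (filterS _ (filterI n1 nV)) => k [k1 Vk]; rewrite uV.
Qed.

(** Replaces a partition of unity: an additive property that holds for functions supported in
    suitable neighbourhoods of all points holds on [Cc_twist]. *)
Lemma Cc_ind (P : (S -> Cplx R) -> Prop) : P (fun=> 0) ->
  (forall f g, Cc_twist f -> Cc_twist g -> P f -> P g -> P (fun s => f s + g s)) ->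
  (forall h, exists W, [/\ open W, W h & forall f K, Cc_twist f -> compact K -> K `<=` W ->
     supported_in f K -> P f]) ->
  forall f, Cc_twist f -> P f.
Proof.
move=> P0 PD Ploc.
have ex h : exists u : H -> Cplx R, exists O : set H, [/\ continuous u, nbhs h O,
    forall k, O k -> u k = 1 & forall f, Cc_twist f -> P (fun s => u (p s) * f s)].
  have [W [oW Wh PW]] := Ploc h.
  have [u [L [V [uc [Lc LV] [_ VW] uL u1]]]] := bump_on oW Wh.
  exists u, [set k | u k = 1]; split => // f Cf; apply: (PW _ L) => //.
  - exact: Cc_scale.
  - exact: subset_trans LV VW.
  - move=> s n0; apply: contrapT => /uL us; move/eqP: n0; apply.
    by rewrite us mul0r.
have [u uP] := choice ex; have [N NP] := choice uP.
(* Induction on the length of a cover of the support: u_h f is local, and (1 - u_h) f vanishes over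
   [N h], so the cover loses one member. *)
have cover (l : seq H) : forall f, Cc_twist f ->
    (forall s, f s != 0 -> exists2 h, h \in l & N h (p s)) -> P f.
  elim: l => [f _ fl|h l IH f Cf fl].
    have -> : f = fun=> 0; last by [].
    by apply/funext => s; apply/eqP; apply: contrapT => /negP /fl[].
  have [uc _ u1 Pu] := NP h.
  have vc : continuous (fun k => 1 - u h k).
    by move=> k; apply: cvgB; [exact: cvg_cst|exact: uc].
  have -> : f = fun s => u h (p s) * f s + (1 - u h (p s)) * f s.
    by apply/funext => s; rewrite -mulrDl addrC subrK mul1r.
  apply: PD; [exact: Cc_scale|exact: (Cc_scale hH vc)|exact: Pu|].
  apply: IH; first exact: (Cc_scale hH vc).
  move=> s n0; have fs : f s != 0 by apply: contraNneq n0 => ->; rewrite mulr0.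
  have [k] := fl s fs; rewrite inE => /orP[/eqP -> /u1 e|]; last by exists k.
  by move/eqP: n0; rewrite e subrr mul0r.
move=> f Cf; have [K Kc fK] := Cc_support Cf.
have On k : K k -> nbhs k (N k) by have [_ ? _ _] := NP k.
have [l _ lK] := compact_cover_seq Kc On.
by apply: (cover l) => // s /fK /lK.
Qed.

Lemma Cc_bump (s0 : S) W : open W -> W (p s0) -> exists f, exists K V : set H,
  [/\ Cc_twist f, f s0 = 1, supported_in f K, compact K /\ K `<=` V & bisection V /\ V `<=` W].
Proof.
move=> oW Ws; have [U [phi [oU Us phi1 phiP]]] := fibre_coordinate s0.
have [u [L [V [uc [Lc LV] [bV VW] uL u1]]]] := bump_on (openI oU oW) (conj Us Ws).
have LU h : L h -> U h by move=> /LV /VW [].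
pose f s := u (p s) * phi s.
have f0 s : ~ L (p s) -> f s = 0 by move=> /uL us; rewrite /f us mul0r.
exists f, L, V.
have fL : supported_in f L.
  by move=> s; apply: contraNP => /f0 ->.
split => //; last by split => // h /VW[].
- apply: (@Cc_intro _ _ _ _ hH f L) => //.
  + move=> s; have [Ls|nL] := pselect (L (p s)).
      apply: cvgM; last by have [] := phiP s (LU _ Ls).
      exact: (@continuous_comp _ _ _ p u s (@tproj_continuous _ _ _ S s) (uc _)).
    apply: (@cvg_near_eq _ _ _ _ (fun=> 0)).
      have oL : open (~` L) by apply: closed_openC; exact: compact_closed.
      have nL' : nbhs s (p @^-1` (~` L)).
        by apply: (@tproj_continuous _ _ _ S s); exact: open_nbhs_nbhs.
      by apply: (filterS _ nL') => t /f0.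
    by rewrite (f0 _ nL); exact: cvg_cst.
  + move=> z s z1; rewrite -/(tact z s).
    have [Ls|nL] := pselect (L (p s)).
      by have [_ _ e] := phiP s (LU _ Ls); rewrite /f tproj_act // e // mulrCA.
    by rewrite !f0 ?mulr0 // tproj_act.
- by rewrite /f phi1 mulr1; exact: nbhs_singleton u1.
Qed.

Lemma tconv_bisection f g V s t : equivariant f -> equivariant g ->
  supported_in f V -> bisection V -> V (p t) -> grng t = grng s ->
  tconv f g s = f t * g (gmul (ginv t) s).
Proof.
move=> fe ge fV [_ _ Vr] Vt ts; apply: tconv_single => // r rs n0.
apply: Vr => //; last by rewrite !tproj_rng rs ts.
by apply: fV; apply: contraNneq n0 => ->; rewrite mul0r.
Qed.

Lemma tconv_off f g V s : supported_in f V -> (forall h, V h -> grng h <> grng s) ->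
  tconv f g s = 0.
Proof.
move=> fV nV; apply: tconv_zero => t ts.
by rewrite (supported_eq0 fV) ?mul0r // => /nV; rewrite tproj_rng.
Qed.

(** If the left factor lives on a bisection, at most one term of the sum survives. Continuity
    amounts to choosing its arrow and its lift continuously. *)
Lemma Cc_tconv f g (K V : set H) : Cc_twist f -> Cc_twist g -> supported_in f K ->
  compact K -> K `<=` V -> bisection V -> Cc_twist (tconv f g).
Proof.
move=> Cf Cg fK Kc KV bV; have [oV _ Vr] := bV.
have [fc fe _] := Cf; have [gc ge _] := Cg; have [L Lc gL] := Cc_support Cg.
have fV : supported_in f V by move=> s /fK /KV.
have ro := local_homeomorphism_open he.1.
have single := tconv_bisection fe ge fV bV.
have lift h s : V h -> grng h = grng s -> exists t, [/\ p t = h, V (p t) & grng t = grng s].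
  by move=> Vh hs; have [t th] := tproj_surj S h; exists t; rewrite -tproj_rng th.
apply: (@Cc_intro _ _ _ _ hH _
  ((fun q : H * H => gmul q.1 q.2) @` ((K `*` L) `&` [set q | gsrc q.1 = grng q.2]))).
- move=> s; have [[h Vh hs]|nV] := pselect ((@grng X H @` V) (grng s)); last first.
    (* No arrow of [V] has the range of [s]. The ranges of [K] form a closed set, so the convolution
       vanishes on a neighbourhood of [s]. *)
    have cK : closed (@grng X H @` K).
      apply: compact_closed => //; apply: continuous_compact Kc.
      by apply: continuous_subspaceT; exact: grng_continuous.
    have nK : nbhs s [set t | ~ (@grng X H @` K) (grng t)].
      have n' : nbhs (grng s) (~` (@grng X H @` K)).
        apply: open_nbhs_nbhs; split; first exact: closed_openC.
        by move=> [k /KV Vk ks]; apply: nV; exists k.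
      exact: (@grng_continuous X S s _ n').
    have off t : ~ (@grng X H @` K) (grng t) -> tconv f g t = 0.
      by move=> nt; apply: (tconv_off _ fK) => k Kk e; apply: nt; exists k.
    apply: (@cvg_near_eq _ _ _ _ (fun=> 0)); first by apply: (filterS _ nK) => t /off.
    rewrite off; first exact: cvg_cst.
    by move=> [k /KV Vk ks]; apply: nV; exists k.
  have [sg sgP] := slice_section ro oV Vr h.
  have [Vg rg gcs] := sgP (grng s) (ex_intro2 _ _ h Vh hs).
  have eh : sg (grng s) = h by apply: Vr => //; rewrite rg.
  have [t0 th] := tproj_surj S h.
  have [U [tau [oU Ut tau0 tauP]]] := local_section t0; rewrite th in Ut tau0.
  (* A lift, continuous near [s], of the only arrow of [V] with the same range. *)
  pose tt s' := tau (sg (grng s')).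
  have sgc : (fun s' => sg (grng s')) @ s --> h.
    by rewrite -eh; exact: (cvg_comp _ sg (@grng_continuous X S s) gcs).
  have [_ tauc] := tauP _ Ut.
  have ttc : tt @ s --> tt s.
    by rewrite {2}/tt eh; exact: (cvg_comp _ tau sgc tauc).
  have near : \forall s' \near s, V (p (tt s')) /\ grng (tt s') = grng s'.
    have nV : nbhs s [set s' | (@grng X H @` V) (grng s')].
      have n' : nbhs (grng s) (@grng X H @` V).
        by apply: open_nbhs_nbhs; split; [exact: ro|exists h].
      exact: (@grng_continuous X S s _ n').
    have nU : nbhs s [set s' | U (sg (grng s'))] by apply: (sgc U); exact: open_nbhs_nbhs.
    apply: (filterS _ (filterI nV nU)) => s' [/sgP[Vs' rs' _] /tauP[ps' _]].
    by rewrite /tt ps' -(tproj_rng (tau (sg (grng s')))) ps'.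
  have [Vtt rtt] := nbhs_singleton near.
  apply: (@cvg_near_eq _ _ _ _ (fun s' => f (tt s') * g (gmul (ginv (tt s')) s'))).
    by apply: (filterS _ near) => s' [Vs' rs']; exact: single.
  rewrite (single s (tt s)) //.
  apply: cvgM; first exact: (cvg_comp _ f ttc (fc _)).
  apply: (cvg_comp (fun s' => gmul (ginv (tt s')) s') g _ (gc _)).
  apply: gmul_cvg => //.
  + by rewrite gsrcV.
  + by apply: (filterS _ near) => s' [_ rs']; rewrite gsrcV.
  + exact: (cvg_comp _ (@ginv X S) ttc (@ginv_continuous X S _)).
- move=> z s z1; rewrite -/(tact z s).
  have [[h Vh hs]|nV] := pselect ((@grng X H @` V) (grng s)); last first.
    rewrite !(tconv_off _ fV) ?mulr0 ?tact_rng // => h Vh hs; apply: nV; exists h => //.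
  have [t [_ Vt ts]] := lift h s Vh hs.
  rewrite (single s t) // (single (tact z s) t) ?tact_rng //.
  by rewrite tact_mul_r ?gsrcV // (equivariant_act _ ge z1) mulrCA.
- have cc : closed [set q : H * H | gsrc q.1 = grng q.2].
    apply: (@closed_equalizer _ _ (fun q : H * H => gsrc q.1) (fun q : H * H => grng q.2)) => //.
      move=> q; exact: (cvg_comp fst (@gsrc X H) (@cvg_fst _ _ (nbhs q.1) (nbhs q.2) _)
        (@gsrc_continuous X H _)).
    move=> q; exact: (cvg_comp snd (@grng X H) (@cvg_snd _ _ (nbhs q.1) (nbhs q.2) _)
      (@grng_continuous X H _)).
  apply: continuous_compact; last by apply: compact_closedI => //; exact: compact_setX.
  apply: continuous_subspaceW (@gmul_continuous X H).
  by move=> q [].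
- move=> s n0; have [[h Vh hs]|nV] := pselect ((@grng X H @` V) (grng s)); last first.
    by move/eqP: n0; case; apply: (tconv_off _ fV) => h Vh hs; apply: nV; exists h.
  have [t [_ Vt ts]] := lift h s Vh hs.
  move: n0; rewrite (single s t) // mulf_eq0 negb_or => /andP[/fK Kt /gL Lt].
  exists (p t, p (gmul (ginv t) s)) => /=.
    by split => //=; rewrite tproj_src tproj_rng grngM ?gsrcV // grngV.
  by rewrite -tprojM ?grngM ?gsrcV ?grngV // gmulVKl.
Qed.

End Bisections.

Lemma closure_binary (T : topologicalType) (F : T -> T -> T) (D : set T) (a b : T) :
  (forall c d, D c -> D d -> D (F c d)) ->
  (fun q : T * T => F q.1 q.2) @ (a, b) --> F a b ->
  closure D a -> closure D b -> closure D (F a b).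
Proof.
move=> FD Fc Da Db N /Fc [[N1 N2] /= [/Da[c [Dc Nc]] /Db[d [Dd Nd]]] NN].
by exists (F c d); split; [exact: FD|exact: (NN (c, d))].
Qed.

(** * The reduced algebra of the canonical twist *)

Section NormaliserDense.
Context (R : realType) (X : topologicalType) (B : cstarAlgType R).
Context (iota : (X -> Cplx R) -> B) (E : B -> B) (hs : faithful_inclusion iota E).
Implicit Types (a b c n m : B) (z : Cplx R).

Local Notation A := (C0_image iota).
Local Notation N := (lspan (normaliser A)).

Lemma lspan_normaliser_mul a b : N a -> N b -> N (a ** b).
Proof.
move=> Na Nb; have nb n : normaliser A n -> N (n ** b).
  move=> nn; move: b Nb; apply: lspan_ind => [|w m b nm IH]; first by rewrite cmul0r; exact: lspan0.
  rewrite cmulDr cmulZr; apply: lspan_lin => //; apply: lspan_sub.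
  exact: normaliser_mul.
move: a Na; apply: lspan_ind => [|z n a nn IH]; first by rewrite cmul0l; exact: lspan0.
by rewrite cmulDl cmulZl; apply: lspan_lin => //; exact: nb.
Qed.

Lemma lspan_normaliser_adj a : N a -> N a^#.
Proof.
move: a; apply: lspan_ind => [|z n a nn IH]; first by rewrite cadj0; exact: lspan0.
rewrite cadjD cadjZ; apply: lspan_lin => //; apply: lspan_sub.
exact: normaliser_adj.
Qed.

(** Normalisers are stable under products and adjoints, so the closure of their span is a closed
    star subalgebra, and generation becomes linear density. *)
Lemma normaliser_dense b : closure N b.
Proof.
have [_ gen] := fi_regular hs.
suff -> : closure N = setT by [].
apply: gen; last by move=> n nn; apply: subset_closure; exact: lspan_sub.
have c1 (a c : B) : fst @ (nbhs (a, c)) --> a by exact: cvg_fst.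
have c2 (a c : B) : snd @ (nbhs (a, c)) --> c by exact: cvg_snd.
split.
- exact: closed_closure.
- by apply: subset_closure; exact: lspan0.
- move=> z a c; apply: (closure_binary (F := fun a c => z *: a + c)).
    by move=> ? ?; exact: lspan_lin.
  apply: cvgD; last exact: c2.
  by apply: cvgZ; [exact: cvg_cst|exact: c1].
- move=> a c; apply: (closure_binary (F := cmul)); first exact: lspan_normaliser_mul.
  by apply: cvg_cmul; [exact: c1|exact: c2].
- move=> a Na; apply: (closure_binary (F := fun a c => a^#) _ _ Na Na).
    by move=> ? ? ? _; exact: lspan_normaliser_adj.
  by apply: cvg_cadj; exact: c1.
Qed.

End NormaliserDense.

(** * Elements of B as functions on the canonical twist *)

Section CanonicalConvolution.
Context (R : realType) (X : topologicalType) (B : cstarAlgType R).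
Context (iota : (X -> Cplx R) -> B) (E : B -> B) (hs : faithful_inclusion iota E).
Context (hext : extension_property (C0_image iota)).
Implicit Types (a b c n m : B) (x y : X) (z w : Cplx R).

Local Notation ev := (expect iota E).
Local Notation A := (C0_image iota).
Local Notation G := (germ_groupoid hs hext).
Local Notation H := (orbit_groupoid hs hext).
Local Notation S := (germ_twist hs hext).
Local Notation p := (@tproj R X H S).
Local Notation sec := (germ_section hs hext).
Implicit Types (s t r : G) (h k : H) (f g u : S -> Cplx R).
Let hXc := fi_locally_compact hs.
Let hX := fi_hausdorff hs.
Let hH : hausdorff_space H := orbit_hausdorff hs.
Let he : etale H := orbit_etale hs hext.

Definition hat b : S -> Cplx R := fun s => germ_fun s b.

Lemma equivariant_scale f z s : equivariant f -> circle z -> f (germ_scale z s) = z * f s.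
Proof.
move=> fe z1; rewrite -(fe z (s : S) z1); congr (f _); apply/esym.
exact: germ_incl_l.
Qed.

Lemma hat_equivariant b : equivariant (hat b).
Proof. by move=> z s z1; rewrite /hat germ_incl_l // germ_scale_fun. Qed.

Lemma hat_continuous b : continuous (hat b).
Proof. exact: germ_fun_continuous. Qed.

Lemma hatD b c : hat (b + c) = fun s => hat b s + hat c s.
Proof. by apply/funext => s; exact: germD. Qed.

Lemma hat_lin z b c : hat (z *: b + c) = fun s => z * hat b s + hat c s.
Proof. by apply/funext => s; exact: germ_lin. Qed.

Lemma hat0 : hat 0 = fun=> 0.
Proof. by apply/funext => s; exact: germ0. Qed.

Lemma hat_adj b : hat b^# = tstar (hat b).
Proof.
apply/funext => s; change (germ_fun s b^# = ((germ_fun s b^#)^*)^*).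
by rewrite conjCK.
Qed.

(** Vanishing on all eigenfunctionals gives E(n^# b) = 0 for every normaliser, by density E(b^# b) =
    0, and [E] is faithful. *)
Lemma hat_eq0 b : hat b = (fun=> 0) -> b = 0.
Proof.
move=> b0; have nb n x : normaliser A n -> ev x (n^# ** b) = 0.
  move=> nn; have pf := expect_pos hs x.
  have [n0|n0] := eqVneq (ev x (n^# ** n)) 0.
    by apply: (pf_null_l pf); rewrite cadjK.
  have := congr1 (fun f => f (sec n x)) b0; rewrite /hat germ_section_fun // => /eqP.
  by rewrite mulf_eq0 invr_eq0 sqrtC_eq0 (negbTE n0) => /eqP.
have cb c x : lspan (normaliser A) c -> ev x (c^# ** b) = 0.
  have pf := expect_pos hs x; move: c; apply: lspan_ind => [|z n c nn IH].
    by rewrite cadj0 cmul0l (pf0 pf).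
  by rewrite cadjD cadjZ cmulDl cmulZl (pfD pf) (pfZ pf) nb // IH mulr0 addr0.
apply: (expect_faithful hs) => x; apply: small_eq0 => e e0.
have d0 : 0 < e / (`|b| + 1) by rewrite divr_gt0 // ltr_wpDl.
have [c Nc bc] := (closure_normP _ _).1 (@normaliser_dense _ _ _ _ _ hs b) _ d0.
have pf := expect_pos hs x.
have -> : ev x (b^# ** b) = ev x ((b - c)^# ** b).
  by rewrite cadjB cmulBl (pfB pf) (cb c) // subr0.
apply: le_trans (expect_le hs x _) _; apply: le_trans (cnormM _ _) _.
rewrite norm_cadj; apply: le_trans (ler_wpM2r (normr_ge0 _) (ltW bc)) _.
by rewrite mulrAC ler_pdivrMr ?ltr_wpDl // ler_wpM2l ?(ltW e0) // lerDl.
Qed.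

Lemma hat_inj b c : hat b = hat c -> b = c.
Proof.
move=> bc; apply/eqP; rewrite -subr_eq0; apply/eqP; apply: hat_eq0.
by apply/funext => s; have := congr1 (fun f => f s) bc; rewrite /hat (germB hs) => ->; rewrite subrr.
Qed.

(** The value of [n a] at [s] is s(n) times [a] at the source of [s]. So [a] has to be [f] divided
    by the value at [n], both along the section of [n], and 0 elsewhere. *)
Lemma hat_local f n (K : set H) : normaliser A n -> Cc_twist f -> compact K ->
  K `<=` [set h | orbit_mod h n != 0] -> supported_in f K ->
  exists2 m, normaliser A m & hat m = f.
Proof.
move=> nn Cf Kc Kn fK; have [fc fe _] := Cf.
pose O x := ev x (n^# ** n) != 0.
pose a x := if pselect (O x) then f (sec n x) / sqrtC (ev x (n^# ** n)) else 0.
have aO x : O x -> a x = f (sec n x) / sqrtC (ev x (n^# ** n)).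
  by rewrite /a; case: pselect.
pose L := @gsrc X H @` K.
have Lc : compact L.
  apply: continuous_compact Kc; apply: continuous_subspaceT => h.
  exact: (@gsrc_continuous X H).
have aL x : ~ L x -> a x = 0.
  rewrite /a; case: pselect => // Ox Lx; rewrite (supported_eq0 fK) ?mul0r // => Ks.
  by apply: Lx; exists (p (sec n x)) => //; exact: germ_section_src.
have LO x : L x -> O x.
  move=> [h Kh <-]; have [s sh] := germ_proj_surj hs hext h.
  by have := Kn _ Kh; rewrite -sh /= orbit_modE normr_eq0 => /(germ_sqr_neq0 nn).
have Oo : open O by apply: open_neq0; exact: (expect_continuous hs).
have ac : continuous a.
  move=> x; have [Ox|nO] := pselect (O x).
    have nx : nbhs x O by exact: open_nbhs_nbhs.
    apply: (@cvg_near_eq _ _ _ _ (fun x => f (sec n x) / sqrtC (ev x (n^# ** n)))).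
      by apply: filterS nx => y; exact: aO.
    have sc := @germ_section_continuous _ _ _ _ _ hs hext n x nn Ox.
    have sq : (fun y => germ_fun (sec n y) n) @ x --> germ_fun (sec n x) n.
      exact: (cvg_comp _ _ sc (@germ_fun_continuous _ _ _ _ _ n _)).
    have c1 : (fun y => f (sec n y)) @ x --> f (sec n x).
      exact: (cvg_comp (fun y => sec n y) f sc (fc (sec n x))).
    have c2 : (fun y => (sqrtC (ev y (n^# ** n)))^-1) @ x --> (sqrtC (ev x (n^# ** n)))^-1.
      apply: cvgV; first by rewrite sqrtC_eq0.
      rewrite -(germ_section_normaliser hs hext nn Ox); apply: cvg_near_eq sq.
      by apply: filterS nx => y Oy; rewrite germ_section_normaliser.
    rewrite (aO x Ox); exact: cvgM c1 c2.
  have nL : ~ L x by move=> /LO.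
  have nx : nbhs x (~` L).
    apply: open_nbhs_nbhs; split => //; apply: closed_openC.
    exact: compact_closed.
  apply: (@cvg_near_eq _ _ _ _ (fun=> 0)); first by apply: filterS nx => y; exact: aL.
  rewrite (aL x nL); exact: cvg_cst.
have Ca : C0 a by exact: (C0_compact ac Lc aL).
exists (n ** iota a).
  exact: (normaliser_mul nn (normaliser_A hs (iota_A iota Ca))).
apply/funext => s; rewrite /hat (germ_iota_r hs) //.
have [s0|s0] := eqVneq (germ_fun s n) 0.
  rewrite s0 mul0r (supported_eq0 fK) // => /Kn /=.
  by rewrite orbit_modE s0 normr0 eqxx.
have Os : O (gsrc s) by exact: germ_sqr_neq0 s0.
rewrite aO // (germ_sqr nn s0) sqrCK //.
have ph := germ_phase_circle s0.
have -> : f s = germ_phase n s * f (sec n (gsrc s)).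
  by rewrite -(equivariant_scale _ fe ph) germ_section_phase.
by rewrite /germ_phase mulrA mulrAC.
Qed.

Lemma hat_surj f : Cc_twist f -> exists b, hat b = f.
Proof.
apply: (@Cc_ind _ _ _ S hXc hX hH he (fun f => exists b, hat b = f)) => {f}.
- by exists 0; exact: hat0.
- by move=> f g _ _ [b <-] [c <-]; exists (b + c); exact: hatD.
- move=> h; have [n nn n1] := germ_neq0 (orbit_lift hs hext h).
  exists [set k : H | orbit_mod k n != 0]; split.
  + by apply: open_neq0; exact: orbit_mod_continuous.
  + by rewrite /= (orbit_modL hs hext) n1 normr1 oner_eq0.
  + by move=> f K Cf Kc KW fK; have [m _ <-] := hat_local nn Cf Kc KW fK; exists m.
Qed.

End CanonicalConvolution.

(** * Finiteness of convolution sums *)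

Section ConvolutionFinite.
Context (R : realType) (X : topologicalType) (H : topGroupoid X) (S : twist R H).
Context (hXc : locally_compact [set: X]) (hX : hausdorff_space X).
Context (hH : hausdorff_space H) (he : etale H).
Implicit Types (s t r : S) (h k : H) (x y : X) (f g : S -> Cplx R).

(** A bisection meets each range fibre at most once. The convolution with [f] on the left is
    therefore a genuine finite sum. *)
Lemma Cc_finite f y : Cc_twist f -> finite_set [set h | grng h = y /\ f (tlift S h) != 0].
Proof.
move: f; apply: (@Cc_ind _ _ _ S hXc hX hH he) => [|f g _ _ ff fg|h].
- by apply: (sub_finite_set _ (@finite_set0 H)) => h [_ /eqP].
- have : finite_set ([set h | grng h = y /\ f (tlift S h) != 0] `|`
      [set h | grng h = y /\ g (tlift S h) != 0]) by rewrite finite_setU.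
  apply: sub_finite_set => h /= [hy n0]; apply: contrapT => /not_orP[nf ng].
  move/eqP: n0; apply; have [f0|f0] := eqVneq (f (tlift S h)) 0; last by case: nf.
  by rewrite f0 add0r; apply/eqP; apply: contrapT => /negP g0; apply: ng.
- have [V [[oV Vs Vr] Vh _]] := bisection_at he openT (I : setT h).
  exists V; split => // f K _ _ KV fK.
  have fV k : f (tlift S k) != 0 -> V k by move=> /fK /KV; rewrite tlift_proj.
  have [[k [ky k0]]|none] := pselect (exists k : H, grng k = y /\ f (tlift S k) != 0).
    apply: (sub_finite_set _ (finite_set1 k)) => l [ly /fV l0]; apply: Vr => //.
      exact: fV.
    by rewrite ly ky.
  by apply: (sub_finite_set _ (@finite_set0 H)) => l ?; case: none; exists l.
Qed.

Lemma tconv_finite f g s (D : set H) : [set h | grng h = grng s /\ f (tlift S h) != 0] `<=` D ->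
  D `<=` [set h | grng h = grng s] ->
  tconv f g s = \sum_(h \in D) f (tlift S h) * g (gmul (ginv (tlift S h)) s).
Proof.
move=> fD Ds; apply/esym/fsbig_widen => // h [hs nD] /=.
have [->|f0] := eqVneq (f (tlift S h)) 0; first by rewrite mul0r.
by case: nD; apply: fD.
Qed.

Lemma tconvD f f' g s : Cc_twist f -> Cc_twist f' ->
  tconv (fun t => f t + f' t) g s = tconv f g s + tconv f' g s.
Proof.
move=> Cf Cf'; pose D (f : S -> Cplx R) := [set h | grng h = grng s /\ f (tlift S h) != 0].
have Ds (f0 : S -> Cplx R) : D f0 `<=` [set h | grng h = grng s] by move=> h [].
have Dss : D f `|` D f' `<=` [set h | grng h = grng s] by move=> h [] [].
rewrite !(@tconv_finite _ _ s (D f `|` D f')) //.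
- rewrite -fsbig_split; last by rewrite finite_setU; split; exact: Cc_finite.
  by apply: eq_fsbigr => h _; rewrite mulrDl.
- move=> h [hs n0]; have [f0|f0] := eqVneq (f (tlift S h)) 0; [right|left]; split => //.
  by move: n0; rewrite f0 add0r.
Qed.

End ConvolutionFinite.

(** * Products in B and convolution *)

Section CanonicalProduct.
Context (R : realType) (X : topologicalType) (B : cstarAlgType R).
Context (iota : (X -> Cplx R) -> B) (E : B -> B) (hs : faithful_inclusion iota E).
Context (hext : extension_property (C0_image iota)).
Implicit Types (a b c n m : B) (x y : X) (z w : Cplx R).

Local Notation ev := (expect iota E).
Local Notation A := (C0_image iota).
Local Notation G := (germ_groupoid hs hext).
Local Notation H := (orbit_groupoid hs hext).
Local Notation S := (germ_twist hs hext).
Local Notation hat := (@hat R X B iota E hs hext).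
Implicit Types (s t r : G) (h k : H) (f g u : S -> Cplx R).
Let hXc := fi_locally_compact hs.
Let hX := fi_hausdorff hs.
Let hH : hausdorff_space H := orbit_hausdorff hs.
Let he : etale H := orbit_etale hs hext.

Lemma germ_inv_fun s b : germ_fun (ginv s) b = (germ_fun s b^#)^*.
Proof. by []. Qed.

Lemma germ_src_unique s t m : normaliser A m -> germ_fun s m != 0 -> germ_fun t m != 0 ->
  grng s = grng t -> gsrc s = gsrc t.
Proof.
move=> nm s0 t0 st; rewrite -(grngV s) -(grngV t).
apply: (germ_rng_unique (normaliser_adj nm)); rewrite ?gsrcV //.
- by rewrite germ_inv_fun cadjK conjC_eq0.
- by rewrite germ_inv_fun cadjK conjC_eq0.
Qed.

(** Write s = t r and apply the division formula; [m^# m] contributes the scalar |t(m)|^2, of which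
    the denominator cancels one factor. *)
Lemma germ_mul_normaliser s t m c : normaliser A m -> germ_fun t m != 0 -> grng t = grng s ->
  germ_fun s (m ** c) = germ_fun t m * germ_fun (gmul (ginv t) s) c.
Proof.
move=> nm t0 ts; set r := gmul (ginv t) s.
have rr : grng r = gsrc t by rewrite grngM ?grngV // gsrcV.
have -> : s = gmul t r by rewrite gmulVKl.
rewrite [LHS](germ_mul_fun_div hs hext _ (esym rr) nm t0) cmulA.
have -> : germ_fun r (m^# ** m ** c) = ev (gsrc t) (m^# ** m) * germ_fun r c.
  by rewrite -rr; apply: (germ_A_l hs); exact: (normaliser_sqr hs nm).
rewrite (germ_sqr nm t0) normCK.
by rewrite -!mulrA (mulrCA (_^*)) mulfV ?conjC_eq0 // mulr1.
Qed.

(** If E(m m^#) were nonzero at the range of [s], the inverse of the section of [m^#] there would be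
    an arrow where [m] does not vanish. So [m^#] is null at that point. *)
Lemma germ_mul_zero s m c : normaliser A m ->
  (forall t, grng t = grng s -> germ_fun t m = 0) -> germ_fun s (m ** c) = 0.
Proof.
move=> nm t0; have [nn n1 n2 n3] := germ_repP s; set n := germ_rep s in nn n1 n2 n3 *.
have m0 : ev (grng s) (m^#^# ** m^#) = 0.
  apply/eqP; apply: contrapT => /negP m0.
  have nma := normaliser_adj nm; have := germ_section_neq0 hs hext nma m0.
  rewrite -conjC_eq0 -[germ_fun _ _]conjCK -{1}(cadjK m) -germ_inv_fun.
  by rewrite conjCK cadjK t0 ?eqxx // grngV germ_section_src.
have pf := expect_pos hs (gsrc s).
rewrite n3 cmulA; apply: (pf_null_l pf).
rewrite cadjM cadjK -cmulA (cmulA m) cmulA.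
by rewrite n2 -{1}(cadjK m).
Qed.

Lemma hat_mul_normaliser s m c : normaliser A m ->
  germ_fun s (m ** c) = tconv (hat m) (hat c) (s : S).
Proof.
move=> nm; have [[t [ts t0]]|none] := pselect (exists t, grng t = grng s /\ germ_fun t m != 0).
  rewrite (germ_mul_normaliser c nm t0 ts); apply/esym.
  apply: (@tconv_single _ _ _ S (hat m) (hat c) s t) => //.
  - exact: hat_equivariant.
  - exact: hat_equivariant.
  - move=> r rs n0; have r0 : germ_fun r m != 0.
      by apply: contraNneq n0 => e; rewrite [hat m r]e mul0r.
    have rt : grng r = grng t by rewrite [LHS]rs ts.
    by apply: orbit_eq; [exact: rt|exact: (germ_src_unique nm r0 t0 rt)].
have t0 t : grng t = grng s -> germ_fun t m = 0.
  by move=> ts; apply/eqP; apply: contrapT => /negP t0; apply: none; exists t.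
rewrite germ_mul_zero //; apply/esym; apply: (@tconv_zero _ _ _ S) => t /t0 e.
by rewrite [hat m t]e mul0r.
Qed.

(** [Cc_ind] on the left factor, which is locally a normaliser. The right factor ranges over all of
    [B], because below it also represents vectors of the regular representation. *)
Lemma hat_mul b c s : Cc_twist (hat b) -> germ_fun s (b ** c) = tconv (hat b) (hat c) (s : S).
Proof.
move=> Cb; move e : (hat b) Cb => f Cf; move: f Cf b e.
apply: (@Cc_ind _ _ _ S hXc hX hH he) => [b /hat_eq0 ->|f g Cf Cg IHf IHg b bE|h].
- by rewrite cmul0l (germ0 hs); apply/esym; apply: tconv_zero => t _; rewrite mul0r.
- have [b1 e1] := hat_surj Cf; have [b2 e2] := hat_surj Cg.
  have -> : b = b1 + b2 by apply: (@hat_inj _ _ _ _ _ hs hext); rewrite bE hatD e1 e2.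
  by rewrite cmulDl (germD hs) (tconvD hXc hX hH he) // (IHf b1) // (IHg b2).
- have [n nn n1] := germ_neq0 (orbit_lift hs hext h).
  exists [set k : H | orbit_mod k n != 0]; split.
  + by apply: open_neq0; exact: orbit_mod_continuous.
  + by rewrite /= (orbit_modL hs hext) n1 normr1 oner_eq0.
  + move=> f K Cf Kc KW fK b bE; have [m nm mE] := hat_local nn Cf Kc KW fK.
    have -> : b = m by apply: (@hat_inj _ _ _ _ _ hs hext); rewrite bE mE.
    by rewrite hat_mul_normaliser // mE.
Qed.

End CanonicalProduct.

(** * Square sums and the norm of l2 *)

Section SquareSums.
Context (R : realType) (X : topologicalType) (H : topGroupoid X) (S : twist R H).
Implicit Types (x : X) (xi : S -> Cplx R) (F : seq H) (r : R).

Local Notation sq x xi :=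
  (\esum_(h in [set h : H | gsrc h = x]) ((rnorm (xi (tlift S h))) ^+ 2)%:E)%E.

Lemma sqsum_le x xi (r : R) :
  (forall F, uniq F -> (forall h, h \in F -> gsrc h = x) ->
     \sum_(h <- F) `|xi (tlift S h)| ^+ 2 <= toC r) ->
  (sq x xi <= r%:E)%E.
Proof.
move=> hF; apply: ge_ereal_sup => _ [D [fD Dx] <-].
rewrite fsbig_finite // sumEFin lee_fin -toC_le rmorph_sum /=.
under eq_bigr => h _ do rewrite rmorphXn /= rnormE.
apply: hF; first exact: finmap.fset_uniq.
by move=> h; rewrite in_fset_set // inE => /Dx.
Qed.

Lemma sqsum_ge x xi F (r : R) : uniq F -> (forall h, h \in F -> gsrc h = x) ->
  (sq x xi <= r%:E)%E -> \sum_(h <- F) `|xi (tlift S h)| ^+ 2 <= toC r.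
Proof.
move=> uF Fx; have -> : \sum_(h <- F) `|xi (tlift S h)| ^+ 2 =
    toC (\sum_(h <- F) (rnorm (xi (tlift S h))) ^+ 2).
  by rewrite rmorph_sum /=; apply: eq_bigr => h _; rewrite rmorphXn /= rnormE.
rewrite toC_le -lee_fin; apply: le_trans; apply: esum_ge.
exists [set` F]; first by split; [exact: finite_seq|move=> h /Fx].
by rewrite -fsbig_seq // sumEFin.
Qed.

Lemma sqsum_ge0 x xi : (0 <= sq x xi)%E.
Proof. by apply: esum_ge0 => h _; rewrite lee_fin sqr_ge0. Qed.

Lemma l2norm_le x xi r : 0 <= r -> (l2norm x xi <= r%:E)%E = (sq x xi <= (r ^+ 2)%:E)%E.
Proof.
move=> r0; have s0 := sqsum_ge0 x xi; rewrite /l2norm; set s := (\esum_(h in _) _)%E in s0 *.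
have i2 : (2^-1 * 2 = 1 :> R) by rewrite mulVf // pnatr_eq0.
apply/idP/idP => le.
  have -> : s = ((s `^ 2^-1) `^ 2)%E by rewrite -poweRrM i2 poweRe1.
  have -> : (r ^+ 2)%:E = (r%:E `^ 2)%E by rewrite poweR_EFin powR_mulrn.
  apply: gt0_ler_poweR => //; rewrite in_itv /= ?leey ?andbT ?poweR_ge0 //.
have -> : r%:E = ((r ^+ 2)%:E `^ 2^-1)%E.
  by rewrite poweR_EFin -powR_mulrn // -powRrM mulrC i2 powRr1.
apply: gt0_ler_poweR => //; rewrite ?in_itv /= ?leey ?andbT ?invr_ge0 //.
by rewrite lee_fin sqr_ge0.
Qed.

Lemma Cc_unit_C0 (hX : hausdorff_space X) (f : S -> Cplx R) :
  Cc_twist f -> C0 (fun x => f (gunit S x)).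
Proof.
move=> Cf; have [fc _ _] := Cf; have [K Kc fK] := Cc_support Cf.
apply: (@C0_compact _ _ _ (@gsrc X H @` K)).
- by move=> x; apply: (@continuous_comp _ _ _ (gunit S) f); [exact: gunit_continuous|exact: fc].
- by apply: continuous_compact Kc; apply: continuous_subspaceT; exact: gsrc_continuous.
- move=> x nx; apply: (supported_eq0 fK); rewrite tproj_unit => Kx.
  by apply: nx; exists (gunit H x) => //; rewrite gsrc1.
Qed.

End SquareSums.

(** * Bessel and Parseval *)

Section Parseval.
Context (R : realType) (X : topologicalType) (B : cstarAlgType R).
Context (iota : (X -> Cplx R) -> B) (E : B -> B) (hs : faithful_inclusion iota E).
Context (hext : extension_property (C0_image iota)).
Implicit Types (a b c n m : B) (x y : X) (z w : Cplx R).

Local Notation ev := (expect iota E).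
Local Notation A := (C0_image iota).
Local Notation G := (germ_groupoid hs hext).
Local Notation H := (orbit_groupoid hs hext).
Local Notation S := (germ_twist hs hext).
Local Notation p := (@tproj R X H S).
Local Notation sec := (germ_section hs hext).
Local Notation hat := (@hat R X B iota E hs hext).
Implicit Types (s t r : S) (h k : H) (f g u : S -> Cplx R) (F : seq H).

Definition orbit_rep h : B := germ_rep (tlift S h : G).

Lemma orbit_repP h x : gsrc h = x -> [/\ normaliser A (orbit_rep h),
  ev x ((orbit_rep h)^# ** orbit_rep h) = 1
  & forall b, hat b (tlift S h) = ev x ((orbit_rep h)^# ** b)].
Proof.
move=> hx; have [n1 n2 _ n4] := germ_repP (tlift S h : G).
have e : germ_src (tlift S h : G) = x by rewrite -hx; exact: (tlift_src S h).
by split=> // [|b]; rewrite ?[LHS]n4 -e.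
Qed.

(** A nonzero inner product forces equal ranges by [germ_rng_unique]. Hence arrows with source [x]
    yield orthonormal vectors in the GNS space at [x]. *)
Lemma orbit_rep_orthogonal h k : gsrc h = gsrc k ->
  hat (orbit_rep k) (tlift S h) = if h == k then 1 else 0.
Proof.
move=> hk; have [nk k1 kE] := orbit_repP (erefl (gsrc k)).
have [->|nhk] := eqVneq h k; first by rewrite kE.
apply/eqP; apply: contraNT nhk => h0; apply/eqP; apply: orbit_eq => //.
have k0 : hat (orbit_rep k) (tlift S k) != 0 by rewrite kE k1 oner_eq0.
have := germ_rng_unique nk h0 k0; rewrite !(tlift_src S) => /(_ hk).
by move=> e; rewrite -[LHS](tlift_rng S h) -[RHS](tlift_rng S k).
Qed.

Definition comb F (c : H -> Cplx R) : B := \sum_(h <- F) c h *: orbit_rep h.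

Lemma hat_comb F (c : H -> Cplx R) h x : uniq F -> (forall k, k \in F -> gsrc k = x) ->
  gsrc h = x -> hat (comb F c) (tlift S h) = if h \in F then c h else 0.
Proof.
move=> + + hx; elim: F => [_ _|k F IH /= /andP[kF uF] Fx].
  by rewrite /comb big_nil hat0 in_nil.
have kx : gsrc k = x by apply: Fx; rewrite mem_head.
rewrite /comb big_cons hat_lin -/(comb F c) IH //; last first.
  by move=> l lF; apply: Fx; rewrite in_cons lF orbT.
rewrite orbit_rep_orthogonal ?hx ?kx // in_cons.
have [->|_] /= := eqVneq h k; last by rewrite mulr0 add0r.
by rewrite (negbTE kF) mulr1 addr0.
Qed.

Lemma expect_comb F (c : H -> Cplx R) b x : (forall k, k \in F -> gsrc k = x) ->
  ev x ((comb F c)^# ** b) = \sum_(h <- F) (c h)^* * hat b (tlift S h).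
Proof.
have pf := expect_pos hs x; elim: F => [_|k F IH Fx].
  by rewrite /comb !big_nil cadj0 cmul0l (pf0 pf).
have kx : gsrc k = x by apply: Fx; rewrite mem_head.
have [_ _ kE] := orbit_repP kx.
rewrite /comb !big_cons cadjD cadjZ cmulDl cmulZl (pfD pf) (pfZ pf) -/(comb F c) IH ?kE //.
by move=> l lF; apply: Fx; rewrite in_cons lF orbT.
Qed.

Lemma expect_comb_sqr F (c : H -> Cplx R) x : uniq F -> (forall k, k \in F -> gsrc k = x) ->
  ev x ((comb F c)^# ** comb F c) = \sum_(h <- F) `|c h| ^+ 2.
Proof.
move=> uF Fx; rewrite expect_comb //; apply: eq_big_seq => h hF.
by rewrite (hat_comb _ uF Fx (Fx _ hF)) hF normCK mulrC.
Qed.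

(** The component of [b] orthogonal to the representatives of [F] in the GNS space at their common
    source. *)
Definition residual F b : B := b - comb F (fun h => hat b (tlift S h)).

Lemma residual_lin F z b c : residual F (z *: b + c) = z *: residual F b + residual F c.
Proof.
rewrite /residual; have -> : comb F (fun h => hat (z *: b + c) (tlift S h)) =
    z *: comb F (fun h => hat b (tlift S h)) + comb F (fun h => hat c (tlift S h)).
  rewrite /comb scaler_sumr -big_split; apply: eq_bigr => h _.
  by rewrite hat_lin scalerDl scalerA.
by rewrite scalerBr opprD addrACA.
Qed.

Lemma residual_sqr F b x : uniq F -> (forall k, k \in F -> gsrc k = x) ->
  ev x ((residual F b)^# ** residual F b) =
  ev x (b^# ** b) - \sum_(h <- F) `|hat b (tlift S h)| ^+ 2.
Proof.
move=> uF Fx; have pf := expect_pos hs x; rewrite /residual; set q := comb F _.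
have qb : ev x (q^# ** b) = \sum_(h <- F) `|hat b (tlift S h)| ^+ 2.
  by rewrite expect_comb //; apply: eq_bigr => h _; rewrite normCK mulrC.
have bq : ev x (b^# ** q) = \sum_(h <- F) `|hat b (tlift S h)| ^+ 2.
  rewrite (pf_herm pf) qb rmorph_sum; apply: eq_bigr => h _.
  by rewrite rmorphXn /= conj_normC.
rewrite cadjB cmulBl !cmulBr !(pfB pf) qb bq expect_comb_sqr // subrr subr0.
by [].
Qed.

Lemma bessel F b x : uniq F -> (forall k, k \in F -> gsrc k = x) ->
  \sum_(h <- F) `|hat b (tlift S h)| ^+ 2 <= ev x (b^# ** b).
Proof.
move=> uF Fx; rewrite -subr_ge0 -residual_sqr //.
by have [_] := expect_pos hs x; apply.
Qed.

Lemma expect_add_null (u v : B) x : ev x (v^# ** v) = 0 ->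
  ev x ((u + v)^# ** (u + v)) = ev x (u^# ** u).
Proof.
move=> v0; have pf := expect_pos hs x.
have v0' : ev x (v^# ** v^#^#) = 0 by rewrite cadjK.
rewrite cadjD cmulDl !cmulDr !(pfD pf) v0 (pf_null pf u^# v0) (pf_null_l pf u v0').
by rewrite !addr0.
Qed.

(** At [x] a normaliser is, up to a null element, a multiple of the representative of the arrow of
    its section. Quantifying over all larger lists lets the summands of a combination be treated one
    at a time. *)
Lemma lspan_residual c x : lspan (normaliser A) c ->
  exists F, [/\ uniq F, forall h, h \in F -> gsrc h = x
    & forall F', uniq F' -> (forall h, h \in F' -> gsrc h = x) -> {subset F <= F'} ->
      ev x ((residual F' c)^# ** residual F' c) = 0].
Proof.
have pf := expect_pos hs x.
move: c; apply: lspan_ind => [|z n c nn [F [uF Fx FP]]].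
  exists [::]; split => // F' uF' F'x _; rewrite residual_sqr // cmul0r (pf0 pf).
  by rewrite big1 ?subr0 // => h _; rewrite hat0 normr0 expr0n.
pose F1 := if ev x (n^# ** n) == 0 then F else undup (p (sec n x) :: F).
have F1F : {subset F <= F1}.
  by move=> h hF; rewrite /F1; case: ifP => // _; rewrite mem_undup in_cons hF orbT.
exists F1; split.
- by rewrite /F1; case: ifP => // _; exact: undup_uniq.
- move=> h; rewrite /F1; case: ifP => _; first exact: Fx.
  rewrite mem_undup in_cons => /orP[/eqP ->|]; last exact: Fx.
  exact: (germ_section_src hs hext n x).
move=> F' uF' F'x sF'.
have n0 : ev x ((residual F' n)^# ** residual F' n) = 0.
  apply/eqP; rewrite eq_le; apply/andP; split; last exact: pf.2.
  rewrite residual_sqr // subr_le0; have [e0|e0] := eqVneq (ev x (n^# ** n)) 0.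
    by rewrite e0; apply: sumr_ge0 => h _; rewrite exprn_ge0.
  have hF' : p (sec n x) \in F'.
    by apply: sF'; rewrite /F1 (negbTE e0) mem_undup mem_head.
  have s0 := germ_section_neq0 hs hext nn e0.
  have := germ_sqr nn s0; rewrite germ_section_src => ->.
  rewrite (bigD1_seq _ hF' uF') /=.
  rewrite (equivariant_norm (hat_equivariant n) (tlift_proj S (p (sec n x)))).
  by rewrite lerDl; apply: sumr_ge0 => h _; rewrite exprn_ge0.
rewrite residual_lin expect_add_null; last by apply: FP => // h /F1F /sF'.
by rewrite cadjZ cmulZl cmulZr !(pfZ pf) n0 !mulr0.
Qed.

(** [b] is approximated by a combination [c] of normalisers, whose residual is null. What remains is
    at most |b - c|^2, hence the tolerance sqrt(e). *)
Lemma parseval b x (e : Cplx R) : 0 < e -> exists F, [/\ uniq F, forall h, h \in F -> gsrc h = x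
  & ev x (b^# ** b) <= \sum_(h <- F) `|hat b (tlift S h)| ^+ 2 + e].
Proof.
move=> e0; have d0 : 0 < sqrtC e by rewrite sqrtC_gt0.
have [c Nc bc] := (closure_normP _ _).1 (@normaliser_dense _ _ _ _ _ hs b) _ d0.
have [F [uF Fx FP]] := lspan_residual x Nc; exists F; split => //.
have pf := expect_pos hs x.
rewrite -lerBlDl -residual_sqr //.
have -> : residual F b = residual F (b - c) + residual F c.
  by rewrite -{1}(subrK c b) -[b - c]scale1r residual_lin !scale1r.
rewrite expect_add_null ?FP // residual_sqr //.
apply: le_trans (_ : ev x ((b - c)^# ** (b - c)) <= e).
  by rewrite gerBl; apply: sumr_ge0 => h _; rewrite exprn_ge0.
have [ev0 evp] := pf; rewrite -[leLHS]ger0_norm ?evp //.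
apply: le_trans (expect_le hs x _) _; rewrite cnorm_adjM -[leRHS]sqrtCK.
by rewrite ler_pXn2r ?nnegrE ?(ltW bc) // ltW.
Qed.

End Parseval.

(** * The reduced norm and the implication from (2) to (3) *)

Section CanonicalModel.
Context (R : realType) (X : topologicalType) (B : cstarAlgType R).
Context (iota : (X -> Cplx R) -> B) (E : B -> B) (hs : faithful_inclusion iota E).
Context (hext : extension_property (C0_image iota)).
Implicit Types (a b c n m : B) (x y : X) (z w : Cplx R).

Local Notation ev := (expect iota E).
Local Notation A := (C0_image iota).
Local Notation G := (germ_groupoid hs hext).
Local Notation H := (orbit_groupoid hs hext).
Local Notation S := (germ_twist hs hext).
Local Notation p := (@tproj R X H S).
Local Notation sec := (germ_section hs hext).
Local Notation hat := (@hat R X B iota E hs hext).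
Implicit Types (s t r : S) (h k : H) (f g u : S -> Cplx R) (F : seq H).
Let hio : C0_star_hom iota := (fi_embedding hs).1.
Let hXc := fi_locally_compact hs.
Let hX := fi_hausdorff hs.
Let hH : hausdorff_space H := orbit_hausdorff hs.
Let he : etale H := orbit_etale hs hext.

(** Finitely many coordinates of the convolution involve finitely many coordinates of [xi]. There
    [xi] agrees with evaluation of some [c] in [B], so Bessel for [b c] and [pf_mul_le] give the
    bound. *)
Lemma hat_reduced_le b : Cc_twist (hat b) -> (reduced_norm (hat b) <= (rnorm b)%:E)%E.
Proof.
move=> Cb; have b0 : 0 <= rnorm b by rewrite -toC_le rnormE toC0.
rewrite /reduced_norm ge_max lee_fin b0 /=; apply: ge_ereal_sup => _ [x [xi [[xie _ _] xi1 ->]]].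
move: xi1; rewrite (l2norm_le _ _ (@ler01 R)) (l2norm_le _ _ b0) => xi1.
apply: sqsum_le => F uF Fx; rewrite rmorphXn /= rnormE.
pose D s := [set h | grng h = grng s /\ hat b (tlift S h) != 0].
have fD s : finite_set (D s) by exact: (Cc_finite hXc hX hH he).
(* The coordinates of the vector that enter the convolution at [s]. *)
pose Q s : set H := (fun h => p (gmul (ginv (tlift S h)) s)) @` D s.
have fQ s : finite_set (Q s) by exact: finite_image.
have [F' F'P] : exists F' : seq H, forall h, h \in F -> forall k, Q (tlift S h) k -> k \in F'.
  elim: F {uF Fx} => [|h F [F' F'P]]; first by exists [::].
  have [q qE] := (finite_seqP _).1 (fQ (tlift S h)).
  exists (q ++ F') => k; rewrite in_cons => /orP[/eqP -> l|kF l Ql].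
    by rewrite qE /= mem_cat => ->.
  by rewrite mem_cat (F'P k) ?orbT.
pose F1 := [seq h <- undup F' | `[< gsrc h = x >]].
have uF1 : uniq F1 by rewrite filter_uniq // undup_uniq.
have F1x h : h \in F1 -> gsrc h = x by rewrite mem_filter => /andP[/asboolP].
pose c := comb F1 (fun h => xi (tlift S h)).
have cE h : h \in F -> tconv (hat b) xi (tlift S h) = hat (b ** c) (tlift S h).
  move=> hF; rewrite [RHS]hat_mul //; apply: eq_fsbigr => k /set_mem kh.
  have [->|k0] := eqVneq (hat b (tlift S k)) 0; first by rewrite !mul0r.
  pose t : S := gmul (ginv (tlift S k)) (tlift S h); congr (_ * _); change (xi t = hat c t).
  have ts : gsrc t = x.
    by rewrite gsrcM ?tlift_src ?Fx // gsrcV tlift_rng.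
  have tF : p t \in F1.
    rewrite mem_filter mem_undup tproj_src ts asboolT //=.
    by apply: (F'P h) => //; exists k.
  have [z z1 ->] : exists2 z, circle z & t = tact z (tlift S (p t)).
    by apply: tfiber; rewrite tlift_proj.
  rewrite (equivariant_act _ xie z1) (equivariant_act _ (hat_equivariant c) z1).
  by rewrite (hat_comb _ uF1 F1x) ?tF // tproj_src.
rewrite (eq_big_seq _ (fun h hF => congr1 (fun w : Cplx R => `|w| ^+ 2) (cE h hF))).
apply: le_trans (bessel _ uF Fx) _; apply: le_trans (pf_mul_le (expect_pos hs x) _ _) _.
rewrite -[leRHS]mulr1 ler_wpM2l ?exprn_ge0 // expect_comb_sqr //.
by have := sqsum_ge uF1 F1x xi1; rewrite expr1n.
Qed.

(** By [expect_norm_le] it suffices to estimate E((b c)^# (b c))(x) for normalised [c]. Parseval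
    computes it from the coordinates of [b c], which are those of the convolution of [hat b] with
    the restriction of [hat c] to the fibre over [x]. *)
Lemma hat_reduced_ge b : Cc_twist (hat b) -> ((rnorm b)%:E <= reduced_norm (hat b))%E.
Proof.
move=> Cb; have r0 : (0 <= reduced_norm (hat b))%E by rewrite /reduced_norm le_max lexx.
have : reduced_norm (hat b) \is a fin_num.
  by rewrite ge0_fin_numE //; apply: le_lt_trans (hat_reduced_le Cb) (ltry _).
case e : (reduced_norm (hat b)) => [r| |] // _; rewrite e lee_fin in r0.
rewrite lee_fin -toC_le rnormE; have r0' : 0 <= toC r by rewrite -toC0 toC_le.
apply: (expect_norm_le hs) => // x c; have pf := expect_pos hs x.
have [c0|c0] := eqVneq (ev x (c^# ** c)) 0.
  by apply: le_trans (pf_mul_le pf _ _) _; rewrite c0 !mulr0.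
wlog c1 : c c0 / ev x (c^# ** c) = 1.
  move=> hw; have cp : 0 < ev x (c^# ** c) by rewrite lt_def c0 pf.2.
  pose l := (sqrtC (ev x (c^# ** c)))^-1.
  have l0 : 0 < l by rewrite invr_gt0 sqrtC_gt0.
  have scale d : ev x ((l *: d)^# ** (l *: d)) = l ^+ 2 * ev x (d^# ** d).
    by rewrite cadjZ cmulZl cmulZr !(pfZ pf) mulrA geC0_conj ?(ltW l0).
  have cl : ev x ((l *: c)^# ** (l *: c)) = 1.
    by rewrite scale exprVn sqrtCK mulVf.
  have := hw (l *: c); rewrite cl oner_eq0 => /(_ isT erefl).
  rewrite cmulZr scale mulr1 exprVn sqrtCK => le.
  by rewrite mulrC -ler_pdivrMl.
(* The restriction of [hat c] to the fibre over [x], extended by 0; Bessel puts it into the unit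
   ball. *)
rewrite c1 mulr1; pose xi (s : S) : Cplx R := if pselect (gsrc s = x) then hat c s else 0.
have xiE s : gsrc s = x -> xi s = hat c s by rewrite /xi; case: pselect.
have xi0 s : gsrc s <> x -> xi s = 0 by rewrite /xi; case: pselect.
have xi1 : (l2norm x xi <= 1%:E)%E.
  rewrite l2norm_le ?ler01 // expr1n; apply: sqsum_le => F uF Fx.
  have -> : \sum_(h <- F) `|xi (tlift S h)| ^+ 2 = \sum_(h <- F) `|hat c (tlift S h)| ^+ 2.
    by apply: eq_big_seq => h hF; rewrite xiE // tlift_src Fx.
  by apply: le_trans (bessel _ uF Fx) _; rewrite c1.
have xil : l2_twist x xi.
  split.
  - move=> z s z1; have [sx|sx] := pselect (gsrc s = x).
      by rewrite -/(tact z s) !xiE ?tact_src // (equivariant_act _ (hat_equivariant c) z1).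
    by rewrite -/(tact z s) !xi0 ?tact_src // mulr0.
  - exact: xi0.
  - by apply: le_lt_trans xi1 (ltry _).
have le : (l2norm x (tconv (hat b) xi) <= r%:E)%E.
  rewrite -e /reduced_norm le_max; apply/orP; right; apply: ereal_sup_ubound.
  by exists x, xi.
rewrite l2norm_le // in le; rewrite -rmorphXn /=.
have rr : toC (r ^+ 2) \is Num.real by rewrite ger0_real // -toC0 toC_le sqr_ge0.
have lr := ger0_real (pf.2 (b ** c)); rewrite (real_leNgt lr rr); apply/negP => lt.
(* Otherwise Parseval up to half of this gap would contradict the bound by r^2. *)
have d0 : 0 < ev x ((b ** c)^# ** (b ** c)) - toC (r ^+ 2) by rewrite subr_gt0.
have [F [uF Fx Fle]] := parseval hs hext (b ** c) x (divr_gt0 d0 (ltr0n _ 2)).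
suff : ev x ((b ** c)^# ** (b ** c)) - toC (r ^+ 2) <=
    (ev x ((b ** c)^# ** (b ** c)) - toC (r ^+ 2)) / 2.
  rewrite ler_pdivlMr ?ltr0n // -[leRHS]mulr1 ler_pM2l // => /(lt_le_trans (ltr1n _ 2)).
  by rewrite ltxx.
rewrite lerBlDl; apply: le_trans Fle _; rewrite lerD2r; apply: le_trans (sqsum_ge uF Fx le).
rewrite le_eqVlt; apply/orP; left; apply/eqP; apply: eq_big_seq => h hF.
congr (`|_| ^+ 2); rewrite [LHS]hat_mul //; apply: eq_fsbigr => k /set_mem kh.
by rewrite xiE // gsrcM ?tlift_src ?Fx // gsrcV tlift_rng.
Qed.

Definition hat_inv f : B := xget 0 [set b | hat b = f].

Lemma hat_invK f : Cc_twist f -> hat (hat_inv f) = f.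
Proof. by move=> /hat_surj[b bf]; rewrite /hat_inv; case: xgetP => [c _ //|/(_ b)]. Qed.

Lemma hat_inv_eq f b : hat b = f -> hat_inv f = b.
Proof.
move=> bf; rewrite /hat_inv; case: xgetP => [c _ /= cf|/(_ b)//].
by apply: (@hat_inj _ _ _ _ _ hs hext); rewrite cf.
Qed.

Lemma hat_inv_star_hom : star_hom_on (@tconv R X H S) (@tstar R X H S) (@Cc_twist R X H S) hat_inv.
Proof.
split=> [z f g Cf Cg|f g Cf Cg|f Cf]; apply: hat_inv_eq.
- by rewrite hat_lin !hat_invK.
- by apply/funext => s; rewrite [LHS]hat_mul ?hat_invK.
- by rewrite hat_adj hat_invK.
Qed.

Lemma hat_inv_isometric f : Cc_twist f -> (rnorm (hat_inv f))%:E = reduced_norm f.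
Proof.
move=> Cf; have Cb := Cf; rewrite -(hat_invK Cf) in Cb; rewrite -{2}(hat_invK Cf).
by apply/eqP; rewrite eq_le hat_reduced_le // hat_reduced_ge.
Qed.

(** [hat n] need not have compact support, but [hat (n k)] has for a cut-off [k] of E(n^# n). The
    error has square norm |n^# n (1 - k)^2| <= 2d. *)
Lemma hat_inv_normaliser n : normaliser A n -> closure (hat_inv @` @Cc_twist R X H S) n.
Proof.
move=> nn; apply/closure_normP => e e0.
pose f0 x := ev x (n^# ** n); have Cf0 : C0 f0 := expect_C0 hs _.
have e2 : 0 < e ^+ 2 by rewrite exprn_gt0.
(* The value e^2/4, so that the error 2d is below e^2. *)
have [d [d0 de]] : exists d : R, 0 < d /\ toC (2 * d) < e ^+ 2.
  exists (4^-1 * complex.Re (e ^+ 2)).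
  have eE : toC (complex.Re (e ^+ 2)) = e ^+ 2 by apply: toC_Re_ge0; exact: ltW.
  have re0 : 0 < complex.Re (e ^+ 2) by rewrite -toC_lt eE.
  split; first by rewrite mulr_gt0 // invr_gt0.
  by rewrite -eE toC_lt; lra.
have [k [Ck k01 kn0 k1]] := C0_cutoff Cf0 d0.
exists (n ** iota k).
  have Cc : Cc_twist (hat (n ** iota k)).
    apply: (@Cc_intro _ _ _ _ hH _ ((fun x => p (sec n x)) @` [set x | toC d <= `|f0 x|])).
    - exact: hat_continuous.
    - exact: hat_equivariant.
    - apply: continuous_compact (C0_compact_ge Cf0 d0).
      apply/subspace_continuousP => x fx; apply: cvg_within_filter.
      have x0 : ev x (n^# ** n) != 0.
        rewrite -normr_gt0; apply: lt_le_trans fx.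
        by rewrite -toC0 toC_lt.
      have sc := @germ_section_continuous _ _ _ _ _ hs hext n x nn x0.
      have pc : (fun y => p (sec n y)) @ nbhs x --> p (sec n x).
        exact: (cvg_comp _ p sc (@tproj_continuous _ _ _ S _)).
      exact: pc.
    - move=> s; rewrite /hat (germ_iota_r hs) // mulf_eq0 negb_or => /andP[s0 ks].
      exists (gsrc s); first exact: kn0.
      have := @proj_section _ _ _ _ _ hs hext (p s) n nn; apply.
      by rewrite [orbit_mod _ _](orbit_modE (s : G)) normr_eq0.
  by exists (hat (n ** iota k)) => //; exact: hat_inv_eq.
have kr x : k x \is Num.real by apply: ger0_real; have /andP[] := k01 x.
have ik : (iota k)^# = iota k := iota_real hio Ck kr.
have Ck1 := C0M Cf0 Ck; have Ck2 := C0M Ck1 Ck.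
have Cg := C0B (C0B Cf0 Ck1) (C0B Ck1 Ck2).
have nE : n^# ** n = iota f0 by rewrite /f0 (expect_A hs) //; exact: (normaliser_sqr hs nn).
have com : iota k ** (n^# ** n) = n^# ** n ** iota k by rewrite nE (iota_comm hio Ck Cf0).
have sq : (n - n ** iota k)^# ** (n - n ** iota k) =
    iota (fun x => f0 x - f0 x * k x - (f0 x * k x - f0 x * k x * k x)).
  rewrite (iota_B hio (C0B Cf0 Ck1) (C0B Ck1 Ck2)) (iota_B hio Cf0 Ck1) (iota_B hio Ck1 Ck2).
  rewrite (iota_M hio Ck1 Ck) (iota_M hio Cf0 Ck) -nE cadjB cadjM ik cmulBl !cmulBr.
  by rewrite -(cmulA (iota k)) com (cmulA (iota k ** n^#)) -(cmulA (iota k)) com !cmulA.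
have nle : `|n - n ** iota k| ^+ 2 <= toC (2 * d).
  rewrite -cnorm_adjM sq; have td : 0 <= toC (2 * d) by rewrite -toC0 toC_le mulr_ge0 // ltW.
  apply: (iota_norm_le hio) => // x.
  have -> : f0 x - f0 x * k x - (f0 x * k x - f0 x * k x * k x) = f0 x * (1 - k x) ^+ 2.
    by rewrite expr2; ring.
  have [kx|kx] := eqVneq (k x) 1; first by rewrite kx subrr expr0n mulr0 normr0.
  have /andP[k0 kle] := k01 x; have k10 : 0 <= 1 - k x by rewrite subr_ge0.
  rewrite normrM (ger0_norm (exprn_ge0 2 k10)) -[leRHS]mulr1; apply: ler_pM => //.
  - by rewrite exprn_ge0.
  - have f0r : toC (2 * d) \is Num.real by rewrite ger0_real.
    rewrite real_leNgt ?ger0_real //; apply/negP => /ltW /k1 e1.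
    by rewrite e1 eqxx in kx.
  - by rewrite expr_le1 // gerBl.
by rewrite -(@ltr_pXn2r _ 2) ?nnegrE ?normr_ge0 ?(ltW e0) //; exact: le_lt_trans nle de.
Qed.

Lemma hat_inv_dense : closure (hat_inv @` @Cc_twist R X H S) = setT.
Proof.
apply/seteqP; split => // b _; set D := hat_inv @` _.
have lD z c d : closure D c -> closure D d -> closure D (z *: c + d).
  apply: (closure_binary (F := fun c d => z *: c + d)).
    move=> _ _ [f Cf <-] [g Cg <-]; exists (fun s => z * f s + g s).
      exact: (Cc_lin hH).
    by apply: hat_inv_eq; rewrite hat_lin !hat_invK.
  by apply: cvgD; [apply: cvgZ; [exact: cvg_cst|exact: cvg_fst]|exact: cvg_snd].
have ND : lspan (normaliser A) `<=` closure D.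
  apply: lspan_ind => [|z n c nn Dc].
    apply: subset_closure; exists (fun=> 0); first exact: Cc_0.
    by apply: hat_inv_eq; exact: hat0.
  by apply: lD => //; exact: hat_inv_normaliser.
have := closure_subset ND (@normaliser_dense _ _ _ _ _ hs b).
by rewrite -(closure_id _).1 //; exact: closed_closure.
Qed.

(** The completion is realised on [B] itself, with inverse evaluation as the structure map. *)
Definition germ_reduced : reduced_cstar S :=
  @ReducedCstar R X H S B hat_inv hat_inv_star_hom hat_inv_isometric hat_inv_dense.

Lemma hat_iota f : Cc_twist f -> (forall s, (forall x, p s <> gunit H x) -> f s = 0) ->
  hat (iota (fun x => f (gunit S x))) = f.
Proof.
move=> Cf f0; have Ca : C0 (fun x => f (gunit S x)) by exact: Cc_unit_C0.
have [_ fe _] := Cf; apply/funext => s.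
have [sr|sr] := pselect (grng s = gsrc s).
  have ps : p s = gunit H (gsrc s).
    have := @orbit_principal _ _ _ _ _ hs hext (p s) => e.
    by rewrite {1}e // tproj_src ?tproj_rng.
  have [z z1 sz] := (@twist_exact _ _ _ S s _).1 ps; rewrite sz; move: (gsrc s) z1 => x z1 {sz ps sr}.
  rewrite /hat [LHS](germ_incl_fun hs hext _ _ z1) (expect_iota hs) //.
  by rewrite tincl_act // (equivariant_act _ fe z1).
rewrite f0; last first.
  by move=> x e; apply: sr; rewrite -tproj_rng -tproj_src e grng1 gsrc1.
(* Off the units some [u] takes different values at range and source. As [iota u] commutes with
   [iota a], the value of [iota a] at [s] must vanish. *)
have [u [Cu us]] : exists u : X -> Cplx R, C0 u /\ u (grng s) <> u (gsrc s).
  apply: contrapT => nu; apply: sr; apply: (C0_separates hs) => u Cu.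
  by apply: contrapT => ne; apply: nu; exists u.
set a := fun x => f (gunit S x) in Ca *.
have e1 := germ_iota_l hs (s : G) (iota a) Cu; have e2 := germ_iota_r hs (s : G) (iota a) Cu.
rewrite (iota_comm hio Cu Ca) e2 in e1.
apply/eqP; apply: contrapT => /negP a0; apply: us.
by apply: (mulIf a0); apply: etrans (esym e1) _; rewrite mulrC.
Qed.

Lemma germ_twist_model : twist_model iota S.
Proof.
split; [exact: hH|exact: he|exact: orbit_principal|].
exists germ_reduced, iota, id; split => //.
- split; first exact: hio.
  by move=> f Cf f0; apply/esym; apply: hat_inv_eq; exact: hat_iota.
- by split; [split|exists id].
Qed.

End CanonicalModel.

(** * Models *)

Section UnitFunctions.
Context (R : realType) (X : topologicalType) (H : topGroupoid X) (S : twist R H).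
Context (hH : hausdorff_space H) (he : etale H).
Implicit Types (s t r : S) (h k : H) (x y : X) (z w : Cplx R) (f g : S -> Cplx R).
Implicit Types (a : X -> Cplx R).

Local Notation p := (@tproj R X H S).

Definition unit_space : set H := [set h | h = gunit H (gsrc h)].

(** Close to a unit, an arrow and the unit at its source both lie in a set on which the source map
    is injective, so they coincide. *)
Lemma unit_space_open : open unit_space.
Proof.
rewrite openE => h hU; have [V [oV Vh _ _ [g [_ gK]]]] := he.2 h.
have nV : nbhs h V by exact: open_nbhs_nbhs.
have uc : (fun k : H => gunit H (gsrc k)) @ h --> h.
  rewrite {2}hU; exact: (cvg_comp (@gsrc X H) (gunit H) (@gsrc_continuous X H h)
    (@gunit_continuous X H _)).
have nV' : nbhs h [set k | V (gunit H (gsrc k))] by exact: uc.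
apply: (filterS _ (filterI nV nV')) => k [Vk Vuk].
by rewrite /unit_space /= -[LHS](gK k) // -[RHS](gK _ Vuk) gsrc1.
Qed.

Lemma unit_space_closed : closed unit_space.
Proof.
apply: (@closed_equalizer _ _ id (fun h : H => gunit H (gsrc h)) hH).
  by move=> h; exact: cvg_id.
by move=> h; apply: (@continuous_comp _ _ _ (@gsrc X H) (gunit H));
  [exact: gsrc_continuous|exact: gunit_continuous].
Qed.

Lemma unit_fibre s : unit_space (p s) -> exists2 z, circle z & s = tincl S (gsrc s) z.
Proof. by move=> e; apply/twist_exact; rewrite {1}e tproj_src. Qed.

(** The function over the units that corresponds to [a]: it is a(x) z at [tincl S x z]. The
    coordinate [z] is unique by [tincl_inj], so it may be picked by choice. *)
Definition unit_fun a : S -> Cplx R := fun s =>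
  if pselect (unit_space (p s)) is left e then a (gsrc s) * projT1 (cid2 (unit_fibre e)) else 0.

Lemma unit_fun_off a s : ~ unit_space (p s) -> unit_fun a s = 0.
Proof. by rewrite /unit_fun; case: pselect. Qed.

Lemma tincl_unit_space x z : circle z -> unit_space (p (tincl S x z)).
Proof. by move=> z1; rewrite /unit_space /= tproj_incl // gsrc1. Qed.

Lemma unit_fun_incl a x z : circle z -> unit_fun a (tincl S x z) = a x * z.
Proof.
move=> z1; rewrite /unit_fun; case: pselect => [e|[]]; last exact: tincl_unit_space.
case: cid2 => w /= w1; rewrite tincl_src // => /(tincl_inj z1 w1) ->.
by [].
Qed.

Lemma unit_fun1 a x : unit_fun a (gunit S x) = a x.
Proof. by rewrite -tincl1 unit_fun_incl ?mulr1 //; exact: circle1. Qed.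

Lemma unit_fun_equivariant a : equivariant (unit_fun a).
Proof.
move=> z s z1; rewrite -/(tact z s).
have [e|e] := pselect (unit_space (p s)); last by rewrite !unit_fun_off ?mulr0 ?tproj_act.
have [w w1 ->] := unit_fibre e; move: (gsrc s) => x.
rewrite unit_fun_incl // /tact tincl_rng // -tinclM // unit_fun_incl.
  by rewrite mulrCA.
by rewrite /circle /= normrM z1 w1 mulr1.
Qed.

Lemma unit_fun_continuous a : continuous a -> continuous (unit_fun a).
Proof.
move=> ac s; have [e|e] := pselect (unit_space (p s)); last first.
  have n0 : nbhs s (p @^-1` (~` unit_space)).
    apply: (@tproj_continuous _ _ _ S s); apply: open_nbhs_nbhs; split=> //.
    by apply: closed_openC; exact: unit_space_closed.
  apply: (@cvg_near_eq _ _ _ _ (fun=> 0)).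
    by apply: (filterS _ n0) => t; exact: unit_fun_off.
  by rewrite unit_fun_off //; exact: cvg_cst.
have [U [phi [oU Us _ phiP]]] := fibre_coordinate (gunit S (gsrc s)).
have pU : U (p s) by rewrite e tproj_src -(tproj_unit S).
(* The chosen [z] is the quotient of the local fibre coordinates of [t] and of the unit at its
   source, which shows continuity. *)
pose c t := a (gsrc t) * (phi t * (phi (gunit S (gsrc t)))^*).
have uc : (fun t : S => gunit S (gsrc t)) @ s --> gunit S (gsrc s).
  exact: (cvg_comp (@gsrc X S) (gunit S) (@gsrc_continuous X S s) (@gunit_continuous X S _)).
have near : \forall t \near s, unit_fun a t = c t.
  have n1 : nbhs s (p @^-1` (U `&` unit_space)).
    apply: (@tproj_continuous _ _ _ S s); apply: open_nbhs_nbhs; split=> //.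
    by apply: openI => //; exact: unit_space_open.
  apply: (filterS _ n1) => t [/= Ut et]; have [w w1 tw] := unit_fibre et.
  have Uu : U (p (gunit S (gsrc t))) by rewrite tproj_unit -(tproj_src t) -et.
  have [_ cu pu] := phiP _ Uu.
  rewrite tw unit_fun_incl // /c tincl_src // tincl_act // pu // -mulrA circle_conjK //.
  by rewrite mulr1.
apply: (@cvg_near_eq _ _ (nbhs s) (unit_fun a) c _ _ near); rewrite (nbhs_singleton near).
have c1 : (fun t : S => a (gsrc t)) @ s --> a (gsrc s).
  exact: (cvg_comp (@gsrc X S) a (@gsrc_continuous X S s) (ac _)).
have [c2 _ _] := phiP s pU; have [c3' _ _] := phiP _ Us.
have c3 : (fun t : S => (phi (gunit S (gsrc t)))^*) @ s --> (phi (gunit S (gsrc s)))^*.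
  have c4 := cvg_comp _ phi uc c3'.
  exact: (cvg_comp _ (fun w : Cplx R => w^*) c4 (@conj_continuous R _)).
exact: cvgM c1 (cvgM c2 c3).
Qed.

Lemma Cc_unit_fun a (K : set X) : continuous a -> compact K -> (forall x, ~ K x -> a x = 0) ->
  Cc_twist (unit_fun a).
Proof.
move=> ac Kc Ka; apply: (@Cc_intro _ _ _ _ hH _ (@gunit X H @` K)).
- exact: unit_fun_continuous.
- exact: unit_fun_equivariant.
- by apply: continuous_compact Kc; apply: continuous_subspaceT; exact: gunit_continuous.
- move=> s n0; have [e|e] := pselect (unit_space (p s)); last first.
    by move/eqP: n0; rewrite unit_fun_off.
  have [w w1 sw] := unit_fibre e; exists (gsrc s); last by rewrite e tproj_src.
  apply: contrapT => /Ka a0; move/eqP: n0; apply.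
  by rewrite sw unit_fun_incl // a0 mul0r.
Qed.

Lemma tconv_unit_fun a f s : equivariant f -> tconv (unit_fun a) f s = a (grng s) * f s.
Proof.
move=> fe; rewrite (@tconv_single _ _ _ S _ _ s (gunit S (grng s))).
- by rewrite unit_fun1 ginv1 g1mul.
- exact: unit_fun_equivariant.
- exact: fe.
- by rewrite grng1.
move=> t ts n0; have [e|e] := pselect (unit_space (p t)); last first.
  by move/eqP: n0; rewrite unit_fun_off // mul0r.
rewrite tproj_unit -ts -tproj_rng {1}e; congr (gunit H _).
by have := congr1 (@grng X H) e; rewrite grng1 => ->.
Qed.

End UnitFunctions.

(** * Compactly supported functions inside B *)

Section ModelRepresentation.
Context (R : realType) (X : topologicalType) (B : cstarAlgType R).
Context (iota : (X -> Cplx R) -> B).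
Context (H : topGroupoid X) (S : twist R H).

(** Transports a model into [B], so that neither the completion nor the isomorphism has to be
    carried along. *)
Definition model_map (j : (S -> Cplx R) -> B) : Prop :=
  [/\ star_hom_on (@tconv R X H S) (@tstar R X H S) (@Cc_twist R X H S) j,
      forall b, closure (j @` @Cc_twist R X H S) b
    & forall f, Cc_twist f -> supported_in f (@unit_space X H) ->
        j f = iota (fun x => f (gunit S x))].

(** [star_iso] is an algebraic notion; density of the image survives under the inverse isomorphism
    because star homomorphisms are contractive. *)
Lemma model_map_exists : hausdorff_space X -> reduced_model S iota -> exists j, model_map j.
Proof.
move=> hX [D [k [Phi [[kh ku] [[lin mul adj] [Psi PhiK PsiK]] Phik]]]].
have inj : injective Phi := can_inj PhiK.
have hPsi : star_hom_on cmul cadj setT Psi.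
  split=> [z f g _ _|f g _ _|f _]; apply: inj; rewrite PsiK.
  - by rewrite lin // !PsiK.
  - by rewrite mul // !PsiK.
  - by rewrite adj // PsiK.
have [Plin Pmul Padj] := hPsi; have [rlin rmul radj] := rmap_star_hom D.
exists (fun f => Psi (rmap D f)); split.
- split=> [z f g Cf Cg|f g Cf Cg|f Cf].
  + by rewrite rlin // Plin.
  + by rewrite rmul // Pmul.
  + by rewrite radj // Padj.
- move=> b; apply/closure_normP => e e0.
  have : closure (rmap D @` @Cc_twist R X H S) (Phi b) by rewrite rmap_dense.
  move=> /closure_normP/(_ e e0)[_ [f Cf <-] le]; exists (Psi (rmap D f)); first by exists f.
  apply: le_lt_trans le; rewrite -{1}(PhiK b).
  have -> : Psi (Phi b) - Psi (rmap D f) = Psi (Phi b - rmap D f).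
    by have := Plin (- 1) (rmap D f) (Phi b) I I; rewrite !scaleN1r addrC [RHS]addrC => ->.
  exact: star_hom_contractive.
- move=> f Cf fU; rewrite -ku //; last first.
    move=> s ns; apply: (supported_eq0 fU) => e; apply: (ns (gsrc s)).
    by rewrite {1}e tproj_src.
  by rewrite -Phik ?PhiK //; exact: Cc_unit_C0.
Qed.

End ModelRepresentation.

(** * Normalisers in a model and the implication from (3) to (1) *)

Section ModelNormalisers.
Context (R : realType) (X : topologicalType) (B : cstarAlgType R).
Context (iota : (X -> Cplx R) -> B) (E : B -> B) (hs : faithful_inclusion iota E).
Context (H : topGroupoid X) (S : twist R H) (hH : hausdorff_space H) (he : etale H).
Context (j : (S -> Cplx R) -> B) (hj : model_map iota j).
Implicit Types (a u : X -> Cplx R) (b c n m : B) (x y : X) (z w : Cplx R).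
Implicit Types (s t r : S) (h k : H) (f g : S -> Cplx R) (K V : set H).

Local Notation ev := (expect iota E).
Local Notation A := (C0_image iota).
Local Notation p := (@tproj R X H S).
Let hio : C0_star_hom iota := (fi_embedding hs).1.
Let hXc := fi_locally_compact hs.
Let hX := fi_hausdorff hs.
Let hE := fi_expectation hs.

Lemma model_lin z f g : Cc_twist f -> Cc_twist g -> j (fun s => z * f s + g s) = z *: j f + j g.
Proof. by have [[lin _ _] _ _] := hj; exact: lin. Qed.

Lemma modelM f g : Cc_twist f -> Cc_twist g -> j (tconv f g) = j f ** j g.
Proof. by have [[_ mul _] _ _] := hj; exact: mul. Qed.

Lemma model_adj f : Cc_twist f -> j (tstar f) = (j f)^#.
Proof. by have [[_ _ adj] _ _] := hj; exact: adj. Qed.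

Lemma modelD f g : Cc_twist f -> Cc_twist g -> j (fun s => f s + g s) = j f + j g.
Proof.
move=> Cf Cg; have := model_lin 1 Cf Cg; rewrite scale1r => <-; congr j.
by apply/funext => s; rewrite mul1r.
Qed.

Lemma model0 : j (fun=> 0) = 0.
Proof.
have C := Cc_0 S hH; have := modelD C C.
have -> : (fun _ : S => 0 + 0 : Cplx R) = fun=> 0 by apply/funext => s; rewrite addr0.
by move=> e; apply: (addrI (j (fun=> 0))); rewrite addr0 -e.
Qed.

Lemma model_dense b (e : Cplx R) : 0 < e -> exists2 f, Cc_twist f & `|b - j f| < e.
Proof.
move=> e0; have [_ dense _] := hj.
by have [_ [f Cf <-] le] := (closure_normP _ _).1 (dense b) _ e0; exists f.
Qed.

Lemma model_unit f : Cc_twist f -> supported_in f (@unit_space X H) ->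
  j f = iota (fun x => f (gunit S x)).
Proof. by have [_ _ ju] := hj; exact: ju. Qed.

(** With compact support, [unit_fun a] lies in [Cc_twist], and multiplication by [iota a] becomes a
    convolution. *)
Lemma model_iota a (K : set X) f : continuous a -> compact K -> (forall x, ~ K x -> a x = 0) ->
  Cc_twist f -> Cc_twist (fun s => a (grng s) * f s) /\ iota a ** j f = j (fun s => a (grng s) * f s).
Proof.
move=> ac Kc Ka Cf; have [_ fe _] := Cf.
have Ca := Cc_unit_fun S hH he ac Kc Ka.
have e : tconv (unit_fun (S := S) a) f = fun s => a (grng s) * f s.
  by apply/funext => s; exact: tconv_unit_fun.
split.
  have := Cc_scale hH (u := fun h => a (grng h)) (f := f).
  have uc : continuous (fun h : H => a (grng h)).
    by move=> h; apply: (@continuous_comp _ _ _ (@grng X H) a); [exact: grng_continuous|exact: ac].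
  move=> /(_ uc Cf); congr Cc_twist; apply/funext => s; by rewrite tproj_rng.
rewrite -e modelM // (model_unit Ca).
  by congr (iota _ ** _); apply/funext => x; rewrite unit_fun1.
by move=> s; apply: contraNP => /unit_fun_off ->.
Qed.

Lemma bisection_inv V : bisection V -> bisection (@ginv X H @^-1` V).
Proof.
move=> [oV Vs Vr]; split.
- by apply: open_comp => // h _; exact: ginv_continuous.
- move=> h k /Vr hr /hr; rewrite !grngV => e /e ik.
  by rewrite -(ginvK h) ik ginvK.
- move=> h k /Vs hr /hr; rewrite !gsrcV => e /e ik.
  by rewrite -(ginvK h) ik ginvK.
Qed.

Lemma tstar_supported f K : supported_in f K -> supported_in (tstar f) (@ginv X H @` K).
Proof.
move=> fK s; rewrite /tstar conjC_eq0 => /fK; rewrite tprojV => Ks.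
by exists (ginv (p s)) => //; rewrite ginvK.
Qed.

Lemma compact_inv K : compact K -> compact (@ginv X H @` K).
Proof.
by move=> Kc; apply: continuous_compact Kc; apply: continuous_subspaceT; exact: ginv_continuous.
Qed.

Lemma ginv_image_sub K V : K `<=` V -> @ginv X H @` K `<=` @ginv X H @^-1` V.
Proof. by move=> KV _ [h /KV Vh <-]; rewrite /= ginvK. Qed.

Lemma Cc_star_tconv f g K V : Cc_twist f -> Cc_twist g -> supported_in f K -> compact K ->
  K `<=` V -> bisection V -> Cc_twist (tconv (tstar f) g).
Proof.
move=> Cf Cg fK Kc KV bV; apply: (Cc_tconv hX hH he (Cc_conj_star hH Cf) Cg).
- exact: tstar_supported fK.
- exact: compact_inv.
- exact: ginv_image_sub KV.
- exact: bisection_inv.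
Qed.

(** The two arrows in a nonzero term lie in [V] and have the same range, so they coincide and the
    product is supported on the units, where [j] takes values in A. *)
Lemma bisection_star_mul f g K V : Cc_twist f -> Cc_twist g -> supported_in f K ->
  supported_in g V -> compact K -> K `<=` V -> bisection V -> A ((j f)^# ** j g).
Proof.
move=> Cf Cg fK gV Kc KV bV; have Cfg := Cc_star_tconv Cf Cg fK Kc KV bV.
rewrite -model_adj // -modelM //; last exact: Cc_conj_star.
rewrite (model_unit Cfg); first by apply: iota_A; exact: Cc_unit_C0.
move=> s n0; have [_ Vs Vr] := bV.
have [t [ts f0 g0]] : exists t, [/\ grng t = grng s, tstar f t != 0 & g (gmul (ginv t) s) != 0].
  apply: contrapT => none; move/eqP: n0; apply; apply: tconv_zero => t ts.
  apply/eqP; apply: contrapT => /negP; rewrite mulf_eq0 negb_or => /andP[f0 g0].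
  by apply: none; exists t.
have Vt : V (p (ginv t)) by apply: KV; apply: fK; move: f0; rewrite /tstar conjC_eq0.
have Vg := gV _ g0.
have e : p (gmul (ginv t) s) = p (ginv t).
  by apply: Vr => //; rewrite !tproj_rng grngM // gsrcV.
rewrite /unit_space /=; apply: etrans (_ : gmul (p t) (p (gmul (ginv t) s)) = _).
  by rewrite -tprojM ?grngM ?gsrcV ?grngV // gmulVKl.
rewrite e tprojV gmulV tproj_rng ts; congr (gunit H _).
by have := tproj_eq_src e; rewrite gsrcM ?gsrcV // tproj_src => ->.
Qed.

(** The function of [b] may lack compact support; it is replaced by cut-offs, and A is closed. *)
Lemma bisection_normaliser_half f K V b : Cc_twist f -> supported_in f K -> compact K ->
  K `<=` V -> bisection V -> A b -> A ((j f)^# ** b ** j f).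
Proof.
move=> Cf fK Kc KV bV [a Ca <-]; apply: (C0_image_closed hs) => e e0.
pose q : Cplx R := `|j f| ^+ 2 + 1; have q0 : 0 < q by rewrite ltr_wpDl ?exprn_ge0.
have eq0 : 0 < e / q by rewrite divr_gt0.
have eE : toC (complex.Re (e / q)) = e / q by apply: toC_Re_ge0; exact: ltW.
have d0 : 0 < 2^-1 * complex.Re (e / q).
  by rewrite mulr_gt0 ?invr_gt0 // -toC_lt eE.
have [k [Ck k01 kn0 k1]] := C0_cutoff Ca d0; set d := 2^-1 * _ in d0 kn0 k1.
have d2 : 2 * d = complex.Re (e / q) by rewrite /d mulrA divff ?mul1r // pnatr_eq0.
have Cka := C0M Ck Ca.
have Kd := C0_compact_ge Ca d0.
have off x : ~ [set x | toC d <= `|a x|] x -> k x * a x = 0.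
  by move=> nx; have [->|/kn0 //] := eqVneq (k x) 0; rewrite mul0r.
have [Cg gE] := model_iota Cka.1 Kd off Cf.
exists ((j f)^# ** iota (fun x => k x * a x) ** j f).
  rewrite -cmulA gE; apply: (bisection_star_mul Cf Cg fK _ Kc KV bV).
  by move=> s n0; apply: KV; apply: fK; apply: contraNneq n0 => ->; rewrite mulr0.
rewrite -!cmulA -cmulBr -cmulBl -(iota_B hio) //.
have le : `|iota (fun x => a x - k x * a x)| <= e / q.
  apply: (iota_norm_le hio); [exact: C0B|exact: ltW|] => x.
  have -> : a x - k x * a x = (1 - k x) * a x by rewrite mulrBl mul1r.
  have [->|kx] := eqVneq (k x) 1; first by rewrite subrr mul0r normr0 ltW.
  have /andP[k0 kle] := k01 x; rewrite normrM -[leRHS]mul1r; apply: ler_pM => //.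
    by rewrite ger0_norm ?subr_ge0 // gerBl.
  rewrite -eE real_leNgt ?ger0_real //; last by rewrite eE ltW.
  by apply/negP => /ltW; rewrite -d2 => /k1 e1; rewrite e1 eqxx in kx.
apply: le_trans (cnormM _ _) _; rewrite norm_cadj.
apply: le_trans (ler_wpM2l (normr_ge0 _) (cnormM _ _)) _.
rewrite mulrCA; apply: le_trans (ler_wpM2r _ le) _; first by rewrite mulr_ge0.
rewrite mulrAC ler_pdivrMr // ler_wpM2l ?(ltW e0) //.
by rewrite /q expr2 lerDl.
Qed.

Lemma bisection_normaliser f K V : Cc_twist f -> supported_in f K -> compact K ->
  K `<=` V -> bisection V -> normaliser A (j f).
Proof.
move=> Cf fK Kc KV bV b Ab; split; last exact: (bisection_normaliser_half Cf fK Kc KV bV Ab).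
rewrite -{1}(cadjK (j f)) -model_adj //.
apply: (bisection_normaliser_half (Cc_conj_star hH Cf) (tstar_supported fK) (compact_inv Kc)
  (ginv_image_sub KV) (bisection_inv bV) Ab).
Qed.

(** From n n = 0 follows E(n^# n)(x) E(n n^#)(x) = 0; whichever factor vanishes, Cauchy-Schwarz
    kills [n]. *)
Lemma expect_square_zero n x : normaliser A n -> n ** n = 0 -> ev x n = 0.
Proof.
move=> nn n0; have pf := expect_pos hs x; have [u [Cu u01 u1]] := unit_bump hs x.
have l0 : ev x (n^# ** n) * ev x (n ** n^#) = 0.
  rewrite -(expect_mul_l hs); last exact: (normaliser_sqr hs nn).
  by rewrite cmulA -(cmulA n^#) n0 cmul0r cmul0l (pf0 pf).
have ul : ev x (iota u ** n) = ev x n by rewrite (expect_iota_l hs) // u1 mul1r.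
have ur : ev x (n ** iota u) = ev x n by rewrite (expect_iota_r hs) // u1 mulr1.
move/eqP: l0; rewrite mulf_eq0 => /orP[/eqP e|/eqP e].
  by rewrite -ul; exact: (pf_null pf _ e).
by rewrite -ur; exact: (pf_null_l pf _ e).
Qed.

Context (hp : principal H).
Local Notation Z := [set b | normaliser A b /\ b ** b = 0].

(** Both claims are additive and local, so [Cc_ind] proves them together. Near an arrow that is not
    a unit, the first reduces to [expect_square_zero]. *)
Lemma model_expect f : Cc_twist f -> (forall x, ev x (j f) = f (gunit S x)) /\
  closure (lspan Z) (j f - iota (fun x => f (gunit S x))).
Proof.
move: f; apply: (@Cc_ind _ _ _ S hXc hX hH he) => [|f g Cf Cg [f1 f2] [g1 g2]|h].
- have i0 : iota (fun=> 0) = 0 by exact: (iota_0 hio).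
  split=> [x|]; first by rewrite model0 (pf0 (expect_pos hs x)).
  by rewrite model0 i0 subr0; apply: subset_closure; exact: lspan0.
- split=> [x|].
    by rewrite modelD // (pfD (expect_pos hs x)) f1 g1.
  rewrite (modelD Cf Cg) (iota_D hio (Cc_unit_C0 hX Cf) (Cc_unit_C0 hX Cg)) opprD addrACA.
  apply: (closure_binary (F := +%R) _ _ f2 g2).
    by move=> c d Zc Zd; rewrite -[c]scale1r; exact: lspan_lin.
  by apply: cvgD; [exact: cvg_fst|exact: cvg_snd].
have [hU|hU] := pselect (@unit_space X H h).
  exists (@unit_space X H); split=> //; first exact: unit_space_open.
  move=> f K Cf Kc KU fK; have fU : supported_in f (@unit_space X H) by move=> s /fK /KU.
  have Ca : C0 (fun x => f (gunit S x)) by exact: Cc_unit_C0.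
  rewrite (model_unit Cf fU); split=> [x|]; first by rewrite (expect_iota hs).
  by rewrite subrr; apply: subset_closure; exact: lspan0.
(* By principality, only units have equal endpoints. *)
have hrs : gsrc h != grng h.
  by apply/eqP => e; apply: hU; exact: hp.
have hX' := hX; rewrite open_hausdorff in hX'.
have [[P Q] /= [sP rQ] [oP oQ PQ]] := hX' _ _ hrs.
rewrite !inE in sP rQ.
have oO : open ((@gsrc X H @^-1` P) `&` (@grng X H @^-1` Q)).
  apply: openI; apply: open_comp => // k _.
    exact: gsrc_continuous.
  exact: grng_continuous.
have [V [bV Vh VO]] := bisection_at he oO (conj sP rQ).
exists V; split => //; first by have [] := bV.
move=> f K Cf Kc KV fK.
have nn := bisection_normaliser Cf fK Kc KV bV.
have disj x : P x -> Q x -> False.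
  by move=> Px Qx; have : (P `&` Q) x by []; rewrite (eqP PQ).
have ff : tconv f f = fun=> 0.
  apply/funext => s; apply: tconv_zero => t ts; apply/eqP; apply: contrapT => /negP.
  rewrite mulf_eq0 negb_or => /andP[/fK /KV /VO[/= Pt _] /fK /KV /VO[_ /= Qt]].
  by move: Qt; rewrite tproj_rng grngM ?gsrcV // grngV -tproj_src => /(disj _ Pt).
have n0 : j f ** j f = 0 by rewrite -modelM // ff model0.
have f0 x : f (gunit S x) = 0.
  apply: (supported_eq0 fK) => /KV /VO[/= Px Qx]; move: Px Qx.
  by rewrite tproj_unit gsrc1 grng1; exact: disj.
split=> [x|]; first by rewrite f0; exact: expect_square_zero.
have -> : (fun x => f (gunit S x)) = fun=> 0 by apply/funext.
rewrite (iota_0 hio) subr0; apply: subset_closure; apply: lspan_sub.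
by split.
Qed.

Lemma model_diagonal : cstar_diagonal A E.
Proof.
apply/seteqP; split=> b.
  move=> cb; have Z0 c : lspan Z c -> E c = 0.
    move: c; apply: lspan_ind => [|z c d [nc c0] d0]; first exact: (E0 hE).
    rewrite (E_lin hE) d0 addr0 -(iota_expect hs).
    have -> : (fun x => ev x c) = fun=> 0.
      by apply/funext => x; exact: expect_square_zero.
    by rewrite (iota_0 hio) scaler0.
  apply/eqP; rewrite -normr_eq0; apply/eqP; apply: small_eq0 => e e0; rewrite normr_id.
  have [c Zc bc] := (closure_normP _ _).1 cb _ e0.
  rewrite -[b](subrK c) (ED hE) (Z0 c Zc) addr0.
  by apply: le_trans (E_le hE _) _; exact: ltW.
(* Idempotence of the closure admits approximants that are themselves only limits, as [model_expect]
   provides. *)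
move=> Eb; rewrite -[X in X b](_ : closure (closure (lspan Z)) = _); last first.
  by rewrite -(closure_id _).1 //; exact: closed_closure.
apply/closure_normP => e e0; have e2 : 0 < e / 2 by rewrite divr_gt0.
have [f Cf bf] := model_dense b e2; have [f1 f2] := model_expect Cf.
exists (j f - iota (fun x => f (gunit S x))) => //.
have Ef : E (j f) = iota (fun x => f (gunit S x)).
  by rewrite -(iota_expect hs); congr iota; apply/funext.
rewrite -Ef opprB addrCA addrC (_ : E (j f) = - E (b - j f)); last first.
  by rewrite (EB hE) Eb sub0r opprK.
apply: le_lt_trans (ler_normB _ _) _; rewrite [ltRHS](splitr e).
apply: ltrD => //.
by apply: le_lt_trans (E_le hE _) _.
Qed.

End ModelNormalisers.

(** * Uniqueness *)

Section GroupoidIsomorphisms.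
Context (X : topologicalType).

Lemma groupoid_iso_inverse (G G' : topGroupoid X) (F : G -> G') : groupoid_iso F ->
  exists F' : G' -> G, [/\ groupoid_iso F', cancel F F' & cancel F' F].
Proof.
move=> [Fc [F' [F'c FK F'K]] Fs Fr Fm]; exists F'; split => //.
have F's a : gsrc (F' a) = gsrc a by rewrite -Fs F'K.
have F'r a : grng (F' a) = grng a by rewrite -Fr F'K.
split => //; first by exists F.
by move=> a b ab; apply: (can_inj FK); rewrite Fm ?F's ?F'r // !F'K.
Qed.

Lemma groupoid_iso_comp (G G' G'' : topGroupoid X) (F : G -> G') (F1 : G' -> G'') :
  groupoid_iso F -> groupoid_iso F1 -> groupoid_iso (fun a => F1 (F a)).
Proof.
move=> [Fc [F' [F'c FK F'K]] Fs Fr Fm] [F1c [F1' [F1'c F1K F1'K]] F1s F1r F1m]; split.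
- by move=> a; apply: (@continuous_comp _ _ _ F F1); [exact: Fc|exact: F1c].
- exists (fun a => F' (F1' a)); split.
  + by move=> a; apply: (@continuous_comp _ _ _ F1' F'); [exact: F1'c|exact: F'c].
  + by move=> a; rewrite F1K FK.
  + by move=> a; rewrite F'K F1'K.
- by move=> a; rewrite F1s Fs.
- by move=> a; rewrite F1r Fr.
- by move=> a b ab; rewrite Fm // F1m // Fs Fr.
Qed.

End GroupoidIsomorphisms.

Section TwistIsomorphism.
Context (R : realType) (X : topologicalType).

(** The map induced on the quotients, computed through an arbitrary lift; compatibility with the
    circle makes the choice irrelevant. *)
Definition quotient_map (H H' : topGroupoid X) (S : twist R H) (S' : twist R H')
  (Ft : S -> S') (h : H) : H' := tproj (Ft (tlift S h)).

Definition tincl_compatible (H H' : topGroupoid X) (S : twist R H) (S' : twist R H')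
  (Ft : S -> S') : Prop := forall x z, circle z -> Ft (tincl S x z) = tincl S' x z.

Lemma quotient_mapE (H H' : topGroupoid X) (S : twist R H) (S' : twist R H')
    (Ft : S -> S') : groupoid_iso Ft -> tincl_compatible Ft ->
  forall s, quotient_map Ft (tproj s) = tproj (Ft s).
Proof.
move=> [_ _ Fs Fr Fm] Fi s; rewrite /quotient_map.
have [z z1 {2}->] := tfiber (esym (tlift_proj S (tproj s))).
rewrite /tact Fm ?tincl_src // Fi // -(Fr (tlift S _)).
exact: (esym (tproj_act _ z1)).
Qed.

Lemma quotient_map_continuous (H H' : topGroupoid X) (S : twist R H) (S' : twist R H')
    (Ft : S -> S') : groupoid_iso Ft -> tincl_compatible Ft ->
  continuous (quotient_map Ft).
Proof.
move=> Fg Fi h; have Fc : continuous Ft by case: Fg.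
have [s0 sh] := tproj_surj S h; have [U [sig [oU Uh sig0 sigP]]] := local_section s0.
rewrite sh in Uh sig0; have nU : nbhs h U by exact: open_nbhs_nbhs.
have near : \forall k \near h, quotient_map Ft k = tproj (Ft (sig k)).
  by apply: (filterS _ nU) => k /sigP[pk _]; rewrite -{1}pk; exact: quotient_mapE.
apply: (@cvg_near_eq _ _ (nbhs h) (quotient_map Ft) (fun k => tproj (Ft (sig k))) _ _ near).
rewrite (nbhs_singleton near); have [_ sc] := sigP _ Uh.
have c1 := cvg_comp _ Ft sc (Fc _).
exact: (cvg_comp _ (@tproj _ _ _ S') c1 (@tproj_continuous _ _ _ S' _)).
Qed.

Lemma quotient_mapK (H H' : topGroupoid X) (S : twist R H) (S' : twist R H')
    (Ft : S -> S') (Ft' : S' -> S) : groupoid_iso Ft -> tincl_compatible Ft ->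
  groupoid_iso Ft' -> tincl_compatible Ft' ->
  cancel Ft Ft' -> cancel (quotient_map Ft) (quotient_map Ft').
Proof.
move=> Fg Fi Fg' Fi' FK h; rewrite [quotient_map Ft h]/quotient_map.
by rewrite quotient_mapE // FK tlift_proj.
Qed.

Lemma twist_isomorphicP (H H' : topGroupoid X) (S : twist R H) (S' : twist R H')
    (Ft : S -> S') : groupoid_iso Ft -> tincl_compatible Ft -> twist_isomorphic S S'.
Proof.
move=> Fg Fi; have [Ft' [Fg' FK F'K]] := groupoid_iso_inverse Fg.
have Fi' : tincl_compatible Ft' by move=> x z z1; rewrite -Fi // FK.
have [_ _ Fs Fr Fm] := Fg.
exists (quotient_map Ft), Ft; split => //; last by move=> s; rewrite quotient_mapE.
split.
- exact: quotient_map_continuous.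
- exists (quotient_map Ft'); split.
  + exact: quotient_map_continuous.
  + exact: quotient_mapK.
  + exact: quotient_mapK.
- by move=> h; rewrite /quotient_map tproj_src Fs tlift_src.
- by move=> h; rewrite /quotient_map tproj_rng Fr tlift_rng.
- move=> h k hk; rewrite -{1}(tlift_proj S h) -{1}(tlift_proj S k).
  have lk : gsrc (tlift S h) = grng (tlift S k) by rewrite tlift_src tlift_rng.
  by rewrite -tprojM // quotient_mapE // Fm // tprojM // Fs Fr.
Qed.

End TwistIsomorphism.

(** * Points of a model as eigenfunctionals *)

Section ModelGerms.
Context (R : realType) (X : topologicalType) (B : cstarAlgType R).
Context (iota : (X -> Cplx R) -> B) (E : B -> B) (hs : faithful_inclusion iota E).
Context (hext : extension_property (C0_image iota)).
Context (H : topGroupoid X) (S : twist R H) (hH : hausdorff_space H) (he : etale H).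
Context (hp : principal H).
Context (j : (S -> Cplx R) -> B) (hj : model_map iota j).
Implicit Types (a u : X -> Cplx R) (b c n m : B) (x y : X) (z w : Cplx R).
Implicit Types (s t r : S) (h k : H) (f g : S -> Cplx R) (K V : set H).

Local Notation ev := (expect iota E).
Local Notation p := (@tproj R X H S).
Local Notation eigen := (eigenfunctional iota E).
Local Notation G := (germ_groupoid hs hext).
Let hXc := fi_locally_compact hs.
Let hX := fi_hausdorff hs.

(** Only the lift [s] itself contributes, with value 1, so convolution by the adjoint of [f] is
    translation by [s]. *)
Lemma tconv_star_at f g V s t : equivariant f -> equivariant g -> supported_in f V ->
  bisection V -> f s = 1 -> gsrc s = grng t -> tconv (tstar f) g t = g (gmul s t).
Proof.
move=> fe ge fV bV fs st.
have se : equivariant (tstar f).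
  move=> z r z1; rewrite /tstar -/(tact z r) tact_inv // (equivariant_act _ fe (circle_conj z1)).
  by rewrite rmorphM /= conjCK.
have sV : supported_in (tstar f) (@ginv X H @^-1` V).
  by move=> r; rewrite /tstar conjC_eq0 => /fV; rewrite tprojV.
rewrite (tconv_bisection se ge sV (bisection_inv bV) (t := ginv s)).
- by rewrite /tstar ginvK fs conjC1 mul1r.
- by rewrite /= -tprojV ginvK; apply: fV; rewrite fs oner_eq0.
- by rewrite grngV.
Qed.

Lemma model_bump s : exists f, exists K V,
  [/\ Cc_twist f, f s = 1, supported_in f K, compact K /\ K `<=` V & bisection V].
Proof.
have [f [K [V [Cf fs fK KV [bV _]]]]] := Cc_bump hXc hX hH he openT (I : setT (p s)).
by exists f, K, V.
Qed.

(** [E] restricts functions to the units, and translating by [s] moves the value at [s] to the unit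
    at its source. Thus evaluation at [s] is an eigenfunctional represented by [j f]. *)
Lemma model_eval f g K V s : Cc_twist f -> f s = 1 -> supported_in f K -> compact K ->
  K `<=` V -> bisection V -> Cc_twist g -> ev (gsrc s) ((j f)^# ** j g) = g s.
Proof.
move=> Cf fs fK Kc KV bV Cg; have [_ fe _] := Cf; have [_ ge _] := Cg.
have Cfg := Cc_star_tconv hs hH he Cf Cg fK Kc KV bV.
rewrite -(model_adj hj Cf) -(modelM hj) //; last exact: Cc_conj_star.
have [-> _] := model_expect hs hH he hj hp Cfg.
have fV : supported_in f V by move=> r /fK /KV.
by rewrite (tconv_star_at fe ge fV bV fs) ?grng1 // gmul1.
Qed.

Lemma model_germ_exists s : exists phi, eigen phi (grng s) (gsrc s) /\
  forall g, Cc_twist g -> phi (j g) = g s.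
Proof.
have [f [K [V [Cf fs fK [Kc KV] bV]]]] := model_bump s.
have evE g : Cc_twist g -> ev (gsrc s) ((j f)^# ** j g) = g s.
  exact: model_eval Cf fs fK Kc KV bV.
have nn := bisection_normaliser hs hH he hj Cf fK Kc KV bV.
have n1 : ev (gsrc s) ((j f)^# ** j f) = 1 by rewrite evE.
have n0 : ev (gsrc s) ((j f)^# ** j f) != 0 by rewrite n1 oner_eq0.
have [y ey] := eigen_exists hs hext nn n0.
set phi := (fun b => _) in ey.
have phiE g : Cc_twist g -> phi (j g) = g s.
  by move=> Cg; rewrite /phi n1 sqrtC1 invr1 mul1r evE.
suff <- : y = grng s by exists phi.
(* A bump that is 1 at the range of [s] and 0 at [y] would act on the functional by both numbers. *)
apply: contrapT => ny.
have oy : open (~` [set y]).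
  by apply: closed_openC; apply: accessible_closed_set1; exact: hausdorff_accessible.
have [u [L [Cu Lc Ly uL [_ u1]]]] := bump_at hs oy (fun e : grng s = y => ny (esym e)).
have [Cg gE] := model_iota hH he hj Cu.1 Lc uL Cf.
have := eigen_iota_l hs (j f) ey Cu; rewrite gE !phiE // fs !mulr1 (nbhs_singleton u1).
by rewrite uL => [/eqP|/Ly []//]; rewrite oner_eq0.
Qed.

Definition model_germ s : G := mk_germ (projT2 (cid (model_germ_exists s))).1.

Lemma model_germ_fun s g : Cc_twist g -> germ_fun (model_germ s) (j g) = g s.
Proof. exact: (projT2 (cid (model_germ_exists s))).2. Qed.

Lemma model_germ_rng s : grng (model_germ s) = grng s. Proof. by []. Qed.

Lemma model_germ_src s : gsrc (model_germ s) = gsrc s. Proof. by []. Qed.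

(** Eigenfunctionals are contractive, so the dense image of [j] determines them. *)
Lemma germ_determined (s t : G) : (forall g, Cc_twist g -> germ_fun s (j g) = germ_fun t (j g)) ->
  grng s = grng t -> gsrc s = gsrc t -> s = t.
Proof.
move=> st er es; apply: germ_eq => // b; apply/eqP; rewrite -subr_eq0; apply/eqP.
apply: small_eq0 => e e0; have e2 : 0 < e / 2 by rewrite divr_gt0.
have [g Cg bg] := model_dense hj b e2.
have -> : germ_fun s b - germ_fun t b = germ_fun s (b - j g) - germ_fun t (b - j g).
  by rewrite !(germB hs) st // opprB addrA subrK.
apply: le_trans (ler_normB _ _) _; rewrite [leRHS]splitr.
by apply: lerD; apply: le_trans (germ_le hs _ _) _; exact: ltW.
Qed.

Lemma model_germ_continuous : continuous model_germ.
Proof.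
move=> s; apply: (germ_cvg (F := nbhs s)) => [b||].
- apply/cvgrPdist_lt => e e0; have e3 : 0 < e / 3 by rewrite divr_gt0.
  have [g Cg bg] := model_dense hj b e3; have [gc _ _] := Cg.
  have /cvgrPdist_lt/(_ _ e3) := gc s; apply: filterS => t gst.
  have -> : germ_fun (model_germ s) b - germ_fun (model_germ t) b =
      germ_fun (model_germ s) (b - j g) + (g s - g t) - germ_fun (model_germ t) (b - j g).
    by rewrite !(germB hs) !model_germ_fun //; ring.
  have -> : e = e / 3 + e / 3 + e / 3 by field.
  apply: le_lt_trans (ler_normB _ _) _; apply: ltrD.
    apply: le_lt_trans (ler_normD _ _) _; apply: ltrD => //.
    exact: le_lt_trans (germ_le hs _ _) bg.
  exact: le_lt_trans (germ_le hs _ _) bg.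
- exact: (@grng_continuous X S).
- exact: (@gsrc_continuous X S).
Qed.

Lemma model_germM s t : gsrc s = grng t ->
  model_germ (gmul s t) = gmul (model_germ s) (model_germ t).
Proof.
move=> st; have [f [K [V [Cf fs fK [Kc KV] bV]]]] := model_bump s.
have nn := bisection_normaliser hs hH he hj Cf fK Kc KV bV.
have [_ fe _] := Cf; have fV : supported_in f V by move=> r /fK /KV.
have st' : gsrc (model_germ s) = grng (model_germ t) by [].
apply: germ_determined => [g Cg||].
- have [_ ge _] := Cg; rewrite model_germ_fun //.
  have n1 : germ_fun (model_germ s) (j f) = 1 by rewrite model_germ_fun.
  rewrite [RHS](germ_mul_fun hs hext _ st' nn n1).
  rewrite -(model_adj hj Cf) -(modelM hj) //; last exact: Cc_conj_star.
  rewrite model_germ_fun ?(tconv_star_at fe ge fV bV fs st) //.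
  exact: (Cc_star_tconv hs hH he Cf Cg fK Kc KV bV).
- by rewrite (grngM st') !model_germ_rng grngM.
- by rewrite (gsrcM st') !model_germ_src gsrcM.
Qed.

Lemma model_germ_act z s : circle z -> model_germ (tact z s) = germ_scale z (model_germ s).
Proof.
move=> z1; apply: germ_determined => [g Cg||].
- have [_ ge _] := Cg.
  by rewrite germ_scale_fun // !model_germ_fun // (equivariant_act _ ge z1).
- by rewrite germ_scale_rng !model_germ_rng tact_rng.
- by rewrite germ_scale_src !model_germ_src tact_src.
Qed.

Lemma model_germ_unit x : model_germ (gunit S x) = gunit G x.
Proof.
apply: germ_determined => [g Cg||].
- rewrite model_germ_fun //.
  by have [e _] := model_expect hs hH he hj hp Cg; exact: esym (e x).
- by rewrite model_germ_rng !grng1.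
- by rewrite model_germ_src !gsrc1.
Qed.

Lemma model_germ_incl x z : circle z -> model_germ (tincl S x z) = germ_incl hs hext x z.
Proof. by move=> z1; rewrite tincl_act // model_germ_act // model_germ_unit. Qed.

Lemma principal_eq h k : grng h = grng k -> gsrc h = gsrc k -> h = k.
Proof.
move=> er es; have c : gsrc h = grng (ginv k) by rewrite grngV.
have := hp (h := gmul h (ginv k)); rewrite gsrcM // grngM // gsrcV => /(_ (esym er)) e.
by rewrite -(gmulVKr es) e g1mul.
Qed.

Lemma model_germ_inj : injective model_germ.
Proof.
move=> s t e; have er : grng s = grng t := congr1 (fun s : G => grng s) e.
have es : gsrc s = gsrc t := congr1 (fun s : G => gsrc s) e.
have [z z1 sz] : exists2 z, circle z & s = tact z t.
  by apply: tfiber; apply: principal_eq; rewrite ?tproj_rng ?tproj_src.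
have [f [K [V [Cf ft _ _ _]]]] := model_bump t; have [_ fe _] := Cf.
have := congr1 (fun s : G => germ_fun s (j f)) e; rewrite /= !model_germ_fun // sz.
by rewrite (equivariant_act _ fe z1) ft mulr1 => ->; rewrite tact1.
Qed.

(** An eigenfunctional is continuous and nonzero, and [Cc_twist] is additively generated by
    functions on bisections, so one of these detects it. *)
Lemma model_germ_support (s : G) : exists f, exists K V,
  [/\ Cc_twist f, supported_in f K, compact K /\ K `<=` V, bisection V
    & germ_fun s (j f) != 0].
Proof.
apply: contrapT => none; have [n _ n1] := germ_neq0 s.
have all0 g : Cc_twist g -> germ_fun s (j g) = 0.
  move: g; apply: (@Cc_ind _ _ _ S hXc hX hH he) => [|f g Cf Cg f0 g0|h].
  - by rewrite (model0 hH hj) (germ0 hs).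
  - by rewrite (modelD hj) // (germD hs) f0 g0 addr0.
  - have [V [bV Vh _]] := bisection_at he openT (I : setT h).
    exists V; split => //; first by have [] := bV.
    move=> f K Cf Kc KV fK; apply/eqP; apply: contrapT => /negP f0.
    by apply: none; exists f, K, V.
have [g Cg ng] := model_dense hj n (ltr01 : 0 < 1 :> Cplx R).
have := le_lt_trans (germ_le hs s _) ng.
by rewrite (germB hs) n1 all0 // subr0 normr1 ltxx.
Qed.

(** If [s] does not vanish at [j f] for [f] on a bisection, then E((j f)^# j f) is nonzero at the
    source of [s], so [f] is nonzero at a point of the twist with that source. Its eigenfunctional
    and [s] are both nonzero at the normaliser [j f]; hence they share the range and differ by a
    phase. *)
Lemma model_germ_surj (s : G) : exists t, model_germ t = s.
Proof.
have [f [K [V [Cf fK [Kc KV] bV s0]]]] := model_germ_support s.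
have nn := bisection_normaliser hs hH he hj Cf fK Kc KV bV.
have x0 := germ_sqr_neq0 nn s0; have [_ fe _] := Cf.
have Cff := Cc_star_tconv hs hH he Cf Cf fK Kc KV bV.
have : tconv (tstar f) f (gunit S (gsrc s)) != 0.
  have [<- _] := model_expect hs hH he hj hp Cff.
  by rewrite (modelM hj) ?(model_adj hj) //; exact: Cc_conj_star.
move=> t0; have [t [tx ft]] : exists t, grng t = gsrc s /\ tstar f t != 0.
  apply: contrapT => none; move/eqP: t0; apply; apply: tconv_zero => t; rewrite grng1 => tx.
  have [->|n0] := eqVneq (tstar f t) 0; first by rewrite mul0r.
  by case: none; exists t.
have st : gsrc (model_germ (ginv t)) = gsrc s by rewrite model_germ_src gsrcV.
have f0 : germ_fun (model_germ (ginv t)) (j f) != 0.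
  by rewrite model_germ_fun //; move: ft; rewrite /tstar conjC_eq0.
have rt := germ_rng_unique nn f0 s0 st.
have es := germP s; have et := germP (model_germ (ginv t)).
rewrite -[germ_rng s]rt -[germ_src s]st in es.
have [z z1 zE] := eigen_same hs hext et es.
exists (tact z (ginv t)); rewrite model_germ_act //; apply: germ_eq => [b||].
- by rewrite germ_scale_fun // zE.
- by rewrite [LHS]germ_scale_rng.
- by rewrite [LHS]germ_scale_src.
Qed.

Definition germ_point (s : G) : S := projT1 (cid (model_germ_surj s)).

Lemma germ_pointK (s : G) : model_germ (germ_point s) = s.
Proof. exact: projT2 (cid (model_germ_surj s)). Qed.

Lemma model_germK : cancel model_germ germ_point.
Proof. by move=> s; apply: model_germ_inj; rewrite germ_pointK. Qed.

Lemma germ_point_src (s : G) : gsrc (germ_point s) = gsrc s.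
Proof. by rewrite -{2}(germ_pointK s) model_germ_src. Qed.

Lemma germ_point_rng (s : G) : grng (germ_point s) = grng s.
Proof. by rewrite -{2}(germ_pointK s) model_germ_rng. Qed.

(* Near a point the inverse is [s |-> w (tau (sg (gsrc s)))], with [sg] the inverse of the
   source map on a bisection, [tau] a local section of the twist and [w] a quotient of values. *)
Lemma germ_point_continuous : continuous germ_point.
Proof.
move=> s1; pose s0 := germ_point s1.
have [f [K [V [Cf fs fK [Kc KV] bV]]]] := model_bump s0; have [oV Vs _] := bV.
have [fc fe _] := Cf; have fV r : f r != 0 -> V (p r) by move=> /fK /KV.
have fE (s : G) : germ_fun s (j f) = f (germ_point s) by rewrite -{1}(germ_pointK s) model_germ_fun.
have Vs0 : V (p s0) by apply: fV; rewrite fs oner_eq0.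
have [U [tau [oU Us0 tau0 tauP]]] := local_section s0.
have [sg sgP] := slice_section (local_homeomorphism_open he.2) oV Vs (p s0).
have [_ _ sgc] := sgP _ (ex_intro2 _ _ (p s0) Vs0 erefl).
have sgE h : V h -> sg (gsrc h) = h.
  by move=> Vh; have [Vg gg _] := sgP _ (ex_intro2 _ _ h Vh erefl); exact: Vs.
have x1 : gsrc s1 = gsrc (p s0) by rewrite tproj_src germ_point_src.
have c1 : (fun s : G => sg (gsrc s)) @ s1 --> p s0.
  rewrite -x1 in sgc; have := cvg_comp (@gsrc X G) sg (@gsrc_continuous X G s1) sgc.
  by rewrite x1 sgE.
have [_ tc] := tauP _ Us0; rewrite tau0 in tc.
have c2 : (fun s : G => tau (sg (gsrc s))) @ s1 --> s0 by exact: (cvg_comp _ tau c1 tc).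
have c3 : (fun s : G => f (tau (sg (gsrc s)))) @ s1 --> (1 : Cplx R).
  by rewrite -fs; exact: (cvg_comp _ f c2 (fc s0)).
have c4 : (fun s : G => germ_fun s (j f)) @ s1 --> (1 : Cplx R).
  rewrite -[X in _ --> X](_ : germ_fun s1 (j f) = 1); last by rewrite fE.
  exact: germ_fun_continuous.
pose w (s : G) : Cplx R := germ_fun s (j f) / f (tau (sg (gsrc s))).
have c5 : w @ s1 --> (1 : Cplx R).
  rewrite -[X in _ --> X](_ : 1 / 1 = 1); last by rewrite divr1.
  by apply: cvgM c4 _; apply: cvgV c3; rewrite oner_eq0.
have n1 : nbhs s1 [set s : G | germ_fun s (j f) != 0].
  have s10 : germ_fun s1 (j f) != 0 by rewrite fE fs oner_eq0.
  exact: (cvgr_neq0 (F := nbhs s1) _ (@germ_fun_continuous _ _ _ _ _ (j f) s1) s10).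
have n2 : nbhs s1 [set s : G | U (sg (gsrc s))] by apply: (c1 U); exact: open_nbhs_nbhs.
have near : \forall s \near s1, [/\ circle (w s), grng (tau (sg (gsrc s))) = grng s
    & germ_point s = tact (w s) (tau (sg (gsrc s)))].
  apply: (filterS _ (filterI n1 n2)) => s [/= fs0 /tauP[pt _]].
  have Vp : V (p (germ_point s)) by apply: fV; rewrite -fE.
  have e : sg (gsrc s) = p (germ_point s).
    by rewrite -germ_point_src -(tproj_src (germ_point s)) sgE.
  have [v v1 vE] : exists2 v, circle v & germ_point s = tact v (tau (sg (gsrc s))).
    by apply: tfiber; rewrite pt e.
  have f0 : f (tau (sg (gsrc s))) != 0.
    apply: contraNneq fs0 => f0; rewrite fE vE (equivariant_act _ fe v1) f0 mulr0.
    by [].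
  have -> : w s = v by rewrite /w fE vE (equivariant_act _ fe v1) mulfK.
  split => //; by rewrite -(tproj_rng (tau _)) pt e tproj_rng germ_point_rng.
have near' : \forall s \near s1,
    germ_point s = gmul (tincl S (grng s) (w s)) (tau (sg (gsrc s))).
  by apply: (filterS _ near) => s [_ e1 ->]; rewrite /tact e1.
suff lim : (fun s : G => gmul (tincl S (grng s) (w s)) (tau (sg (gsrc s)))) @ nbhs s1 -->
    germ_point s1.
  exact: (@cvg_near_eq _ _ (nbhs s1) _ _ _ _ near' lim).
have r1 : grng s1 = grng s0 by rewrite germ_point_rng.
have -> : germ_point s1 = gmul (tincl S (grng s1) 1) s0 by rewrite tincl1 r1 g1mul.
apply: gmul_cvg.
- by rewrite tincl_src //; exact: circle1.
- by apply: (filterS _ near) => s [w1 e1 _]; rewrite tincl_src.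
- have tc' : (fun q : X * Cplx R => tincl S q.1 q.2) @
      within ([set: X] `*` @circle R) (nbhs (grng s1, 1 : Cplx R)) --> tincl S (grng s1) 1.
    move/subspace_continuousP: (@tincl_continuous R X H S) => /(_ (grng s1, 1 : Cplx R)); apply.
    by split => //; exact: circle1.
  have pr : (fun s : G => (grng s, w s)) @ s1 --> (grng s1, 1 : Cplx R).
    exact: (cvg_pair (@grng_continuous X G s1) c5).
  have pw : (fun s : G => (grng s, w s)) @ s1 -->
      within ([set: X] `*` @circle R) (nbhs (grng s1, 1 : Cplx R)).
    move=> W WW.
    have W' : nbhs s1 [set s : G | ([set: X] `*` @circle R) (grng s, w s) -> W (grng s, w s)] :=
      pr _ WW.
    by apply: (filterS _ (filterI W' near)) => s [Ws [w1 _ _]]; exact: Ws.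
  exact: (cvg_comp _ (fun q : X * Cplx R => tincl S q.1 q.2) pw tc').
- exact: c2.
Qed.

Lemma model_germ_iso : groupoid_iso model_germ /\
  tincl_compatible (S' := germ_twist hs hext) model_germ.
Proof.
split; last by move=> x z z1; exact: model_germ_incl.
split; [exact: model_germ_continuous| |exact: model_germ_src|exact: model_germ_rng|].
  exists germ_point; split; [exact: germ_point_continuous|exact: model_germK|].
  exact: germ_pointK.
exact: model_germM.
Qed.

End ModelGerms.

Lemma twist_model_germ (R : realType) (X : topologicalType) (B : cstarAlgType R)
    (iota : (X -> Cplx R) -> B) (E : B -> B) (hs : faithful_inclusion iota E)
    (hext : extension_property (C0_image iota)) (H : topGroupoid X) (S : twist R H) :
  twist_model iota S -> exists Ft : S -> germ_twist hs hext,
    groupoid_iso Ft /\ tincl_compatible Ft.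
Proof.
move=> [hH he hp hm]; have [j hj] := model_map_exists (fi_hausdorff hs) hm.
by exists (model_germ hs hext hH he hp hj); exact: model_germ_iso.
Qed.

Lemma twist_model_unique (R : realType) (X : topologicalType) (B : cstarAlgType R)
    (iota : (X -> Cplx R) -> B) (E : B -> B) (hs : faithful_inclusion iota E)
    (hext : extension_property (C0_image iota)) (H H' : topGroupoid X)
    (S : twist R H) (S' : twist R H') :
  twist_model iota S -> twist_model iota S' -> twist_isomorphic S S'.
Proof.
move=> /(twist_model_germ hs hext)[F [Fg Fi]] /(twist_model_germ hs hext)[F1 [F1g F1i]].
have [F1' [F1'g F1K _]] := groupoid_iso_inverse F1g.
apply: (@twist_isomorphicP _ _ _ _ _ _ (fun s => F1' (F s))).
  exact: groupoid_iso_comp.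
by move=> x z z1; rewrite Fi // -F1i // F1K.
Qed.

Theorem proposition8p1 (R : realType) (X : topologicalType)
    (hXc : locally_compact [set: X]) (hX : hausdorff_space X)
    (B : cstarAlgType R) (iota : (X -> Cplx R) -> B)
    (hiota : C0_embedding iota)
    (hreg : regular_inclusion (C0_image iota))
    (E : B -> B)
    (hE : conditional_expectation (C0_image iota) E)
    (hEf : faithful_expectation E) :
  ((cstar_diagonal (C0_image iota) E <->
      extension_property (C0_image iota)) /\
   (extension_property (C0_image iota) <->
      exists (H : topGroupoid X) (S : twist R H), twist_model iota S)) /\
  (forall (H H' : topGroupoid X) (S : twist R H) (S' : twist R H'),
     twist_model iota S -> twist_model iota S' -> twist_isomorphic S S').
Proof.
have hs : faithful_inclusion iota E by split.
have model_12 (H : topGroupoid X) (S : twist R H) : twist_model iota S ->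
    cstar_diagonal (C0_image iota) E.
  move=> [hH he hp hm]; have [j hj] := model_map_exists hX hm.
  exact: (model_diagonal hs hH he hj hp).
have ext12 := diagonal_extension hs.
split; last first.
  (* The extension property, needed to form the canonical twist, is obtained from one of the two
     models through (1). *)
  move=> H H' S S' mS mS'; have hext := ext12 (model_12 H S mS).
  exact: (twist_model_unique hs hext mS mS').
have ext23 : extension_property (C0_image iota) ->
    exists (H : topGroupoid X) (S : twist R H), twist_model iota S.
  move=> hext; exists (orbit_groupoid hs hext), (germ_twist hs hext).
  exact: germ_twist_model.
split; split => //.
- by move=> /ext23[H [S /model_12]].
- by move=> [H [S /model_12 /ext12]].
Qed.
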